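(* Let $bc\in\{per,ap,dir\}$. There exist $m$ ($m\in\mathbb{Z}_+$ if $bc\in\{per,ap\}$, $m\in\mathbb{N}$ if $bc=dir$) giving a spectral splitting of $L_{bc}$ of the form described in the context, and a constant $C>0$, such that for every nonempty subset $\Omega\subset\{m+1,m+2,\dots\}$, with $d(\Omega)=\min_{n\in\Omega}n$, $$\|P(\widetilde\Delta,L_{bc})-P(\Delta,L_{bc}^0)\|_2\le \frac{C}{d(\Omega)^{2k-3/2}},$$ where $\Delta=\Delta(\Omega)$ and $\widetilde\Delta=\widetilde\Delta(\Omega)$.
   Context: $\mathbb{Z}_+=\mathbb{N}\cup\{0\}$. Let $k>1$ be an integer, $\omega>0$, $q\in L_2[0,\omega]$ complex-valued. $L_2[0,\omega]$ has inner product $(x,y)=\frac1\omega\int_0^\omega x\overline y\,d\tau$; $\|\cdot\|_2$ is the Hilbert-Schmidt norm of operators on $L_2[0,\omega]$. $H^{2k}[0,\omega]$ is the Sobolev space of $y$ with $y^{(2k-1)}$ absolutely continuous, $y^{(2k)}\in L_2[0,\omega]$. $L_{bc}y=(-1)^ky^{(2k)}-qy$ and $L^0_{bc}y=(-1)^ky^{(2k)}$, both with domain $\{y\in H^{2k}[0,\omega]: y\text{ satisfies } bc\}$, where: $bc=per$: $y^{(j)}(0)=y^{(j)}(\omega)$, $0\le j\le 2k-1$; $bc=ap$: $y^{(j)}(0)=-y^{(j)}(\omega)$, $0\le j\le 2k-1$; $bc=dir$: $y^{(2i)}(0)=y^{(2i)}(\omega)=0$, $0\le i\le k-1$. Put $\theta=0$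 for $per$, $\theta=1$ for $ap$. Unperturbed projections. For $bc\in\{per,ap\}$: $\lambda_n=(\pi(2n+\theta)/\omega)^{2k}$, $n\in\mathbb{Z}_+$, $e_n(t)=e^{-i\pi(2n+\theta)t/\omega}$, $n\in\mathbb{Z}$, and $\mathbb{P}_nx=(x,e_{-n-\theta})e_{-n-\theta}+(x,e_n)e_n$ (with $\mathbb{P}_0x=(x,e_0)e_0$ if $\theta=0$). For $bc=dir$: $\lambda_{n,dir}=(\pi n/\omega)^{2k}$, $e_{n,dir}(t)=\sqrt2\sin(\pi nt/\omega)$, $P_{n,dir}x=(x,e_{n,dir})e_{n,dir}$, $n\in\mathbb{N}$. These are the Riesz projections of $L^0_{bc}$ for the eigenvalues $\lambda_n$, resp. $\lambda_{n,dir}$. Spectral splitting. $L_{bc}$ has discrete spectrum and $\sigma(L_{bc})=\sigma_{(m)}\cup\bigcup_{n\ge m+1}\sigma_n$ with mutually disjoint sets. For $bc\in\{per,ap\}$, $\sigma_{(m)}$ is finite with at most $2m+1$ points and $\sigma_n=\{\widetilde\lambda_n^-,\widetilde\lambda_n^+\}$ with $\widetilde\lambda_n^{\mp}=\lambda_n-\frac1\omega\int_0^\omega q\,dt+o(1)$ as $n\to\infty$. For $bc=dir$, $\sigma_{(m)}$ is finite with at most $m$ points and $\sigma_n=\{\widetilde\lambda_{n,dir}\}$ with $\widetilde\lambda_{n,dir}=\lambda_{n,dir}-\frac1\omega\int_0^\omega q\,dt+o(1)$. $\widetilde{\mathbb{P}}_n$ (for $per,ap$), resp. $\widetilde P_{n,dir}$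 (for $dir$), is the Riesz projection of $L_{bc}$ for $\sigma_n$, $n\ge m+1$. For $\Omega\subset\{m+1,m+2,\dots\}$: if $bc\in\{per,ap\}$, $\Delta(\Omega)=\{\lambda_n:n\in\Omega\}$, $\widetilde\Delta(\Omega)=\bigcup_{n\in\Omega}\sigma_n$, $P(\Delta,L^0_{bc})x=\sum_{n\in\Omega}\mathbb{P}_nx$, $P(\widetilde\Delta,L_{bc})x=\sum_{n\in\Omega}\widetilde{\mathbb{P}}_nx$; if $bc=dir$, $\Delta(\Omega)=\{\lambda_{n,dir}:n\in\Omega\}$, $\widetilde\Delta(\Omega)=\bigcup_{n\in\Omega}\sigma_n$, $P(\Delta,L^0_{dir})x=\sum_{n\in\Omega}P_{n,dir}x$, $P(\widetilde\Delta,L_{dir})x=\sum_{n\in\Omega}\widetilde P_{n,dir}x$, for $x\in L_2[0,\omega]$.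
   Formalization: For bc = ap the set σ_(m) is allowed at most 2m+2 points instead of 2m+1: all antiperiodic λ_0,…,λ_m are double, so the bound 2m+1 fails when all eigenvalues of L_ap are simple. *)

(* Defs.v *)
From mathcomp Require Import all_boot all_order all_algebra.
From mathcomp Require Import complex.
From mathcomp Require Import all_classical all_reals all_analysis.
Import Order.TTheory GRing.Theory Num.Theory.
Import numFieldNormedType.Exports.

Set Implicit Arguments.
Unset Strict Implicit.
Unset Printing Implicit Defensive.

Local Open Scope classical_set_scope.
Local Open Scope complex_scope.
Local Open Scope ring_scope.

Definition cabs {R : realType} (z : R[i]) : R := ComplexField.Normc.normc z.

Definition cexp_i {R : realType} (s : R) : R[i] := cos s +i* sin s.

Definition cintegral {R : realType} (D : set R) (f : R -> R[i]) : R[i] :=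
  (\int[lebesgue_measure]_(t in D) complex.Re (f t))
  +i* (\int[lebesgue_measure]_(t in D) complex.Im (f t)).

(* Elements of L_2[0, omega] are represented by functions [R -> R[i]], of which only the
   restriction to [0, omega] matters, and identified when [aeeq]. *)

Definition aeeq {R : realType} (omega : R) (x y : R -> R[i]) : Prop :=
  {ae lebesgue_measure, forall t : R, t \in `[0, omega] -> x t = y t}.

Definition L2 {R : realType} (omega : R) (x : R -> R[i]) : Prop :=
  [/\ measurable_fun `[0, omega]%classic (fun t => complex.Re (x t)),
      measurable_fun `[0, omega]%classic (fun t => complex.Im (x t)) &
      (\int[lebesgue_measure]_(t in `[0%R, omega]%classic)
         ((cabs (x t)) ^+ 2)%:E < +oo)%E].

Definition ip {R : realType} (omega : R) (x y : R -> R[i]) : R[i] :=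
  (omega^-1)%:C * cintegral `[0, omega]%classic (fun t => x t * (y t)^*).

Definition L2norm {R : realType} (omega : R) (x : R -> R[i]) : R :=
  Num.sqrt (complex.Re (ip omega x x)).

Definition mean {R : realType} (omega : R) (x : R -> R[i]) : R[i] :=
  (omega^-1)%:C * cintegral `[0, omega]%classic x.

(* Linearity and boundedness imply compatibility with [aeeq]. *)
Definition bounded_op {R : realType} (omega : R)
    (T : (R -> R[i]) -> (R -> R[i])) : Prop :=
  [/\ forall x, L2 omega x -> L2 omega (T x),
      forall (a : R[i]) x y, L2 omega x -> L2 omega y ->
        aeeq omega (T (fun t => a * x t + y t))
                   (fun t => a * T x t + T y t) &
      exists M : R, forall x, L2 omega x ->
        L2norm omega (T x) <= M * L2norm omega x].

Definition finite_rank {R : realType} (omega : R)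
    (T : (R -> R[i]) -> (R -> R[i])) : Prop :=
  exists2 u : seq (R -> R[i]),
    forall i : 'I_(size u), L2 omega u`_i &
    forall x, L2 omega x -> exists c : 'I_(size u) -> R[i],
      aeeq omega (T x) (fun t => \sum_i c i * u`_i t).

Definition orthonormal_basis {R : realType} (omega : R)
    (b : nat -> R -> R[i]) : Prop :=
  [/\ forall n, L2 omega (b n),
      forall n p, ip omega (b n) (b p) = (n == p)%:R &
      forall x, L2 omega x -> (forall n, ip omega x (b n) = 0) ->
        aeeq omega x (fun=> 0)].

(* For a bounded operator [T] the sum does not depend on the orthonormal basis,
   so the supremum is over a single value. *)
Definition HSnorm {R : realType} (omega : R)
    (T : (R -> R[i]) -> (R -> R[i])) : \bar R :=
  ereal_sup
    [set ((\sum_(0 <= n <oo) ((L2norm omega (T (b n))) ^+ 2)%:E) `^ 2^-1)%E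
    | b in [set b | orthonormal_basis omega b]].

(* [T x] is the sum, converging in L_2[0, omega], of the [P n x] over n in
   Omega. *)
Definition op_sum {R : realType} (omega : R) (Omega : set nat)
    (P : nat -> (R -> R[i]) -> (R -> R[i]))
    (T : (R -> R[i]) -> (R -> R[i])) : Prop :=
  bounded_op omega T /\
  forall x, L2 omega x ->
    L2norm omega (fun t => (\sum_(0 <= n < N | n \in Omega) P n x t) - T x t)
      @[N --> \oo] --> (0 : R).

Inductive bcond := Per | Ap | Dir.

Definition theta (bc : bcond) : nat := if bc is Ap then 1%N else 0%N.

(* Derivative at [t] relative to [0, omega]: one-sided at the end points. *)
Definition has_deriv {R : realType} (omega : R) (f : R -> R[i]) (t : R)
    (l : R[i]) : Prop :=
  cabs (((s - t)^-1)%:C * (f s - f t) - l)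
    @[s --> within `[0, omega]%classic t^'] --> (0 : R).

Definition abs_continuous {R : realType} (omega : R) (f : R -> R[i]) : Prop :=
  forall eps : R, 0 < eps -> exists2 delta : R, 0 < delta &
    forall s : seq (R * R),
      (forall p, p \in s -> [/\ 0 <= p.1, p.1 <= p.2 & p.2 <= omega]) ->
      pairwise (fun p p' => (p.2 <= p'.1) || (p'.2 <= p.1)) s ->
      \sum_(p <- s) (p.2 - p.1) < delta ->
      \sum_(p <- s) cabs (f p.2 - f p.1) < eps.

(* [Y 0] is in H^r[0, omega] with successive derivatives [Y 1], ..., [Y r]
   on [0, omega], the last one being an almost everywhere derivative. *)
Definition sobolev {R : realType} (omega : R) (r : nat) (Y : nat -> R -> R[i])
    : Prop :=
  [/\ forall j, (j < r.-1)%N -> forall t, t \in `[0, omega] ->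
        has_deriv omega (Y j) t (Y j.+1 t),
      abs_continuous omega (Y r.-1),
      {ae lebesgue_measure, forall t : R, t \in `[0, omega] ->
        has_deriv omega (Y r.-1) t (Y r t)} &
      L2 omega (Y r)].

Definition satisfies_bc {R : realType} (omega : R) (k : nat) (bc : bcond)
    (Y : nat -> R -> R[i]) : Prop :=
  match bc with
  | Per => forall j, (j <= (2 * k).-1)%N -> Y j 0 = Y j omega
  | Ap => forall j, (j <= (2 * k).-1)%N -> Y j 0 = - Y j omega
  | Dir => forall i, (i <= k.-1)%N ->
      Y (2 * i)%N 0 = 0 /\ Y (2 * i)%N omega = 0
  end.

(* The graph of L_bc, as an operator in L_2[0, omega]: (the class of) [y] is in
   the domain of L_bc and L_bc y = f. *)
Definition Lbc {R : realType} (omega : R) (k : nat) (q : R -> R[i])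
    (bc : bcond) (y f : R -> R[i]) : Prop :=
  exists Y : nat -> R -> R[i],
    [/\ sobolev omega (2 * k) Y, satisfies_bc omega k bc Y,
        aeeq omega y (Y 0%N) &
        aeeq omega f (fun t => (-1) ^+ k * Y (2 * k)%N t - q t * Y 0%N t)].

(* [T] is the bounded inverse of z - L_bc. *)
Definition is_resolvent {R : realType} (omega : R) (k : nat) (q : R -> R[i])
    (bc : bcond) (z : R[i]) (T : (R -> R[i]) -> (R -> R[i])) : Prop :=
  bounded_op omega T /\
  forall f y, L2 omega f -> L2 omega y ->
    (aeeq omega (T f) y <-> Lbc omega k q bc y (fun t => z * y t - f t)).

Definition spectrum {R : realType} (omega : R) (k : nat) (q : R -> R[i])
    (bc : bcond) : set R[i] :=
  [set z | ~ exists T, is_resolvent omega k q bc z T].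

(* (2 i pi)^-1 times the integral of [f] over the positively oriented circle of
   centre [c] and radius [r]. *)
Definition circle_mean {R : realType} (c : R[i]) (r : R) (f : R[i] -> R[i])
    : R[i] :=
  (2 * 'i%C * pi%:C)^-1 *
  cintegral `[0, 2 * pi]%classic
    (fun s => f (c + r%:C * cexp_i s) * ('i%C * r%:C * cexp_i s)).

(* [P] is the Riesz projection (2 i pi)^-1 \oint (z - L_bc)^-1 dz for the part
   [S] of the spectrum. The contour consists of finitely many disjoint circles,
   given by their centres and radii, with [S] inside and the rest of the
   spectrum outside; [P] does not depend on its choice. The operator-valued
   integral is the weak one. *)
Definition riesz_projection {R : realType} (omega : R) (k : nat)
    (q : R -> R[i]) (bc : bcond) (S : set R[i])
    (P : (R -> R[i]) -> (R -> R[i])) : Prop :=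
  bounded_op omega P /\
  exists (gam : seq (R[i] * R)) (Rs : R[i] -> (R -> R[i]) -> (R -> R[i])),
    [/\ all (fun d => 0 < d.2) gam,
        pairwise (fun d d' => d.2 + d'.2 < cabs (d.1 - d'.1)) gam,
        spectrum omega k q bc `&`
          [set z | has (fun d => cabs (z - d.1) < d.2) gam] = S,
        forall z, has (fun d => cabs (z - d.1) == d.2) gam ->
          is_resolvent omega k q bc z (Rs z) &
        forall x y, L2 omega x -> L2 omega y ->
          ip omega (P x) y =
          \sum_(d <- gam) circle_mean d.1 d.2 (fun z => ip omega (Rs z x) y)].

(* The spectrum consists of isolated points of finite algebraic multiplicity. *)
Definition discrete_spectrum {R : realType} (omega : R) (k : nat)
    (q : R -> R[i]) (bc : bcond) : Prop :=
  forall z, spectrum omega k q bc z ->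
    exists2 P, riesz_projection omega k q bc [set z] P & finite_rank omega P.

Definition eigval0 {R : realType} (omega : R) (k : nat) (bc : bcond) (n : nat)
    : R :=
  match bc with
  | Dir => (pi * n%:R / omega) ^+ (2 * k)
  | _ => (pi * (2 * n + theta bc)%:R / omega) ^+ (2 * k)
  end.

Definition efun {R : realType} (omega : R) (bc : bcond) (n : int)
    : R -> R[i] :=
  fun t => cexp_i (- (pi * (2 * n + (theta bc)%:Z)%:~R * t / omega)).

Definition efun_dir {R : realType} (omega : R) (n : nat) : R -> R[i] :=
  fun t => (Num.sqrt 2 * sin (pi * n%:R * t / omega))%:C.

Definition proj1 {R : realType} (omega : R) (e x : R -> R[i]) : R -> R[i] :=
  fun t => ip omega x e * e t.

Definition proj0 {R : realType} (omega : R) (bc : bcond) (n : nat)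
    (x : R -> R[i]) : R -> R[i] :=
  match bc with
  | Dir => proj1 omega (efun_dir omega n) x
  | _ =>
      let e := efun omega bc in
      if (n == 0%N) && (theta bc == 0%N) then proj1 omega (e 0) x
      else fun t => proj1 omega (e (- n%:Z - (theta bc)%:Z)) x t
                    + proj1 omega (e n%:Z) x t
  end.

(* The number of eigenvalues of the unperturbed operator of index at most [m],
   with multiplicity: 2m+1 in the periodic case, 2m+2 in the antiperiodic case
   (where the eigenvalue of index 0 is also double), m in the Dirichlet case. *)
Definition head_bound (bc : bcond) (m : nat) : nat :=
  match bc with
  | Per => (2 * m + 1)%N
  | Ap => (2 * m + 2)%N
  | Dir => m
  end.

Definition eigval_asymp {R : realType} (omega : R) (k : nat) (q : R -> R[i])
    (bc : bcond) (mu : nat -> R[i]) : Prop :=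
  cabs (mu n - ((eigval0 omega k bc n)%:C - mean omega q))
    @[n --> \oo] --> (0 : R).

Definition spectral_splitting {R : realType} (omega : R) (k : nat)
    (q : R -> R[i]) (bc : bcond) (m : nat) (sigma0 : set R[i])
    (sigma : nat -> set R[i]) : Prop :=
  [/\ discrete_spectrum omega k q bc,
      spectrum omega k q bc =
        sigma0 `|` \bigcup_(n in [set n | (m < n)%N]) sigma n,
      trivIset [set n | (m < n)%N] sigma /\
        (forall n, (m < n)%N -> sigma0 `&` sigma n = set0),
      (sigma0 #<= `I_(head_bound bc m))%card &
      match bc with
      | Dir => exists mu : nat -> R[i],
          (forall n, (m < n)%N -> sigma n = [set mu n]) /\
          eigval_asymp omega k q bc mu
      | _ => exists mu_m mu_p : nat -> R[i],
          [/\ forall n, (m < n)%N -> sigma n = [set mu_m n; mu_p n],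
              eigval_asymp omega k q bc mu_m &
              eigval_asymp omega k q bc mu_p]
      end].

(* Main.v *)
(* In the Fourier basis of L^0_bc the operator L_bc is the infinite matrix Lam - Q,
   where Lam is the diagonal matrix of the eigenvalues lam_i and Q is the matrix of the
   multiplication by q, whose columns are bounded in l^2. The gaps grow like
   |lam_i - lam_j| >= c |i - j| max(i, j)^(2k - 1), so that for large m a contraction
   produces K with small Hilbert-Schmidt norm and D commuting with the projections onto
   the blocks {lam_i = lambda_n}, n > m, and onto the remaining finite block, such that
   (Lam - Q)(1 + K) = (1 + K)(Lam - D). Everything that concerns the spectrum can then
   be read off Lam - D: its eigenvalues are those of its finite blocks, its resolvent has
   an explicit Laurent expansion at each lambda_n, and the Riesz projections of Lam - Q
   are U P U^-1 with U = 1 + K and P a coordinate projection. Finally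
   U P U^-1 - P = [K, P] U^-1, whose Hilbert-Schmidt norm is controlled by the entries
   of K with an index in the blocks of Omega; these are O(1 / |lam_i - lam_j|). *)

Require Import Defs.
From HB Require Import structures.
From mathcomp Require Import all_boot all_order all_algebra.
From mathcomp Require Import complex ring lra zify.
From mathcomp Require Import all_classical all_reals all_analysis.
From mathcomp Require Import measurable_realfun.
Import Order.TTheory GRing.Theory Num.Theory.
Import numFieldNormedType.Exports.

Set Implicit Arguments.
Unset Strict Implicit.
Unset Printing Implicit Defensive.

Local Open Scope classical_set_scope.
Local Open Scope complex_scope.
Local Open Scope ring_scope.

(** * Complex series *)

(** As [q] is only square-integrable, Q is in general unbounded on l^2. It is bounded from l^1 to
    l^2, however, and the domain of [lam] lies in l^1 because [lam i >= c * i^2]; all products with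
    Q are formed on l^1, where K acts as well. The unknown of the contraction is not K but its
    commutator with [lam], measured by the supremum of its entries: division by the gaps produces
    weights with small row and column sums, which makes every series in the equation converge
    absolutely. The intertwining relation yields one inclusion of graphs only; the other follows
    from the resolvent of [lam - D] at a remote negative point -t and from the injectivity of the
    perturbed operator plus t. The size of m makes the norm of K at most 1/4 and the gaps at least
    [4 * del], where [del] bounds the norm of D, so that circles of radius [2 * del] separate the
    blocks. One U conjugates all the Riesz projections, hence also their sum over an infinite Omega.
    The exponent is half of 4k - 3, the decay of the tail of the sum of i^(-2(2k - 1)). *)

Section ComplexModulus.
Context {R : realType}.
Implicit Types (z w : R[i]).

Lemma cabs_ge0 z : 0 <= cabs z.
Proof. by case: z => a b; rewrite /cabs /=; exact: sqrtr_ge0. Qed.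

Lemma cabs0 : cabs (0 : R[i]) = 0. Proof. exact: ComplexField.Normc.normc0. Qed.

Lemma cabs1 : cabs (1 : R[i]) = 1. Proof. exact: ComplexField.Normc.normc1. Qed.

Lemma cabsM z w : cabs (z * w) = cabs z * cabs w.
Proof. exact: ComplexField.Normc.normcM. Qed.

Lemma cabsV z : cabs z^-1 = (cabs z)^-1.
Proof. exact: ComplexField.Normc.normcV. Qed.

Lemma cabsX z n : cabs (z ^+ n) = cabs z ^+ n.
Proof. by elim: n => [|n IH]; rewrite ?expr0 ?cabs1// !exprS cabsM IH. Qed.

Lemma cabsN z : cabs (- z) = cabs z. Proof. exact: complex.normcN. Qed.

Lemma cabsD z w : cabs (z + w) <= cabs z + cabs w.
Proof. exact: complex.le_normcD. Qed.

Lemma cabsB z w : cabs (z - w) <= cabs z + cabs w.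
Proof. by rewrite -(cabsN w) cabsD. Qed.

Lemma cabs_distC z w : cabs (z - w) = cabs (w - z).
Proof. by rewrite -cabsN opprB. Qed.

Lemma cabs_distD w z v : cabs (z - v) <= cabs (z - w) + cabs (w - v).
Proof. by rewrite -{1}(subrK w z) -addrA cabsD. Qed.

Lemma cabs_subD z w : cabs z - cabs w <= cabs (z + w).
Proof. by rewrite lerBlDr -{1}(addrK w z) cabsB. Qed.

Lemma cabs_eq0 z : (cabs z == 0) = (z == 0).
Proof.
apply/eqP/eqP => [|->]; [exact: ComplexField.Normc.eq0_normc|exact: cabs0].
Qed.

Lemma cabs_gt0 z : (0 < cabs z) = (z != 0).
Proof. by rewrite lt_def cabs_eq0 cabs_ge0 andbT. Qed.

Lemma cabs_sqr z : cabs z ^+ 2 = complex.Re z ^+ 2 + complex.Im z ^+ 2.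
Proof.
by case: z => a b; rewrite /cabs /= sqr_sqrtr // addr_ge0 ?sqr_ge0.
Qed.

Lemma cabsJ z : cabs z^* = cabs z.
Proof. by case: z => a b; rewrite /cabs /= sqrrN. Qed.

Lemma mulcJ z : z * z^* = (cabs z ^+ 2)%:C.
Proof.
rewrite cabs_sqr; case: z => a b; apply/eqP; rewrite eq_complex /=.
by rewrite !expr2 mulrN opprK mulrN (mulrC b a) addNr !eqxx.
Qed.

Lemma cabsR (x : R) : cabs x%:C = `|x|.
Proof. by rewrite /cabs /= expr0n addr0 sqrtr_sqr. Qed.

Lemma Re_le_cabs z : `|complex.Re z| <= cabs z.
Proof.
rewrite -(ler_pXn2r (ltn0Sn 1)) ?nnegrE ?cabs_ge0//.
by rewrite cabs_sqr real_normK ?num_real// lerDl sqr_ge0.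
Qed.

Lemma Im_le_cabs z : `|complex.Im z| <= cabs z.
Proof.
rewrite -(ler_pXn2r (ltn0Sn 1)) ?nnegrE ?cabs_ge0//.
by rewrite cabs_sqr real_normK ?num_real// lerDr sqr_ge0.
Qed.

Lemma cabs_le_ReIm z : cabs z <= `|complex.Re z| + `|complex.Im z|.
Proof.
rewrite -(ler_pXn2r (ltn0Sn 1)) ?nnegrE ?cabs_ge0 ?addr_ge0//.
rewrite cabs_sqr sqrrD !real_normK ?num_real// lerD2r lerDl.
by rewrite mulrn_wge0 // mulr_ge0.
Qed.

Lemma cabs_sum (I : Type) (r : seq I) (P : pred I) (F : I -> R[i]) :
  cabs (\sum_(i <- r | P i) F i) <= \sum_(i <- r | P i) cabs (F i).
Proof.
apply: (big_ind2 (fun a b => cabs a <= b)) => [|a b c d ab cd|//].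
  by rewrite cabs0.
exact: le_trans (cabsD _ _) (lerD ab cd).
Qed.

Lemma cabs_cexp_i (s : R) : cabs (cexp_i s) = 1.
Proof. by rewrite /cabs /cexp_i /= cos2Dsin2 sqrtr1. Qed.

Lemma Re_sum (I : Type) (r : seq I) (P : pred I) (F : I -> R[i]) :
  complex.Re (\sum_(i <- r | P i) F i) = \sum_(i <- r | P i) complex.Re (F i).
Proof. by apply: (big_morph (@complex.Re R)) => // -[a b] [c d]. Qed.

Lemma Im_sum (I : Type) (r : seq I) (P : pred I) (F : I -> R[i]) :
  complex.Im (\sum_(i <- r | P i) F i) = \sum_(i <- r | P i) complex.Im (F i).
Proof. by apply: (big_morph (@complex.Im R)) => // -[a b] [c d]. Qed.

End ComplexModulus.

(** * Nonnegative series and finite Cauchy-Schwarz inequalities *)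

Section RealSums.
Context {R : realType}.
Implicit Types (a b : nat -> R).

Definition rsum a : R := limn (fun n => \sum_(i < n) a i).

Lemma cvg_rsum a M : (forall i, 0 <= a i) -> (forall n, \sum_(i < n) a i <= M) ->
  (\sum_(i < n) a i) @[n --> \oo] --> rsum a.
Proof.
move=> a0 aM; apply: nondecreasing_is_cvgn.
  by apply/nondecreasing_seqP => n; rewrite big_ord_recr lerDl.
by exists M => _ [n _ <-].
Qed.

Lemma rsum_le a M : (forall i, 0 <= a i) -> (forall n, \sum_(i < n) a i <= M) ->
  rsum a <= M.
Proof.
move=> a0 aM; have h := cvg_rsum a0 aM.
apply: limr_le; first by apply/cvg_ex; exists (rsum a).
by apply: nearW => n; exact: aM.
Qed.

Lemma psum_le_rsum a M n : (forall i, 0 <= a i) ->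
  (forall n, \sum_(i < n) a i <= M) -> \sum_(i < n) a i <= rsum a.
Proof.
move=> a0 aM.
apply: (@nondecreasing_cvgn_le _ (fun n => \sum_(i < n) a i)).
  by apply/nondecreasing_seqP => p; rewrite big_ord_recr lerDl.
by apply/cvg_ex; exists (rsum a); exact: cvg_rsum aM.
Qed.

Lemma psum_le a n p : (forall i, 0 <= a i) -> (n <= p)%N ->
  \sum_(i < n) a i <= \sum_(i < p) a i.
Proof.
move=> a0 np; rewrite -!(big_mkord xpredT a) [leRHS](big_cat_nat (leq0n n) np)/=.
by rewrite lerDl sumr_ge0.
Qed.

(** The sum of (a i * t + b i)^2 is a nonnegative quadratic polynomial in t; its value at the
    minimum -P / A gives the inequality. *)
Lemma sum_CS (I : Type) (r : seq I) (a b : I -> R) :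
  (\sum_(i <- r) a i * b i) ^+ 2
    <= (\sum_(i <- r) a i ^+ 2) * (\sum_(i <- r) b i ^+ 2).
Proof.
set A := \sum_(i <- r) a i ^+ 2; set B := \sum_(i <- r) b i ^+ 2.
set P := \sum_(i <- r) a i * b i.
have A0 : 0 <= A by rewrite sumr_ge0// => i _; rewrite sqr_ge0.
have key (t : R) : 0 <= A * t ^+ 2 + 2 * P * t + B.
  have -> : A * t ^+ 2 + 2 * P * t + B = \sum_(i <- r) (a i * t + b i) ^+ 2.
    rewrite /A /P /B mulr_suml mulr_sumr mulr_suml -!big_split /=.
    by apply: eq_bigr => i _; ring.
  by rewrite sumr_ge0// => i _; rewrite sqr_ge0.
have [A00|An0] := eqVneq A 0.
  have [->|Pn] := eqVneq P 0; first by rewrite expr0n A00 mul0r.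
  (* For A = 0 the polynomial is affine and would take the value -1 at this point. *)
  have := key (- (B + 1) / (2 * P)); rewrite A00.
  have -> : 0 * (- (B + 1) / (2 * P)) ^+ 2 + 2 * P * (- (B + 1) / (2 * P)) + B = - 1.
    by field.
  lra.
have Ap : 0 < A by rewrite lt_def An0.
have := key (- P / A).
have -> : A * (- P / A) ^+ 2 + 2 * P * (- P / A) + B = B - P ^+ 2 / A by field.
by rewrite subr_ge0 ler_pdivrMr // mulrC.
Qed.

(** The bounds M and N stand for the exact norms, so that finite sections of infinite sequences are
    treated with constants independent of their length. *)
Lemma sum_Minkowski (I : Type) (r : seq I) (a b : I -> R) (M N : R) :
  0 <= M -> 0 <= N ->
  \sum_(i <- r) a i ^+ 2 <= M ^+ 2 -> \sum_(i <- r) b i ^+ 2 <= N ^+ 2 ->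
  \sum_(i <- r) (a i + b i) ^+ 2 <= (M + N) ^+ 2.
Proof.
move=> M0 N0 aM bN.
have -> : \sum_(i <- r) (a i + b i) ^+ 2 = \sum_(i <- r) a i ^+ 2
    + 2 * (\sum_(i <- r) a i * b i) + \sum_(i <- r) b i ^+ 2.
  by rewrite mulr_sumr -!big_split /=; apply: eq_bigr => i _; ring.
have := sum_CS r a b.
have A0 : 0 <= \sum_(i <- r) a i ^+ 2 by rewrite sumr_ge0// => i _; rewrite sqr_ge0.
have B0 : 0 <= \sum_(i <- r) b i ^+ 2 by rewrite sumr_ge0// => i _; rewrite sqr_ge0.
set A := \sum_(i <- r) a i ^+ 2 in aM A0 *; set B := \sum_(i <- r) b i ^+ 2 in bN B0 *.
set P := \sum_(i <- r) a i * b i => PAB.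
have PMN : P <= M * N.
  have : P ^+ 2 <= (M * N) ^+ 2.
    by apply: le_trans PAB _; rewrite exprMn ler_pM.
  move=> h; apply: le_trans (ler_norm _) _.
  rewrite -(ler_pXn2r (ltn0Sn 1)) ?nnegrE ?mulr_ge0//.
  by rewrite real_normK ?num_real.
nra.
Qed.

End RealSums.

(** * Absolutely convergent complex series *)

Section ComplexSums.
Context {R : realType}.
Implicit Types (a b u : nat -> R[i]) (l z : R[i]).

(** Convergence is measured by the real-valued modulus, the form in which [has_deriv] and
    [eigval_asymp] state their limits. *)
Definition ctends u l := cabs (u n - l) @[n --> \oo] --> (0 : R).

Lemma ctendsP u l : ctends u l <->
  forall e, 0 < e -> exists N, forall n, (N <= n)%N -> cabs (u n - l) < e.
Proof.
split=> [h e e0|h].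
  move/cvgrPdist_lt : h => /(_ e e0)[N _ hN]; exists N => n Nn.
  by have := hN n Nn; rewrite /= sub0r normrN ger0_norm// cabs_ge0.
apply/cvgrPdist_lt => e e0; have [N hN] := h e e0; exists N => // n Nn.
by rewrite /= sub0r normrN ger0_norm ?cabs_ge0// hN.
Qed.

Lemma ctends_cst l : ctends (fun=> l) l.
Proof. by apply/ctendsP => e e0; exists 0%N => n _; rewrite subrr cabs0. Qed.

Lemma ctendsD u v l k : ctends u l -> ctends v k -> ctends (fun n => u n + v n) (l + k).
Proof.
move=> /ctendsP hu /ctendsP hv; apply/ctendsP => e e0.
have [N hN] := hu (e / 2) ltac:(lra); have [P hP] := hv (e / 2) ltac:(lra).
exists (maxn N P) => n; rewrite geq_max => /andP[Nn Pn].
have := hN n Nn; have := hP n Pn.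
rewrite opprD addrACA; have := cabsD (u n - l) (v n - k); lra.
Qed.

Lemma ctendsZ z u l : ctends u l -> ctends (fun n => z * u n) (z * l).
Proof.
move=> h; rewrite /ctends.
under eq_fun do rewrite -mulrBr cabsM.
by have := cvgM (cvg_cst (cabs z)) h; rewrite mulr0; apply.
Qed.

Lemma ctendsB u v l k : ctends u l -> ctends v k -> ctends (fun n => u n - v n) (l - k).
Proof.
move=> hu /(ctendsZ (-1)) hv; have := ctendsD hu hv.
by rewrite mulN1r; under [X in ctends X]eq_fun do rewrite mulN1r.
Qed.

Lemma ctends_bound u l M : ctends u l -> (forall n, cabs (u n) <= M) -> cabs l <= M.
Proof.
move=> /ctendsP h uM; apply/ler_addgt0Pr => e e0.
have [N /(_ _ (leqnn _)) hN] := h e e0.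
have := cabsD (l - u N) (u N); rewrite subrK cabs_distC.
move: hN (uM N); lra.
Qed.

Lemma ctends_uniq u l k : ctends u l -> ctends u k -> l = k.
Proof.
move=> hl hk; have := ctendsB hl hk.
under [X in ctends X]eq_fun do rewrite subrr.
move=> h; have := @ctends_bound _ _ 0 h; rewrite cabs0 => /(_ (fun=> lexx _)).
rewrite le_eqVlt ltNge cabs_ge0 orbF cabs_eq0 subr_eq0.
by move=> /eqP.
Qed.

Lemma ctends_ReIm u l : complex.Re (u n) @[n --> \oo] --> complex.Re l ->
  complex.Im (u n) @[n --> \oo] --> complex.Im l -> ctends u l.
Proof.
move=> hr hi; rewrite /ctends.
apply: (@squeeze_cvgr _ _ _ _ (fun=> 0) (fun n => `|complex.Re (u n) - complex.Re l|
   + `|complex.Im (u n) - complex.Im l|)).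
- apply: nearW => n; rewrite cabs_ge0/=; apply: le_trans (cabs_le_ReIm _) _.
  by case: (u n) => ? ?; case: l {hr hi} => ? ?.
- exact: cvg_cst.
- rewrite -[X in _ --> X](addr0 (0 : R)); apply: cvgD.
  + by apply/norm_cvg0P; rewrite -(subrr (complex.Re l)); apply: cvgB => //; exact: cvg_cst.
  + by apply/norm_cvg0P; rewrite -(subrr (complex.Im l)); apply: cvgB => //; exact: cvg_cst.
Qed.

(** The a priori rate [e] passes to the limit; this is how convergence uniform in further parameters
    is obtained, as for the entries of the iterates in [Phi_fix]. *)
Lemma ctends_cauchy u (e : nat -> R) : e n @[n --> \oo] --> (0 : R) ->
  (forall n p, (n <= p)%N -> cabs (u p - u n) <= e n) ->
  exists l, ctends u l /\ forall n, cabs (l - u n) <= e n.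
Proof.
move=> e0 ue.
have C (f : R[i] -> R) : (forall z w, `|f z - f w| <= cabs (z - w)) ->
    exists l : R, f (u n) @[n --> \oo] --> l.
  move=> fl; apply/cvg_ex; apply/cauchy_cvgP/cauchy_ballP => d d0.
  have /cvgrPdist_lt/(_ (d / 2) ltac:(lra))[N _ hN] := e0.
  have hd p : (N <= p)%N -> `|f (u N) - f (u p)| < d / 2.
    move=> Np; apply: le_lt_trans (fl _ _) _; rewrite cabs_distC.
    apply: le_lt_trans (ue _ _ Np) _; have := hN N (leqnn N).
    by rewrite /= sub0r normrN; apply: le_lt_trans; exact: ler_norm.
  near_simpl; exists ([set n | (N <= n)%N], [set n | (N <= n)%N]).
    by split; exists N.
  move=> [n p] [/= /hd hn /hd hp].
  rewrite /ball /=; apply: le_lt_trans (ler_distD (f (u N)) _ _) _.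
  by rewrite distrC; lra.
have [|a ha] := C (@complex.Re R).
  by move=> [x y] [x' y']; exact: (Re_le_cabs (x +i* y - x' +i* y')).
have [|b hb] := C (@complex.Im R).
  by move=> [x y] [x' y']; exact: (Im_le_cabs (x +i* y - x' +i* y')).
have h : ctends u (a +i* b) by exact: ctends_ReIm.
exists (a +i* b); split => // n.
have hs : ctends (fun p => u (p + n)%N - u n) (a +i* b - u n).
  apply: ctendsB; last exact: ctends_cst.
  apply/ctendsP => d d0; have /ctendsP/(_ d d0)[N hN] := h.
  by exists N => p Np; apply: hN; exact: leq_trans (leq_addr _ _).
by apply: ctends_bound hs _ => p; apply: ue; exact: leq_addl.
Qed.

Definition csummable a := exists M, forall n, \sum_(i < n) cabs (a i) <= M.

(** A total function, with real and imaginary parts summed separately; statements about it assume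
    absolute convergence, [csummable]. *)
Definition csum a : R[i] :=
  limn (fun n => \sum_(i < n) complex.Re (a i))
  +i* limn (fun n => \sum_(i < n) complex.Im (a i)).

Lemma ctends_csum a : csummable a -> ctends (fun n => \sum_(i < n) a i) (csum a).
Proof.
case=> M aM.
have ha : cvgn (fun n => \sum_(i < n) cabs (a i)).
  by apply/cvg_ex; exists (rsum (fun i => cabs (a i))); apply: cvg_rsum aM => i; exact: cabs_ge0.
have C (f : nat -> R) : (forall i, `|f i| <= cabs (a i)) ->
    cvgn (fun n => \sum_(i < n) f i).
  move=> fa; have -> : (fun n => \sum_(i < n) f i) = series f.
    by apply/funext => n; rewrite /series /= big_mkord.
  apply: normed_cvg; apply: (@series_le_cvg _ _ (fun i => cabs (a i))) => //.
  - by move=> n; exact: normr_ge0.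
  - by move=> n; exact: cabs_ge0.
  - rewrite /series /=; under eq_fun do rewrite big_mkord.
    exact: ha.
apply: ctends_ReIm; rewrite /=.
  under eq_fun do rewrite Re_sum; apply: (C (fun i => complex.Re (a i))) => i.
  exact: Re_le_cabs.
under eq_fun do rewrite Im_sum; apply: (C (fun i => complex.Im (a i))) => i.
exact: Im_le_cabs.
Qed.

Lemma csummable_le a b : csummable b -> (forall i, cabs (a i) <= cabs (b i)) -> csummable a.
Proof.
by case=> M bM ab; exists M => n; apply: le_trans (bM n); apply: ler_sum.
Qed.

Lemma csummableD a b : csummable a -> csummable b -> csummable (fun i => a i + b i).
Proof.
move=> [M aM] [N bN]; exists (M + N) => n.
apply: le_trans (lerD (aM n) (bN n)); rewrite -big_split /=.
by apply: ler_sum => i _; exact: cabsD.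
Qed.

Lemma csummableZ z a : csummable a -> csummable (fun i => z * a i).
Proof.
move=> [M aM]; exists (cabs z * M) => n.
under eq_bigr do rewrite cabsM.
by rewrite -mulr_sumr ler_wpM2l ?cabs_ge0.
Qed.

Lemma csumD a b : csummable a -> csummable b ->
  csum (fun i => a i + b i) = csum a + csum b.
Proof.
move=> ha hb; apply: (ctends_uniq (ctends_csum (csummableD ha hb))).
under eq_fun do rewrite big_split /=.
exact: ctendsD (ctends_csum ha) (ctends_csum hb).
Qed.

Lemma csumZ z a : csummable a -> csum (fun i => z * a i) = z * csum a.
Proof.
move=> ha; apply: (ctends_uniq (ctends_csum (csummableZ z ha))).
under eq_fun do rewrite -mulr_sumr.
exact: ctendsZ (ctends_csum ha).
Qed.

Lemma csumB a b : csummable a -> csummable b ->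
  csum (fun i => a i - b i) = csum a - csum b.
Proof.
move=> ha hb; rewrite -mulN1r -csumZ // -csumD //; last exact: csummableZ.
by congr csum; apply/funext => i; rewrite mulN1r.
Qed.

Lemma csum_bound a M : (forall n, \sum_(i < n) cabs (a i) <= M) -> cabs (csum a) <= M.
Proof.
move=> aM; apply: (@ctends_bound (fun n => \sum_(i < n) a i)).
  by apply: ctends_csum; exists M.
by move=> n; apply: le_trans (aM n); exact: cabs_sum.
Qed.

Lemma csummable_fin a N : (forall i, (N <= i)%N -> a i = 0) -> csummable a.
Proof.
move=> aN; exists (\sum_(i < N) cabs (a i)) => n.
have [nN|/ltnW Nn] := leqP n N.
  by apply: (@psum_le _ (fun i => cabs (a i))) => // i; exact: cabs_ge0.
rewrite -!(big_mkord xpredT (fun i => cabs (a i))) (big_cat_nat (leq0n N) Nn)/=.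
have -> : \sum_(N <= i < n) cabs (a i) = 0; last by rewrite addr0.
by rewrite big_nat_cond big1// => i /andP[/andP[Ni _] _]; rewrite aN ?cabs0.
Qed.

Lemma csum_fin a N : (forall i, (N <= i)%N -> a i = 0) -> csum a = \sum_(i < N) a i.
Proof.
move=> aN; apply: (ctends_uniq (ctends_csum (csummable_fin aN))).
apply/ctendsP => e e0; exists N => n Nn.
rewrite -!(big_mkord xpredT a) (big_cat_nat (leq0n N) Nn)/=.
have -> : \sum_(N <= i < n) a i = 0; last by rewrite addr0 subrr cabs0.
by rewrite big_nat_cond big1// => i /andP[/andP[Ni _] _]; rewrite aN.
Qed.

Lemma csum0 : csum (fun=> 0) = 0.
Proof. by rewrite (@csum_fin _ 0%N) // big_ord0. Qed.

Lemma csum1 a j : (forall i, i != j -> a i = 0) -> csum a = a j.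
Proof.
move=> aj; rewrite (@csum_fin _ j.+1) => [|i ji]; last first.
  by apply: aj; rewrite gtn_eqF.
by rewrite big_ord_recr /= big1 ?add0r// => i _; apply: aj; rewrite ltn_eqF.
Qed.

Lemma csummable_sum (n : nat) (a : nat -> nat -> R[i]) :
  (forall i, csummable (a i)) -> csummable (fun j => \sum_(i < n) a i j).
Proof.
move=> ha; elim: n => [|n IH].
  by exists 0 => n; rewrite big1// => i _; rewrite big_ord0 cabs0.
by under eq_fun do rewrite big_ord_recr /=; exact: csummableD.
Qed.

Lemma csum_sum (n : nat) (a : nat -> nat -> R[i]) :
  (forall i, csummable (a i)) ->
  csum (fun j => \sum_(i < n) a i j) = \sum_(i < n) csum (a i).
Proof.
move=> ha; elim: n => [|n IH].
  by rewrite big_ord0 -[RHS]csum0; congr csum; apply/funext => j; rewrite big_ord0.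
rewrite big_ord_recr /= -IH -csumD //; last exact: csummable_sum.
by congr csum; apply/funext => j; rewrite big_ord_recr.
Qed.

Lemma csum_tail a m B : csummable a ->
  (forall p, \sum_(i < p) cabs (a (m + i)%N) <= B) ->
  cabs (csum a - \sum_(i < m) a i) <= B.
Proof.
move=> ha aB.
have h : ctends (fun p => \sum_(i < m + p) a i - \sum_(i < m) a i)
                (csum a - \sum_(i < m) a i).
  apply: ctendsB; last exact: ctends_cst.
  apply/ctendsP => e e0; have /ctendsP/(_ e e0)[N hN] := ctends_csum ha.
  by exists N => p Np; apply: hN; exact: leq_trans (leq_addl _ _).
apply: ctends_bound h _ => p; rewrite big_split_ord /= addrAC subrr add0r.
by apply: le_trans (cabs_sum _ _ _) _; exact: aB.
Qed.

(** The bound on finite rectangles passes to the limit in their width while the number of rows is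
    fixed; each row is itself dominated by a rectangle containing it. *)
Lemma rsum2_bound (b : nat -> nat -> R) M n : (forall i j, 0 <= b i j) ->
  (forall n m, \sum_(i < n) \sum_(j < m) b i j <= M) ->
  \sum_(i < n) rsum (b i) <= M.
Proof.
move=> b0 bM.
have bi i m : \sum_(j < m) b i j <= M.
  apply: le_trans (bM i.+1 m); rewrite big_ord_recr /= lerDr.
  by rewrite sumr_ge0 // => ? _; rewrite sumr_ge0.
have h : \sum_(i < n) \sum_(j < m) b i j @[m --> \oo] --> \sum_(i < n) rsum (b i).
  elim: n => [|n IH].
    by rewrite big_ord0; under eq_fun do rewrite big_ord0; exact: cvg_cst.
  rewrite big_ord_recr /=; under eq_fun do rewrite big_ord_recr /=.
  by apply: cvgD => //; apply: cvg_rsum (bi n).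
have <- := cvg_lim _ h => //; apply: limr_le; first by apply/cvg_ex; eexists; exact: h.
exact: nearW.
Qed.

(* The error of the truncation at [m] of the sum of the column sums is at most the tail of the
   column sums of the moduli, uniformly in the number of rows. *)
Lemma csum_exchange (a : nat -> nat -> R[i]) M :
  (forall n m, \sum_(i < n) \sum_(j < m) cabs (a i j) <= M) ->
  csum (fun i => csum (a i)) = csum (fun j => csum (a^~ j)).
Proof.
move=> aM.
have row i : csummable (a i).
  exists M => m; apply: le_trans (aM i.+1 m); rewrite big_ord_recr /= lerDr.
  by rewrite sumr_ge0 // => ? _; rewrite sumr_ge0// => ? _; exact: cabs_ge0.
have col j : csummable (a^~ j).
  exists M => n; apply: le_trans (aM n j.+1); apply: ler_sum => i _.
  by rewrite big_ord_recr /= lerDr sumr_ge0 // => ? _; exact: cabs_ge0.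
pose T j := rsum (fun i => cabs (a i j)).
have colM j n : \sum_(i < n) cabs (a i j) <= M.
  apply: le_trans (aM n j.+1); apply: ler_sum => i _.
  by rewrite big_ord_recr /= lerDr sumr_ge0 // => ? _; exact: cabs_ge0.
have T0 j : 0 <= T j.
  have := psum_le_rsum 0 (fun i => cabs_ge0 (a i j)) (colM j).
  by rewrite big_ord0.
have TM m : \sum_(j < m) T j <= M.
  apply: (rsum2_bound (b := fun j i => cabs (a i j))) => [? ?|? ?]; first exact: cabs_ge0.
  by rewrite exchange_big; exact: aM.
have rowS : csummable (fun i => csum (a i)).
  exists M => n; apply: (@le_trans _ _ (\sum_(i < n) rsum (fun j => cabs (a i j)))).
    apply: ler_sum => i _; apply: csum_bound => m.
    apply: (psum_le_rsum (M := M)) => [?|p]; first exact: cabs_ge0.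
    apply: le_trans (aM i.+1 p); rewrite big_ord_recr /= lerDr.
    by rewrite sumr_ge0 // => ? _; rewrite sumr_ge0// => ? _; exact: cabs_ge0.
  by apply: (rsum2_bound (b := fun i j => cabs (a i j))) => // ? ?; exact: cabs_ge0.
have colS : csummable (fun j => csum (a^~ j)).
  exists M => m; apply: le_trans (TM m); apply: ler_sum => j _.
  apply: csum_bound => n; apply: psum_le_rsum (colM j) => i; exact: cabs_ge0.
have key m : cabs (csum (fun i => csum (a i)) - \sum_(j < m) csum (a^~ j))
    <= rsum T - \sum_(j < m) T j.
  have h : ctends (fun n => \sum_(i < n) csum (a i) - \sum_(j < m) \sum_(i < n) a i j)
      (csum (fun i => csum (a i)) - \sum_(j < m) csum (a^~ j)).
    apply: ctendsB; first exact: ctends_csum.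
    elim: m => [|m IH].
      by rewrite big_ord0; under [X in ctends X]eq_fun do rewrite big_ord0; exact: ctends_cst.
    rewrite big_ord_recr /=; under [X in ctends X]eq_fun do rewrite big_ord_recr /=.
    by apply: ctendsD => //; exact: ctends_csum.
  apply: ctends_bound h _ => n; rewrite -csum_sum //.
  apply: csum_tail; first exact: csummable_sum.
  move=> p; apply: (@le_trans _ _ (\sum_(i < p) T (m + i)%N)).
    apply: ler_sum => i _; apply: le_trans (cabs_sum _ _ _) _.
    by apply: psum_le_rsum (colM _) => ?; exact: cabs_ge0.
  by have := psum_le_rsum (m + p) T0 TM; rewrite big_split_ord /= lerBrDl.
apply: ctends_uniq (ctends_csum colS).
rewrite /ctends; apply: (@squeeze_cvgr _ _ _ _ (fun=> 0) (fun m => rsum T - \sum_(j < m) T j)).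
- by apply: nearW => m; rewrite cabs_ge0 cabs_distC key.
- exact: cvg_cst.
- by have h := cvgB (cvg_cst (rsum T)) (cvg_rsum T0 TM); rewrite subrr in h; exact: h.
Qed.

End ComplexSums.

(** * The Hilbert space of square-summable sequences *)

Definition is_ell2 {R : realType} (a : nat -> R[i]) :=
  exists M : R, forall n, \sum_(i < n) cabs (a i) ^+ 2 <= M.

(** Packing the sequence with its summability yields a module over [R[i]], so that operators are
    [{linear H -> H}]; boundedness is kept apart, as an inequality with an explicit constant. *)
Record ell2 (R : realType) := Ell2 {
  coef :> nat -> R[i];
  coefP : is_ell2 coef }.

HB.instance Definition _ (R : realType) := gen_eqMixin (ell2 R).
HB.instance Definition _ (R : realType) := gen_choiceMixin (ell2 R).

Section Ell2Space.
Context {R : realType}.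
Implicit Types (x y : ell2 R) (z : R[i]).
Notation H := (ell2 R).

Lemma ell2_ext x y : (forall i, x i = y i) -> x = y.
Proof.
case: x y => [a ha] [b hb] /= ab; have e : a = b by apply/funext.
by rewrite -e in hb *; congr Ell2; exact: Prop_irrelevance.
Qed.

Lemma is_ell2D (a b : nat -> R[i]) : is_ell2 a -> is_ell2 b -> is_ell2 (fun i => a i + b i).
Proof.
move=> [M aM] [N bN]; exists (2 * (M + N)) => n.
apply: (@le_trans _ _ (2 * (\sum_(i < n) cabs (a i) ^+ 2 + \sum_(i < n) cabs (b i) ^+ 2))).
  rewrite -big_split mulr_sumr /=; apply: ler_sum => i _.
  have := cabsD (a i) (b i); have := cabs_ge0 (a i + b i).
  have := cabs_ge0 (a i); have := cabs_ge0 (b i).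
  move: (cabs (a i)) (cabs (b i)) (cabs (a i + b i)) => p q r *.
  apply: (@le_trans _ _ ((p + q) ^+ 2)).
    by rewrite ler_pXn2r ?nnegrE ?addr_ge0.
  by have := sqr_ge0 (p - q); nra.
by rewrite ler_wpM2l // lerD.
Qed.

Lemma is_ell2Z z (a : nat -> R[i]) : is_ell2 a -> is_ell2 (fun i => z * a i).
Proof.
move=> [M aM]; exists (cabs z ^+ 2 * M) => n.
under eq_bigr do rewrite cabsM exprMn.
by rewrite -mulr_sumr ler_wpM2l // sqr_ge0.
Qed.

Lemma is_ell20 : is_ell2 (fun=> 0 : R[i]).
Proof. by exists 0 => n; rewrite big1// => i _; rewrite cabs0 expr0n. Qed.

Lemma is_ell2N (a : nat -> R[i]) : is_ell2 a -> is_ell2 (fun i => - a i).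
Proof.
move=> /(is_ell2Z (-1)); congr is_ell2.
by apply/funext => i; rewrite mulN1r.
Qed.

Definition ell2_zero : H := Ell2 is_ell20.
Definition ell2_opp x : H := Ell2 (is_ell2N (coefP x)).
Definition ell2_add x y : H := Ell2 (is_ell2D (coefP x) (coefP y)).
Definition ell2_scale z x : H := Ell2 (is_ell2Z z (coefP x)).

Lemma ell2_addA : associative ell2_add.
Proof. by move=> x y w; apply: ell2_ext => i /=; rewrite addrA. Qed.
Lemma ell2_addC : commutative ell2_add.
Proof. by move=> x y; apply: ell2_ext => i /=; rewrite addrC. Qed.
Lemma ell2_add0 : left_id ell2_zero ell2_add.
Proof. by move=> x; apply: ell2_ext => i /=; rewrite add0r. Qed.
Lemma ell2_addN : left_inverse ell2_zero ell2_opp ell2_add.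
Proof. by move=> x; apply: ell2_ext => i /=; rewrite addNr. Qed.
End Ell2Space.

HB.instance Definition _ (R : realType) := GRing.isZmodule.Build (ell2 R)
  (@ell2_addA R) (@ell2_addC R) (@ell2_add0 R) (@ell2_addN R).

Section Ell2Lmodule.
Context {R : realType}.
Notation H := (ell2 R).
Lemma ell2_scaleA (a b : R[i]) (x : H) :
  ell2_scale a (ell2_scale b x) = ell2_scale (a * b) x.
Proof. by apply: ell2_ext => i /=; rewrite mulrA. Qed.
Lemma ell2_scale1 : left_id 1 (@ell2_scale R).
Proof. by move=> x; apply: ell2_ext => i /=; rewrite mul1r. Qed.
Lemma ell2_scaleDr : right_distributive (@ell2_scale R) +%R.
Proof. by move=> a x y; apply: ell2_ext => i /=; rewrite mulrDr. Qed.
Lemma ell2_scaleDl (x : H) : {morph (@ell2_scale R)^~ x : a b / a + b}.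
Proof. by move=> a b; apply: ell2_ext => i /=; rewrite mulrDl. Qed.
End Ell2Lmodule.

HB.instance Definition _ (R : realType) := GRing.Zmodule_isLmodule.Build R[i] (ell2 R)
  (@ell2_scaleA R) (@ell2_scale1 R) (@ell2_scaleDr R) (@ell2_scaleDl R).

Section Ell2Norm.
Context {R : realType}.
Notation H := (ell2 R).
Implicit Types (x y : H) (z : R[i]).

Lemma lcoef0 i : (0 : H) i = 0. Proof. by []. Qed.
Lemma lcoefD x y i : (x + y) i = x i + y i. Proof. by []. Qed.
Lemma lcoefN x i : (- x) i = - x i. Proof. by []. Qed.
Lemma lcoefB x y i : (x - y) i = x i - y i. Proof. by []. Qed.
Lemma lcoefZ z x i : (z *: x) i = z * x i. Proof. by []. Qed.
Definition lcoefE := (lcoef0, lcoefD, lcoefN, lcoefZ).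

Lemma lcoef_sum (I : Type) (r : seq I) (P : pred I) (F : I -> H) i :
  (\sum_(j <- r | P j) F j) i = \sum_(j <- r | P j) F j i.
Proof. by apply: (big_morph (fun x : H => x i)). Qed.

Definition nrm x : R := Num.sqrt (rsum (fun i => cabs (x i) ^+ 2)).

Lemma nrm_ge0 x : 0 <= nrm x. Proof. exact: sqrtr_ge0. Qed.
Hint Resolve nrm_ge0 : core.

Lemma nrm_sqr x : nrm x ^+ 2 = rsum (fun i => cabs (x i) ^+ 2).
Proof.
rewrite sqr_sqrtr //; have [M xM] := coefP x.
by have := psum_le_rsum 0 (fun i => sqr_ge0 (cabs (x i))) xM; rewrite big_ord0.
Qed.

Lemma psum_nrm x n : \sum_(i < n) cabs (x i) ^+ 2 <= nrm x ^+ 2.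
Proof.
have [M xM] := coefP x; rewrite nrm_sqr.
by apply: (psum_le_rsum (M := M)) => // i; exact: sqr_ge0.
Qed.

Lemma cvg_nrm x : \sum_(i < n) cabs (x i) ^+ 2 @[n --> \oo] --> nrm x ^+ 2.
Proof.
have [M xM] := coefP x; rewrite nrm_sqr.
by apply: (cvg_rsum (M := M)) => // i; exact: sqr_ge0.
Qed.

Lemma nrm_le x M : 0 <= M -> (forall n, \sum_(i < n) cabs (x i) ^+ 2 <= M ^+ 2) ->
  nrm x <= M.
Proof.
move=> M0 xM; rewrite -(ler_pXn2r (ltn0Sn 1)) ?nnegrE// nrm_sqr.
by apply: rsum_le => // i; exact: sqr_ge0.
Qed.

Lemma coef_le_nrm x i : cabs (x i) <= nrm x.
Proof.
rewrite -(ler_pXn2r (ltn0Sn 1)) ?nnegrE ?cabs_ge0//.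
apply: le_trans (psum_nrm x i.+1); rewrite big_ord_recr /= lerDr.
by rewrite sumr_ge0 // => ? _; exact: sqr_ge0.
Qed.

Lemma nrmD x y : nrm (x + y) <= nrm x + nrm y.
Proof.
apply: nrm_le; first by rewrite addr_ge0.
move=> n; have := sum_Minkowski (nrm_ge0 x) (nrm_ge0 y) (psum_nrm x n) (psum_nrm y n).
apply: le_trans; apply: ler_sum => i _.
by rewrite ler_pXn2r ?nnegrE ?addr_ge0 ?cabs_ge0// cabsD.
Qed.

Lemma nrm0 : nrm 0 = 0.
Proof.
apply/eqP; rewrite eq_le nrm_ge0 andbT; apply: nrm_le => // n.
by rewrite big1 ?expr0n// => i _; rewrite cabs0 expr0n.
Qed.

Lemma nrmZ z x : nrm (z *: x) = cabs z * nrm x.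
Proof.
have le z' x' : nrm (z' *: x') <= cabs z' * nrm x'.
  apply: nrm_le; first by rewrite mulr_ge0 ?cabs_ge0.
  move=> n; under eq_bigr do rewrite lcoefZ cabsM exprMn.
  by rewrite -mulr_sumr exprMn ler_wpM2l ?sqr_ge0// psum_nrm.
apply/eqP; rewrite eq_le le /=; have [->|z0] := eqVneq z 0.
  by rewrite cabs0 mul0r.
have := le z^-1 (z *: x); rewrite scalerA mulVf // scale1r cabsV.
by rewrite mulrC ler_pdivlMr ?cabs_gt0 // mulrC.
Qed.

Lemma nrmN x : nrm (- x) = nrm x.
Proof. by rewrite -scaleN1r nrmZ cabsN cabs1 mul1r. Qed.

Lemma nrmB x y : nrm (x - y) <= nrm x + nrm y.
Proof. by rewrite -(nrmN y) nrmD. Qed.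

Lemma nrm_eq0 x : nrm x = 0 -> x = 0.
Proof.
move=> x0; apply: ell2_ext => i; apply/eqP; rewrite -cabs_eq0.
by have := coef_le_nrm x i; rewrite x0 le_eqVlt ltNge cabs_ge0 orbF.
Qed.

Lemma ell2_CS (a : nat -> R[i]) A x n : 0 <= A ->
  (forall n, \sum_(i < n) cabs (a i) ^+ 2 <= A ^+ 2) ->
  \sum_(i < n) cabs (a i * x i) <= A * nrm x.
Proof.
move=> A0 aA; rewrite -(ler_pXn2r (ltn0Sn 1)) ?nnegrE ?mulr_ge0 ?sumr_ge0// => [|? _]; last exact: cabs_ge0.
under eq_bigr do rewrite cabsM.
apply: le_trans (sum_CS _ _ _) _; rewrite exprMn.
by rewrite ler_pM ?psum_nrm ?sumr_ge0// => i _; exact: sqr_ge0.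
Qed.

Lemma csummable_CS (a : nat -> R[i]) x : is_ell2 a -> csummable (fun i => a i * x i).
Proof.
move=> ha; exists (nrm (Ell2 ha) * nrm x) => n; apply: ell2_CS => // p.
exact: (psum_nrm (Ell2 ha)).
Qed.

Lemma csum_CS (a : nat -> R[i]) A x : 0 <= A ->
  (forall n, \sum_(i < n) cabs (a i) ^+ 2 <= A ^+ 2) ->
  cabs (csum (fun i => a i * x i)) <= A * nrm x.
Proof. by move=> A0 aA; apply: csum_bound => n; exact: ell2_CS. Qed.

Lemma is_ell2_le (a b : nat -> R[i]) M : is_ell2 b ->
  (forall i, cabs (a i) <= M * cabs (b i)) -> is_ell2 a.
Proof.
move=> [N bN] ab; exists (M ^+ 2 * N) => n.
apply: le_trans (ler_wpM2l (sqr_ge0 M) (bN n)); rewrite mulr_sumr.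
apply: ler_sum => i _; rewrite -exprMn ler_pXn2r ?nnegrE ?cabs_ge0//.
exact: le_trans (cabs_ge0 _) (ab i).
Qed.

(** The coordinates converge, and the bound on a finite section of [u p - u n] passes to the limit
    in p before the section grows. *)
Lemma ell2_complete (u : nat -> H) (e : nat -> R) : e n @[n --> \oo] --> (0 : R) ->
  (forall n p, (n <= p)%N -> nrm (u p - u n) <= e n) ->
  exists x, forall n, nrm (x - u n) <= e n.
Proof.
move=> e0 ue.
have C i : exists l, ctends (fun n => u n i) l.
  have [|l [hl _]] := @ctends_cauchy _ (fun n => u n i) e e0; last by exists l.
  by move=> n p np; apply: le_trans (ue _ _ np); exact: coef_le_nrm (u p - u n) i.
have [a ha] := choice C.
have en n : 0 <= e n by apply: le_trans (ue n n (leqnn n)).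
have key n N : \sum_(i < N) cabs (a i - u n i) ^+ 2 <= e n ^+ 2.
  have h : \sum_(i < N) cabs (u p i - u n i) ^+ 2 @[p --> \oo]
      --> \sum_(i < N) cabs (a i - u n i) ^+ 2.
    elim: N => [|N IH].
      by rewrite big_ord0; under eq_fun do rewrite big_ord0; exact: cvg_cst.
    rewrite big_ord_recr /=; under eq_fun do rewrite big_ord_recr /=.
    apply: cvgD => //; rewrite expr2; under eq_fun do rewrite expr2.
    have h : cabs (u p N - u n N) @[p --> \oo] --> cabs (a N - u n N).
      apply/cvgrPdist_le => d d0; have /ctendsP/(_ _ d0)[P hP] := ha N.
      exists P => // p Pp; have := hP p Pp; rewrite /= => /ltW; apply: le_trans.
      rewrite ler_norml.
      have := cabs_distD (a N) (u p N) (u n N); have := cabs_distD (u p N) (a N) (u n N).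
      rewrite (cabs_distC (a N) (u p N)); set A := cabs (_ - _); set B := cabs (_ - _); set D := cabs (_ - _).
      by move=> ? ?; apply/andP; split; lra.
    exact: cvgM.
  have <- := cvg_lim _ h => //; apply: limr_le; first by apply/cvg_ex; eexists; exact: h.
  near=> p; have np : (n <= p)%N by near: p; exists n.
  apply: le_trans (psum_nrm (u p - u n) N) _.
  by rewrite ler_pXn2r ?nnegrE// ue.
have la : is_ell2 a.
  have -> : a = fun i => (a i - u 0%N i) + u 0%N i by apply/funext => i; rewrite subrK.
  by apply: is_ell2D; [exists (e 0%N ^+ 2) => n; exact: key|exact: coefP].
by exists (Ell2 la) => n; apply: nrm_le => // N; exact: key.
Unshelve. all: by end_near.
Qed.

(** Two images of the same vector differ by an image of 0, so uniqueness at 0 makes a total linear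
    relation the graph of a linear operator. *)
Lemma ell2_choice (P : H -> H -> Prop) :
  (forall x, exists y, P x y) ->
  (forall (a : R[i]) x y x' y', P x y -> P x' y' -> P (a *: x + x') (a *: y + y')) ->
  (forall y, P 0 y -> y = 0) ->
  exists T : {linear H -> H}, forall x y, P x y <-> y = T x.
Proof.
move=> ex lin uniq; have [f hf] := choice ex.
have U x y y' : P x y -> P x y' -> y = y'.
  move=> h h'; have := lin (-1) _ _ _ _ h h'; rewrite scaleN1r addNr => /uniq.
  by rewrite scaleN1r addrC => /eqP; rewrite subr_eq0 => /eqP.
have fl : linear f.
  by move=> a x y; apply: (U (a *: x + y)) => //; exact: lin.
pose F : {linear H -> H} := HB.pack f (GRing.isLinear.Build _ _ _ _ f fl).
by exists F => x y; split=> [h|->]; [exact: U h (hf x)|exact: hf].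
Qed.

Lemma geometric_cvg0 (q C : R) : 0 <= q -> q < 1 -> C * q ^+ n @[n --> \oo] --> (0 : R).
Proof.
move=> q0 q1; rewrite -(mulr0 C); apply: cvgM; first exact: cvg_cst.
by apply: cvg_expr; rewrite ger0_norm.
Qed.

(** The inverse of 1 + T is built vector by vector, as the limit of u (n + 1) = x - T (u n). The
    inequality (1 - q) |x| <= |x + T x| gives both uniqueness and the norm bound. *)
Lemma neumann (T : {linear H -> H}) (q : R) : q < 1 ->
  (forall x, nrm (T x) <= q * nrm x) ->
  exists V : {linear H -> H},
    [/\ forall x, V x + T (V x) = x, forall x, V (x + T x) = x &
        forall x, nrm (V x) <= (1 - q)^-1 * nrm x].
Proof.
move=> q1 hq.
have low x : (1 - q) * nrm x <= nrm (x + T x).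
  have := nrmB (x + T x) (T x); rewrite addrK; have := hq x; lra.
(* A negative [q] forces every vector to be 0, and then any operator is the inverse. *)
have [q0|q0] := ltP q 0.
  have z x : x = 0.
    by apply: nrm_eq0; have := hq x; have := nrm_ge0 x; have := nrm_ge0 (T x); nra.
  exists T; split=> x; first by rewrite [RHS]z [LHS]z.
    by rewrite [RHS]z [LHS]z.
  by rewrite [T x]z nrm0 mulr_ge0 // invr_ge0; lra.
pose P x y := y + T y = x.
have [||//|V hV] := @ell2_choice P.
- move=> x; have [u [u0 E]] : exists u : nat -> H, u 0%N = 0 /\ forall m, u m.+1 = x - T (u m).
    by exists (fix u n := if n is m.+1 then x - T (u m) else 0).
  have step n : nrm (u n.+1 - u n) <= nrm x * q ^+ n.
    elim: n => [|n IH]; first by rewrite E u0 linear0 !subr0 mulr1.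
    have -> : u n.+2 - u n.+1 = - T (u n.+1 - u n).
      by rewrite linearB (E n.+1) [in X in _ - X]E; apply: ell2_ext => i; rewrite !lcoefE; ring.
    rewrite nrmN; apply: le_trans (hq _) _.
    by rewrite exprS mulrCA ler_wpM2l.
  have ue n p : (n <= p)%N -> nrm (u p - u n) <= (nrm x / (1 - q)) * q ^+ n.
    move=> /subnKC <-; move: (p - n)%N => k; elim: k n => [|k IH] n.
      by rewrite addn0 subrr nrm0 mulr_ge0 ?exprn_ge0// divr_ge0//; lra.
    rewrite addnS -addSn -(subrK (u n.+1) (u (n.+1 + k)%N)) -addrA.
    apply: le_trans (nrmD _ _) _; apply: le_trans (lerD (IH _) (step n)) _.
    rewrite exprS le_eqVlt; apply/orP; left; apply/eqP; field; lra.
  have [y hy] := ell2_complete (geometric_cvg0 (nrm x / (1 - q)) q0 q1) ue.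
  exists y; apply/eqP; rewrite -subr_eq0; apply/eqP/nrm_eq0/eqP.
  rewrite eq_le nrm_ge0 andbT; apply/ler_addgt0Pr => d d0; rewrite add0r.
  have h : (nrm x / (1 - q) * 2) * q ^+ n @[n --> \oo] --> (0 : R) by exact: geometric_cvg0.
  have /cvgrPdist_lt/(_ d d0)[N _ /(_ N (leqnn N))] := h.
  rewrite /= sub0r normrN => hN; apply: le_trans (ltW (le_lt_trans (ler_norm _) hN)).
  have -> : y + T y - x = (y - u N.+1) + T (y - u N).
    by rewrite linearB E; apply: ell2_ext => i; rewrite !lcoefE; ring.
  apply: le_trans (nrmD _ _) _; have h1 := hy N.+1; have h2 := hq (y - u N).
  have h3 := ler_wpM2l q0 (hy N); rewrite exprS in h1.
  have : 0 <= nrm x / (1 - q) * q ^+ N by rewrite mulr_ge0 ?exprn_ge0// divr_ge0//; lra.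
  move: h1 h2 h3; rewrite mulrCA; set g := _ * q ^+ N; move=> h1 h2 h3 g0.
  have -> : nrm x / (1 - q) * 2 * q ^+ N = 2 * g by rewrite /g; ring.
  have : q * g <= g by rewrite ler_piMl // ltW.
  lra.
- move=> a x y x' y' <- <-; rewrite /P linearP scalerDr.
  by apply: ell2_ext => i; rewrite !lcoefE; ring.
- move=> y h; apply: nrm_eq0; have := low y; rewrite h nrm0; have := nrm_ge0 y; nra.
exists V; split=> x.
- by have /hV := erefl (V x).
- by apply/esym/hV.
- rewrite mulrC ler_pdivlMr ?subr_gt0// mulrC; apply: le_trans (low _) _.
  by have /hV -> := erefl (V x).
Qed.

End Ell2Norm.
#[global] Hint Resolve nrm_ge0 : core.

(** * Similarity to a block-diagonal operator *)

Section InfiniteMatrices.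
Context {R : realType}.
Notation H := (ell2 R).

(** Schur test with weights: Cauchy-Schwarz splits each row between u and v, and the sum over the
    rows then only involves v. [schur_op] and [Q_ell1] correspond to two choices of the weights. *)
Lemma weighted_bound (a : nat -> nat -> R[i]) (u v : nat -> nat -> R) (A B : R) :
  (forall i j, 0 <= u i j) -> (forall i j, 0 <= v i j) ->
  (forall i j, cabs (a i j) ^+ 2 <= u i j * v i j) ->
  (forall i n, \sum_(j < n) u i j <= A) ->
  (forall n m, \sum_(i < n) \sum_(j < m) v i j <= B) ->
  (forall i, csummable (a i)) /\
  forall n, \sum_(i < n) cabs (csum (a i)) ^+ 2 <= A * B.
Proof.
move=> u0 v0 auv uA vB.
have A0 : 0 <= A by have := uA 0%N 0%N; rewrite big_ord0.
have vi i m : \sum_(j < m) v i j <= B.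
  apply: le_trans (vB i.+1 m); rewrite big_ord_recr /= lerDr.
  by rewrite sumr_ge0 // => ? _; rewrite sumr_ge0.
have V0 i : 0 <= rsum (v i) by have := psum_le_rsum 0 (v0 i) (vi i); rewrite big_ord0.
have ai i m : \sum_(j < m) cabs (a i j) <= Num.sqrt (A * rsum (v i)).
  rewrite -(ler_pXn2r (ltn0Sn 1)) ?nnegrE ?sqrtr_ge0 ?sumr_ge0// => [|? _]; last exact: cabs_ge0.
  rewrite sqr_sqrtr ?mulr_ge0//.
  apply: (@le_trans _ _ ((\sum_(j < m) Num.sqrt (u i j) * Num.sqrt (v i j)) ^+ 2)).
    rewrite ler_pXn2r ?nnegrE ?sumr_ge0//; try by move=> *; rewrite ?cabs_ge0 ?mulr_ge0 ?sqrtr_ge0.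
    apply: ler_sum => j _; rewrite -(ler_pXn2r (ltn0Sn 1)) ?nnegrE ?cabs_ge0 ?mulr_ge0 ?sqrtr_ge0//.
    by rewrite exprMn !sqr_sqrtr.
  apply: le_trans (sum_CS _ _ _) _; rewrite ler_pM ?sumr_ge0//; try by move=> *; exact: sqr_ge0.
    by under eq_bigr do rewrite sqr_sqrtr//.
  under eq_bigr do rewrite sqr_sqrtr//.
  exact: psum_le_rsum (vi i).
split=> [i|n]; first by exists (Num.sqrt (A * rsum (v i))).
apply: (@le_trans _ _ (\sum_(i < n) A * rsum (v i))).
  apply: ler_sum => i _; apply: (@le_trans _ _ (Num.sqrt (A * rsum (v i)) ^+ 2)).
    by rewrite ler_pXn2r ?nnegrE ?cabs_ge0 ?sqrtr_ge0// csum_bound.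
  by rewrite sqr_sqrtr // mulr_ge0.
by rewrite -mulr_sumr ler_wpM2l // rsum2_bound.
Qed.

Lemma schur_op (A : nat -> nat -> R[i]) (G : R) :
  (forall i n, \sum_(j < n) cabs (A i j) <= G) ->
  (forall j n, \sum_(i < n) cabs (A i j) <= G) ->
  exists T : {linear H -> H},
    [/\ forall (x : H) i, csummable (fun j => A i j * x j),
        forall x i, T x i = csum (fun j => A i j * x j) &
        forall x, nrm (T x) <= G * nrm x].
Proof.
move=> rowG colG.
have G0 : 0 <= G by have := rowG 0%N 0%N; rewrite big_ord0.
have key (x : H) : (forall i, csummable (fun j => A i j * x j)) /\
    forall n, \sum_(i < n) cabs (csum (fun j => A i j * x j)) ^+ 2 <= G * (G * nrm x ^+ 2).
  apply: (@weighted_bound _ (fun i j => cabs (A i j)) (fun i j => cabs (A i j) * cabs (x j) ^+ 2)).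
  - by move=> i j; exact: cabs_ge0.
  - by move=> i j; rewrite mulr_ge0 ?cabs_ge0 ?sqr_ge0.
  - by move=> i j; rewrite cabsM exprMn [X in _ <= X]mulrA -expr2.
  - exact: rowG.
  - move=> n m; rewrite exchange_big /=.
    apply: le_trans (ler_wpM2l G0 (psum_nrm x m)); rewrite mulr_sumr.
    by apply: ler_sum => j _; rewrite -mulr_suml ler_wpM2r ?sqr_ge0 ?colG.
have l2 (x : H) : is_ell2 (fun i => csum (fun j => A i j * x j)).
  by exists (G * (G * nrm x ^+ 2)); have [] := key x.
pose f (x : H) : H := Ell2 (l2 x).
have fl : linear f.
  move=> a x y; apply: ell2_ext => i; rewrite /f/= -csumZ; last by have [] := key x.
  rewrite -csumD; [|by apply: csummableZ; have [] := key x|by have [] := key y].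
  by congr csum; apply/funext => j; rewrite mulrDr mulrCA.
pose F : {linear H -> H} := HB.pack f (GRing.isLinear.Build _ _ _ _ f fl).
exists F; split=> //=.
- by move=> x; have [] := key x.
- move=> x; apply: nrm_le; first exact: mulr_ge0 G0 (nrm_ge0 x).
  by move=> n; rewrite exprMn expr2 -mulrA; have [_] := key x; apply.
Qed.

Lemma diag_op (a : nat -> R[i]) (G : R) : 0 <= G -> (forall i, cabs (a i) <= G) ->
  exists T : {linear H -> H}, (forall x i, T x i = a i * x i) /\
    forall x, nrm (T x) <= G * nrm x.
Proof.
move=> G0 aG; pose A i j := if i == j then a i else 0.
have b i n : \sum_(j < n) cabs (A i j) <= G.
  have [ni|ni] := leqP n i.
    by rewrite big1// => j _; rewrite /A gtn_eqF ?cabs0//; exact: leq_trans (ltn_ord j) ni.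
  rewrite (bigD1 (Ordinal ni)) //= big1 => [|j /negbTE jn].
    by rewrite /A eqxx addr0.
  by rewrite /A; case: eqP => [e|]; rewrite ?cabs0//; move/eqP: jn => []; exact: val_inj.
have [|T [_ hT bT]] := @schur_op A G b.
  move=> j n; apply: le_trans (b j n); apply: ler_sum => i _.
  by rewrite /A eq_sym; case: eqP => [->|].
exists T; split=> // x i; rewrite hT (@csum1 _ _ i) /A ?eqxx// => j ji.
by rewrite eq_sym (negbTE ji) mul0r.
Qed.

(** [F] stays below 4 and grows at step n by at least the n-th term, thanks to 1/d^2 <= 2/d - 2/(d +
    1) on either side of j. The term i = j is 0, because 0^-1 = 0. *)
Lemma sum_inv_sq (j n : nat) : \sum_(i < n) ((i%:R - j%:R) ^+ 2)^-1 <= 4 :> R.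
Proof.
pose F n : R := if (n <= j)%N then 2 / (j.+1 - n)%:R else 4 - 2 / (n - j)%:R.
have F4 : F n <= 4.
  rewrite /F; case: leqP => h; last by rewrite gerBl divr_ge0.
  rewrite ler_pdivrMr ?ltr0n ?subn_gt0//.
  have : 1 <= (j.+1 - n)%:R :> R by rewrite ler1n subn_gt0.
  lra.
apply: le_trans F4; elim: n => [|n IH].
  by rewrite big_ord0 /F leq0n divr_ge0.
rewrite big_ord_recr /=; suff : ((n%:R - j%:R) ^+ 2)^-1 <= F n.+1 - F n by lra.
have step d : (0 < d)%N -> (d%:R ^+ 2)^-1 <= 2 / d%:R - 2 / d.+1%:R :> R.
  move=> d0; have : 0 < d%:R :> R by rewrite ltr0n.
  have : 1 <= d%:R :> R by rewrite ler1n.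
  set x : R := d%:R => x1 x0.
  have -> : d.+1%:R = x + 1 :> R by rewrite natr1.
  have -> : 2 / x - 2 / (x + 1) = 2 / (x * (x + 1)) by field; lra.
  rewrite -[leLHS]mul1r ler_pdivrMr ?exprn_gt0// mulrAC ler_pdivlMr ?mulr_gt0//; nra.
rewrite /F; have [nj|jn|->] := ltngtP n j.
- have -> : (n%:R - j%:R) ^+ 2 = (j - n)%:R ^+ 2 :> R.
    by rewrite natrB ?(ltnW nj)// -sqrrN opprB.
  rewrite subSS; have := step (j - n)%N; rewrite subn_gt0 => /(_ nj).
  by rewrite subSn // ltnW.
- have -> : (n%:R - j%:R) ^+ 2 = (n - j)%:R ^+ 2 :> R by rewrite natrB // ltnW.
  have := step (n - j)%N; rewrite subn_gt0 => /(_ jn); rewrite subSn ?(ltnW jn)//.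
  set X := _ ^- 2; set Y := 2 / _; set Z := 2 / _; lra.
- by rewrite subrr expr0n invr0 subSn // subnn; lra.
Qed.

End InfiniteMatrices.

(** * The fixed-point equation for K and D *)

Section FixedPoint.
Context {R : realType}.
Notation H := (ell2 R).
Variables (lam : nat -> R) (blk cut : nat -> nat) (Q : nat -> nat -> R[i]).
Variables (M c : R) (p m : nat).
Hypothesis M_gt0 : 0 < M.
Hypothesis c_gt0 : 0 < c.
Hypothesis m_gt0 : (0 < m)%N.
Hypothesis m_large : 32 * M <= c * m%:R ^+ 2.
Hypothesis Q_col : forall j n, \sum_(i < n) cabs (Q i j) ^+ 2 <= M ^+ 2.
Hypothesis lam_gap : forall i j, blk i != blk j ->
  c * `|i%:R - j%:R| * (maxn i j)%:R ^+ p.+3 <= `|lam i - lam j|.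
Hypothesis blk_le : forall i, (blk i <= i.+1)%N.
Hypothesis blk_eq : forall i j, blk i = blk j -> (i <= j.+1)%N.
Hypothesis blk_cut : forall i n, (blk i <= n)%N = (i < cut n)%N.
Hypothesis cut_le : forall n, (cut n <= 2 * n + 2)%N.

(** Raising each block index to at least [m] merges the blocks up to [m] into one. Of two unrelated
    indices one is at least [m], so their gap is large. *)
Definition simb (i j : nat) := maxn (blk i) m == maxn (blk j) m.

Lemma simb_refl i : simb i i. Proof. exact: eqxx. Qed.
Lemma simb_sym i j : simb i j = simb j i. Proof. exact: eq_sym. Qed.
Lemma simb_trans i j l : simb i j -> simb j l -> simb i l.
Proof. by rewrite /simb => /eqP ->. Qed.

Lemma simbN i j : ~~ simb i j -> blk i != blk j /\ (m <= maxn i j)%N.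
Proof.
rewrite /simb => h; split; first by apply: contra h => /eqP ->.
apply: contraR h; rewrite -ltnNge gtn_max => /andP[im jm].
by rewrite !(maxn_idPr _)// ; [exact: leq_trans (blk_le j) jm|exact: leq_trans (blk_le i) im].
Qed.

(** Off the blocks, entrywise multiplication by [kap] inverts the commutator with [lam]. *)
Definition kap i j : R := if simb i j then 0 else (lam i - lam j)^-1.

Lemma kap_sym i j : `|kap i j| = `|kap j i|.
Proof. by rewrite /kap simb_sym; case: ifP => // _; rewrite !normfV distrC. Qed.

Lemma gap_lb i j n : ~~ simb i j -> (n <= maxn i j)%N ->
  c * `|i%:R - j%:R| * n%:R ^+ p.+3 <= `|lam i - lam j|.
Proof.
move=> /simbN[ij _] nij; apply: le_trans (lam_gap ij).
rewrite ler_wpM2l ?mulr_ge0 ?(ltW c_gt0)//.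
by rewrite ler_pXn2r ?nnegrE// ler_nat.
Qed.

Lemma simbN_dist i j : ~~ simb i j -> 1 <= `|i%:R - j%:R| :> R.
Proof.
move=> h; have ij : i != j by apply: contra h => /eqP ->; exact: simb_refl.
have [l|l|e] := ltngtP i j; last by rewrite e eqxx in ij.
  by rewrite distrC -natrB ?(ltnW l)// normr_nat ler1n subn_gt0.
by rewrite -natrB ?(ltnW l)// normr_nat ler1n subn_gt0.
Qed.

(** The left-hand side equals [4 * del]. It comes from [m_large] multiplied by m, the exponent of
    the gap being at least 3, together with m + 1 <= 2 m. *)
Lemma gap_m3 i j : ~~ simb i j -> 16 * M * (m.+1)%:R <= `|lam i - lam j|.
Proof.
move=> h; have [_ hm] := simbN h; apply: le_trans (gap_lb h hm).
have d1 := simbN_dist h; set d := `|i%:R - j%:R| in d1 *.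
have m1 : 1 <= m%:R :> R by rewrite ler1n.
have : m%:R ^+ 3 <= m%:R ^+ p.+3 :> R.
  by rewrite -[p.+3]addn3 exprD ler_peMl ?exprn_ge0 ?exprn_ege1.
set y := _ ^+ p.+3 => my; rewrite -natr1.
have : 32 * M * m%:R <= c * m%:R ^+ 3 by rewrite [_ ^+ 3]exprSr mulrA ler_wpM2r.
have : c * m%:R ^+ 3 <= c * y by rewrite ler_wpM2l // ltW.
have : c * y <= c * d * y.
  by rewrite mulrAC ler_peMr // mulr_ge0 ?(ltW c_gt0)// exprn_ge0.
have : M * 1 <= M * m%:R by rewrite ler_wpM2l // ltW.
lra.
Qed.

(** One factor max(i, j) of the gap is traded for |i - j|, which is not larger; the entries then
    decay like the inverse square of the distance to the diagonal and are summable along rows and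
    columns. *)
Lemma kap_le_gen n i j : (0 < n)%N -> (n <= maxn i j)%N ->
  `|kap i j| <= (c * n%:R ^+ 2)^-1 * ((i%:R - j%:R) ^+ 2)^-1.
Proof.
move=> n0 hn.
have cn : 0 < c * n%:R ^+ 2 by rewrite mulr_gt0 // exprn_gt0 // ltr0n.
rewrite /kap; case: ifPn => [_|h].
  by rewrite normr0 mulr_ge0 // invr_ge0 ?sqr_ge0 // ltW.
have d1 := simbN_dist h.
rewrite normfV -invfM lef_pV2 ?posrE.
- apply: le_trans (gap_lb h (leqnn _)).
  rewrite -[(_ - _) ^+ 2]real_normK ?num_real//.
  have ds : `|i%:R - j%:R| <= (maxn i j)%:R :> R.
    rewrite ler_norml; apply/andP; split.
      have : j%:R <= (maxn i j)%:R :> R by rewrite ler_nat leq_maxr.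
      by have : 0 <= i%:R :> R by []; lra.
    have : i%:R <= (maxn i j)%:R :> R by rewrite ler_nat leq_maxl.
    by have : 0 <= j%:R :> R by []; lra.
  set d := `|_ - _| in d1 ds *; set x := (maxn i j)%:R in ds *.
  have nx : n%:R <= x by rewrite ler_nat.
  have x1 : 1 <= x by lra.
  have x3 : x ^+ 3 <= x ^+ p.+3.
    by rewrite -[p.+3]addn3 exprD ler_peMl ?exprn_ge0 ?exprn_ege1//; lra.
  rewrite -!mulrA ler_wpM2l ?(ltW c_gt0)//.
  rewrite [leLHS](_ : _ = d * (n%:R ^+ 2 * d)); last by ring.
  have d0 : 0 <= d by lra.
  apply: ler_wpM2l => //; apply: (le_trans _ x3); rewrite [leRHS]exprSr.
  by apply: ler_pM => //; rewrite ?sqr_ge0 // ler_pXn2r ?nnegrE //; lra.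
- apply: lt_le_trans (gap_m3 h); rewrite !mulr_gt0 //; exact: ltr0n.
- rewrite mulr_gt0 // -real_normK ?num_real// exprn_gt0 //; lra.
Qed.

(** The square already contains |i - j|^2, so the full power of n is kept here; the rate of the
    final estimate has its source in this bound. *)
Lemma kap_sq_le n i j : (0 < n)%N -> (n <= maxn i j)%N ->
  kap i j ^+ 2 <= (c * n%:R ^+ p.+3) ^- 2 * ((i%:R - j%:R) ^+ 2)^-1.
Proof.
move=> n0 hn; have cn : 0 < c * n%:R ^+ p.+3 by rewrite mulr_gt0 // exprn_gt0 // ltr0n.
rewrite /kap; case: ifPn => [_|h].
  by rewrite expr0n mulr_ge0 // invr_ge0 ?sqr_ge0.
have d1 := simbN_dist h.
rewrite -[_ ^+ 2]real_normK ?num_real// normfV exprVn -invfM lef_pV2 ?posrE.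
- rewrite -[(i%:R - j%:R) ^+ 2]real_normK ?num_real// -exprMn.
  have := gap_lb h hn; rewrite mulrAC => gl.
  by rewrite ler_pXn2r ?nnegrE ?(mulr_ge0 (ltW cn)).
- rewrite exprn_gt0 //; apply: lt_le_trans (gap_m3 h); rewrite !mulr_gt0 //; exact: ltr0n.
- apply: mulr_gt0; first exact: exprn_gt0.
  by rewrite -real_normK ?num_real// exprn_gt0 //; lra.
Qed.

Lemma kap_sq_row n i N : (0 < n)%N -> (n <= i)%N ->
  \sum_(j < N) kap i j ^+ 2 <= 4 * (c * n%:R ^+ p.+3) ^- 2.
Proof.
move=> n0 ni; rewrite mulrC.
apply: (@le_trans _ _ (\sum_(j < N) (c * n%:R ^+ p.+3) ^- 2 * ((j%:R - i%:R) ^+ 2)^-1)).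
  apply: ler_sum => j _; rewrite -[(j%:R - i%:R) ^+ 2]sqrrN opprB.
  by apply: kap_sq_le => //; exact: leq_trans ni (leq_maxl _ _).
by rewrite -mulr_sumr ler_wpM2l ?sum_inv_sq // invr_ge0 sqr_ge0.
Qed.

Lemma kap_sq_sym i j : kap i j ^+ 2 = kap j i ^+ 2.
Proof. by rewrite -real_normK ?num_real// kap_sym real_normK ?num_real. Qed.

Lemma kap_col_gen n j N : (0 < n)%N -> (n <= j)%N ->
  \sum_(i < N) `|kap i j| <= 4 / (c * n%:R ^+ 2).
Proof.
move=> n0 nj; rewrite [4 / _]mulrC.
apply: (@le_trans _ _ (\sum_(i < N) (c * n%:R ^+ 2)^-1 * ((i%:R - j%:R) ^+ 2)^-1)).
  by apply: ler_sum => i _; apply: kap_le_gen => //; exact: leq_trans nj (leq_maxr _ _).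
by rewrite -mulr_sumr ler_wpM2l ?sum_inv_sq// invr_ge0 mulr_ge0 ?(ltW c_gt0) ?sqr_ge0.
Qed.

Lemma kap_le i j : `|kap i j| <= (c * m%:R ^+ 2)^-1 * ((i%:R - j%:R) ^+ 2)^-1.
Proof.
case h: (simb i j).
  rewrite /kap h normr0 mulr_ge0 // invr_ge0 ?sqr_ge0 // mulr_ge0 ?(ltW c_gt0) //.
by apply: kap_le_gen => //; have [] := simbN (negbT h).
Qed.

(** Bounds the row and column sums of [kap]. By [m_large], [M * gam] is at most 1/8, the number that
    controls both the contraction and the norm of K. *)
Definition gam : R := 4 / (c * m%:R ^+ 2).

Lemma kap_col j n : \sum_(i < n) `|kap i j| <= gam.
Proof.
have cm : 0 < c * m%:R ^+ 2 by rewrite mulr_gt0 // exprn_gt0 // ltr0n.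
apply: (@le_trans _ _ (\sum_(i < n) (c * m%:R ^+ 2)^-1 * ((i%:R - j%:R) ^+ 2)^-1)).
  by apply: ler_sum => i _; exact: kap_le.
by rewrite -mulr_sumr /gam [4 / _]mulrC ler_wpM2l ?invr_ge0 ?(ltW cm)// sum_inv_sq.
Qed.

Lemma kap_row i n : \sum_(j < n) `|kap i j| <= gam.
Proof. by apply: le_trans (kap_col i n); apply: ler_sum => j _; rewrite kap_sym. Qed.

Lemma gam_ge0 : 0 <= gam. Proof. by have := kap_col 0 0; rewrite big_ord0. Qed.

Lemma Mgam : M * gam <= 8^-1.
Proof.
have cm : 0 < c * m%:R ^+ 2 by rewrite mulr_gt0 // exprn_gt0 // ltr0n.
by rewrite /gam mulrA ler_pdivrMr //; move: m_large; lra.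
Qed.

Lemma Q_le i j : cabs (Q i j) <= M.
Proof.
rewrite -(ler_pXn2r (ltn0Sn 1)) ?nnegrE ?cabs_ge0 ?(ltW M_gt0)//.
apply: le_trans (Q_col j i.+1); rewrite big_ord_recr /= lerDr.
by rewrite sumr_ge0 // => ? _; exact: sqr_ge0.
Qed.

Implicit Types X Y : nat -> nat -> R[i].

(* With K = Kof X, the equation (lam - Q)(1 + K) = (1 + K)(lam - D) splits into its block
   part, which says that D = Dof X, and its off-diagonal part, which says that
   (lam i - lam j) K i j = X i j for X = Phi X. *)
Definition Kof X i j := (kap i j)%:C * X i j.
Definition QKof X i j := csum (fun l => Q i l * Kof X l j).
Definition Dof X i j := if simb i j then Q i j + QKof X i j else 0.
Definition KDof X i j := csum (fun l => Kof X i l * Dof X l j).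
Definition Phi X i j := if simb i j then 0 else Q i j + QKof X i j - KDof X i j.
(** The supremum of the entries is the norm in which [Phi] contracts: one factor of every product
    carries [kap], so bounded entries are enough for convergence. *)
Definition bdd X (B : R) := forall i j, cabs (X i j) <= B.

Lemma bdd_ge0 X B : bdd X B -> 0 <= B.
Proof. by move=> /(_ 0%N 0%N); apply: le_trans; exact: cabs_ge0. Qed.

Lemma QK_sum X B i j n : bdd X B ->
  \sum_(l < n) cabs (Q i l * Kof X l j) <= M * gam * B.
Proof.
move=> XB; have B0 := bdd_ge0 XB.
apply: (@le_trans _ _ (M * B * \sum_(l < n) `|kap l j|)).
  rewrite mulr_sumr; apply: ler_sum => l _; rewrite !cabsM cabsR -mulrA.
  rewrite ler_pM ?cabs_ge0 ?mulr_ge0 ?cabs_ge0 ?Q_le// mulrC.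
  by rewrite ler_wpM2r.
by rewrite [M * gam * B]mulrAC ler_wpM2l ?mulr_ge0 ?(ltW M_gt0)// kap_col.
Qed.

Lemma KD_sum X (E : nat -> nat -> R[i]) B B' i j n : bdd X B -> bdd E B' ->
  \sum_(l < n) cabs (Kof X i l * E l j) <= gam * B * B'.
Proof.
move=> XB EB; have B0 := bdd_ge0 XB; have B0' := bdd_ge0 EB.
apply: (@le_trans _ _ (B * B' * \sum_(l < n) `|kap i l|)).
  rewrite mulr_sumr; apply: ler_sum => l _; rewrite !cabsM cabsR -mulrA mulrC.
  rewrite ler_wpM2r // ler_pM ?cabs_ge0 //.
by rewrite -[gam * B * B']mulrA [gam * _]mulrC ler_wpM2l ?mulr_ge0 // kap_row.
Qed.

Lemma QK_bdd X B : bdd X B -> bdd (QKof X) (M * gam * B).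
Proof. by move=> XB i j; apply: csum_bound => n; exact: QK_sum. Qed.

Lemma D_bdd X B : bdd X B -> bdd (Dof X) (M + M * gam * B).
Proof.
move=> XB i j; rewrite /Dof; case: ifP => _.
  by apply: le_trans (cabsD _ _) _; rewrite lerD ?Q_le// QK_bdd.
have B0 := bdd_ge0 XB; have M0 := ltW M_gt0.
by rewrite cabs0 addr_ge0 // (mulr_ge0 (mulr_ge0 M0 gam_ge0)).
Qed.

Lemma QK_csummable X B i j : bdd X B -> csummable (fun l => Q i l * Kof X l j).
Proof. by move=> XB; exists (M * gam * B) => n; exact: QK_sum. Qed.

Lemma KD_csummable X E B B' i j : bdd X B -> bdd E B' ->
  csummable (fun l => Kof X i l * E l j).
Proof. by move=> XB EB; exists (gam * B * B') => n; exact: KD_sum. Qed.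

Lemma QKofB X Y B i j : bdd X B -> bdd Y B ->
  QKof X i j - QKof Y i j = QKof (fun i j => X i j - Y i j) i j.
Proof.
move=> XB YB; rewrite -csumB; [|exact: QK_csummable XB|exact: QK_csummable YB].
by congr csum; apply/funext => l; rewrite /Kof; ring.
Qed.

Lemma D_lip X Y B e : bdd X B -> bdd Y B -> bdd (fun i j => X i j - Y i j) e ->
  bdd (fun i j => Dof X i j - Dof Y i j) (M * gam * e).
Proof.
move=> XB YB XYe i j; have e0 := bdd_ge0 XYe.
rewrite /Dof; case: ifP => _.
  by rewrite opprD addrACA subrr add0r (QKofB _ _ XB YB) QK_bdd.
have M0 := ltW M_gt0.
by rewrite subrr cabs0 (mulr_ge0 (mulr_ge0 M0 gam_ge0)).
Qed.

Lemma KD_lip X Y B e : bdd X B -> bdd Y B -> bdd (fun i j => X i j - Y i j) e ->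
  bdd (fun i j => KDof X i j - KDof Y i j)
    (gam * e * (M + M * gam * B) + gam * B * (M * gam * e)).
Proof.
move=> XB YB XYe i j.
have DX := D_bdd XB; have DY := D_bdd YB; have DXY := D_lip XB YB XYe.
rewrite -csumB; [|exact: KD_csummable XB DX|exact: KD_csummable YB DY].
have -> : csum (fun l => Kof X i l * Dof X l j - Kof Y i l * Dof Y l j) =
    csum (fun l => Kof (fun i j => X i j - Y i j) i l * Dof X l j) +
    csum (fun l => Kof Y i l * (Dof X l j - Dof Y l j)).
  rewrite -csumD; [|exact: KD_csummable XYe DX|exact: (KD_csummable _ _ YB DXY)].
  by congr csum; apply/funext => l; rewrite /Kof; ring.
apply: le_trans (cabsD _ _) _; rewrite lerD //.
  by apply: csum_bound => n; exact: KD_sum XYe DX.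
by apply: csum_bound => n; exact: (KD_sum _ _ _ YB DXY).
Qed.

(** With s = M * gam the three terms add up to at most M (1 + 2 s)^2, which is below 2 M for s <=
    1/8. *)
Lemma Phi_bdd X : bdd X (2 * M) -> bdd (Phi X) (2 * M).
Proof.
move=> XB i j; rewrite /Phi; case: ifP => _; first by rewrite cabs0; move: M_gt0; lra.
apply: le_trans (cabsB _ _) _; have := cabsD (Q i j) (QKof X i j).
have := Q_le i j; have := QK_bdd XB i j.
have : cabs (KDof X i j) <= _ := csum_bound (fun n => KD_sum i j n XB (D_bdd XB)).
have := Mgam; have := gam_ge0; move: M_gt0.
set a := cabs (KDof _ _ _); set b := cabs (QKof _ _ _); set d := cabs (Q _ _).
set s := M * gam => *.
have : gam * (2 * M) * (M + s * (2 * M)) = 2 * M * (s + 2 * s ^+ 2) by rewrite /s; ring.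
have : s * (2 * M) = 2 * M * s by ring.
have s0 : 0 <= s by rewrite mulr_ge0 // ltW.
have : M * s <= M * 8^-1 by rewrite ler_wpM2l // ltW.
have : M * s ^+ 2 <= M * (8^-1) ^+ 2 by rewrite ler_wpM2l ?(ltW M_gt0)// ler_pXn2r ?nnegrE//; lra.
lra.
Qed.

(** The Lipschitz constant found is 2 s + 4 s^2 with s = M * gam, at most 5/16 for s <= 1/8. *)
Lemma Phi_lip X Y e : bdd X (2 * M) -> bdd Y (2 * M) ->
  bdd (fun i j => X i j - Y i j) e -> bdd (fun i j => Phi X i j - Phi Y i j) (e / 2).
Proof.
move=> XB YB XYe i j; have e0 := bdd_ge0 XYe; rewrite /Phi.
case: (simb i j); first by rewrite subrr cabs0; lra.
have -> : Q i j + QKof X i j - KDof X i j - (Q i j + QKof Y i j - KDof Y i j) =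
  (QKof X i j - QKof Y i j) - (KDof X i j - KDof Y i j) by ring.
apply: le_trans (cabsB _ _) _; rewrite (QKofB _ _ XB YB).
have := QK_bdd XYe i j; have := KD_lip XB YB XYe i j.
set a := cabs _; set b := cabs _; have := Mgam; have := gam_ge0; move: M_gt0.
move=> M0 g0; set s := M * gam => s8; rewrite /=.
have -> : gam * e * (M + s * (2 * M)) + gam * (2 * M) * (s * e) = e * (s + 4 * s ^+ 2).
  by rewrite /s; ring.
have s0 : 0 <= s by rewrite mulr_ge0 // ltW.
have : e * s <= e * 8^-1 by rewrite ler_wpM2l.
have : e * s ^+ 2 <= e * (8^-1) ^+ 2 by rewrite ler_wpM2l // ler_pXn2r ?nnegrE//; lra.
lra.
Qed.

(** The iterates from 0 converge at a rate uniform in the entry, so the limit can be compared with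
    [u N.+1] through [Phi_lip]; no limit has to be taken inside the infinite sums of [Phi]. *)
Lemma Phi_fix : exists2 X, bdd X (2 * M) & forall i j, Phi X i j = X i j.
Proof.
pose u n := iter n Phi (fun _ _ => 0).
have M2 : 0 <= 2 * M by move: M_gt0; lra.
have ub n : bdd (u n) (2 * M).
  elim: n => [|n IH]; first by move=> i j; rewrite cabs0.
  exact: Phi_bdd IH.
have step n : bdd (fun i j => u n.+1 i j - u n i j) (2 * M * 2^-1 ^+ n).
  elim: n => [|n IH].
    by move=> i j; rewrite expr0 mulr1 [u 0%N]/= subr0; exact: ub 1%N i j.
  have := Phi_lip (ub n.+1) (ub n) IH.
  by rewrite -mulrA -exprSr.
have ue n l i j : (n <= l)%N -> cabs (u l i j - u n i j) <= 4 * M * 2^-1 ^+ n.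
  move=> /subnKC <-; move: (l - n)%N => k; elim: k n => [|k IH] n.
    rewrite addn0 subrr cabs0 mulr_ge0 ?exprn_ge0//; move: M_gt0; lra.
  rewrite addnS -addSn; apply: le_trans (cabs_distD (u n.+1 i j) _ _) _.
  apply: le_trans (lerD (IH _) (step n i j)) _.
  by rewrite exprS le_eqVlt; apply/orP; left; apply/eqP; field.
have e0 : 4 * M * 2^-1 ^+ n @[n --> \oo] --> (0 : R) by apply: geometric_cvg0; lra.
have C i j : exists l, ctends (fun n => u n i j) l /\
    forall n, cabs (l - u n i j) <= 4 * M * 2^-1 ^+ n.
  by apply: (ctends_cauchy e0) => n l; exact: ue.
have [X' hX'] := choice (fun ij : nat * nat => C ij.1 ij.2).
pose X i j := X' (i, j); have hX i j := hX' (i, j).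
exists X => [i j|i j].
  by have [h _] := hX i j; apply: ctends_bound h _ => n; exact: ub.
have XB : bdd X (2 * M).
  by move=> a b; have [h _] := hX a b; apply: ctends_bound h _ => n; exact: ub.
apply/eqP; rewrite -subr_eq0 -cabs_eq0 eq_le cabs_ge0 andbT.
apply/ler_addgt0Pr => d d0; rewrite add0r.
have h : (4 * M * 2) * 2^-1 ^+ n @[n --> \oo] --> (0 : R) by apply: geometric_cvg0; lra.
have /cvgrPdist_lt/(_ d d0)[N _ /(_ N (leqnn N))] := h.
rewrite /= sub0r normrN => hN; apply: le_trans (ltW (le_lt_trans (ler_norm _) hN)).
apply: le_trans (cabs_distD (u N.+1 i j) _ _) _.
have h1 : cabs (Phi X i j - u N.+1 i j) <= 4 * M * 2^-1 ^+ N / 2.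
  by apply: (Phi_lip XB (ub N)) => a b; have [_] := hX a b; apply.
have h2 : cabs (u N.+1 i j - X i j) <= 4 * M * 2^-1 ^+ N.+1.
  by rewrite cabs_distC; have [_] := hX i j; apply.
rewrite exprS in h2.
have : 0 <= 4 * M * 2^-1 ^+ N by rewrite mulr_ge0 ?exprn_ge0//; move: M_gt0; lra.
lra.
Qed.

Hypothesis lam_low : forall i, c * i%:R ^+ 2 <= lam i.

Lemma lam_ge0 i : 0 <= lam i.
Proof. by apply: le_trans (lam_low i); rewrite mulr_ge0 ?sqr_ge0 // ltW. Qed.

(** (t + lam i)^2 >= t * lam i >= t * c * i^2, the term i = 0 being counted apart. The bound tends
    to 0 as t grows: the inverse of t + [lam] maps l^2 to l^1 with small norm. *)
Lemma inv_lam_sq t n : 0 < t ->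
  \sum_(i < n) cabs ((t + lam i)^-1)%:C ^+ 2 <= (t ^+ 2)^-1 + 4 / (t * c).
Proof.
move=> t0; apply: (@le_trans _ _ (\sum_(i < n) ((if i == 0%N :> nat then (t ^+ 2)^-1 else 0)
    + (t * c)^-1 * ((i%:R - 0%:R) ^+ 2)^-1))).
  apply: ler_sum => i _; have l0 := lam_ge0 i.
  rewrite cabsR ger0_norm ?invr_ge0; last by apply: addr_ge0 => //; exact: ltW.
  rewrite subr0 exprVn; case: eqP => [->|/eqP i0].
    rewrite expr0n invr0 mulr0 addr0 lef_pV2 ?posrE ?exprn_gt0 ?ltr_wpDr ?lam_ge0//.
    by rewrite ler_pXn2r ?nnegrE ?addr_ge0 ?(ltW t0) ?lam_ge0// lerDl lam_ge0.
  have i1 : 1 <= (nat_of_ord i)%:R :> R by rewrite ler1n lt0n.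
  rewrite add0r -invfM lef_pV2 ?posrE.
  - have := lam_low i; set x := lam i in l0 *; have := c_gt0; have : 0 <= x ^+ 2 by exact: sqr_ge0.
    have : t * (c * (nat_of_ord i)%:R ^+ 2) <= t * x by rewrite ler_wpM2l ?(ltW t0) ?lam_low.
    rewrite sqrrD -mulrA; have := sqr_ge0 t; have : 0 <= t * x by rewrite mulr_ge0 // ltW.
    lra.
  - by rewrite exprn_gt0 // ltr_wpDr.
  - by rewrite (mulr_gt0 (mulr_gt0 t0 c_gt0)) // exprn_gt0 //; lra.
rewrite big_split /=; apply: lerD.
  case: n => [|n]; first by rewrite big_ord0 invr_ge0 sqr_ge0.
  by rewrite big_ord_recl /= big1 ?addr0.
by rewrite -mulr_sumr mulrC ler_wpM2r ?sum_inv_sq// invr_ge0 mulr_ge0 ?(ltW c_gt0) ?(ltW t0).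
Qed.

(** [x] belongs to the domain of [lam] and has image [w]; the type of [w] says that the image is
    square-summable. *)
Definition scaled_by (x w : H) := forall i, w i = (lam i)%:C * x i.

Lemma dom_ell1 t B (x w : H) n : 0 < t -> 0 <= B -> (t ^+ 2)^-1 + 4 / (t * c) <= B ^+ 2 ->
  scaled_by x w -> \sum_(i < n) cabs (x i) <= B * nrm (t%:C *: x + w).
Proof.
move=> t0 B0 tB xw.
have -> : \sum_(i < n) cabs (x i) =
    \sum_(i < n) cabs (((t + lam i)^-1)%:C * (t%:C *: x + w) i).
  apply: eq_bigr => i _; congr cabs; rewrite !lcoefE xw -mulrDl -rmorphD mulrA -rmorphM.
  rewrite mulVf ?rmorph1 ?mul1r// gt_eqF //; have := lam_ge0 i; lra.
apply: (ell2_CS (a := fun i => ((t + lam i)^-1)%:C)) => // n'.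
by apply: le_trans tB; exact: inv_lam_sq.
Qed.

Lemma dom_ell1_ex (x w : H) : scaled_by x w ->
  exists B : R, forall n, \sum_(i < n) cabs (x i) <= B.
Proof.
move=> xw; pose B := Num.sqrt (1 + 4 / c).
exists (B * nrm (1%:C *: x + w)) => n; apply: dom_ell1 => //; first exact: sqrtr_ge0.
rewrite sqr_sqrtr ?expr1n ?invr1 ?mul1r// addr_ge0 // divr_ge0 //; exact: ltW.
Qed.

(** The weights |x j| and |Q i j|^2 |x j| turn columns bounded in l^2 into boundedness from l^1 to
    l^2. *)
Lemma Q_ell1 (x : nat -> R[i]) (X : R) : (forall n, \sum_(i < n) cabs (x i) <= X) ->
  (forall i, csummable (fun j => Q i j * x j)) /\
  forall n, \sum_(i < n) cabs (csum (fun j => Q i j * x j)) ^+ 2 <= (M * X) ^+ 2.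
Proof.
move=> xX; have X0 : 0 <= X by have := xX 0%N; rewrite big_ord0.
have -> : (M * X) ^+ 2 = X * (M ^+ 2 * X) by ring.
apply: (@weighted_bound _ _ (fun i j => cabs (x j)) (fun i j => cabs (Q i j) ^+ 2 * cabs (x j))).
- by move=> i j; exact: cabs_ge0.
- by move=> i j; rewrite mulr_ge0 ?cabs_ge0 ?sqr_ge0.
- move=> i j; rewrite cabsM exprMn le_eqVlt; apply/orP; left; apply/eqP; ring.
- by move=> _; exact: xX.
- move=> n l; rewrite exchange_big /=.
  apply: le_trans (ler_wpM2l (sqr_ge0 M) (xX l)); rewrite mulr_sumr.
  by apply: ler_sum => j _; rewrite -mulr_suml ler_wpM2r ?cabs_ge0 ?Q_col.
Qed.

Lemma count_interval (P : pred nat) a b n : (forall j, P j -> (a <= j < a + b)%N) ->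
  \sum_(j < n) (P j)%:R <= b%:R :> R.
Proof.
move=> Pab; rewrite -natr_sum ler_nat.
(* The bound by b alone is not inductive; the number of elements of the interval below n is. *)
suff h : (\sum_(j < n) (P j : nat) <= minn (n - a) b)%N.
  by apply: leq_trans h _; exact: geq_minr.
elim: n => [|n IH]; first by rewrite big_ord0.
rewrite big_ord_recr /=; move: IH (Pab n); set s := bigop _ _ _.
by case: (P n) => [IH /(_ isT) /=|IH _ /=]; move: IH; lia.
Qed.

(** The merged block is an initial segment of length at most [cut m]; any other block consists of
    neighbours of i, for which 3 is a crude bound. *)
Lemma simb_count i n : \sum_(j < n) (simb i j)%:R <= (2 * m + 2)%:R :> R.
Proof.
have [bi|bi] := leqP (blk i) m.
  apply: (@count_interval _ 0%N) => j; rewrite /simb (maxn_idPr bi) => /eqP h.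
  have : (blk j <= m)%N by rewrite h leq_maxl.
  by rewrite blk_cut add0n => /leq_trans -> //; exact: cut_le.
apply: (@le_trans _ _ 3%:R); last by rewrite ler_nat; move: m_gt0; lia.
apply: (@count_interval _ i.-1) => j; rewrite /simb (maxn_idPl (ltnW bi)) => /eqP h.
have bj : (m < blk j)%N by move: h bi; lia.
move: h; rewrite (maxn_idPl (ltnW bj)) => h {bi bj}.
by have := blk_eq h; have := blk_eq (esym h); lia.
Qed.

(** The Schur bound for D: entries at most [2 * M], at most [2 * m + 2] of them nonzero in each row
    and column. *)
Definition del : R := 2 * M * (2 * m + 2)%:R.

Lemma gap_del i j : ~~ simb i j -> 4 * del <= `|lam i - lam j|.
Proof.
move=> /gap_m3; rewrite /del natrD natrM -natr1; apply: le_trans.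
by rewrite le_eqVlt; apply/orP; left; apply/eqP; ring.
Qed.

Lemma del_gt0 : 0 < del.
Proof. by rewrite /del !mulr_gt0 // ltr0n; lia. Qed.

Section Similarity.
Variable X : nat -> nat -> R[i].
Hypothesis XB : bdd X (2 * M).
Hypothesis XP : forall i j, Phi X i j = X i j.

Let Km := Kof X.
Let Dm := Dof X.

Lemma Km_le i j : cabs (Km i j) <= 2 * M * `|kap i j|.
Proof. by rewrite /Km /Kof cabsM cabsR mulrC ler_wpM2r. Qed.

Lemma Dm_le i j : cabs (Dm i j) <= 2 * M.
Proof.
apply: le_trans (D_bdd XB i j) _; have := Mgam; have := M_gt0.
set s := M * gam => M0 s8; have : M * s <= M * 8^-1 by rewrite ler_wpM2l // ltW.
lra.
Qed.

Lemma Dm_off i j : ~~ simb i j -> Dm i j = 0.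
Proof. by rewrite /Dm /Dof => /negbTE ->. Qed.

(** The difference is an entry of Q K, bounded through the column of [kap] at j >= n. It makes D
    asymptotically equal to the block part of Q, whence the asymptotics of the eigenvalues. *)
Lemma Dm_near_Q n i j : simb i j -> (0 < n)%N -> (n <= j)%N ->
  cabs (Dm i j - Q i j) <= 8 * M ^+ 2 / (c * n%:R ^+ 2).
Proof.
move=> ij n0 nj; rewrite /Dm /Dof ij addrAC subrr add0r.
apply: csum_bound => N.
apply: (@le_trans _ _ (2 * M ^+ 2 * \sum_(l < N) `|kap l j|)).
  rewrite mulr_sumr; apply: ler_sum => l _; rewrite cabsM.
  apply: le_trans (ler_pM (cabs_ge0 _) (cabs_ge0 _) (Q_le i l) (Km_le l j)) _.
  by rewrite le_eqVlt; apply/orP; left; apply/eqP; ring.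
apply: le_trans (ler_wpM2l _ (kap_col_gen N n0 nj)) _; first by rewrite mulr_ge0 // sqr_ge0.
by rewrite le_eqVlt; apply/orP; left; apply/eqP; ring.
Qed.

Lemma K_intertwine i j : (lam i - lam j)%:C * Km i j =
  Q i j + csum (fun l => Q i l * Km l j) - csum (fun l => Km i l * Dm l j) - Dm i j.
Proof.
rewrite {1}/Km /Kof -XP /Phi; case ij: (simb i j).
  (* Inside a block the entry of K D vanishes: K i l is 0 for l in the block of i, and D l j is 0
     for l outside it. *)
  rewrite !mulr0 /Dm {2}/Dof ij -/(QKof X i j) (_ : csum _ = 0); last first.
    rewrite -csum0; congr csum; apply/funext => l; rewrite /Km /Kof /kap.
    case il : (simb i l); first by rewrite mul0r mul0r.
    rewrite [Dof X l j]Dm_off ?mulr0//; apply: contraFN il => lj.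
    by rewrite (simb_trans ij)// simb_sym.
  by rewrite subr0 subrr.
rewrite mulrA -rmorphM /kap ij divff ?rmorph1 ?mul1r; last first.
  rewrite -normr_gt0; apply: lt_le_trans (gap_del (negbT ij)).
  by rewrite mulr_gt0 // del_gt0.
by rewrite [Dm i j]/Dm [Dof X i j]/Dof ij subr0.
Qed.

Lemma K_op : exists K : {linear H -> H},
  [/\ forall (x : H) i, csummable (fun j => Km i j * x j),
      forall x i, K x i = csum (fun j => Km i j * x j) &
      forall x, nrm (K x) <= 4^-1 * nrm x].
Proof.
have h n (f : 'I_n -> R) : \sum_(j < n) f j <= gam -> 2 * M * \sum_(j < n) f j <= 4^-1.
  move=> hf; apply: le_trans (ler_wpM2l _ hf) _; first by rewrite mulr_ge0 // ltW.
  by rewrite -mulrA; have := Mgam; lra.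
apply: schur_op => i n.
  apply: le_trans (h n _ (kap_row i n)); rewrite mulr_sumr.
  by apply: ler_sum => j _; exact: Km_le.
apply: le_trans (h n _ (kap_col i n)); rewrite mulr_sumr.
by apply: ler_sum => j _; exact: Km_le.
Qed.

Lemma D_op : exists D : {linear H -> H},
  [/\ forall (x : H) i, csummable (fun j => Dm i j * x j),
      forall x i, D x i = csum (fun j => Dm i j * x j) &
      forall x, nrm (D x) <= del * nrm x].
Proof.
have M0 := ltW M_gt0.
have h i j : cabs (Dm i j) <= 2 * M * (simb i j)%:R.
  case ij: (simb i j); first by rewrite mulr1 Dm_le.
  by rewrite Dm_off ?ij // cabs0 mulr0.
apply: schur_op => i n.
  apply: (@le_trans _ _ (2 * M * \sum_(j < n) (simb i j)%:R)).
    by rewrite mulr_sumr; apply: ler_sum => j _.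
  by rewrite ler_wpM2l ?simb_count // mulr_ge0.
apply: (@le_trans _ _ (2 * M * \sum_(j < n) (simb i j)%:R)).
  by rewrite mulr_sumr; apply: ler_sum => j _; rewrite simb_sym.
by rewrite ler_wpM2l ?simb_count // mulr_ge0.
Qed.

Variables (K D : {linear H -> H}).
Hypothesis K_sum : forall (x : H) i, csummable (fun j => Km i j * x j).
Hypothesis KE : forall x i, K x i = csum (fun j => Km i j * x j).
Hypothesis K_nrm : forall x, nrm (K x) <= 4^-1 * nrm x.
Hypothesis D_sum : forall (x : H) i, csummable (fun j => Dm i j * x j).
Hypothesis DE : forall x i, D x i = csum (fun j => Dm i j * x j).
Hypothesis D_nrm : forall x, nrm (D x) <= del * nrm x.

Definition Qact (x : H) i := csum (fun j => Q i j * x j).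

(* [Lgraph x y] : in coordinates, [x] is in the domain of the perturbed operator,
   which maps it to [y]. *)
Definition Lgraph (x y : H) := exists2 w, scaled_by x w & forall i, y i = w i - Qact x i.

(** Column sums of K bound it on l^1, which allows [Q] to be applied to K x. *)
Lemma K_dom_ell1 (x : H) B : (forall n, \sum_(i < n) cabs (x i) <= B) ->
  forall n, \sum_(i < n) cabs (K x i) <= 2 * M * gam * B.
Proof.
move=> xB n; have M0 := ltW M_gt0.
apply: (@le_trans _ _ (\sum_(i < n) rsum (fun j => 2 * M * `|kap i j| * cabs (x j)))).
  apply: ler_sum => i _; rewrite KE; apply: csum_bound => l.
  apply: (@le_trans _ _ (\sum_(j < l) 2 * M * `|kap i j| * cabs (x j))).
    by apply: ler_sum => j _; rewrite cabsM ler_wpM2r ?cabs_ge0 ?Km_le.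
  apply: (psum_le_rsum (M := 2 * M * (c * m%:R ^+ 2)^-1 * 4 * B)) => [j|l'].
    by rewrite !mulr_ge0 ?cabs_ge0.
  apply: (@le_trans _ _ (2 * M * gam * \sum_(j < l') cabs (x j))).
    rewrite mulr_sumr; apply: ler_sum => j _; rewrite ler_wpM2r ?cabs_ge0// ler_wpM2l ?mulr_ge0//.
    apply: le_trans (kap_col j i.+1); rewrite big_ord_recr /= lerDr.
    by rewrite sumr_ge0.
  apply: le_trans (ler_wpM2l _ (xB l')) _.
    by rewrite mulr_ge0 ?gam_ge0// mulr_ge0.
  by rewrite /gam le_eqVlt; apply/orP; left; apply/eqP; ring.
apply: (rsum2_bound (b := fun i j => 2 * M * `|kap i j| * cabs (x j))) => [i j|n' l].
  by rewrite !mulr_ge0 ?cabs_ge0.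
rewrite exchange_big /=; apply: le_trans (ler_wpM2l _ (xB l)).
  rewrite mulr_sumr; apply: ler_sum => j _; rewrite -mulr_suml ler_wpM2r ?cabs_ge0//.
  by rewrite -mulr_sumr ler_wpM2l ?mulr_ge0 ?kap_col.
by rewrite mulr_ge0 ?gam_ge0// mulr_ge0.
Qed.

(** Associativity (Q K) x = Q (K x) is an exchange of infinite sums; absolute convergence rests on x
    being in l^1. *)
Lemma exchange_QK (x : H) B i : (forall n, \sum_(j < n) cabs (x j) <= B) ->
  csum (fun j => csum (fun l => Q i l * Km l j) * x j) = Qact (K x) i.
Proof.
move=> xB; have M2 : 0 <= 2 * M by rewrite mulr_ge0 // ltW.
have g0 := gam_ge0.
rewrite [LHS](_ : _ = csum (fun j => csum (fun l => Q i l * Km l j * x j))); last first.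
  congr csum; apply/funext => j; rewrite mulrC -csumZ; last exact: QK_csummable XB.
  by congr csum; apply/funext => l; rewrite mulrC.
rewrite (csum_exchange (M := M * gam * (2 * M) * B)).
  congr csum; apply/funext => l; rewrite KE -csumZ //.
  by congr csum; apply/funext => j; rewrite mulrA.
move=> n l; apply: le_trans (ler_wpM2l _ (xB n)).
  rewrite mulr_sumr; apply: ler_sum => j _; under eq_bigr do rewrite cabsM.
  by rewrite -mulr_suml ler_wpM2r ?cabs_ge0// QK_sum.
by rewrite mulr_ge0 // mulr_ge0 // ltW.
Qed.

Lemma exchange_KD (x : H) B i : (forall n, \sum_(j < n) cabs (x j) <= B) ->
  csum (fun j => csum (fun l => Km i l * Dm l j) * x j) = K (D x) i.
Proof.
move=> xB; have M2 : 0 <= 2 * M by rewrite mulr_ge0 // ltW.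
have g0 := gam_ge0.
rewrite [LHS](_ : _ = csum (fun j => csum (fun l => Km i l * Dm l j * x j))); last first.
  congr csum; apply/funext => j; rewrite mulrC -csumZ; last exact: KD_csummable XB Dm_le.
  by congr csum; apply/funext => l; rewrite mulrC.
rewrite (csum_exchange (M := gam * (2 * M) * (2 * M) * B)).
  rewrite KE; congr csum; apply/funext => l; rewrite DE -csumZ //.
  by congr csum; apply/funext => j; rewrite mulrA.
move=> n l; apply: le_trans (ler_wpM2l _ (xB n)).
  rewrite mulr_sumr; apply: ler_sum => j _; under eq_bigr do rewrite cabsM.
  by rewrite -mulr_suml ler_wpM2r ?cabs_ge0// (KD_sum _ _ _ XB Dm_le).
by rewrite mulr_ge0 // mulr_ge0.
Qed.

Lemma Qact_D (x y : H) B B' i : (forall n, \sum_(i < n) cabs (x i) <= B) ->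
  (forall n, \sum_(i < n) cabs (y i) <= B') -> Qact (x + y) i = Qact x i + Qact y i.
Proof.
move=> /Q_ell1[xQ _] /Q_ell1[yQ _]; rewrite /Qact -csumD //.
by congr csum; apply/funext => j; rewrite lcoefD mulrDr.
Qed.

Lemma csummable_entry (a : nat -> R[i]) (x : H) A B : (forall j, cabs (a j) <= A) ->
  (forall n, \sum_(i < n) cabs (x i) <= B) -> csummable (fun j => a j * x j).
Proof.
move=> aA xB; have A0 := le_trans (cabs_ge0 _) (aA 0%N).
exists (A * B) => n; apply: le_trans (ler_wpM2l A0 (xB n)); rewrite mulr_sumr.
by apply: ler_sum => j _; rewrite cabsM ler_wpM2r ?cabs_ge0.
Qed.

(** It is not clear beforehand that K x lies in the domain of [lam]. The candidate for the image of
    x + K x under [lam] is the prescribed value plus Q (x + K x), square-summable by [Q_ell1]; the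
    entrywise relation [K_intertwine], summed against x, identifies it. *)
Lemma S_to_L (x w : H) : scaled_by x w -> Lgraph (x + K x) (w - D x + K (w - D x)).
Proof.
move=> xw; have [B xB] := dom_ell1_ex xw.
have KxB := K_dom_ell1 xB.
have UxB n : \sum_(i < n) cabs ((x + K x) i) <= B + 2 * M * gam * B.
  apply: le_trans (lerD (xB n) (KxB n)); rewrite -big_split /=.
  by apply: ler_sum => i _; exact: cabsD.
have [Qs Qn] := Q_ell1 UxB.
have lQ : is_ell2 (Qact (x + K x)) by eexists; exact: Qn.
exists ((w - D x + K (w - D x)) + Ell2 lQ) => i; last by rewrite lcoefD /= addrK.
rewrite lcoefD /= (Qact_D _ xB KxB) linearB.
have key : (lam i)%:C * K x i - K w i =
    Qact x i + Qact (K x) i - K (D x) i - D x i.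
  have s1 := csummable_entry (Q_le i) xB.
  have s2 : csummable (fun j => csum (fun l => Q i l * Km l j) * x j).
    by apply: (csummable_entry _ xB) => j; exact: (QK_bdd XB i j).
  have s3 : csummable (fun j => csum (fun l => Km i l * Dm l j) * x j).
    apply: (csummable_entry (A := gam * (2 * M) * (2 * M)) _ xB) => j; apply: csum_bound => n.
    exact: KD_sum XB Dm_le.
  rewrite -(exchange_QK _ xB) -(exchange_KD _ xB) DE /Qact -csumD // -csumB //; last exact: csummableD.
  rewrite -csumB //; last first.
    apply: (csummable_le (csummableD (csummableD s1 s2) (csummableZ (-1) s3))) => j.
    by rewrite mulN1r.
  rewrite !KE -csumZ // -csumB //; last exact: csummableZ.
  congr csum; apply/funext => j; transitivity ((lam i - lam j)%:C * Km i j * x j).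
    by rewrite xw rmorphB /=; ring.
  by rewrite K_intertwine; ring.
rewrite !lcoefE mulrDr -xw -/(coef (K x) i).
move: key => /(canRL (subrK _)) ->; ring.
Qed.

(** For y = (t + lam) v the equation reads y = Q v, hence |y| <= M * B * |y| with M * B <= 1/2: a
    remote point -t is not an eigenvalue of the perturbed operator. *)
Lemma L_injective t B (v : H) : 0 < t -> 0 <= B -> (t ^+ 2)^-1 + 4 / (t * c) <= B ^+ 2 ->
  M * B <= 2^-1 -> Lgraph v ((- t)%:C *: v) -> v = 0.
Proof.
move=> t0 B0 tB MB [w vw h]; pose y : H := t%:C *: v + w.
have vB n : \sum_(i < n) cabs (v i) <= B * nrm y by exact: dom_ell1.
have yE i : y i = Qact v i.
  by have := h i; rewrite !lcoefE rmorphN mulNr => e; rewrite -[RHS]opprK -[- Qact v i](addKr (w i)) -e; ring.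
have yle : nrm y <= M * (B * nrm y).
  have [_ Qn] := Q_ell1 vB; apply: nrm_le => [|n]; first exact: mulr_ge0 (ltW M_gt0) (mulr_ge0 B0 (nrm_ge0 y)).
  by under eq_bigr do rewrite yE; exact: Qn.
have y0 : nrm y = 0.
  have := nrm_ge0 y; move: yle; rewrite mulrA => h1 h2.
  have := ler_wpM2r h2 MB; lra.
apply: ell2_ext => i; apply/eqP; rewrite -cabs_eq0 eq_le cabs_ge0 andbT.
have := vB i.+1; rewrite y0 mulr0 big_ord_recr /=; apply: le_trans.
by rewrite lerDr sumr_ge0// => ? _; exact: cabs_ge0.
Qed.

(** (z - lam) x + D x = f is solved by x = (1 + G D)^-1 G f, where G inverts z - [lam] and G D has
    norm at most 1/2. *)
Lemma S_solve z (f : H) : (forall i, 2 * del <= cabs (z - (lam i)%:C)) ->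
  exists x w : H, scaled_by x w /\ w - D x = z *: x - f.
Proof.
move=> zl; have d0 := del_gt0.
have [||G [GE Gn]] := @diag_op _ (fun i => (z - (lam i)%:C)^-1) (2 * del)^-1.
- by rewrite invr_ge0 mulr_ge0 // ltW.
- move=> i; have zi : 0 < cabs (z - (lam i)%:C) by apply: lt_le_trans (zl i); rewrite mulr_gt0.
  by rewrite cabsV lef_pV2 ?posrE // mulr_gt0.
have [|V [V1 _ _]] := @neumann _ (G \o D)%FUN 2^-1 ltac:(lra).
  move=> x /=; apply: le_trans (Gn _) _; rewrite mulrC ler_pdivrMr ?mulr_gt0//.
  by apply: le_trans (D_nrm x) _; rewrite le_eqVlt; apply/orP; left; apply/eqP; field.
exists (V (G f)), (D (V (G f)) + (z *: V (G f) - f)); split; last by rewrite addrAC subrr add0r.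
move=> i; have zi : z - (lam i)%:C != 0.
  by rewrite -cabs_gt0; apply: lt_le_trans (zl i); rewrite mulr_gt0.
have e : (z - (lam i)%:C) * V (G f) i + D (V (G f)) i = f i.
  have := congr1 (fun h : H => coef h i) (V1 (G f)).
  rewrite lcoefD (GE (D _)) GE => /(congr1 (fun u => (z - (lam i)%:C) * u)).
  by rewrite mulrDr !mulrA divff // !mul1r.
by rewrite !lcoefE -e; ring.
Qed.

(** Nothing shows directly that x is in the domain of [lam]. At z = -t the equation for [lam - D]
    with right-hand side z x - y has a solution x' in the domain; then x - x' is sent by 1 + K to a
    vector of the kernel treated in [L_injective], so x = x'. *)
Lemma L_to_S (x y : H) : Lgraph (x + K x) (y + K y) ->
  exists2 w, scaled_by x w & y = w - D x.
Proof.
move=> Lxy; have d0 := del_gt0; have M0 := M_gt0; have c0 := c_gt0.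
(* [2 * del] is the distance needed by [S_solve]. The other terms make 1/t^2 at most 1/(16 M^2) and
   4/(t c) at most 1/(8 M^2), so that B = 1/(2 M) is admissible in [L_injective]. *)
pose t := 2 * del + 4 * M + 32 * M ^+ 2 / c.
have t1 : 2 * del + 4 * M <= t by rewrite /t lerDl divr_ge0 ?mulr_ge0 ?sqr_ge0 // ltW.
have t2 : 32 * M ^+ 2 / c <= t by rewrite /t lerDr addr_ge0 ?mulr_ge0// ltW.
have t0 : 0 < t by apply: lt_le_trans t1; rewrite addr_gt0 // mulr_gt0.
pose B := (2 * M)^-1.
have tB : (t ^+ 2)^-1 + 4 / (t * c) <= B ^+ 2.
  have h1 : (t ^+ 2)^-1 <= ((4 * M) ^+ 2)^-1.
    rewrite lef_pV2 ?posrE ?exprn_gt0 ?mulr_gt0//.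
    by rewrite ler_pXn2r ?nnegrE ?mulr_ge0 ?(ltW t0) ?(ltW M0)//; lra.
  have h2 : 4 / (t * c) <= 4 / (32 * M ^+ 2).
    rewrite ler_wpM2l // lef_pV2 ?posrE ?mulr_gt0 ?exprn_gt0//.
    by rewrite -ler_pdivrMr.
  have -> : B ^+ 2 = 4 * ((4 * M) ^+ 2)^-1 by rewrite /B; field; lra.
  have e3 : ((4 * M) ^+ 2)^-1 = 2^-1 * (4 / (32 * M ^+ 2)) by field; lra.
  have : 0 <= 4 / (32 * M ^+ 2) by rewrite divr_ge0 // mulr_ge0 // sqr_ge0.
  by move: h1 h2; rewrite e3; set A := _ ^- 2; set b := 4 / (t * c); set d := 4 / _; lra.
pose z : R[i] := (- t)%:C.
have [|x' [w' [xw' e']]] := @S_solve z (z *: x - y).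
  move=> i; rewrite /z -rmorphB cabsR -opprD normrN ger0_norm; have := lam_ge0 i; lra.
have Lx' := S_to_L xw'.
suff xx' : x = x'.
  by rewrite -xx' in e' xw'; exists w'; rewrite // e' opprB addrCA subrr addr0.
apply/eqP; rewrite -subr_eq0; apply/eqP.
have inj (v : H) : v + K v = 0 -> v = 0.
  move=> h; apply: nrm_eq0; have := K_nrm v.
  have -> : K v = - v by apply/eqP; rewrite -addr_eq0 addrC h.
  by rewrite nrmN; have := nrm_ge0 v; lra.
apply: inj; apply: (@L_injective t B) => //; first by rewrite invr_ge0 mulr_ge0 // ltW.
  by rewrite /B le_eqVlt; apply/orP; left; apply/eqP; field; lra.
have [w1 h1 e1] := Lxy; have [w2 h2 e2] := Lx'.
have [B1 xB1] := dom_ell1_ex h1; have [B2 xB2] := dom_ell1_ex h2.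
have E : x - x' + K (x - x') = (x + K x) + - 1 *: (x' + K x').
  by rewrite linearB scaleN1r; apply: ell2_ext => i; rewrite !lcoefE; ring.
rewrite E; exists (w1 + - 1 *: w2) => i.
  by rewrite !lcoefE h1 h2 !lcoefE; ring.
have -> : Qact (x + K x + -1 *: (x' + K x')) i = Qact (x + K x) i - Qact (x' + K x') i.
  have xB2' n : \sum_(i < n) cabs ((- 1 *: (x' + K x')) i) <= B2.
    by under eq_bigr do rewrite lcoefZ cabsM cabsN cabs1 mul1r.
  rewrite (Qact_D _ xB1 xB2') -[- Qact (x' + _) i]mulN1r /Qact -csumZ; last by have [] := Q_ell1 xB2.
  by congr (_ + csum _); apply/funext => j; rewrite lcoefZ mulrCA.
have {}e1 := e1 i; have {}e2 := e2 i.
rewrite e' in e2; rewrite -/z !lcoefE.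
have EK : K (z *: x' - (z *: x - y)) = z *: K x' - (z *: K x - K y).
  by rewrite !linearB !linearZ.
move: e1 e2; rewrite EK !lcoefE.
set q1 := Qact _ _; set q2 := Qact _ _ => e1 e2.
have -> : w1 i = y i + coef (K y) i + q1 by rewrite e1 subrK.
have -> : w2 i = z * x' i - (z * x i - y i) + (z * K x' i - (z * K x i - coef (K y) i)) + q2.
  rewrite e2 subrK //.
ring.
Qed.

End Similarity.

(** As K has norm at most 1/4, U = 1 + K and its inverse V have norms at most 5/4 and 4/3; 2 is a
    convenient common bound. *)
Lemma similarity : exists (Km Dm : nat -> nat -> R[i]) (U V D : {linear H -> H}),
 [/\ [/\ forall x, U (V x) = x, forall x, V (U x) = x,
       forall x, nrm (U x) <= 2 * nrm x & forall x, nrm (V x) <= 2 * nrm x],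
     forall x y, Lgraph (U x) (U y) <-> exists2 w, scaled_by x w & y = w - D x,
     [/\ forall (x : H) i, csummable (fun j => Km i j * x j),
         forall x i, U x i = x i + csum (fun j => Km i j * x j) &
         forall i j, cabs (Km i j) <= 2 * M * `|kap i j|] &
     [/\ forall (x : H) i, csummable (fun j => Dm i j * x j),
         forall x i, D x i = csum (fun j => Dm i j * x j),
         forall i j, ~~ simb i j -> Dm i j = 0,
         forall n i j, simb i j -> (0 < n)%N -> (n <= j)%N ->
           cabs (Dm i j - Q i j) <= 8 * M ^+ 2 / (c * n%:R ^+ 2) &
         forall x, nrm (D x) <= del * nrm x]].
Proof.
have [X XB XP] := Phi_fix.
have [K [Ks KE Kn]] := K_op XB; have [D [Ds DE Dn]] := D_op XB.
have [|V [V1 V2 Vn]] := @neumann _ K 4^-1 ltac:(lra); first exact: Kn.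
pose f (x : H) := x + K x.
have fl : linear f by move=> a x y; rewrite /f linearP scalerDr addrACA.
pose U : {linear H -> H} := HB.pack f (GRing.isLinear.Build _ _ _ _ f fl).
exists (Kof X), (Dof X), U, V, D; split.
- split=> // x; rewrite /= /f.
    by apply: le_trans (nrmD _ _) _; have := Kn x; have := nrm_ge0 x; lra.
  apply: le_trans (Vn x) _; apply: ler_wpM2r; first exact: nrm_ge0.
  by rewrite -[leLHS]mul1r ler_pdivrMr; lra.
- move=> x y; split; first exact: (L_to_S XB XP Ks KE Kn Ds DE Dn).
  by move=> [w xw ->]; exact: (S_to_L XB XP Ks KE Ds DE).
- split=> // [x i|i j]; last exact: (Km_le XB).
  by rewrite -KE.
- by split=> //; [exact: Dm_off|exact: Dm_near_Q].
Qed.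

End FixedPoint.

(** * Spectral theory of the block-diagonal operator *)

(* [E] is the projection onto the generalized kernel of [B], and [T] its Drazin inverse. *)
Lemma drazin_mx (F : fieldType) (n : nat) (B : 'M[F]_n.+1) :
  exists (E T : 'M[F]_n.+1) d,
    [/\ E * E = E, T * E = 0, B * T = 1 - E, T * B = 1 - E & 
        B * E = E * B /\ B ^+ d * E = 0].
Proof.
have [d [h h0 eh]] := multiplicity_XsubC (char_poly B) 0.
rewrite monic_neq0 ?char_poly_monic //= in h0.
rewrite subr0 in eh.
(* The exponent d + 1, rather than d, leaves a factor X to invert even when 0 is not a root and d =
   0. *)
have cop : coprimep ('X^(d.+1)) h.
  by rewrite coprimep_expl // -['X]subr0 coprimep_sym coprimep_XsubC.
have /Bezout_eq1_coprimepP[[u v] /= uv] := cop.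
pose f := horner_mx B.
have fM p q : f (p * q) = f p * f q by exact: rmorphM.
have fC p q : f p * f q = f q * f p by rewrite -!fM mulrC.
have fB p q : f (p - q) = f p - f q by exact: rmorphB.
have fX : f 'X = B by exact: horner_mx_X.
have fchi : f (h * 'X^d) = 0 by rewrite -eh; exact: Cayley_Hamilton.
have fone : f 1 = 1 by exact: rmorph1.
pose e := v * h; pose t := u * 'X^d * (1 - e).
have e1 : 1 - e = u * 'X^(d.+1) by rewrite -uv addrK.
have fee : f (e * (1 - e)) = 0.
  rewrite e1 /e exprS (_ : v * h * _ = h * 'X^d * (v * u * 'X)); last by ring.
  by rewrite fM fchi mul0r.
have ee : f e * f e = f e.
  by move: fee; rewrite mulrBr mulr1 fB (fM e e) => /eqP; rewrite subr_eq0 => /eqP <-.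
have bt : f ('X * t) = 1 - f e.
  rewrite -fone -fB /t (_ : 'X * _ = (1 - e) * (1 - e)); last by rewrite {3}e1 exprS; ring.
  rewrite (_ : (1 - e) * (1 - e) = 1 - e - e * (1 - e)); last by ring.
  by rewrite (fB (1 - e) (e * (1 - e))) fee subr0.
exists (f e), (f t), d; split=> //.
- rewrite -fM (_ : t * e = u * 'X^d * (e * (1 - e))); last by rewrite /t; ring.
  by rewrite (fM (u * 'X^d) (e * (1 - e))) fee mulr0.
- by rewrite -{1}fX -fM.
- by rewrite -{1}fX -fM mulrC.
- split; first by rewrite -{1 2}fX fC.
  rewrite -{1}fX -rmorphXn -fM /e (_ : 'X^d * _ = h * 'X^d * v); last by ring.
  by rewrite fM fchi mul0r.
Qed.

Lemma lin_ex {R : realType} (f : ell2 R -> ell2 R) : linear f ->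
  exists F : {linear ell2 R -> ell2 R}, forall x, F x = f x.
Proof.
move=> fl; pose F : {linear ell2 R -> ell2 R} := HB.pack f (GRing.isLinear.Build _ _ _ _ f fl).
by exists F.
Qed.

Arguments coef : simpl never.

Section BlockOperator.
Context {R : realType}.
Notation H := (ell2 R).
Variables (lam : nat -> R) (sim : rel nat) (Dm : nat -> nat -> R[i]).
Variables (D : {linear H -> H}) (del : R).
Hypothesis sim_refl : forall i, sim i i.
Hypothesis sim_sym : forall i j, sim i j = sim j i.
Hypothesis sim_trans : forall i j l, sim i j -> sim j l -> sim i l.
Hypothesis DE : forall (x : H) i, D x i = csum (fun j => Dm i j * x j).
Hypothesis Dm_off : forall i j, ~~ sim i j -> Dm i j = 0.
Hypothesis D_nrm : forall x, nrm (D x) <= del * nrm x.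
Hypothesis del_gt0 : 0 < del.
Hypothesis cutoff : forall B : R, exists2 N, forall i, (N <= i)%N -> B <= lam i &
  forall i j, sim i j -> (i <= N)%N = (j <= N)%N.

Definition Sgraph (x y : H) := exists2 w, scaled_by lam x w & y = w - D x.

Lemma SgraphP x y : Sgraph x y <-> forall i, y i = (lam i)%:C * x i - D x i.
Proof.
split=> [[w xw ->] i|h]; first by rewrite lcoefB xw.
exists (y + D x); last by rewrite addrK.
by move=> i; rewrite lcoefD h subrK.
Qed.

Lemma Sgraph_lin (a : R[i]) x y x' y' : Sgraph x y -> Sgraph x' y' ->
  Sgraph (a *: x + x') (a *: y + y').
Proof.
move=> /SgraphP h /SgraphP h'; apply/SgraphP => i.
by rewrite linearP !(lcoefD, lcoefZ) h h'; ring.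
Qed.

Lemma SgraphD x y x' y' : Sgraph x y -> Sgraph x' y' -> Sgraph (x + x') (y + y').
Proof. by move=> h h'; have := Sgraph_lin 1 h h'; rewrite !scale1r. Qed.

Lemma SgraphZ a x y : Sgraph x y -> Sgraph (a *: x) (a *: y).
Proof.
move=> h; have h0 : Sgraph 0 0 by apply/SgraphP => i; rewrite linear0 !lcoef0 mulr0 subr0.
by have := Sgraph_lin a h h0; rewrite !addr0.
Qed.

Lemma SgraphB x y x' y' : Sgraph x y -> Sgraph x' y' -> Sgraph (x - x') (y - y').
Proof. by move=> h h'; rewrite -[- x']scaleN1r -[- y']scaleN1r; apply: SgraphD => //; exact: SgraphZ. Qed.

(** W is a union of blocks, which is what makes the coordinate projection onto W commute with D. *)
Definition saturated (W : pred nat) := forall i j, sim i j -> W i = W j.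

Lemma prj_op (W : pred nat) : exists P : {linear H -> H},
  (forall x i, P x i = (W i)%:R * x i) /\ forall x, nrm (P x) <= nrm x.
Proof.
have [//||P [h n]] := @diag_op R (fun i => (W i)%:R) 1.
  by move=> i; case: (W i); rewrite ?cabs1 ?cabs0.
by exists P; split=> // x; rewrite -[leRHS]mul1r.
Qed.

Lemma D_local (x x' : H) i : (forall j, sim i j -> x j = x' j) -> D x i = D x' i.
Proof.
move=> h; rewrite !DE; congr csum; apply/funext => j.
by case ij : (sim i j); [rewrite h|rewrite Dm_off ?ij // !mul0r].
Qed.

Lemma D_commute W (P : {linear H -> H}) : saturated W ->
  (forall x i, P x i = (W i)%:R * x i) -> forall x, D (P x) = P (D x).
Proof.
move=> sW PE x; apply: ell2_ext => i; rewrite PE; case Wi : (W i).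
  by rewrite mul1r; apply: D_local => j ij; rewrite PE -(sW _ _ ij) Wi mul1r.
rewrite mul0r (@D_local _ 0) ?linear0 // => j ij.
by rewrite PE -(sW _ _ ij) Wi mul0r.
Qed.

Lemma Sgraph_prj W (P : {linear H -> H}) x y : saturated W ->
  (forall x i, P x i = (W i)%:R * x i) -> Sgraph x y -> Sgraph (P x) (P y).
Proof.
move=> sW PE /SgraphP h; apply/SgraphP => i.
by rewrite (D_commute sW PE) !PE h; ring.
Qed.

(** On the range of P the inverse is (1 - G D)^-1 G, with G the inverse of lam - c on W and 0
    elsewhere; the norm of G D is at most del / a < 1. *)
Lemma partial_inverse (W : pred nat) (P : {linear H -> H}) c (a : R) : saturated W ->
  (forall x i, P x i = (W i)%:R * x i) -> del < a ->
  (forall i, W i -> a <= cabs ((lam i)%:C - c)) ->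
  exists T : {linear H -> H},
    [/\ forall x, P (T x) = T x, forall x, T (P x) = T x,
        forall x, Sgraph (T x) (c *: T x + P x),
        forall x y, Sgraph x y -> T (y - c *: x) = P x &
        forall x, nrm (T x) <= (a - del)^-1 * nrm x].
Proof.
move=> sW PE dela lama; have a0 : 0 < a := lt_trans del_gt0 dela.
pose g i : R[i] := (W i)%:R * ((lam i)%:C - c)^-1.
have [||G [GE Gn]] := @diag_op _ g a^-1.
- by rewrite invr_ge0 ltW.
- move=> i; rewrite /g; case Wi: (W i); last by rewrite mul0r cabs0 invr_ge0 ltW.
  have h := lama i Wi; rewrite mul1r cabsV lef_pV2 ?posrE //; exact: lt_le_trans h.
have q1 : del / a < 1 by rewrite ltr_pdivrMr // mul1r.
have [|M NE] := @lin_ex _ (fun x => - G (D x)).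
  by move=> u x y; rewrite !linearP.
have [|V [V1 V2 Vn]] := @neumann _ M (del / a) q1.
  move=> x; rewrite NE nrmN; apply: le_trans (Gn _) _.
  by rewrite mulrAC ler_pdivlMr // mulrC mulVKf ?gt_eqF.
have PG x : P (G x) = G x.
  by apply: ell2_ext => i; rewrite PE GE /g; case: (W i); rewrite ?mul1r // !mul0r.
have GP x : G (P x) = G x.
  by apply: ell2_ext => i; rewrite !GE PE /g; case: (W i); rewrite ?mul1r // !mul0r ?mulr0.
have V1' x : V x = G (D (V x)) + x.
  by rewrite -[X in _ = _ + X]V1 NE addrCA subrr addr0.
exists (V \o G)%FUN; split=> /=.
- by move=> x; rewrite V1' raddfD /= !PG.
- by move=> x; rewrite GP.
- move=> x; apply/SgraphP => i; rewrite lcoefD lcoefZ PE.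
  have e := congr1 (fun h : H => coef h i) (V1' (G x)).
  rewrite lcoefD !GE /g in e.
  case Wi: (W i) e => /=; rewrite ?mul1r ?mul0r => e.
    have n0 : (lam i)%:C - c != 0.
      by rewrite -cabs_gt0; apply: lt_le_trans (lama i Wi).
    have : ((lam i)%:C - c) * V (G x) i = D (V (G x)) i + x i.
      by rewrite e mulrDr !mulrA divff // !mul1r.
    move=> e'; have -> : (lam i)%:C * V (G x) i = ((lam i)%:C - c) * V (G x) i + c * V (G x) i by ring.
    by rewrite e'; ring.
  rewrite e (@D_local _ 0) ?linear0 ?lcoef0 ?addr0 ?mulr0 ?subr0 // => j ij.
  rewrite -[V (G x)]/(V (G x)) V1' lcoefD !GE /g -(sW _ _ ij) Wi !mul0r addr0 //.
- move=> x y /SgraphP h; rewrite -(V2 (P x)) NE; congr (V _).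
  rewrite (D_commute sW PE) GP; apply: ell2_ext => i.
  rewrite lcoefB PE !GE lcoefB lcoefZ h /g; case Wi: (W i); rewrite ?mul0r ?subr0 // ?mul1r.
  have n0 : (lam i)%:C - c != 0.
    by rewrite -cabs_gt0; apply: lt_le_trans (lama i Wi).
  by field.
- move=> x; apply: le_trans (Vn _) _.
  have -> : (a - del)^-1 = (1 - del / a)^-1 * a^-1 by field; lra.
  by rewrite -mulrA ler_wpM2l // invr_ge0; lra.
Qed.

(* [E] is the spectral projection of [lam - D] at [c], [N0] its nilpotent part there and
   [T] the reduced resolvent. *)
Definition spectral_data c (E T N0 : {linear H -> H}) :=
  [/\ forall x, Sgraph (T x) (c *: T x + x - E x),
      forall x y, Sgraph x y -> T (y - c *: x) = x - E x,
      forall x, Sgraph (E x) (c *: E x + N0 x),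
      forall x y, Sgraph x y -> E (y - c *: x) = N0 x &
      [/\ forall x, E (E x) = E x, forall x, T (E x) = 0,
          forall x, N0 (E x) = N0 x & forall x, E (N0 x) = N0 x]].

(** The growth condition under which the principal part of the Laurent series at c converges for |z
    - c| > rho. A nilpotent [N0] satisfies it for every rho > 0. *)
Definition power_bound (E N0 : {linear H -> H}) (rho : R) :=
  exists2 C : R, 0 <= C & forall s x, nrm (iter s N0 (E x)) <= C * rho ^+ s * nrm x.

(** [N0] multiplies E x by z - c, which the growth bound forbids unless E x = 0; then x = (z - c) T
    x, and T is too small for a nonzero x. *)
Lemma no_eigenvalue c E T N0 rho tau z x : spectral_data c E T N0 ->
  power_bound E N0 rho -> 0 <= rho -> rho < cabs (z - c) ->
  0 <= tau -> (forall x, nrm (T x) <= tau * nrm x) -> tau * cabs (z - c) < 1 ->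
  Sgraph x (z *: x) -> x = 0.
Proof.
move=> [T1 T2 E1 E2 [EE TE NE EN]] [C C0 hC] rho0 rhoz tau0 Tt tz Sx.
have zc0 : 0 < cabs (z - c) by exact: le_lt_trans rhoz.
have e : z *: x - c *: x = (z - c) *: x by rewrite scalerBl.
have hE := E2 _ _ Sx; have hT := T2 _ _ Sx; rewrite e linearZ in hE; rewrite e linearZ in hT.
have it s : iter s N0 (E x) = (z - c) ^+ s *: E x.
  elim: s => [|s IH]; first by rewrite scale1r.
  by rewrite iterS IH linearZ /= NE -hE scalerA -exprSr.
have Ex0 : E x = 0.
  apply: nrm_eq0; apply/eqP; rewrite eq_le nrm_ge0 andbT; apply/ler_addgt0Pr => d d0; rewrite add0r.
  have q1 : rho / cabs (z - c) < 1 by rewrite ltr_pdivrMr // mul1r.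
  have := geometric_cvg0 (C * nrm x) (divr_ge0 rho0 (ltW zc0)) q1.
  move=> /cvgrPdist_lt/(_ d d0)[s _ /(_ s (leqnn s))].
  rewrite /= sub0r normrN => hs; apply: le_trans (ltW (le_lt_trans (ler_norm _) hs)).
  have := hC s x; rewrite it nrmZ cabsX => h.
  rewrite expr_div_n mulrA ler_pdivlMr ?exprn_gt0// mulrC.
  by apply: le_trans h _; rewrite mulrAC.
rewrite Ex0 subr0 in hT; apply: nrm_eq0.
have := Tt x; rewrite /= in hT; have := nrm_ge0 x; have : nrm x = cabs (z - c) * nrm (T x).
  by rewrite -{1}hT nrmZ.
move=> h1 h2 h3; have : nrm x <= cabs (z - c) * tau * nrm x.
  by rewrite {1}h1 -mulrA ler_wpM2l // ltW.
move=> h4; apply/eqP; rewrite eq_le h2 andbT leNgt; apply/negP => h5.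
have : tau * cabs (z - c) * nrm x < 1 * nrm x by rewrite ltr_pM2r.
by rewrite mul1r ltNge [tau * _]mulrC h4.
Qed.

Definition eigenvalue_S z := exists2 x : H, x <> 0 & Sgraph x (z *: x).

Definition is_Sresolvent z (Rz : {linear H -> H}) :=
  (exists C : R, forall x, nrm (Rz x) <= C * nrm x) /\
  forall f x, x = Rz f <-> Sgraph x (z *: x - f).

(** A finite expansion with exact remainder: the sum solves the resolvent equation up to an explicit
    right-hand side, to which the resolvent itself is applied. Only this remainder needs an
    estimate. *)
Lemma laurent c E T N0 z (Rz : {linear H -> H}) : spectral_data c E T N0 ->
  is_Sresolvent z Rz -> z != c -> forall n x,
  Rz x = \sum_(s < n) ((z - c) ^- s.+1 *: iter s N0 (E x) - (z - c) ^+ s *: iter s.+1 T x)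
    + Rz ((z - c) ^- n *: iter n N0 (E x) + (z - c) ^+ n *: iter n T (x - E x)).
Proof.
move=> [T1 T2 E1 E2 [EE TE NE EN]] [_ hR] zc n x.
have zc0 : z - c != 0 by rewrite subr_eq0.
have EI s : E (iter s N0 (E x)) = iter s N0 (E x) by case: s => //= s; rewrite EN.
(* T applied to the pair in [T1] gives T (y - E y) = T y - E (T y), while T E = 0 gives T (y - E y)
   = T y. *)
have ET y : E (T y) = 0.
  have h : T (y - E y) = T y - E (T y).
    rewrite -(T2 _ _ (T1 y)); congr (T _).
    by apply: ell2_ext => i; rewrite !lcoefE; ring.
  have e : T y - T (E y) = T y - E (T y) by rewrite -h linearB.
  rewrite TE subr0 in e.
  by have := subrr (T y); rewrite {2}e opprB addrCA subrr addr0.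
have S1 s : Sgraph (iter s N0 (E x)) (c *: iter s N0 (E x) + iter s.+1 N0 (E x)).
  by have := E1 (iter s N0 (E x)); rewrite EI.
have S2 s : Sgraph (iter s.+1 T x) (c *: iter s.+1 T x + iter s T (x - E x)).
  have := T1 (iter s T x); rewrite -iterS -addrA; congr (Sgraph _ (_ + _)).
  case: s => // s; rewrite iterS ET subr0 -iterS iterSr [in RHS]iterSr.
  by rewrite linearB /= TE subr0.
have key m : Sgraph
   (\sum_(s < m) ((z - c) ^- s.+1 *: iter s N0 (E x) - (z - c) ^+ s *: iter s.+1 T x))
   (z *: \sum_(s < m) ((z - c) ^- s.+1 *: iter s N0 (E x) - (z - c) ^+ s *: iter s.+1 T x) 
     - (x - ((z - c) ^- m *: iter m N0 (E x) + (z - c) ^+ m *: iter m T (x - E x)))).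
  elim: m => [|m IH].
    rewrite big_ord0 scaler0 !expr0 invr1 !scale1r /= (addrC (E x)) subrK subrr subr0.
    by apply/SgraphP => i; rewrite linear0 !lcoef0 mulr0 subr0.
  rewrite big_ord_recr /=.
  have := SgraphD IH (SgraphB (SgraphZ ((z - c) ^- m.+1) (S1 m)) (SgraphZ ((z - c) ^+ m) (S2 m))).
  congr Sgraph; apply: ell2_ext => i; rewrite !lcoefE -!iterS !exprS !invfM.
  rewrite (_ : iter m.+1 T (x - E x) = iter m.+1 T x); last first.
    by rewrite iterSr linearB TE subr0 -iterSr.
  have e : (z - c) * (z - c)^-1 = 1 by rewrite divff.
  have e' : z = (z - c) + c by rewrite subrK.
  set A := (z - c) ^- m; set B := (z - c) ^+ m; set w := z - c in e e' *.
  set u0 := coef (iter m N0 (E x)) i; set u1 := coef (iter m.+1 N0 (E x)) i.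
  set v1 := coef (iter m.+1 T x) i; set v0 := coef (iter m T _) i.
  have -> : A * u0 = w * w^-1 * A * u0 by rewrite e mul1r.
  rewrite e'; ring.
have /hR e := key n.
by rewrite {1}e linearB subrK.
Qed.

(** When E = 0, T inverts (lam - D) - z; the resolvent inverts the opposite operator, hence the
    sign. *)
Lemma Sresolvent_of_data z E T N0 : spectral_data z E T N0 ->
  (exists C : R, forall x, nrm (T x) <= C * nrm x) -> (forall x, E x = 0) ->
  exists Rz, is_Sresolvent z Rz.
Proof.
move=> [T1 T2 _ _ _] [C hC] E0; 
have [|M ME] := @lin_ex _ (fun x => - T x).
  by move=> u x y; rewrite !linearP.
exists M; split; first by exists C => x; rewrite ME nrmN.
move=> f x; rewrite ME; split=> [->|h].
  have := SgraphZ (-1) (T1 f); rewrite E0 subr0 !scaleN1r.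
  by congr Sgraph; rewrite scalerN opprD.
have := T2 _ _ h; rewrite E0 subr0 => <-.
by rewrite addrAC subrr add0r linearN.
Qed.

(** * The finite head of the operator as a matrix *)

Section Head.
Variable N : nat.
Hypothesis satN : forall i j, sim i j -> (i <= N)%N = (j <= N)%N.

Definition inj_seq (v : 'cV[R[i]]_N.+1) (i : nat) : R[i] :=
  if insub i is Some o then v o 0 else 0.

Lemma inj_ell2 v : is_ell2 (inj_seq v).
Proof.
exists (\sum_(i < N.+1) cabs (inj_seq v i) ^+ 2) => n.
have [nN|/ltnW Nn] := leqP n N.+1.
  by apply: (@psum_le _ (fun i => cabs (inj_seq v i) ^+ 2)) => // i; exact: sqr_ge0.
rewrite -!(big_mkord xpredT (fun i => cabs (inj_seq v i) ^+ 2)) [leLHS](big_cat_nat (leq0n N.+1) Nn)/=.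
have -> : \sum_(N.+1 <= i < n) cabs (inj_seq v i) ^+ 2 = 0; last by rewrite addr0.
rewrite big_nat_cond big1// => i /andP[/andP[Ni _] _].
by rewrite /inj_seq insubF ?cabs0 ?expr0n// ltnNge Ni.
Qed.

Definition inj_mx v : H := Ell2 (inj_ell2 v).
Definition res_mx (x : H) : 'cV[R[i]]_N.+1 := \col_(i < N.+1) x i.

Lemma inj_mxE v (o : 'I_N.+1) : inj_mx v o = v o 0.
Proof. by rewrite /coef /= /inj_seq; case: insubP => [k _ /val_inj -> //|]; rewrite ltn_ord. Qed.

Lemma inj_mx_out v i : (N < i)%N -> inj_mx v i = 0.
Proof. by move=> Ni; rewrite /coef /= /inj_seq insubF // ltnNge Ni. Qed.

Lemma res_inj v : res_mx (inj_mx v) = v.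
Proof. by apply/colP => o; rewrite mxE inj_mxE. Qed.

Lemma inj_mx_lin a v w : inj_mx (a *: v + w) = a *: inj_mx v + inj_mx w.
Proof.
apply: ell2_ext => i; rewrite lcoefD lcoefZ.
have [iN|Ni] := ltnP i N.+1; last by rewrite !inj_mx_out // mulr0 addr0.
by rewrite !(inj_mxE _ (Ordinal iN)) !mxE.
Qed.

Lemma res_mx_lin a (x y : H) : res_mx (a *: x + y) = a *: res_mx x + res_mx y.
Proof. by apply/colP => o; rewrite !mxE. Qed.

Lemma fin_op (B : 'M[R[i]]_N.+1) : exists T : {linear H -> H},
  (forall x, T x = inj_mx (B *m res_mx x)) /\
  exists2 C : R, 0 <= C & forall x, nrm (T x) <= C * nrm x.
Proof.
pose f (x : H) := inj_mx (B *m res_mx x).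
have fl : linear f by move=> a x y; rewrite /f res_mx_lin mulmxDr -scalemxAr inj_mx_lin.
have [T TE] := lin_ex fl.
exists T; split=> //.
pose r := Num.sqrt (\sum_(i < N.+1) (\sum_j cabs (B i j)) ^+ 2).
exists r; first exact: sqrtr_ge0.
move=> x; apply: nrm_le; first by rewrite mulr_ge0 ?sqrtr_ge0 ?nrm_ge0.
have key : \sum_(i < N.+1) cabs (T x i) ^+ 2 <= (r * nrm x) ^+ 2.
  rewrite exprMn sqr_sqrtr ?sumr_ge0 // => [|? _]; last exact: sqr_ge0.
  rewrite mulr_suml; apply: ler_sum => i _; rewrite -exprMn.
  rewrite ler_pXn2r ?nnegrE ?cabs_ge0 ?mulr_ge0 ?nrm_ge0 ?sumr_ge0 // => [|? _]; last exact: cabs_ge0.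
  rewrite TE inj_mxE mxE.
  apply: le_trans (cabs_sum _ _ _) _; rewrite mulr_suml; apply: ler_sum => j _.
  by rewrite mxE cabsM ler_wpM2l ?cabs_ge0 ?coef_le_nrm.
move=> n; apply: le_trans key.
have [nN|/ltnW Nn] := leqP n N.+1.
  by apply: (@psum_le _ (fun i => cabs (T x i) ^+ 2)) => // i; exact: sqr_ge0.
rewrite -!(big_mkord xpredT (fun i => cabs (T x i) ^+ 2)) [leLHS](big_cat_nat (leq0n N.+1) Nn)/=.
rewrite [X in _ + X](_ : _ = 0) ?addr0//.
rewrite big_nat_cond big1// => i /andP[/andP[Ni _] _].
by rewrite TE inj_mx_out ?cabs0 ?expr0n.
Qed.

Definition head_mx : 'M[R[i]]_N.+1 :=
  \matrix_(i, j) ((i == j)%:R * (lam i)%:C - Dm i j).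

Lemma D_head (x : H) (o : 'I_N.+1) : D x o = \sum_(j < N.+1) Dm o j * x j.
Proof.
rewrite DE (@csum_fin _ _ N.+1) // => j Nj; rewrite Dm_off ?mul0r //.
by apply/negP => /satN; rewrite -ltnS ltn_ord leqNgt Nj.
Qed.

Lemma res_Sgraph x y : Sgraph x y -> res_mx y = head_mx *m res_mx x.
Proof.
move=> /SgraphP h; apply/colP => o; rewrite !mxE h D_head.
under [RHS]eq_bigr do rewrite !mxE mulrBl.
rewrite big_split /= sumrN; congr (_ - _).
by rewrite (bigD1 o) //= eqxx mul1r big1 ?addr0 // => j jo; rewrite eq_sym (negbTE jo) !mul0r.
Qed.

Lemma inj_Sgraph v : Sgraph (inj_mx v) (inj_mx (head_mx *m v)).
Proof.
apply/SgraphP => i; have [iN|Ni] := ltnP i N.+1.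
  rewrite -[ i ]/(nat_of_ord (Ordinal iN)) inj_mxE D_head inj_mxE mxE.
  under [LHS]eq_bigr do rewrite !mxE mulrBl.
  rewrite big_split /= sumrN; congr (_ - _).
    rewrite (bigD1 (Ordinal iN)) //= eqxx mul1r big1 ?addr0 // => j jo.
    by rewrite eq_sym (negbTE jo) !mul0r.
  by apply: eq_bigr => j _; rewrite -(inj_mxE v j).
rewrite !inj_mx_out // mulr0 (@D_local _ 0) ?linear0 ?lcoef0 ?subr0 ?addr0 // => j ij.
by rewrite inj_mx_out // ltnNge -(satN ij) -ltnNge.
Qed.

End Head.

(** Beyond a saturated cutoff N the numbers lam i are at distance at least [2 * del] from z0 and
    [partial_inverse] applies; the coordinates up to N carry a finite matrix, treated by
    [drazin_mx]. The reduced resolvents of the two parts are added. *)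
Lemma data_exists z0 : exists (E T N0 : {linear H -> H}) N,
  [/\ spectral_data z0 E T N0,
      exists2 C : R, 0 <= C & forall x, nrm (E x) <= C * nrm x,
      exists2 C : R, 0 <= C & forall x, nrm (T x) <= C * nrm x,
      forall rho, 0 < rho -> power_bound E N0 rho &
      (forall x i, (N < i)%N -> E x i = 0) /\ forall x, exists d, iter d N0 (E x) = 0].
Proof.
have [N hN satN] := cutoff (cabs z0 + 2 * del).
have [E0 [T0 [d [EE TE BT TB [BE BdE]]]]] := drazin_mx (head_mx N - z0%:M).
have [E [EE' [CE CE0 hCE]]] := fin_op E0.
have [T [TE' [CT CT0 hCT]]] := fin_op T0.
have [N0 [NE' [CN CN0 hCN]]] := fin_op ((head_mx N - z0%:M) *m E0).
pose W := [pred i | (N < i)%N].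
have sW : saturated W by move=> i j ij; rewrite /W /= !ltnNge (satN _ _ ij).
have [P [PE Pn]] := prj_op W.
have [||T2 [PT TP T21 T22 T2n]] := @partial_inverse W P z0 (2 * del) sW PE; first by have := del_gt0; lra.
  move=> i /ltnW /hN h.
  have := cabs_subD (lam i)%:C (- z0); rewrite cabsN cabsR.
  have := ler_norm (lam i); lra.
have resP x : res_mx N (P x) = 0.
  by apply/colP => o; rewrite !mxE PE /W /= ltnNge -ltnS ltn_ord mul0r.
have injres x : inj_mx (res_mx N x) = x - P x.
  apply: ell2_ext => i; rewrite lcoefB PE /W /=; have [iN|Ni] := ltnP i N.+1.
    by rewrite -[ i ]/(nat_of_ord (Ordinal iN)) inj_mxE mxE mul0r subr0.
  by rewrite inj_mx_out // mul1r subrr.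
have injZ a (v : 'cV[R[i]]_N.+1) : inj_mx (a *: v) = a *: inj_mx v :> H.
  have := inj_mx_lin a v (0 : 'cV_N.+1); rewrite addr0 => ->.
  have -> : inj_mx (0 : 'cV[R[i]]_N.+1) = 0; last by rewrite addr0.
  by apply: ell2_ext => i; rewrite /coef /= /inj_seq; case: insub => // o; rewrite mxE.
have injD (v w : 'cV[R[i]]_N.+1) : inj_mx (v + w) = inj_mx v + inj_mx w :> H.
  by have := inj_mx_lin 1 v w; rewrite !scale1r.
have Pinj (v : 'cV[R[i]]_N.+1) : P (inj_mx v) = 0.
  apply: ell2_ext => i; rewrite PE /W /=; have [iN|Ni] := ltnP i N.+1.
    by rewrite mul0r.
  by rewrite inj_mx_out // mulr0.
have resT2 x : res_mx N (T2 x) = 0 by rewrite -PT resP.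
have resL a x y : res_mx N (y - a *: x) = res_mx N y - a *: res_mx N x.
  by apply/colP => o; rewrite !mxE.
have resD x y : res_mx N (x + y) = res_mx N x + res_mx N y.
  by apply/colP => o; rewrite !mxE.
set B := head_mx N - z0%:M in BT TB BE BdE NE' *.
have hB (v : 'cV[R[i]]_N.+1) : head_mx N *m v = z0 *: v + B *m v.
  by rewrite /B mulmxBl mul_scalar_mx addrCA subrr addr0.
have hB2 (v : 'cV[R[i]]_N.+1) : head_mx N *m v - z0 *: v = B *m v.
  by rewrite hB addrC addKr.
have Ttot : exists T3 : {linear H -> H}, forall x, T3 x = T2 x + T x.
  by apply: lin_ex => u x y; rewrite !linearP addrACA scalerDr.
have [T3 T3E] := Ttot.
have BE' : B *m E0 = E0 *m B by exact: BE.
have EE'' : E0 *m E0 = E0 by exact: EE.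
have TE'' : T0 *m E0 = 0 by exact: TE.
have BT' : B *m T0 = 1%:M - E0 by exact: BT.
have TB' : T0 *m B = 1%:M - E0 by exact: TB.
have itN s x : iter s N0 (E x) = inj_mx (B ^+ s *m E0 *m res_mx N x).
  elim: s => [|s IH]; first by rewrite expr0 mul1mx EE'.
  have BsE : E0 *m B ^+ s = B ^+ s *m E0 by exact: (commrX s (esym BE)).
  have bs : B ^+ s.+1 = B *m B ^+ s by rewrite exprS.
  rewrite iterS IH NE' res_inj bs; congr inj_mx.
  by rewrite -!mulmxA (mulmxA E0 (B ^+ s)) BsE -!mulmxA (mulmxA E0 E0) EE''.
have it0 s x : (d <= s)%N -> iter s N0 (E x) = 0.
  have BdE' : B ^+ d *m E0 = 0 by exact: BdE.
  have bs : B ^+ (s - d + d) = B ^+ (s - d) *m B ^+ d by rewrite exprD.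
  move=> ds; rewrite itN -(subnK ds) bs -(mulmxA _ (B ^+ d)) BdE' mulmx0 mul0mx.
  by rewrite -(scale0r (0 : 'cV_N.+1)) injZ scale0r.
exists E, T3, N0, N; split.
- split.
  + move=> x; rewrite T3E; have := SgraphD (T21 x) (inj_Sgraph satN (T0 *m res_mx N x)).
    rewrite -TE'; congr Sgraph; rewrite hB mulmxA BT' mulmxBl mul1mx !injD injZ -TE'.
    rewrite -[- (E0 *m _)]scaleN1r injZ scaleN1r -EE' injres scalerDr.
    by apply: ell2_ext => i; rewrite !lcoefE; ring.
  + move=> x y Sxy; rewrite T3E (T22 _ _ Sxy) TE' resL (res_Sgraph satN Sxy) hB2.
    rewrite mulmxA TB' mulmxBl mul1mx injD injres.
    rewrite -[- (E0 *m _)]scaleN1r injZ scaleN1r -EE'.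
    by rewrite [x - P x - E x]addrAC addrCA subrr addr0.
  + move=> x; have := inj_Sgraph satN (E0 *m res_mx N x).
    by rewrite hB injD injZ mulmxA -EE' -NE'.
  + move=> x y Sxy; rewrite EE' NE' resL (res_Sgraph satN Sxy) hB2.
    by rewrite mulmxA BE'.
  + split=> x.
    * by rewrite !EE' res_inj mulmxA EE''.
    * rewrite T3E TE' EE' res_inj mulmxA TE'' mul0mx -TP Pinj linear0 add0r.
      by rewrite -(scale0r (0 : 'cV_N.+1)) injZ scale0r.
    * by rewrite !NE' EE' res_inj -!mulmxA (mulmxA E0 E0) EE''.
    * by rewrite EE' !NE' res_inj !mulmxA -BE' -(mulmxA B) EE''.
- by exists CE.
- exists ((2 * del - del)^-1 + CT); first by rewrite addr_ge0 // invr_ge0; have := del_gt0; lra.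
  move=> x; rewrite T3E; apply: le_trans (nrmD _ _) _; rewrite mulrDl lerD //.
- move=> rho rho0.
  have hh : 0 <= CN / rho := divr_ge0 CN0 (ltW rho0).
  have CNr : 0 <= CN / rho + 1 by rewrite addr_ge0 // divr_ge0 // ltW.
  (* Powers of order s >= d vanish; for s < d, (CN / rho)^s is at most (CN / rho + 1)^d. *)
  exists (CE * (CN / rho + 1) ^+ d); first by rewrite mulr_ge0 // exprn_ge0.
  move=> s x; have [ds|sd] := leqP d s.
    rewrite it0 // nrm0.
    exact: mulr_ge0 (mulr_ge0 (mulr_ge0 CE0 (exprn_ge0 d CNr)) (exprn_ge0 s (ltW rho0))) (nrm_ge0 x).
  have hs : nrm (iter s N0 (E x)) <= CE * CN ^+ s * nrm x.
    elim: s {sd} => [|s IH]; first by rewrite mulr1 hCE.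
    rewrite iterS; apply: le_trans (hCN _) _; apply: le_trans (ler_wpM2l CN0 IH) _.
    by rewrite le_eqVlt; apply/orP; left; apply/eqP; rewrite exprS; ring.
  apply: le_trans hs _; apply: ler_wpM2r; first exact: nrm_ge0.
  rewrite -mulrA ler_wpM2l //.
  have -> : CN ^+ s = (CN / rho) ^+ s * rho ^+ s by rewrite -exprMn divfK ?gt_eqF.
  rewrite ler_wpM2r ?exprn_ge0 ?(ltW rho0)//.
  apply: (@le_trans _ _ ((CN / rho + 1) ^+ s)).
    by apply: lerXn2r; rewrite ?nnegrE // lerDl.
  by rewrite ler_weXn2l // ?(ltnW sd)// lerDr.
- by split=> [x i Ni|x]; [rewrite EE' inj_mx_out|exists d; exact: it0].
Qed.

(** Fredholm alternative: if E is not 0, the last nonzero iterate of the nilpotent [N0] on its range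
    is an eigenvector; if E = 0, T provides the resolvent. *)
Lemma Sresolvent_or_eigenvalue z : eigenvalue_S z \/ exists Rz, is_Sresolvent z Rz.
Proof.
have [E [T [N0 [N [dat _ [C _ hC] pb [_ nilp]]]]]] := data_exists z.
case: (pselect (eigenvalue_S z)) => [?|ne]; [by left|right].
apply: (Sresolvent_of_data dat); first by exists C.
have [T1 T2 E1 E2 [EE TE NE EN]] := dat.
move=> x; apply: contrapT => Ex.
have EI s : E (iter s N0 (E x)) = iter s N0 (E x) by case: s => //= s; rewrite EN.
have nz s : iter s N0 (E x) <> 0.
  elim: s => // s IH h; apply: ne; exists (iter s N0 (E x)) => //.
  have := E1 (iter s N0 (E x)); rewrite EI.
  by rewrite -[N0 (iter _ _ _)]/(iter s.+1 N0 (E x)) h addr0.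
have [d hd] := nilp x.
exact: nz d hd.
Qed.

(** E is the coordinate projection P and N0 = -D P, of growth at most [del] but in general not
    nilpotent: the data describe all eigenvalues of the block at once. Outside the block the inverse
    has norm at most 1/(4 del - del). *)
Lemma block_data (W : pred nat) (P : {linear H -> H}) (c : R) : saturated W ->
  (forall x i, P x i = (W i)%:R * x i) -> (forall x, nrm (P x) <= nrm x) ->
  (forall i, W i -> lam i = c) -> (forall i, ~~ W i -> 4 * del <= `|lam i - c|) ->
  exists T N0 : {linear H -> H},
    [/\ spectral_data c%:C P T N0, power_bound P N0 del &
        forall x, nrm (T x) <= (3 * del)^-1 * nrm x].
Proof.
move=> sW PE Pn lamW lamNW; have d0 := del_gt0.
pose W' := [pred i | ~~ W i].
have sW' : saturated W' by move=> i j ij; rewrite /W' /= (sW _ _ ij).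
have [P' [PE' Pn']] := prj_op W'.
have [|i /lamNW h|T [PT TP T1 T2 Tn]] := @partial_inverse W' P' c%:C (4 * del) sW' PE'.
- lra.
- by rewrite -rmorphB cabsR.
have P'E x : P' x = x - P x.
  by apply: ell2_ext => i; rewrite !lcoefE PE PE' /=; case: (W i); rewrite ?mul1r ?mul0r ?subrr ?subr0.
have [|N0 NE] := @lin_ex _ (fun x => - D (P x)); first by move=> u x y; rewrite !linearP.
have PP x : P (P x) = P x.
  by apply: ell2_ext => i; rewrite !PE; case: (W i); rewrite ?mul1r ?mul0r.
have DP := D_commute sW PE.
exists T, N0; split; first split.
- by move=> x; have := T1 x; rewrite P'E addrA.
- by move=> x y /T2; rewrite P'E.
- move=> x; apply/SgraphP => i; rewrite NE !lcoefE; congr (_ - _).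
  by rewrite PE; case Wi: (W i); [rewrite (lamW _ Wi)|rewrite mul0r !mulr0].
- move=> x y /SgraphP h; rewrite NE DP; apply: ell2_ext => i; rewrite !(PE, lcoefE) h.
  by case Wi: (W i); rewrite ?mul0r ?oppr0 // !mul1r (lamW _ Wi); ring.
- split=> [//|x|x|x].
  + rewrite -TP P'E PP subrr linear0 //.
  + by rewrite !NE PP.
  + by rewrite NE linearN /= -DP PP.
- exists 1 => // s x; rewrite mul1r; elim: s => [|s IH]; first by rewrite mul1r Pn.
  rewrite iterS NE nrmN; apply: le_trans (D_nrm _) _; rewrite exprS -mulrA ler_wpM2l ?(ltW d0)//.
  exact: le_trans (Pn _) IH.
- move=> x; apply: le_trans (Tn x) _; rewrite (_ : 4 * del - del = 3 * del) //; ring.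
Qed.

(** For a union W of blocks these are the eigenvalues of the part of [lam - D] in W, expressed
    without introducing an operator on a subspace. *)
Definition eig_on (W : pred nat) z := exists x : H,
  [/\ x <> 0, forall i, ~~ W i -> x i = 0 & Sgraph x (z *: x)].

Lemma eig_on_eigenvalue W z : eig_on W z -> eigenvalue_S z.
Proof. by move=> [x [x0 _ Sx]]; exists x. Qed.

Lemma eigenvalue_eig_on z : eigenvalue_S z -> exists i, eig_on (sim i) z.
Proof.
move=> [x x0 Sx].
have [i xi] : exists i, x i != 0.
  apply: contrapT => h; apply: x0; apply: ell2_ext => i; apply: contrapT => /eqP xi.
  by apply: h; exists i.
have sS : saturated (sim i).
  move=> j l jl; apply/idP/idP => h; first exact: sim_trans h jl.
  by rewrite sim_sym in jl; exact: sim_trans h jl.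
have [P [PE _]] := prj_op (sim i).
exists i, (P x); split.
- by move=> /(congr1 (fun h : H => coef h i)); rewrite PE sim_refl mul1r => /eqP; rewrite (negbTE xi).
- by move=> j /negbTE ij; rewrite PE ij mul0r.
- by have := Sgraph_prj sS PE Sx; rewrite linearZ.
Qed.

(** In coordinates D x = (lam - z) x; if all factors on the support exceeded [del] in modulus, the
    norm of D x would exceed del |x|. *)
Lemma eig_on_near W z : eig_on W z -> exists2 i, W i & cabs (z - (lam i)%:C) <= del.
Proof.
move=> [x [x0 xW /SgraphP Sx]]; apply: contrapT => h; have d0 := del_gt0.
have far i : W i -> del < cabs (z - (lam i)%:C).
  by move=> Wi; rewrite ltNge; apply/negP => hi; apply: h; exists i.
have [i xi] : exists i, x i != 0.
  apply: contrapT => h'; apply: x0; apply: ell2_ext => i; apply: contrapT => /eqP xi.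
  by apply: h'; exists i.
have DxE j : cabs (D x j) = cabs (z - (lam j)%:C) * cabs (x j).
  by rewrite -cabsM -cabsN; congr cabs; have := Sx j; rewrite lcoefZ mulrBl => ->; ring.
have ge j : del ^+ 2 * cabs (x j) ^+ 2 <= cabs (D x j) ^+ 2.
  rewrite DxE -exprMn; case Wj : (W j); last by rewrite xW ?Wj // cabs0 !mulr0.
  have := far _ Wj => /ltW h1; rewrite ler_pXn2r ?nnegrE ?mulr_ge0 ?cabs_ge0 ?(ltW d0)//.
  by rewrite ler_wpM2r ?cabs_ge0.
have Wi : W i by apply: contraNT xi => /xW ->.
(* The strict inequality at one coordinate has to survive the passage to infinite sums, hence this
   fixed surplus. *)
pose eta := cabs (D x i) ^+ 2 - del ^+ 2 * cabs (x i) ^+ 2.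
have eta0 : 0 < eta.
  have xi0 : 0 < cabs (x i) by rewrite cabs_gt0.
  rewrite subr_gt0 DxE -exprMn ltr_pXn2r ?nnegrE ?mulr_ge0 ?cabs_ge0 ?(ltW d0)//.
  by rewrite ltr_pM2r // far.
have key n : \sum_(j < n) cabs (x j) ^+ 2 <= nrm x ^+ 2 - eta / del ^+ 2.
  apply: (@le_trans _ _ (\sum_(j < maxn n i.+1) cabs (x j) ^+ 2)).
    by apply: (@psum_le _ (fun j => cabs (x j) ^+ 2)) => [j|]; [exact: sqr_ge0|exact: leq_maxl].
  have li : (i < maxn n i.+1)%N by rewrite leq_maxr.
  have -> : nrm x ^+ 2 - eta / del ^+ 2 = (del ^+ 2 * nrm x ^+ 2 - eta) / del ^+ 2 by field; rewrite gt_eqF.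
  rewrite ler_pdivlMr ?exprn_gt0 // mulrC lerBrDr.
  apply: (@le_trans _ _ (nrm (D x) ^+ 2)); last first.
    rewrite -exprMn ler_pXn2r ?nnegrE ?mulr_ge0 ?nrm_ge0 ?(ltW d0)//.
  apply: le_trans (psum_nrm (D x) (maxn n i.+1)).
  rewrite (bigD1 (Ordinal li)) //= [leRHS](bigD1 (Ordinal li)) //= mulrDr /eta.
  rewrite addrAC addrCA subrr addr0 lerD2l mulr_sumr; apply: ler_sum => j _; exact: ge.
have := rsum_le (fun j => sqr_ge0 (cabs (x j))) key.
rewrite -nrm_sqr lerBrDr gerDl leNgt divr_gt0 // exprn_gt0 //.
Qed.

Lemma head_eigenvalues N : (forall i j, sim i j -> (i <= N)%N = (j <= N)%N) ->
  exists r : seq R[i], size r = N.+1 /\ forall z, eig_on [pred i | (i <= N)%N] z -> z \in r.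
Proof.
(* [eigenvalue] refers to row vectors, hence the transpose. *)
move=> satN; pose A := (head_mx N)^T.
have [r hr] := closed_field_poly_normal (char_poly A).
rewrite (monicP (char_poly_monic A)) scale1r in hr.
exists r; split.
  by have := size_char_poly A; rewrite hr size_prod_XsubC => -[].
move=> z [x [x0 xN Sx]]; rewrite -root_prod_XsubC -hr -eigenvalue_root_char.
apply/eigenvalueP; exists (res_mx N x)^T.
  rewrite -trmx_mul -(res_Sgraph satN Sx); apply/rowP => i; rewrite !mxE //.
apply/negP => /eqP /rowP h; apply: x0; apply: ell2_ext => i.
have [iN|Ni] := leqP i N; last by rewrite xN //= -ltnNge.
by have := h (Ordinal (iN : (i < N.+1)%N)); rewrite !mxE.
Qed.

Lemma D_pair (x : H) j i : (forall l, l != j -> l != j.+1 -> x l = 0) ->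
  D x i = Dm i j * x j + Dm i j.+1 * x j.+1.
Proof.
move=> xj; rewrite DE (@csum_fin _ _ j.+2) => [|l jl]; last first.
  by rewrite xj ?mulr0 // gtn_eqF //; exact: ltn_trans jl.
rewrite !big_ord_recr /= big1 ?add0r// => l _.
by rewrite xj ?mulr0 // ltn_eqF // ltnS ltnW.
Qed.

(** The block is a 2 by 2 matrix and the condition is the vanishing of a determinant; a kernel
    vector is written down according to which entries are 0. *)
Lemma eig_pair (W : pred nat) j (c : R) z : (forall i, W i = (i == j) || (i == j.+1)) ->
  saturated W -> lam j = c -> lam j.+1 = c ->
  eig_on W z <-> (z - c%:C + Dm j j) * (z - c%:C + Dm j.+1 j.+1) = Dm j j.+1 * Dm j.+1 j.
Proof.
move=> WE sW lj lj1.
set p := z - c%:C + Dm j j; set s := z - c%:C + Dm j.+1 j.+1.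
set q := Dm j j.+1; set r := Dm j.+1 j.
have jj1 : (j.+1 == j) = false by rewrite gtn_eqF.
have xWE (x : H) : (forall i, ~~ W i -> x i = 0) -> forall l, l != j -> l != j.+1 -> x l = 0.
  by move=> xW l lj' lj1'; apply: xW; rewrite WE negb_or lj'.
have SE (x : H) : (forall i, ~~ W i -> x i = 0) ->
    (Sgraph x (z *: x) <-> p * x j + q * x j.+1 = 0 /\ r * x j + s * x j.+1 = 0).
  move=> xW; have Dx i := D_pair i (xWE x xW).
  split=> [/SgraphP h|[h1 h2]].
    have := h j; have := h j.+1; rewrite !lcoefZ !Dx lj lj1 => h2 h1.
    split; apply/eqP; rewrite -subr_eq0.
      by rewrite -(subrr (z * x j)) {2}h1 /p /q; apply/eqP; ring.
    by rewrite -(subrr (z * x j.+1)) {2}h2 /s /r; apply/eqP; ring.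
  apply/SgraphP => i; rewrite lcoefZ; case Wi: (W i); last first.
    rewrite xW ?Wi // (@D_local _ 0) ?linear0 ?lcoef0 ?mulr0 ?subr0 ?addr0 // => l il.
    by rewrite xW // -(sW _ _ il) Wi.
  move: Wi; rewrite WE => /orP[] /eqP ->; rewrite Dx ?lj ?lj1.
    apply/eqP; rewrite -subr_eq0; apply/eqP; rewrite -[RHS]h1 /p /q; ring.
  apply/eqP; rewrite -subr_eq0; apply/eqP; rewrite -[RHS]h2 /s /r; ring.
split=> [[x [x0 xW /(SE x xW)[h1 h2]]]|det].
  have e1 : (p * s - q * r) * x j = 0.
    have -> : (p * s - q * r) * x j = s * (p * x j + q * x j.+1) - q * (r * x j + s * x j.+1) by ring.
    by rewrite h1 h2 !mulr0 subr0.
  have e2 : (p * s - q * r) * x j.+1 = 0.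
    have -> : (p * s - q * r) * x j.+1 = p * (r * x j + s * x j.+1) - r * (p * x j + q * x j.+1) by ring.
    by rewrite h1 h2 !mulr0 subr0.
  apply/eqP; rewrite -subr_eq0; apply/eqP.
  have [//|n0] := eqVneq (p * s - q * r) 0.
  exfalso; apply: x0; apply: ell2_ext => i.
  move/eqP: e1; rewrite mulf_eq0 (negbTE n0) /= => /eqP e1.
  move/eqP: e2; rewrite mulf_eq0 (negbTE n0) /= => /eqP e2.
  by case Wi: (W i); [move: Wi; rewrite WE => /orP[] /eqP ->|rewrite xW ?Wi].
have mk (a b : R[i]) : (a != 0) || (b != 0) -> p * a + q * b = 0 -> r * a + s * b = 0 -> eig_on W z.
  move=> ab h1 h2.
  pose f i := if i == j then a else if i == j.+1 then b else 0.
  have fl : is_ell2 f.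
    exists (\sum_(i < j.+2) cabs (f i) ^+ 2) => n.
    have [nN|/ltnW Nn] := leqP n j.+2.
      by apply: (@psum_le _ (fun i => cabs (f i) ^+ 2)) => // i; exact: sqr_ge0.
    rewrite -!(big_mkord xpredT (fun i => cabs (f i) ^+ 2)) [leLHS](big_cat_nat (leq0n j.+2) Nn)/=.
    rewrite [X in _ + X](_ : _ = 0) ?addr0//.
    rewrite big_nat_cond big1// => i /andP[/andP[Ni _] _].
    by rewrite /f !gtn_eqF ?cabs0 ?expr0n//; exact: ltn_trans Ni.
  pose x : H := Ell2 fl.
  have xj : x j = a by rewrite /coef /= /f eqxx.
  have xj1 : x j.+1 = b by rewrite /coef /= /f jj1 eqxx.
  have xW i : ~~ W i -> x i = 0.
    by rewrite WE negb_or /coef /= /f => /andP[/negbTE -> /negbTE ->].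
  exists x; split=> //; last by apply/(SE x xW); rewrite xj xj1.
  move=> x0; move: ab; rewrite -xj -xj1 x0 !lcoef0 eqxx //.
have [q0|qn] := eqVneq q 0; last first.
  apply: (mk (- q) p); first by rewrite oppr_eq0 qn.
    by ring.
  by rewrite mulrN mulrC -det; ring.
have [p0|pn] := eqVneq p 0; last first.
  have s0 : s = 0.
    by move: det; rewrite q0 mul0r => /eqP; rewrite mulf_eq0 (negbTE pn) => /eqP.
  by apply: (mk 0 1); rewrite ?oner_eq0 ?orbT// ?q0 ?s0 !mulr0 ?mul0r addr0.
have [s0|sn] := eqVneq s 0.
  have [r0|rn] := eqVneq r 0.
    by apply: (mk 1 0); rewrite ?oner_eq0 // ?p0 ?r0 !mul0r mulr0 addr0.
  by apply: (mk 0 1); rewrite ?oner_eq0 ?orbT// ?q0 ?s0 !mulr0 ?mul0r addr0.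
apply: (mk (- s) r); first by rewrite oppr_eq0 sn.
  by rewrite p0 q0 !mul0r addr0.
by rewrite mulrN [s * r]mulrC addNr.
Qed.

Lemma eig_single (W : pred nat) j z : (forall i, W i = (i == j)) -> saturated W ->
  eig_on W z <-> z = (lam j)%:C - Dm j j.
Proof.
move=> WE sW.
have Dx (x : H) i : (forall i, ~~ W i -> x i = 0) -> D x i = Dm i j * x j.
  by move=> xW; rewrite DE (@csum1 _ _ j) // => l lj; rewrite xW ?mulr0 // WE.
split=> [[x [x0 xW /SgraphP h]]|zE].
  have xj : x j != 0.
    apply/eqP => xj; apply: x0; apply: ell2_ext => i.
    by case Wi: (W i); [move: Wi; rewrite WE => /eqP ->|rewrite xW ?Wi].
  apply: (mulIf xj); have := h j; rewrite lcoefZ Dx // => ->; ring.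
pose f i : R[i] := (i == j)%:R.
have fl : is_ell2 f.
  exists 1 => n; have [nj|jn] := leqP n j.
    by rewrite big1 // => i _; rewrite /f ltn_eqF ?cabs0 ?expr0n //; exact: leq_trans (ltn_ord i) nj.
  rewrite (bigD1 (Ordinal jn)) //= big1 => [|i /negbTE ij].
    by rewrite /f eqxx cabs1 expr1n addr0.
  by rewrite /f; case: eqP => [e|]; rewrite ?cabs0 ?expr0n//; move/eqP: ij => []; exact: val_inj.
pose x : H := Ell2 fl.
have xj : x j = 1 by rewrite /coef /= /f eqxx.
have xW i : ~~ W i -> x i = 0 by rewrite WE /coef /= /f => /negbTE ->.
exists x; split=> //.
  by move=> /(congr1 (fun h : H => coef h j)); rewrite xj lcoef0 => /eqP; rewrite oner_eq0.
apply/SgraphP => i; rewrite lcoefZ; case Wi: (W i).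
  by rewrite Dx //; move: Wi; rewrite WE => /eqP ->; rewrite zE xj; ring.
rewrite xW ?Wi // (@D_local _ 0) ?linear0 ?lcoef0 ?mulr0 ?subr0 ?addr0 // => l il.
by rewrite xW // -(sW _ _ il) Wi.
Qed.

(** The eigenvalue equation is read at the coordinate of largest modulus: at most two error terms
    remain, each at most e times that coordinate. Blocks of one and of two indices are covered
    together. *)
Lemma eig_on_close (W : pred nat) j (c e : R) (qb z : R[i]) :
  (forall i, W i -> (i == j) || (i == j.+1)) ->
  (forall i, W i -> lam i = c) -> 0 <= e ->
  (forall i l, W i -> W l -> cabs (Dm i l - (i == l)%:R * qb) <= e) ->
  eig_on W z -> cabs (z - (c%:C - qb)) <= 2 * e.
Proof.
move=> WE lamW e0 hD [x [x0 xW /SgraphP h]].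
have xj l : l != j -> l != j.+1 -> x l = 0.
  by move=> lj lj1; apply: xW; apply/negP => /WE; rewrite (negbTE lj) (negbTE lj1).
pose i := if cabs (x j) <= cabs (x j.+1) then j.+1 else j.
have imax l : cabs (x l) <= cabs (x i).
  have [->|lj] := eqVneq l j; first by rewrite /i; case: ifP.
  have [->|lj1] := eqVneq l j.+1; last by rewrite xj // cabs0 cabs_ge0.
  by rewrite /i; case: ifP => // /negbT; rewrite -ltNge => /ltW.
have xi : x i != 0.
  apply/eqP => xi; apply: x0; apply: ell2_ext => l; apply/eqP.
  by have := imax l; rewrite xi cabs0 le_eqVlt ltNge cabs_ge0 orbF cabs_eq0.
have Wi : W i by apply: contraNT xi => /xW ->.
have term l : cabs ((Dm i l - (i == l)%:R * qb) * x l) <= e * cabs (x i).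
  case Wl: (W l); last by rewrite xW ?Wl // mulr0 cabs0 mulr_ge0 ?cabs_ge0.
  by rewrite cabsM ler_pM ?cabs_ge0 ?hD.
have ij : (i == j) || (i == j.+1) by rewrite /i; case: ifP; rewrite eqxx ?orbT.
have E : (z - (c%:C - qb)) * x i =
    - ((Dm i j - (i == j)%:R * qb) * x j + (Dm i j.+1 - (i == j.+1)%:R * qb) * x j.+1).
  have := h i; rewrite lcoefZ (D_pair _ xj) (lamW _ Wi) => hi.
  have qi : qb * x i = (i == j)%:R * qb * x j + (i == j.+1)%:R * qb * x j.+1.
    have [ji|/eqP ji] := eqVneq i j.
      by rewrite -ji (_ : (i == i.+1) = false) ?ltn_eqF // mul1r !mul0r addr0.
    by move: ij; rewrite (negbTE (introN eqP ji)) /= => /eqP <-; rewrite eqxx !mul0r add0r mul1r.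
  rewrite mulrBl hi mulrBl qi; ring.
have xi0 : 0 < cabs (x i) by rewrite cabs_gt0.
rewrite -(ler_pM2r xi0) -cabsM E cabsN; apply: le_trans (cabsD _ _) _.
have := term j; have := term j.+1; lra.
Qed.

End BlockOperator.

(** * Complex integrals and circle means *)

Section ComplexIntegral.
Context {R : realType}.
Notation mu := (@lebesgue_measure R).
Implicit Types (D : set R) (f g : R -> R[i]) (z : R[i]).

Definition cmf D f := measurable_fun D (fun t => complex.Re (f t)) /\
  measurable_fun D (fun t => complex.Im (f t)).

Definition cintble D f := mu.-integrable D (EFin \o (fun t => complex.Re (f t))) /\
  mu.-integrable D (EFin \o (fun t => complex.Im (f t))).

Lemma cintble_cmf D f : cintble D f -> cmf D f.
Proof. by move=> [/measurable_int/measurable_EFinP ? /measurable_int/measurable_EFinP ?]. Qed.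

Lemma cmf_cst D z : cmf D (fun=> z).
Proof. by split; exact: measurable_cst. Qed.

Lemma cmfD D f g : cmf D f -> cmf D g -> cmf D (fun t => f t + g t).
Proof.
move=> [fr fi] [gr gi]; split.
  rewrite (_ : (fun t => _) = (fun t => complex.Re (f t) + complex.Re (g t))).
    exact: measurable_funD.
  by apply/funext => t; case: (f t) => ? ?; case: (g t).
rewrite (_ : (fun t => _) = (fun t => complex.Im (f t) + complex.Im (g t))).
  exact: measurable_funD.
by apply/funext => t; case: (f t) => ? ?; case: (g t).
Qed.

Lemma cmfM D f g : cmf D f -> cmf D g -> cmf D (fun t => f t * g t).
Proof.
move=> [fr fi] [gr gi]; split.
  rewrite (_ : (fun t => _) = (fun t => complex.Re (f t) * complex.Re (g t)
      - complex.Im (f t) * complex.Im (g t))).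
    by apply: measurable_funB; exact: measurable_funM.
  by apply/funext => t; case: (f t) => ? ?; case: (g t).
rewrite (_ : (fun t => _) = (fun t => complex.Re (f t) * complex.Im (g t)
    + complex.Im (f t) * complex.Re (g t))).
  by apply: measurable_funD; exact: measurable_funM.
by apply/funext => t; case: (f t) => ? ?; case: (g t).
Qed.

Lemma cmfZ D z f : cmf D f -> cmf D (fun t => z * f t).
Proof. by apply: cmfM; exact: cmf_cst. Qed.

Lemma cmfN D f : cmf D f -> cmf D (fun t => - f t).
Proof. by move=> /(cmfZ (-1)); under eq_fun do rewrite mulN1r. Qed.

Lemma cmfB D f g : cmf D f -> cmf D g -> cmf D (fun t => f t - g t).
Proof. by move=> hf /cmfN; exact: cmfD. Qed.

Lemma cmfJ D f : cmf D f -> cmf D (fun t => (f t)^*).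
Proof.
move=> [fr fi]; split.
  by rewrite (_ : (fun t => _) = (fun t => complex.Re (f t))) //; apply/funext => t; case: (f t).
rewrite (_ : (fun t => _) = (fun t => - complex.Im (f t))); last by apply/funext => t; case: (f t).
exact: measurableT_comp.
Qed.

Lemma cmf_real D (g : R -> R) : measurable_fun D g -> cmf D (fun t => (g t)%:C).
Proof. by move=> mg; split=> //=; exact: measurable_cst. Qed.

Lemma cmf_cabs2 D f : cmf D f -> measurable_fun D (fun t => cabs (f t) ^+ 2).
Proof.
move=> [fr fi]; under eq_fun do rewrite cabs_sqr.
by apply: measurable_funD; exact: measurable_funX.
Qed.

Lemma cmf_cabs D f : cmf D f -> measurable_fun D (fun t => cabs (f t)).
Proof.
move=> /cmf_cabs2 h.
rewrite (_ : (fun t => _) = (@Num.sqrt R) \o (fun t => cabs (f t) ^+ 2)); last first.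
  by apply/funext => t /=; rewrite sqrtr_sqr ger0_norm ?cabs_ge0.
by apply: measurableT_comp h; apply: continuous_measurable_fun; exact: sqrt_continuous.
Qed.

Lemma ctends_Re (u : nat -> R[i]) l : ctends u l ->
  complex.Re (u n) @[n --> \oo] --> complex.Re l.
Proof.
move=> h; apply/cvgrPdist_le => e e0.
have /ctendsP/(_ _ e0)[N hN] := h.
exists N => // n Nn; have := ltW (hN n Nn); apply: le_trans; rewrite distrC.
by have := Re_le_cabs (u n - l); case: (u n) => ? ?; case: l {h hN}.
Qed.

Lemma ctends_Im (u : nat -> R[i]) l : ctends u l ->
  complex.Im (u n) @[n --> \oo] --> complex.Im l.
Proof.
move=> h; apply/cvgrPdist_le => e e0.
have /ctendsP/(_ _ e0)[N hN] := h.
exists N => // n Nn; have := ltW (hN n Nn); apply: le_trans; rewrite distrC.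
by have := Im_le_cabs (u n - l); case: (u n) => ? ?; case: l {h hN}.
Qed.

Lemma cmf_lim D (F : nat -> R -> R[i]) f : measurable D -> (forall n, cmf D (F n)) ->
  (forall t, D t -> ctends (F^~ t) (f t)) -> cmf D f.
Proof.
move=> mD mF Ff; split.
  apply: (@measurable_fun_cvg _ _ _ D (fun n t => complex.Re (F n t))) => //.
    by move=> n; case: (mF n).
  by move=> t Dt; exact: ctends_Re (Ff t Dt).
apply: (@measurable_fun_cvg _ _ _ D (fun n t => complex.Im (F n t))) => //.
  by move=> n; case: (mF n).
by move=> t Dt; exact: ctends_Im (Ff t Dt).
Qed.

Lemma cintble_le D f (g : R -> R) : measurable D -> cmf D f ->
  mu.-integrable D (EFin \o g) -> (forall t, D t -> cabs (f t) <= g t) -> cintble D f.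
Proof.
move=> mD [fr fi] ig fg.
have le (h : R[i] -> R) : (forall z, `|h z| <= cabs z) ->
    measurable_fun D (fun t => h (f t)) -> mu.-integrable D (EFin \o (fun t => h (f t))).
  move=> hz mh; apply: le_integrable ig => //; first exact/measurable_EFinP.
  move=> t Dt /=; rewrite lee_fin; apply: le_trans (hz _) _.
  exact: le_trans (fg t Dt) (ler_norm _).
by split; [apply: (le (@complex.Re R)) => // z; exact: Re_le_cabs
          |apply: (le (@complex.Im R)) => // z; exact: Im_le_cabs].
Qed.

Lemma integrable_cabs D f : measurable D -> cintble D f ->
  mu.-integrable D (EFin \o (fun t => cabs (f t))).
Proof.
move=> mD hf; have [mr mi] := hf.
have h : mu.-integrable D (EFin \o (fun t => `|complex.Re (f t)| + `|complex.Im (f t)|)).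
  rewrite (_ : _ \o _ = ((fun t => (`|complex.Re (f t)|)%:E) \+ (fun t => (`|complex.Im (f t)|)%:E))%E) //.
  by apply: integrableD => //; exact: integrable_norm.
apply: le_integrable h => //.
  by apply/measurable_EFinP; apply: cmf_cabs; exact: cintble_cmf.
move=> t Dt /=; rewrite lee_fin ger0_norm ?cabs_ge0//.
by rewrite ger0_norm ?addr_ge0// cabs_le_ReIm.
Qed.

Lemma integrable_cst_fin D (M : R) : measurable D -> (mu D < +oo)%E ->
  mu.-integrable D (EFin \o (fun=> M)).
Proof.
move=> mD fD; apply: measurable_bounded_integrable => //.
exists `|M|; split; first by rewrite num_real.
by move=> x hx t Dt; exact: ltW.
Qed.

Lemma cintble_bounded D f M : measurable D -> (mu D < +oo)%E -> cmf D f ->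
  (forall t, D t -> cabs (f t) <= M) -> cintble D f.
Proof. by move=> mD fD mf; apply: cintble_le => //; exact: integrable_cst_fin. Qed.

Lemma eq_cintegral D f g : (forall t, D t -> f t = g t) -> cintegral D f = cintegral D g.
Proof.
move=> fg; rewrite /cintegral.
by congr (_ +i* _); apply: eq_Rintegral => t /set_mem Dt; rewrite fg.
Qed.

Lemma cintbleD D f g : measurable D -> cintble D f -> cintble D g -> cintble D (fun t => f t + g t).
Proof.
move=> mD hf hg; have := integrable_cabs mD hf; have := integrable_cabs mD hg => ig jf.
apply: (@cintble_le _ _ (fun t => cabs (f t) + cabs (g t))) => //.
- by apply: cmfD; exact: cintble_cmf.
- rewrite (_ : _ \o _ = ((fun t => (cabs (f t))%:E) \+ (fun t => (cabs (g t))%:E))%E) //.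
  exact: integrableD.
- by move=> t _; exact: cabsD.
Qed.

Lemma cintbleZ D z f : measurable D -> cintble D f -> cintble D (fun t => z * f t).
Proof.
move=> mD hf; apply: (@cintble_le _ _ (fun t => cabs z * cabs (f t))) => //.
- by apply: cmfZ; exact: cintble_cmf.
- rewrite (_ : _ \o _ = (fun t => (cabs z)%:E * (cabs (f t))%:E)%E) //.
  by apply: integrableZl => //; exact: integrable_cabs.
- by move=> t _; rewrite cabsM.
Qed.

Lemma cintbleN D f : measurable D -> cintble D f -> cintble D (fun t => - f t).
Proof. by move=> mD /(cintbleZ (-1) mD); under eq_fun do rewrite mulN1r. Qed.

Lemma cintbleB D f g : measurable D -> cintble D f -> cintble D g -> cintble D (fun t => f t - g t).
Proof. by move=> mD hf /(cintbleN mD); exact: cintbleD. Qed.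

Lemma cintegralD D f g : measurable D -> cintble D f -> cintble D g ->
  cintegral D (fun t => f t + g t) = cintegral D f + cintegral D g.
Proof.
move=> mD [fr fi] [gr gi]; apply/eqP; rewrite eq_complex /=; apply/andP; split; apply/eqP.
  by rewrite -RintegralD //; apply: eq_Rintegral => t _; case: (f t) => ? ?; case: (g t).
by rewrite -RintegralD //; apply: eq_Rintegral => t _; case: (f t) => ? ?; case: (g t).
Qed.

Lemma cintegralZ D z f : measurable D -> cintble D f ->
  cintegral D (fun t => z * f t) = z * cintegral D f.
Proof.
move=> mD [fr fi]; case: z => a b.
have Z (r : R) (h : R -> R) : mu.-integrable D (EFin \o h) -> mu.-integrable D (EFin \o (fun t => r * h t)).
  by move=> hh; rewrite (_ : _ \o _ = (fun t => r%:E * (h t)%:E)%E) //; exact: integrableZl.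
have ZB (r s : R) (h k : R -> R) : mu.-integrable D (EFin \o h) -> mu.-integrable D (EFin \o k) ->
    \int[mu]_(t in D) (r * h t + s * k t) = r * \int[mu]_(t in D) h t + s * \int[mu]_(t in D) k t.
  by move=> hh hk; rewrite RintegralD ?RintegralZl //; exact: Z.
apply/eqP; rewrite eq_complex /=; apply/andP; split; apply/eqP.
  by rewrite -mulNr -ZB //; apply: eq_Rintegral => t _; rewrite mulNr; case: (f t).
by rewrite -ZB //; apply: eq_Rintegral => t _; case: (f t).
Qed.

Lemma cintegralN D f : measurable D -> cintble D f ->
  cintegral D (fun t => - f t) = - cintegral D f.
Proof.
move=> mD hf; rewrite -mulN1r -cintegralZ //.
by apply: eq_cintegral => t _; rewrite mulN1r.
Qed.

Lemma cintegralB D f g : measurable D -> cintble D f -> cintble D g ->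
  cintegral D (fun t => f t - g t) = cintegral D f - cintegral D g.
Proof. by move=> mD hf hg; rewrite cintegralD ?cintegralN //; exact: cintbleN. Qed.

Lemma cintegral0 D : cintegral D (fun=> 0) = 0.
Proof. by rewrite /cintegral /Rintegral /= integral0. Qed.

Lemma cintble_sum D n (F : nat -> R -> R[i]) : measurable D -> (forall i, cintble D (F i)) ->
  cintble D (fun t => \sum_(i < n) F i t).
Proof.
move=> mD hF; elim: n => [|n IH].
  under eq_fun do rewrite big_ord0; split => /=; exact: integrable0.
by under eq_fun do rewrite big_ord_recr /=; exact: cintbleD.
Qed.

Lemma cintegral_sum D n (F : nat -> R -> R[i]) : measurable D -> (forall i, cintble D (F i)) ->
  cintegral D (fun t => \sum_(i < n) F i t) = \sum_(i < n) cintegral D (F i).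
Proof.
move=> mD hF; elim: n => [|n IH].
  by rewrite big_ord0; under eq_fun do rewrite big_ord0; exact: cintegral0.
under eq_fun do rewrite big_ord_recr /=.
by rewrite cintegralD // ?IH ?big_ord_recr //; exact: cintble_sum.
Qed.

Lemma cintegralJ D f : measurable D -> cintble D f ->
  cintegral D (fun t => (f t)^*) = (cintegral D f)^*.
Proof.
move=> mD [fr fi]; apply/eqP; rewrite eq_complex /=; apply/andP; split; apply/eqP.
  by apply: eq_Rintegral => t _; case: (f t).
by rewrite -mulN1r -RintegralZl //; apply: eq_Rintegral => t _; rewrite mulN1r; case: (f t).
Qed.

Lemma Re_cintegral D f : complex.Re (cintegral D f) = \int[mu]_(t in D) complex.Re (f t).
Proof. by []. Qed.

Lemma cintegral_real D (g : R -> R) :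
  cintegral D (fun t => (g t)%:C) = (\int[mu]_(t in D) g t)%:C.
Proof.
by rewrite /cintegral /= /Rintegral /= integral0.
Qed.

Lemma cintegral_dct D (F : nat -> R -> R[i]) f (g : R -> R) : measurable D ->
  (forall n, cmf D (F n)) -> mu.-integrable D (EFin \o g) ->
  (forall n t, D t -> cabs (F n t) <= g t) ->
  (forall t, D t -> ctends (F^~ t) (f t)) ->
  cintble D f /\ ctends (fun n => cintegral D (F n)) (cintegral D f).
Proof.
move=> mD mF ig Fg Ff.
have mf : cmf D f by exact: cmf_lim mF Ff.
have fg t : D t -> cabs (f t) <= g t.
  by move=> Dt; apply: ctends_bound (Ff t Dt) _ => n; exact: Fg.
split; first exact: cintble_le ig fg.
have key (h : R[i] -> R) : (forall z, `|h z| <= cabs z) ->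
   (forall n, measurable_fun D (fun t => h (F n t))) ->
   measurable_fun D (fun t => h (f t)) ->
   (forall t, D t -> h (F n t) @[n --> \oo] --> h (f t)) ->
   \int[mu]_(t in D) h (F n t) @[n --> \oo] --> \int[mu]_(t in D) h (f t).
  move=> hz mhF mhf hc.
  have Dc := @dominated_cvg _ _ _ mu D mD (fun n t => (h (F n t))%:E) (fun t => (h (f t))%:E) (EFin \o g).
  apply: fine_cvg; rewrite fineK.
    apply: Dc => //.
    - by move=> n; apply/(@measurable_EFinP _ _ _ D (fun t => h (F n t))).
    - move=> t Dt; apply: cvg_EFin; first exact: nearW.
      exact: hc.
    - by move=> n t Dt /=; rewrite lee_fin; apply: le_trans (hz _) (Fg n t Dt).
  apply: integrable_fin_num => //; apply: le_integrable ig => //; first exact/measurable_EFinP.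
  move=> t Dt /=; rewrite lee_fin; apply: le_trans (hz _) _.
  exact: le_trans (fg t Dt) (ler_norm _).
apply: ctends_ReIm => /=.
  apply: (key (@complex.Re R)).
  - by move=> z; exact: Re_le_cabs.
  - by move=> n; case: (mF n).
  - by case: mf.
  - by move=> t Dt; apply: ctends_Re; exact: Ff.
apply: (key (@complex.Im R)).
- by move=> z; exact: Im_le_cabs.
- by move=> n; case: (mF n).
- by case: mf.
- by move=> t Dt; apply: ctends_Im; exact: Ff.
Qed.

Lemma cexp_iD (s t : R) : cexp_i (s + t) = cexp_i s * cexp_i t.
Proof. by rewrite /cexp_i cosD sinD; apply/eqP; rewrite eq_complex /= eqxx /= addrC. Qed.

Lemma cexp_i0 : cexp_i (0 : R) = 1.
Proof. by rewrite /cexp_i cos0 sin0. Qed.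

Lemma cexp_iN (s : R) : cexp_i (- s) = (cexp_i s)^*.
Proof. by rewrite /cexp_i cosN sinN. Qed.

Lemma cexp_iV (s : R) : (cexp_i s)^-1 = cexp_i (- s).
Proof.
have e : cexp_i s * cexp_i (- s) = 1 by rewrite -cexp_iD subrr cexp_i0.
have n0 : cexp_i s != 0 by apply: contraTneq (ltr01 : (0:R) < 1) => h; rewrite -(cabs_cexp_i s) h cabs0 ltxx.
by apply: (mulfI n0); rewrite divff.
Qed.

Lemma cexp_iX (s : R) n : cexp_i s ^+ n = cexp_i (n%:R * s).
Proof.
elim: n => [|n IH]; first by rewrite mul0r cexp_i0.
by rewrite exprSr IH -cexp_iD -natr1 mulrDl mul1r.
Qed.

Lemma cexp_i_2pi : cexp_i (2 * pi : R) = 1.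
Proof. by rewrite /cexp_i mulr_natl cos2pi sin2pi. Qed.

Lemma measurable_sin : measurable_fun setT (@sin R).
Proof. by apply: continuous_measurable_fun; exact: continuous_sin. Qed.

Lemma measurable_cos : measurable_fun setT (@cos R).
Proof. by apply: continuous_measurable_fun; exact: continuous_cos. Qed.

Lemma cmf_cexp_i D (a : R) : measurable D -> cmf D (fun t => cexp_i (a * t)).
Proof.
move=> mD.
have h : measurable_fun D (fun t => a * t) by exact: measurable_funM.
split; rewrite /cexp_i /=.
  exact: (measurableT_comp measurable_cos h).
exact: (measurableT_comp measurable_sin h).
Qed.

Lemma Rintegral_derive (F f : R -> R) (a b : R) : a < b ->
  (forall x : R, is_derive x (1 : R) F (f x)) -> continuous f ->
  \int[mu]_(t in `[a, b]) f t = F b - F a.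
Proof.
move=> ab dF cf; rewrite /Rintegral (@continuous_FTC2 _ f F a b) //.
- by apply: continuous_subspaceT => x; exact: cf.
- have cF x : {for x, continuous F}.
    by apply: differentiable_continuous; apply/derivable1_diffP; case: (dF x).
  split.
  + by move=> x _; case: (dF x).
  + by apply: cvg_at_right_filter; exact: cF.
  + by apply: cvg_at_left_filter; exact: cF.
- by move=> x _; rewrite derive1E; case: (dF x).
Qed.

Lemma integral_cexp_i (a b : R) : a != 0 -> 0 < b -> cexp_i (a * b) = 1 ->
  cintegral `[0, b] (fun t => cexp_i (a * t)) = 0.
Proof.
move=> a0 b0 [cab sab]; rewrite /cintegral /cexp_i /=.
have cm : continuous (fun x : R => a * x).
  by move=> x; apply: cvgM; [exact: cvg_cst|exact: cvg_id].
have d1 (x : R) : is_derive x (1 : R) (fun t : R => a * t) a.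
  by apply: is_derive_eq; rewrite /GRing.scale /= mulr1.
have ds (x : R) : is_derive x (1 : R) (fun t => a^-1 * sin (a * t)) (cos (a * x)).
  have d2 := is_derive1_comp (is_derive_sin (a * x)) (d1 x).
  have d3 := is_deriveZ (a^-1) d2.
  by apply: (is_derive_eq d3); rewrite /GRing.scale /= mulrCA mulVf // mulr1.
have dc (x : R) : is_derive x (1 : R) (fun t => - (a^-1 * cos (a * t))) (sin (a * x)).
  have d2 := is_derive1_comp (is_derive_cos (a * x)) (d1 x).
  have d3 := is_deriveN (is_deriveZ (a^-1) d2).
  by apply: (is_derive_eq d3); rewrite /GRing.scale /= mulNr mulrN opprK mulrCA mulVf // mulr1.
have -> : \int[mu]_(t in `[0, b]) cos (a * t) = 0.
  rewrite (Rintegral_derive b0 ds) ?sab ?mulr0 ?sin0 ?mulr0 ?subrr //.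
  by move=> x; apply: continuous_comp; [exact: cm|exact: continuous_cos].
have -> : \int[mu]_(t in `[0, b]) sin (a * t) = 0.
  rewrite (Rintegral_derive b0 dc) ?cab ?mulr0 ?cos0 ?subrr //.
  by move=> x; apply: continuous_comp; [exact: cm|exact: continuous_sin].
by [].
Qed.

(** On the circle the series is dominated by two geometric series, as rho / r < 1 and tau * r < 1,
    so it may be integrated term by term; exponentials of nonzero frequency integrate to 0 and the
    coefficient of 1/(z - c) remains. *)
Lemma circle_mean_series (c : R[i]) (r A rho tau : R) (al be : nat -> R[i]) (f : R[i] -> R[i]) :
  0 < r -> 0 <= A -> 0 <= rho < r -> 0 <= tau -> tau * r < 1 ->
  (forall s, cabs (al s) <= A * rho ^+ s) -> (forall s, cabs (be s) <= A * tau ^+ s) ->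
  (forall z, cabs (z - c) = r ->
     ctends (fun n => \sum_(s < n) ((z - c) ^- s.+1 * al s - (z - c) ^+ s * be s)) (f z)) ->
  circle_mean c r f = al 0%N.
Proof.
move=> r0 A0 /andP[rho0 rhor] tau0 taur hal hbe hf.
have rn0 : r%:C != 0 :> R[i] by rewrite -cabs_eq0 cabsR gtr0_norm // gt_eqF.
have en0 s : cexp_i s != 0 :> R[i] by rewrite -cabs_eq0 cabs_cexp_i oner_eq0.
set D := `[0, 2 * pi]%classic : set R.
have mD : measurable D by exact: measurable_itv.
have pi2 : 0 < 2 * pi :> R by rewrite mulr_gt0 // pi_gt0.
have muD : mu D = (2 * pi)%:E by rewrite lebesgue_measure_itv /= lte_fin pi2 /= oppr0 addr0.
have fD : (mu D < +oo)%E by rewrite muD ltry.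
pose w (s : R) := r%:C * cexp_i s.
have cw s : cabs (w s) = r by rewrite cabsM cabsR cabs_cexp_i mulr1 gtr0_norm.
have wn0 s : w s != 0 by rewrite mulf_neq0.
(* The factor dz = i w ds shifts every power of w by one, so that the residue becomes the constant
   term. *)
pose F n (s : R) := \sum_(j < n) ('i%C * (w s ^- j * al j) - 'i%C * (w s ^+ j.+1 * be j)).
have mw : cmf D w by apply: cmfZ; have := @cmf_cexp_i D 1 mD; under eq_fun do rewrite mul1r.
have mcw n : cmf D (fun s => cexp_i (n * s)) by exact: cmf_cexp_i.
have wX n s : w s ^+ n = r%:C ^+ n * cexp_i (n%:R * s) by rewrite exprMn cexp_iX.
have wV n s : w s ^- n = r%:C ^- n * cexp_i (- n%:R * s) by rewrite wX invfM cexp_iV mulNr.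
have iD a (z : R[i]) : cintble D (fun s => z * cexp_i (a * s)).
  apply: (@cintble_bounded D _ (cabs z)) => // [|t _]; first by apply: cmfZ.
  by rewrite cabsM cabs_cexp_i mulr1.
have I0 n z : (0 < n)%N -> cintegral D (fun s => z * cexp_i (n%:R * s)) = 0.
  move=> n0; rewrite cintegralZ //; last by have := iD n%:R 1; under eq_fun do rewrite mul1r.
  rewrite integral_cexp_i ?mulr0 ?pnatr_eq0 -?lt0n //.
  by rewrite -cexp_iX cexp_i_2pi expr1n.
have I0N n z : (0 < n)%N -> cintegral D (fun s => z * cexp_i (- n%:R * s)) = 0.
  move=> n0; rewrite cintegralZ //; last by have := iD (- n%:R) 1; under eq_fun do rewrite mul1r.
  rewrite integral_cexp_i ?mulr0 ?oppr_eq0 ?pnatr_eq0 -?lt0n //.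
  by rewrite mulNr -cexp_iV -cexp_iX cexp_i_2pi expr1n invr1.
have Fj (j : nat) : (fun s => 'i%C * (w s ^- j * al j) - 'i%C * (w s ^+ j.+1 * be j)) =
  (fun s => ('i%C * r%:C ^- j * al j) * cexp_i (- j%:R * s) - ('i%C * r%:C ^+ j.+1 * be j) * cexp_i (j.+1%:R * s)).
  by apply/funext => s; rewrite wV wX; ring.
have iFj (j : nat) : cintble D (fun s => 'i%C * (w s ^- j * al j) - 'i%C * (w s ^+ j.+1 * be j)).
  by rewrite Fj; apply: cintbleB.
have IF n : cintegral D (F n.+1) = 2 * 'i%C * pi%:C * al 0%N.
  have -> := cintegral_sum n.+1 mD iFj; rewrite big_ord_recl big1 ?addr0.
    rewrite Fj cintegralB // (I0 1%N) // subr0.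
    rewrite (_ : (fun s => _) = (fun s => (('i%C * al 0%N) * 1))); last first.
      by apply/funext => s; rewrite oppr0 mul0r cexp_i0 expr0 invr1 !mulr1.
    rewrite cintegralZ //; last by have := iD 0 1; under eq_fun do rewrite mul0r cexp_i0 mulr1.
    have -> : cintegral D (fun=> 1) = (2 * pi)%:C.
      rewrite (cintegral_real D (fun=> 1)) Rintegral_cst // mul1r; congr (_%:C).
      by have := congr1 fine muD.
    by rewrite rmorphM /= rmorph_nat; ring.
  by move=> i _; rewrite Fj cintegralB // I0 // I0N // subrr.
pose B := A * (1 - rho / r)^-1 + r * A * (1 - tau * r)^-1.
have rr : 0 <= rho / r < 1 by rewrite divr_ge0 ?(ltW r0) //= ltr_pdivrMr ?mul1r.
have geo (x : R) n : 0 <= x -> x < 1 -> \sum_(i < n) x ^+ i <= (1 - x)^-1.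
  move=> x0 x1; rewrite -[leRHS]mulr1 ler_pdivlMl ?subr_gt0 // -[1 - x]opprB mulNr -subrX1 opprB.
  by rewrite lerBlDr lerDl exprn_ge0.
have FB n t : D t -> cabs (F n t) <= B.
  move=> _; rewrite /F; apply: le_trans (cabs_sum _ _ _) _.
  have bnd (j : nat) : cabs ('i%C * (w t ^- j * al j) - 'i%C * (w t ^+ j.+1 * be j)) <=
     A * (rho / r) ^+ j + r * A * (tau * r) ^+ j.
    apply: le_trans (cabsB _ _) _; rewrite !cabsM !cabsV !cabsX cw.
    have -> : cabs ('i%C : R[i]) = 1 by rewrite /cabs /= expr0n add0r expr1n sqrtr1.
    rewrite !mul1r; apply: lerD.
      rewrite expr_div_n mulrA [leRHS]mulrC; apply: ler_wpM2l; last exact: hal.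
      by rewrite invr_ge0 exprn_ge0 // ltW.
    rewrite exprS exprMn -!mulrA ler_wpM2l ?(ltW r0) // mulrA [leRHS]mulrC.
    by rewrite ler_wpM2l ?hbe // exprn_ge0 // ltW.
  apply: le_trans (ler_sum _ (fun (j : 'I_n) _ => bnd j)) _.
  rewrite big_split /= -!mulr_sumr; apply: lerD; apply: ler_wpM2l.
  - by [].
  - by apply: geo; case/andP: rr.
  - by rewrite mulr_ge0 // ltW.
  - by apply: geo => //; rewrite mulr_ge0 // ltW.
have [] := @cintegral_dct D F (fun s => f (c + w s) * ('i%C * w s)) (fun=> B) mD.
- by move=> n; exact: cintble_cmf (cintble_sum n mD iFj).
- exact: integrable_cst_fin.
- exact: FB.
- move=> t Dt.
  have := hf (c + w t); rewrite addrAC subrr add0r cw => /(_ erefl) h.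
  have := ctendsZ ('i%C * w t) h; rewrite [_ * f _]mulrC; congr ctends.
  apply/funext => n; rewrite /F mulr_sumr; apply: eq_bigr => j _.
  rewrite mulrBr !exprS; congr (_ - _); last by ring.
  by field; rewrite wn0 expf_neq0.
move=> _ h.
have E : cintegral D (fun s => f (c + w s) * ('i%C * w s)) = 2 * 'i%C * pi%:C * al 0%N.
  apply: ctends_uniq h _; apply/ctendsP => e e0; exists 1%N => -[//|n] _.
  by rewrite IF subrr cabs0.
rewrite /circle_mean; have -> : (fun s => f (c + r%:C * cexp_i s) * ('i%C * r%:C * cexp_i s)) =
   (fun s => f (c + w s) * ('i%C * w s)) by apply/funext => s; rewrite -mulrA.
rewrite E mulKf // !mulf_neq0 ?pnatr_eq0 //.
  by rewrite eq_complex /= oner_eq0 andbF.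
by rewrite -cabs_eq0 cabsR gtr0_norm ?pi_gt0 // gt_eqF ?pi_gt0.
Qed.

End ComplexIntegral.

(** * The space L_2[0, omega] *)

(* A class, so that the lemmas below find the positivity of the length of the
   interval by instance resolution. *)
Class positive_length {R : realType} (omega : R) : Prop := length_gt0 : 0 < omega.

Section L2Space.
Context {R : realType} (omega : R) {omega_pos : positive_length omega}.
Let omega_gt0 : 0 < omega := omega_pos.
Notation mu := (@lebesgue_measure R).
Notation D := (`[0, omega]%classic : set R).
Notation L2 := (@L2 R omega).
Notation ip := (@ip R omega).
Notation L2norm := (@L2norm R omega).
Notation aeeq := (@aeeq R omega).
Implicit Types (x y : R -> R[i]) (z : R[i]).

Lemma conj_real (r : R) : (r%:C : R[i])^* = r%:C. Proof. exact: conjc_real. Qed.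

Lemma conj_one : (1 : R[i])^* = 1. Proof. exact: conjc1. Qed.

Lemma conj_inv z : z^*^* = z. Proof. exact: conjcK. Qed.

Lemma measurable_D : measurable D. Proof. exact: measurable_itv. Qed.
Let mD := measurable_D.

Lemma mu_D : mu D = omega%:E.
Proof. by rewrite lebesgue_measure_itv /= lte_fin omega_gt0 /= oppr0 addr0. Qed.

Lemma mu_D_fin : (mu D < +oo)%E. Proof. by rewrite mu_D ltry. Qed.

Lemma ae_S (P Q : R -> Prop) : (forall t, P t -> Q t) ->
  {ae mu, forall t, P t} -> {ae mu, forall t, Q t}.
Proof. by have ? := ae_filter_ringOfSetsType mu; move=> PQ; exact: filterS. Qed.

Lemma ae_S2 (P P' Q : R -> Prop) : (forall t, P t -> P' t -> Q t) ->
  {ae mu, forall t, P t} -> {ae mu, forall t, P' t} -> {ae mu, forall t, Q t}.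
Proof. by have ? := ae_filter_ringOfSetsType mu; move=> PQ; exact: filterS2. Qed.

Lemma ae_all (P : R -> Prop) : (forall t, P t) -> {ae mu, forall t, P t}.
Proof. by move=> h; apply: (@ae_S (fun=> True)) => //; apply: filterT; exact: (ae_filter_ringOfSetsType mu). Qed.

Lemma aeeqP x y : aeeq x y <-> {ae mu, forall t, D t -> x t = y t}.
Proof. by split; apply: ae_S => t h Dt; apply: h. Qed.

Lemma aeeq_refl x : aeeq x x. Proof. by apply: ae_all. Qed.

Lemma aeeq_sym x y : aeeq x y -> aeeq y x.
Proof. by apply: ae_S => t h /h. Qed.

Lemma aeeq_trans y x v : aeeq x y -> aeeq y v -> aeeq x v.
Proof. by apply: ae_S2 => t h1 h2 Dt; rewrite h1 ?h2. Qed.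

Lemma aeeq_map2 (h : R[i] -> R[i] -> R[i]) x y x' y' : aeeq x y -> aeeq x' y' ->
  aeeq (fun t => h (x t) (x' t)) (fun t => h (y t) (y' t)).
Proof. by apply: ae_S2 => t e e' Dt; rewrite e ?e'. Qed.

Lemma L2P x : L2 x <-> cmf D x /\ mu.-integrable D (EFin \o (fun t => cabs (x t) ^+ 2)).
Proof.
split=> [[mr mi fi]|[[mr mi] /integrableP[_ fi]]]; split => //.
  apply/integrableP; split; first by apply/measurable_EFinP; apply: cmf_cabs2.
  by under eq_integral do rewrite /= ger0_norm ?exprn_ge0 ?cabs_ge0 //.
by under eq_integral do rewrite -[_ ^+ 2]ger0_norm ?exprn_ge0 ?cabs_ge0 //.
Qed.

Lemma L2_cmf x : L2 x -> cmf D x. Proof. by case. Qed.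

Lemma L2_le x (g : R -> R) : cmf D x -> mu.-integrable D (EFin \o g) ->
  (forall t, D t -> cabs (x t) ^+ 2 <= g t) -> L2 x.
Proof.
move=> mx ig xg; apply/L2P; split=> //; apply: le_integrable ig => //.
  by apply/measurable_EFinP; exact: cmf_cabs2.
move=> t Dt /=; rewrite lee_fin ger0_norm ?exprn_ge0 ?cabs_ge0 //.
exact: le_trans (xg t Dt) (ler_norm _).
Qed.

Lemma L2_mulb x f M : L2 x -> cmf D f -> (forall t, D t -> cabs (f t) <= M) ->
  L2 (fun t => x t * f t).
Proof.
move=> /L2P[mx ix] mf fM; apply: (@L2_le _ (fun t => M ^+ 2 * cabs (x t) ^+ 2)).
- exact: cmfM.
- rewrite (_ : _ \o _ = (fun t => (M ^+ 2)%:E * (cabs (x t) ^+ 2)%:E)%E) //.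
  exact: integrableZl.
- move=> t Dt; rewrite cabsM exprMn mulrC ler_wpM2r ?exprn_ge0 ?cabs_ge0 //.
  by rewrite lerXn2r ?nnegrE ?cabs_ge0 ?fM // (le_trans (cabs_ge0 _) (fM _ Dt)).
Qed.

Lemma L2_bounded f M : cmf D f -> (forall t, D t -> cabs (f t) <= M) -> L2 f.
Proof.
move=> mf fM; apply: (@L2_le _ (fun=> M ^+ 2)) => //.
  by apply: integrable_cst_fin => //; exact: mu_D_fin.
move=> t Dt.
by rewrite lerXn2r ?nnegrE ?cabs_ge0 ?fM // (le_trans (cabs_ge0 _) (fM _ Dt)).
Qed.

Lemma L2_cst z : L2 (fun=> z).
Proof. by apply: (@L2_bounded _ (cabs z)) => //; exact: cmf_cst. Qed.

Lemma L2Z z x : L2 x -> L2 (fun t => z * x t).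
Proof.
move=> hx; have := L2_mulb hx (cmf_cst D z) (fun _ _ => lexx (cabs z)).
by under eq_fun do rewrite mulrC.
Qed.

Lemma L2D x y : L2 x -> L2 y -> L2 (fun t => x t + y t).
Proof.
move=> /L2P[mx ix] /L2P[my iy].
apply: (@L2_le _ (fun t => 2 * cabs (x t) ^+ 2 + 2 * cabs (y t) ^+ 2)).
- exact: cmfD.
- rewrite (_ : _ \o _ = ((fun t => 2%:E * (cabs (x t) ^+ 2)%:E) \+
    (fun t => 2%:E * (cabs (y t) ^+ 2)%:E))%E) //.
  by apply: integrableD => //; exact: integrableZl.
- move=> t _; have := cabsD (x t) (y t); have := cabs_ge0 (x t + y t).
  set a := cabs _; set b := cabs (x t); set c := cabs (y t) => a0 ab.
  have : a ^+ 2 <= (b + c) ^+ 2 by rewrite lerXn2r ?nnegrE // (le_trans a0).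
  by move/le_trans; apply; have := sqr_ge0 (b - c); nra.
Qed.

Lemma L2N x : L2 x -> L2 (fun t => - x t).
Proof. by move=> /(L2Z (-1)); under eq_fun do rewrite mulN1r. Qed.

Lemma L2B x y : L2 x -> L2 y -> L2 (fun t => x t - y t).
Proof. by move=> hx /L2N; exact: L2D. Qed.

Lemma L2J x : L2 x -> L2 (fun t => (x t)^*).
Proof.
move=> /L2P[mx ix]; apply: (L2_le (cmfJ mx) ix) => t _.
by rewrite cabsJ.
Qed.

Lemma L2_sum n (F : nat -> R -> R[i]) : (forall i, (i < n)%N -> L2 (F i)) ->
  L2 (fun t => \sum_(i < n) F i t).
Proof.
elim: n => [|n IH] h; first by under eq_fun do rewrite big_ord0; exact: L2_cst.
under eq_fun do rewrite big_ord_recr /=; apply: L2D; last exact: h.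
by apply: IH => i ni; apply: h; exact: ltnW.
Qed.

Lemma ip_intble x y : L2 x -> L2 y -> cintble D (fun t => x t * (y t)^*).
Proof.
move=> /L2P[mx ix] /L2P[my iy].
apply: (@cintble_le _ D _ (fun t => cabs (x t) ^+ 2 + cabs (y t) ^+ 2)) => //.
- by apply: cmfM => //; exact: cmfJ.
- rewrite (_ : _ \o _ = ((fun t => (cabs (x t) ^+ 2)%:E) \+ (fun t => (cabs (y t) ^+ 2)%:E))%E) //.
  exact: integrableD.
- move=> t _; rewrite cabsM cabsJ.
  set b := cabs (x t); set c := cabs (y t).
  by have := sqr_ge0 (b - c); have := sqr_ge0 b; have := sqr_ge0 c; nra.
Qed.

Lemma L2_cintble x : L2 x -> cintble D x.
Proof.
move=> hx; have := ip_intble hx (L2_cst 1).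
by rewrite (_ : (fun t => _) = x) //; apply/funext => t; rewrite [X in _ * X]conj_one mulr1.
Qed.

Lemma ipE x y : ip x y = (omega^-1)%:C * cintegral D (fun t => x t * (y t)^*).
Proof. by []. Qed.

Lemma ipD x y v : L2 x -> L2 y -> L2 v -> ip (fun t => x t + y t) v = ip x v + ip y v.
Proof.
move=> hx hy hv; rewrite /Defs.ip -mulrDr -cintegralD //; try exact: ip_intble.
by congr (_ * _); apply: eq_cintegral => t _; rewrite mulrDl.
Qed.

Lemma ipZ z x v : L2 x -> L2 v -> ip (fun t => z * x t) v = z * ip x v.
Proof.
move=> hx hv; rewrite /Defs.ip mulrCA -[z * cintegral _ _]cintegralZ //; last exact: ip_intble.
by congr (_ * _); apply: eq_cintegral => t _; rewrite mulrA.
Qed.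

Lemma ipJ x y : L2 x -> L2 y -> ip y x = (ip x y)^*.
Proof.
move=> hx hy; rewrite /Defs.ip rmorphM /= -cintegralJ //; last exact: ip_intble.
congr (_ * _); first by rewrite conj_real.
by apply: eq_cintegral => t _; rewrite rmorphM /= conj_inv mulrC.
Qed.

Lemma ipN x v : L2 x -> L2 v -> ip (fun t => - x t) v = - ip x v.
Proof.
move=> hx hv; rewrite -mulN1r -ipZ //.
by have -> : (fun t => - x t) = (fun t => -1 * x t) by apply/funext => t; rewrite mulN1r.
Qed.

Lemma ipB x y v : L2 x -> L2 y -> L2 v -> ip (fun t => x t - y t) v = ip x v - ip y v.
Proof. by move=> hx hy hv; rewrite ipD ?ipN //; exact: L2N. Qed.

Lemma ip0l v : ip (fun=> 0) v = 0.
Proof.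
rewrite /Defs.ip (_ : (fun t => _) = (fun=> 0)) ?cintegral0 ?mulr0 //.
by apply/funext => t; rewrite mul0r.
Qed.

Lemma ip_sum n (F : nat -> R -> R[i]) v : (forall i, (i < n)%N -> L2 (F i)) -> L2 v ->
  ip (fun t => \sum_(i < n) F i t) v = \sum_(i < n) ip (F i) v.
Proof.
move=> + hv; elim: n => [|n IH] h.
  by rewrite big_ord0; under eq_fun do rewrite big_ord0; exact: ip0l.
have hn i : (i < n)%N -> L2 (F i) by move=> ni; apply: h; exact: ltnW.
under eq_fun do rewrite big_ord_recr /=.
by rewrite ipD // ?IH ?big_ord_recr //; [exact: L2_sum|exact: h].
Qed.

Lemma ipDr x y v : L2 x -> L2 y -> L2 v -> ip v (fun t => x t + y t) = ip v x + ip v y.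
Proof.
move=> hx hy hv; have hxy := L2D hx hy.
by rewrite (ipJ hxy hv) ipD // rmorphD /= -!ipJ.
Qed.

Lemma ipZr z x v : L2 x -> L2 v -> ip v (fun t => z * x t) = z^* * ip v x.
Proof.
move=> hx hv; have hzx := L2Z z hx.
by rewrite (ipJ hzx hv) ipZ // rmorphM /= -ipJ.
Qed.

Lemma Re_ip x : complex.Re (ip x x) = omega^-1 * \int[mu]_(t in D) (cabs (x t) ^+ 2).
Proof.
rewrite /Defs.ip.
rewrite (@eq_cintegral _ _ _ (fun t => (cabs (x t) ^+ 2)%:C)); last by move=> t _; rewrite mulcJ.
by rewrite cintegral_real /= mul0r subr0.
Qed.

Lemma L2norm_sqr x : L2norm x ^+ 2 = omega^-1 * \int[mu]_(t in D) (cabs (x t) ^+ 2).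
Proof.
rewrite /Defs.L2norm sqr_sqrtr Re_ip // mulr_ge0 ?invr_ge0 ?(ltW omega_gt0) //.
by apply: Rintegral_ge0 => t _; rewrite exprn_ge0 ?cabs_ge0.
Qed.

Lemma ipxx x : ip x x = (L2norm x ^+ 2)%:C.
Proof.
rewrite L2norm_sqr -Re_ip /Defs.ip.
rewrite (@eq_cintegral _ _ _ (fun t => (cabs (x t) ^+ 2)%:C)); last by move=> t _; rewrite mulcJ.
by rewrite cintegral_real -rmorphM.
Qed.

Lemma L2norm_ge0 x : 0 <= L2norm x. Proof. exact: sqrtr_ge0. Qed.

Lemma integral_sqr x : L2 x ->
  (\int[mu]_(t in D) (cabs (x t) ^+ 2)%:E = (omega * L2norm x ^+ 2)%:E)%E.
Proof.
move=> /L2P[_ ix]; rewrite L2norm_sqr mulrA divff ?gt_eqF // mul1r.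
by rewrite /Rintegral fineK //; exact: integrable_fin_num.
Qed.

Lemma ip_aeeq x x' y y' : L2 x -> L2 x' -> L2 y -> L2 y' ->
  aeeq x x' -> aeeq y y' -> ip x y = ip x' y'.
Proof.
move=> hx hx' hy hy' /aeeqP exx /aeeqP eyy; rewrite /Defs.ip; congr (_ * _).
have [r1 i1] := ip_intble hx hy; have [r2 i2] := ip_intble hx' hy'.
have E : {ae mu, forall t, D t -> x t * (y t)^* = x' t * (y' t)^*}.
  by move: exx eyy; apply: ae_S2 => t e1 e2 Dt; rewrite e1 ?e2.
rewrite /cintegral; congr (_ +i* _); rewrite /Rintegral; congr fine.
  apply: ae_eq_integral => //; [exact: measurable_int r1|exact: measurable_int r2|].
  by move: E; apply: ae_S => t /= e Dt; rewrite e.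
apply: ae_eq_integral => //; [exact: measurable_int i1|exact: measurable_int i2|].
by move: E; apply: ae_S => t /= e Dt; rewrite e.
Qed.

Lemma L2norm_aeeq x y : L2 x -> L2 y -> aeeq x y -> L2norm x = L2norm y.
Proof. by move=> hx hy e; rewrite /Defs.L2norm (ip_aeeq hx hy hx hy). Qed.

Lemma L2norm_eq0 x : L2 x -> L2norm x = 0 -> aeeq x (fun=> 0).
Proof.
move=> hx x0; have := integral_sqr hx; rewrite x0 expr0n mulr0 => h.
have [mx _] := iffLR (L2P x) hx.
apply/aeeqP; have mg : measurable_fun D (EFin \o (fun t => cabs (x t) ^+ 2)).
  by apply/measurable_EFinP; exact: cmf_cabs2.
have [+ _] := ae_eq_integral_abs (@lebesgue_measure R) mD mg.
under eq_integral do rewrite /= ger0_norm ?exprn_ge0 ?cabs_ge0 //.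
move=> /(_ h); apply: ae_S => t /= + Dt => /(_ Dt)[] /eqP.
by rewrite sqrf_eq0 cabs_eq0 => /eqP.
Qed.

Lemma ip_expand x y z : L2 x -> L2 y ->
  L2norm (fun t => x t + z * y t) ^+ 2 =
  L2norm x ^+ 2 + 2 * complex.Re (z^* * ip x y) + cabs z ^+ 2 * L2norm y ^+ 2.
Proof.
move=> hx hy; have hz := L2Z z hy; have h := L2D hx hz.
have E : ip (fun t => x t + z * y t) (fun t => x t + z * y t) =
  ip x x + (z^* * ip x y + (z^* * ip x y)^*) + (z * z^*) * ip y y.
  rewrite ipD // !ipDr // ipZr // !ipZ // !ipZr // rmorphM /= conj_inv -(ipJ hx hy).
  by ring.
have := congr1 (@complex.Re R) E; rewrite !ipxx mulcJ -rmorphM /= => ->.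
by rewrite [complex.Re _]/= !raddfD /=; case: (z^* * ip x y) => ? ? /=; ring.
Qed.

(** |x + z y|^2 >= 0 is expanded at its minimum z = - ip x y / |y|^2. If y has norm 0 it is merely
    almost everywhere 0, and is replaced by 0 inside the inner product. *)
Lemma CS_ip x y : L2 x -> L2 y -> cabs (ip x y) <= L2norm x * L2norm y.
Proof.
move=> hx hy; have [y0|yn0] := eqVneq (L2norm y) 0.
  have e := L2norm_eq0 hy y0.
  rewrite (ip_aeeq hx hx hy (L2_cst 0) (aeeq_refl _) e) (ipJ (L2_cst 0) hx) ip0l.
  by rewrite rmorph0 cabs0 y0 mulr0.
have yp : 0 < L2norm y by rewrite lt_neqAle eq_sym yn0 L2norm_ge0.
pose z := - (ip x y / (L2norm y ^+ 2)%:C).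
have := ip_expand z hx hy.
have -> : z^* * ip x y = - ((cabs (ip x y) ^+ 2 / L2norm y ^+ 2)%:C).
  rewrite /z rmorphN rmorphM /= rmorphV /= ?unitfE ?eq_complex ?expf_neq0 //; last first.
    by rewrite /= negb_and expf_neq0.
  rewrite conj_real.
  by rewrite mulNr mulrAC [_^* * _]mulrC mulcJ [X in _ = - X]rmorphM fmorphV.
have -> : cabs z ^+ 2 = cabs (ip x y) ^+ 2 / L2norm y ^+ 4.
  rewrite /z cabsN cabsM cabsV cabsR ger0_norm ?sqr_ge0 // expr_div_n.
  by rewrite -exprM.
set p := cabs _; set a := L2norm x; set b := L2norm y => h.
have : 0 <= a ^+ 2 - p ^+ 2 / b ^+ 2.
  have -> : a ^+ 2 - p ^+ 2 / b ^+ 2 = a ^+ 2 + 2 * - (p ^+ 2 / b ^+ 2) + p ^+ 2 / b ^+ 4 * b ^+ 2.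
    by field.
  by rewrite -[X in _ <= X]h sqr_ge0.
rewrite subr_ge0 ler_pdivrMr ?exprn_gt0 // -exprMn.
by rewrite ler_pXn2r ?nnegrE ?cabs_ge0 ?mulr_ge0 ?L2norm_ge0.
Qed.

Lemma L2normZ z x : L2 x -> L2norm (fun t => z * x t) = cabs z * L2norm x.
Proof.
move=> hx; apply/eqP; rewrite -(@eqrXn2 _ 2) ?mulr_ge0 ?cabs_ge0 ?L2norm_ge0 //.
have := @ipxx (fun t => z * x t); have hz := L2Z z hx.
rewrite ipZ // ipZr // ipxx mulrA mulcJ -rmorphM exprMn => /(congr1 (@complex.Re R)) /= ->.
by [].
Qed.

Lemma L2normD x y : L2 x -> L2 y -> L2norm (fun t => x t + y t) <= L2norm x + L2norm y.
Proof.
move=> hx hy; rewrite -(@ler_pXn2r _ 2) ?nnegrE ?addr_ge0 ?L2norm_ge0 //.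
have := ip_expand 1 hx hy; under eq_fun do rewrite mul1r.
rewrite rmorph1 mul1r cabs1 expr1n mul1r => ->.
have := le_trans (ler_norm _) (le_trans (Re_le_cabs _) (CS_ip hx hy)).
by rewrite sqrrD; lra.
Qed.

Lemma L2norm_distD y x v : L2 x -> L2 y -> L2 v ->
  L2norm (fun t => x t - v t) <= L2norm (fun t => x t - y t) + L2norm (fun t => y t - v t).
Proof.
move=> hx hy hv; have := L2normD (L2B hx hy) (L2B hy hv).
by under eq_fun do rewrite addrA subrK.
Qed.

Lemma L2norm_le_integral x y (M : R) : 0 <= M -> L2 x ->  cmf D y ->
  (\int[mu]_(t in D) (cabs (y t) ^+ 2)%:E <= (omega * M ^+ 2)%:E)%E ->
  L2 y /\ L2norm y <= M.
Proof.
move=> M0 hx my hy; have h : L2 y.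
  by case: my => ? ?; split => //; apply: le_lt_trans hy _; rewrite ltry.
split=> //; move: hy; rewrite integral_sqr // lee_fin ler_pM2l //.
by rewrite ler_pXn2r ?nnegrE ?L2norm_ge0.
Qed.

End L2Space.

(* Otherwise unification unfolds these constants down to the Lebesgue integral. *)
Opaque ip L2norm L2 aeeq.

(** * Completeness of L_2 *)

Section L2Complete.
Context {R : realType} (omega : R) {omega_pos : positive_length omega}.
Let omega_gt0 : 0 < omega := omega_pos.
Notation mu := (@lebesgue_measure R).
Notation D := (`[0, omega]%classic : set R).
Notation L2 := (@L2 R omega).
Notation ip := (@ip R omega).
Notation L2norm := (@L2norm R omega).
Notation aeeq := (@aeeq R omega).
Implicit Types (x y : R -> R[i]) (z : R[i]).
Let mD : measurable D := measurable_D omega.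

Lemma L2norm1 : L2norm (fun=> 1) = 1.
Proof.
apply/eqP; rewrite -(@eqrXn2 _ 2) ?L2norm_ge0 // expr1n L2norm_sqr.
under eq_Rintegral do rewrite cabs1 expr1n.
rewrite Rintegral_cst // mul1r.
have -> : fine (mu D) = omega by rewrite mu_D.
by apply/eqP; rewrite mulVf // gt_eqF.
Qed.

(** Cauchy-Schwarz against the constant 1, whose norm is 1 in the normalised inner product. *)
Lemma integral_cabs_le x : L2 x ->
  (\int[mu]_(t in D) (cabs (x t))%:E <= (omega * L2norm x)%:E)%E.
Proof.
move=> hx; have [mx _] := iffLR (L2P omega x) hx.
pose a : R -> R[i] := fun t => (cabs (x t))%:C.
have ha : L2 a.
  have [_ ix] := iffLR (L2P omega x) hx.
  apply: (L2_le _ ix) => [|t _]; last by rewrite cabsR real_normK ?num_real.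
  by apply: cmf_real; exact: cmf_cabs.
have na : L2norm a = L2norm x.
  apply/eqP; rewrite -(@eqrXn2 _ 2) ?L2norm_ge0 // !L2norm_sqr; apply/eqP; congr (_ * _).
  by apply: eq_Rintegral => t _; rewrite cabsR ger0_norm ?cabs_ge0.
have ic : mu.-integrable D (EFin \o (fun t => cabs (x t))).
  by apply: integrable_cabs => //; exact: L2_cintble.
pose proof (CS_ip ha (L2_cst 1)) as h.
have := le_trans (ler_norm _) (le_trans (Re_le_cabs _) h).
rewrite na L2norm1 mulr1 ipE (@eq_cintegral _ _ _ a) => [|t _]; last by rewrite [X in _ * X]conj_one mulr1.
rewrite cintegral_real -rmorphM /= ler_pdivrMl //.
rewrite -lee_fin /Rintegral fineK //; exact: integrable_fin_num.
Qed.

Lemma L2norm_telescope (u : nat -> R -> R[i]) (e : nat -> R) : (forall n, L2 (u n)) ->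
  (forall n, L2norm (fun t => u n.+1 t - u n t) <= e n) ->
  forall n p, L2norm (fun t => u (n + p)%N t - u n t) <= \sum_(i < p) e (n + i)%N.
Proof.
move=> hu he n; elim=> [|p IH].
  rewrite big_ord0 addn0 (_ : (fun t => _) = (fun t => 0 * u n t)); last first.
    by apply/funext => t; rewrite subrr mul0r.
  by rewrite L2normZ // cabs0 mul0r.
rewrite big_ord_recr /= addnS addrC.
apply: le_trans (L2norm_distD (hu (n + p).+1) (hu (n + p)%N) (hu n)) _.
exact: lerD.
Qed.

(** The series of |u (n + 1) - u n| has a finite integral, hence converges almost everywhere; the
    rate of convergence in norm then follows from Fatou's lemma. *)
Lemma L2_complete (u : nat -> R -> R[i]) : (forall n, L2 (u n)) ->
  (forall n, L2norm (fun t => u n.+1 t - u n t) <= 2^-1 ^+ n) ->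
  exists2 x, L2 x & forall n, L2norm (fun t => x t - u n t) <= 2 * 2^-1 ^+ n.
Proof.
move=> hu he.
pose phi n t := cabs (u n.+1 t - u n t).
have mphi n : measurable_fun D (fun t => (phi n t)%:E).
  by apply/(@measurable_EFinP _ _ _ D (phi n)); apply: cmf_cabs; apply: cmfB; exact: L2_cmf.
have geo p : \sum_(i < p) 2^-1 ^+ i <= 2 :> R.
  have -> : \sum_(i < p) 2^-1 ^+ i = 2 * (1 - 2^-1 ^+ p) :> R.
    elim: p => [|p IH]; first by rewrite big_ord0 expr0 subrr mulr0.
    by rewrite big_ord_recr /= IH exprS; field.
  have : 0 <= 2^-1 ^+ p :> R by rewrite exprn_ge0 // invr_ge0.
  by set a := _ ^+ p; lra.
have tel n p : L2norm (fun t => u (n + p)%N t - u n t) <= 2 * 2^-1 ^+ n.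
  apply: le_trans (L2norm_telescope hu he n p) _.
  under eq_bigr do rewrite exprD.
  by rewrite -mulr_sumr mulrC ler_wpM2r // exprn_ge0 // invr_ge0.
pose g (t : R) : \bar R := (\sum_(n <oo) (phi n t)%:E)%E.
have g0 t : (0 <= g t)%E by apply: nneseries_ge0 => n _ _; rewrite lee_fin cabs_ge0.
have mg : measurable_fun D g.
  by apply: ge0_emeasurable_sum => // n t _ _; rewrite lee_fin cabs_ge0.
have ig : mu.-integrable D g.
  apply/integrableP; split=> //; under eq_integral do rewrite gee0_abs //.
  rewrite integral_nneseries //; last by move=> n t _; rewrite lee_fin cabs_ge0.
  apply: (@le_lt_trans _ _ (omega * 2)%:E); last by rewrite ltry.
  apply: lime_le; first by apply: is_cvg_nneseries => n _ _; apply: integral_ge0 => t _; rewrite lee_fin cabs_ge0.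
  apply: nearW => n; rewrite big_mkord.
  apply: (@le_trans _ _ (\sum_(i < n) (omega * 2^-1 ^+ i)%:E)%E).
    apply: lee_sum => i _; apply: le_trans (integral_cabs_le (L2B (hu _) (hu _))) _.
    by rewrite lee_fin ler_pM2l.
  by rewrite sumEFin lee_fin -mulr_sumr ler_pM2l.
(* Cutting the functions off outside this set of full measure gives representatives that converge at
   every point of the interval. *)
pose E := D `&` [set t | (g t < +oo)%E].
have mE : measurable E by exact: emeasurable_fun_infty_o.
have ED : {ae mu, forall t, D t -> E t}.
  have := @integrable_ae _ _ R lebesgue_measure D mD g ig; apply: ae_S => t h Dt; split => //=.
  by have := h Dt; rewrite ltey_eq => ->.
pose v n t := u n t * (\1_E t)%:C.
have hv n : L2 (v n).
  apply: (@L2_mulb _ _ _ (fun t => (\1_E t)%:C) 1) => //.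
    by apply: cmf_real; exact: measurable_indic.
  by move=> t _; rewrite cabsR indicE; case: (_ \in _); rewrite ?normr1 ?normr0.
have uv n : aeeq (v n) (u n).
  apply/aeeqP; move: ED; apply: ae_S => t h Dt.
  by rewrite /v indicE mem_set ?mulr1 //; exact: h.
pose x t := v 0%N t + csum (fun n => v n.+1 t - v n t).
have vx t : D t -> ctends (v ^~ t) (x t).
  move=> Dt; have [Et|nEt] := pselect (E t); last first.
    have v0 n : v n t = 0 by rewrite /v indicE memNset // mulr0.
    have -> : x t = 0.
      rewrite /x v0 (_ : (fun n => _) = (fun=> 0)) ?csum0 ?addr0 //.
      by apply/funext => n; rewrite !v0 subrr.
    by rewrite (_ : _ ^~ t = (fun=> 0)); [exact: ctends_cst|apply/funext => n].
  have s : csummable (fun n => v n.+1 t - v n t).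
    exists (fine (g t)) => n; rewrite -lee_fin fineK; last first.
      by rewrite ge0_fin_numE //; case: Et.
    have := @nneseries_lim_ge _ (fun n => (phi n t)%:E) xpredT 0%N n.
    rewrite big_mkord sumEFin => h; apply: le_trans (h _); last by move=> k _ _; rewrite lee_fin cabs_ge0.
    rewrite lee_fin; apply: ler_sum => i _.
    by rewrite /v indicE mem_set // !mulr1.
  have := ctendsD (ctends_cst (v 0%N t)) (ctends_csum s).
  rewrite (_ : (fun n => _) = v ^~ t) //; apply/funext => n.
  elim: n => [|n IH]; first by rewrite big_ord0 addr0.
  by rewrite big_ord_recr /= addrA IH addrC subrK.
have mx : cmf D x by apply: (@cmf_lim _ D v) => // n; exact: L2_cmf.
have main n : L2 (fun t => x t - v n t) /\ L2norm (fun t => x t - v n t) <= 2 * 2^-1 ^+ n.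
  have r0 : 0 <= 2 * 2^-1 ^+ n :> R by rewrite mulr_ge0 // exprn_ge0 // invr_ge0.
  apply: (L2norm_le_integral r0 (hv n)); first by apply: cmfB => //; exact: L2_cmf.
  pose f m t := ((cabs (v (n + m)%N t - v n t)) ^+ 2)%:E.
  have fx t : D t -> limn_einf (f ^~ t) = ((cabs (x t - v n t)) ^+ 2)%:E.
    move=> Dt; have cv : f m t @[m --> \oo] --> ((cabs (x t - v n t)) ^+ 2)%:E.
      apply: cvg_EFin; first exact: nearW.
      apply: (@cvg_comp _ _ _ (fun m => cabs (v (n + m)%N t - v n t)) (fun r : R => r ^+ 2)); last exact: exprn_continuous.
      apply/cvgrPdist_lt => e e0; have /ctendsP/(_ _ e0)[N hN] := vx t Dt.
      exists N => // m /= Nm.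
      have h := hN (n + m)%N (leq_trans Nm (leq_addl _ _)).
      apply: le_lt_trans h; rewrite ler_distlC.
      have := cabs_distD (x t) (v (n + m)%N t) (v n t).
      have := cabs_distD (v (n + m)%N t) (x t) (v n t).
      by rewrite [cabs (x t - v (n + m)%N t)]cabs_distC => h1 h2; apply/andP; split; lra.
    by rewrite is_cvg_limn_einfE; [exact/cvg_lim|apply/cvg_ex; exists ((cabs (x t - v n t)) ^+ 2)%:E].
  have <- : (\int[mu]_(t in D) limn_einf (f ^~ t) = \int[mu]_(t in D) (cabs (x t - v n t) ^+ 2)%:E)%E.
    by apply: eq_integral => t /set_mem Dt; rewrite fx.
  apply: le_trans (@fatou _ _ _ mu D mD f _ _) _.
  - move=> m; apply/(@measurable_EFinP _ _ _ D (fun t => cabs (v (n + m)%N t - v n t) ^+ 2)).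
    by apply: cmf_cabs2; apply: cmfB; exact: L2_cmf.
  - by move=> m t _; rewrite lee_fin exprn_ge0 ?cabs_ge0.
  have bnd m : (\int[mu]_(t in D) f m t <= (omega * (2 * 2^-1 ^+ n) ^+ 2)%:E)%E.
    rewrite integral_sqr; last by apply: L2B; exact: hv.
    rewrite lee_fin ler_pM2l // lerXn2r ?nnegrE ?L2norm_ge0 //.
    apply: le_trans (tel n m); rewrite (L2norm_aeeq (y := fun t => u (n + m)%N t - u n t)) //.
    - by apply: L2B; exact: hv.
    - by apply: L2B; exact: hu.
    - exact: (aeeq_map2 (fun a b => a - b)).
  rewrite limn_einf_lim; apply: lime_le; first exact: is_cvg_einfs.
  by apply: nearW => m; apply: le_trans (bnd m); apply: ereal_inf_lbound; exists m => /=.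
have [h0 _] := main 0%N.
have hx : L2 x by have := L2D h0 (hv 0%N); under eq_fun do rewrite subrK.
exists x => // n; have [h] := main n; apply: le_trans.
rewrite (L2norm_aeeq (y := fun t => x t - v n t)) //; first exact: L2B.
by apply: (aeeq_map2 (fun a b => a - b)); [exact: aeeq_refl|apply: aeeq_sym].
Qed.

End L2Complete.

(** * Coordinates in an orthonormal basis *)

Section OrthonormalBasis.
Context {R : realType} (omega : R) {omega_pos : positive_length omega}.
Let omega_gt0 : 0 < omega := omega_pos.
Notation L2 := (@L2 R omega).
Notation ip := (@ip R omega).
Notation L2norm := (@L2norm R omega).
Notation aeeq := (@aeeq R omega).
Notation H := (ell2 R).
Implicit Types (x y : R -> R[i]) (z : R[i]) (a : nat -> R[i]).

Variable b : nat -> R -> R[i].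
Hypothesis onb : orthonormal_basis omega b.

Let hb n : L2 (b n). Proof. by case: onb. Qed.

Definition partial_sum a n : R -> R[i] := fun t => \sum_(i < n) a i * b i t.

Lemma L2_partial_sum a n : L2 (partial_sum a n).
Proof. by apply: (L2_sum (F := fun i t => a i * b i t)) => i _; exact: L2Z. Qed.
Hint Resolve L2_partial_sum : core.

Lemma ip_partial_sum a n y : L2 y ->
  ip (partial_sum a n) y = \sum_(i < n) a i * (ip y (b i))^*.
Proof.
move=> hy; rewrite (ip_sum (F := fun i t => a i * b i t)) // => [|i _]; last exact: L2Z.
by apply: eq_bigr => i _; rewrite ipZ // (ipJ hy (hb i)).
Qed.

Lemma ip_partial_sum_basis a n j : ip (partial_sum a n) (b j) = if (j < n)%N then a j else 0.
Proof.
have [_ orth _] := onb; rewrite ip_partial_sum //.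
under eq_bigr => i _ do rewrite orth.
case: ifP => jn.
  rewrite (bigD1 (Ordinal jn)) //= eqxx big1 ?addr0 => [|i ij]; first by rewrite [_^*]conj_one mulr1.
  by have -> : (j == i) = false; [rewrite eq_sym; apply: contraNF ij => /eqP e; apply/eqP/val_inj|rewrite [_^*]conjc0 mulr0].
rewrite big1 // => i _; have -> : (j == i) = false by apply: contraFF jn => /eqP ->.
by rewrite [_^*]conjc0 mulr0.
Qed.

Lemma L2norm_partial_sum a n : L2norm (partial_sum a n) ^+ 2 = \sum_(i < n) cabs (a i) ^+ 2.
Proof.
have E : ip (partial_sum a n) (partial_sum a n) = (\sum_(i < n) cabs (a i) ^+ 2)%:C.
  rewrite ip_partial_sum // rmorph_sum; apply: eq_bigr => i _.
  by rewrite ip_partial_sum_basis ltn_ord mulcJ.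
by move/(congr1 (@complex.Re R)): E; rewrite ipxx.
Qed.

Lemma L2norm_partial_sumB a n p : (n <= p)%N ->
  L2norm (fun t => partial_sum a p t - partial_sum a n t) ^+ 2 =
  \sum_(i < p) cabs (a i) ^+ 2 - \sum_(i < n) cabs (a i) ^+ 2.
Proof.
move=> np; pose a' i := if (n <= i)%N then a i else 0.
have -> : (fun t => partial_sum a p t - partial_sum a n t) = partial_sum a' p.
  apply/funext => t; rewrite /partial_sum -!(big_mkord xpredT (fun i => a i * b i t)).
  rewrite [X in X - _](big_cat_nat (leq0n n) np) /= addrAC subrr add0r.
  rewrite -(big_mkord xpredT (fun i => a' i * b i t)) (big_cat_nat (leq0n n) np) /=.
  rewrite [X in _ = X + _]big_nat [X in _ = X + _]big1 ?add0r => [|i /andP[_ ni]]; last by rewrite /a' leqNgt ni mul0r.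
  by apply: eq_big_nat => i /andP[ni _]; rewrite /a' ni.
rewrite L2norm_partial_sum -!(big_mkord xpredT (fun i => cabs (a i) ^+ 2)).
rewrite [X in _ = X - _](big_cat_nat (leq0n n) np) /= addrAC subrr add0r.
rewrite -(big_mkord xpredT (fun i => cabs (a' i) ^+ 2)) (big_cat_nat (leq0n n) np) /=.
rewrite [X in X + _]big_nat [X in X + _]big1 ?add0r => [|i /andP[_ ni]]; last by rewrite /a' leqNgt ni cabs0 expr0n.
by apply: eq_big_nat => i /andP[ni _]; rewrite /a' ni.
Qed.

Lemma bessel x n : L2 x -> \sum_(i < n) cabs (ip x (b i)) ^+ 2 <= L2norm x ^+ 2.
Proof.
move=> hx; pose c i := ip x (b i).
pose proof (ip_expand (-1) hx (L2_partial_sum c n)) as E.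
have Es : ip x (partial_sum c n) = (\sum_(i < n) cabs (c i) ^+ 2)%:C.
  rewrite (ipJ (L2_partial_sum c n) hx) ip_partial_sum // rmorph_sum rmorph_sum; apply: eq_bigr => i _.
  by rewrite mulcJ; exact: conj_real.
move: E; rewrite Es L2norm_partial_sum cabsN cabs1 expr1n mul1r => E.
have := sqr_ge0 (L2norm (fun t => x t + -1 * partial_sum c n t)); rewrite E.
have -> : complex.Re ((-1 : R[i])^* * (\sum_(i < n) cabs (c i) ^+ 2)%:C) = - \sum_(i < n) cabs (c i) ^+ 2.
  have -> : (-1 : R[i])^* = -1 by rewrite -[LHS]/((-1 : R[i])^*) -[-1](rmorphN1 (real_complex R)) conj_real.
  by rewrite mulN1r.
by lra.
Qed.

Lemma is_ell2_coefs x : L2 x -> is_ell2 (fun i => ip x (b i)).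
Proof. by move=> hx; exists (L2norm x ^+ 2) => n; exact: bessel. Qed.

(** Total on functions, with value 0 if the coefficients are not square-summable; by Bessel's
    inequality this does not happen in L_2. *)
Definition cf x : H := match pselect (is_ell2 (fun i => ip x (b i))) with
  | left h => Ell2 h | right _ => 0 end.

Lemma cfE x i : L2 x -> cf x i = ip x (b i).
Proof. by move=> hx; rewrite /cf; case: pselect => // -[]; exact: is_ell2_coefs. Qed.

Lemma riesz_fischer (a : H) : exists2 x, L2 x &
  (forall i, ip x (b i) = a i) /\
  (forall e, 0 < e -> exists N, L2norm (fun t => x t - partial_sum a N t) <= e).
Proof.
have hN k : exists N, nrm a ^+ 2 - \sum_(i < N) cabs (a i) ^+ 2 <= (2^-1 ^+ k) ^+ 2.
  have e0 : 0 < (2^-1 ^+ k) ^+ 2 :> R by rewrite !exprn_gt0 // invr_gt0.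
  have /cvgrPdist_le/(_ _ e0)[N _ hN] := @cvg_nrm _ a; exists N.
  exact: le_trans (ler_norm _) (hN N (leqnn N)).
have [N HN] := choice hN.
(* The [N k] need not be monotone. These indices are increasing, at least [N k] and larger than k,
   so the corresponding partial sums have the increments that [L2_complete] asks for. *)
pose M k := (\sum_(j < k.+1) (N j).+1)%N.
have MM k : (M k <= M k.+1)%N by rewrite /M [leqRHS]big_ord_recr leq_addr.
have NM k : (N k <= M k)%N by rewrite /M big_ord_recr /= (leq_trans (leqnSn _)) // leq_addl.
have mono p q : (p <= q)%N -> \sum_(i < p) cabs (a i) ^+ 2 <= \sum_(i < q) cabs (a i) ^+ 2.
  move=> pq; rewrite -!(big_mkord xpredT (fun i => cabs (a i) ^+ 2)).
  by rewrite [leRHS](big_cat_nat (leq0n p) pq) lerDl sumr_ge0 // => i _; exact: sqr_ge0.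
pose u k := partial_sum a (M k).
have hu k : L2 (u k) by exact: L2_partial_sum.
have he k : L2norm (fun t => u k.+1 t - u k t) <= 2^-1 ^+ k.
  rewrite -(ler_pXn2r (ltn0Sn 1)) ?nnegrE ?L2norm_ge0 ?exprn_ge0 ?invr_ge0 // L2norm_partial_sumB //.
  have := HN k; have := mono _ _ (NM k); have := psum_nrm a (M k.+1).
  by set s := (_ ^+ k) ^+ 2; lra.
have [x hx xu] := L2_complete hu he.
have small e : 0 < e -> exists k0, forall k, (k0 <= k)%N -> 2 * 2^-1 ^+ k <= e :> R.
  move=> e0; have h12 : 2^-1 < 1 :> R by rewrite invf_lt1 // ltr1n.
  have h : (2 * 2^-1 ^+ n : R) @[n --> \oo] --> (0 : R) by apply: geometric_cvg0 => //; rewrite invr_ge0.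
  move/cvgrPdist_le : h => /(_ e e0)[k0 _ hk]; exists k0 => k kk.
  by have := hk k kk; rewrite /= sub0r normrN ger0_norm // mulr_ge0 // exprn_ge0 // invr_ge0.
exists x => //; split=> [i|e e0]; last first.
  by have [k0 hk] := small e e0; exists (M k0); apply: le_trans (xu k0) (hk _ _).
apply/eqP; rewrite -subr_eq0 -cabs_eq0 eq_le cabs_ge0 andbT.
apply/ler_addgt0Pl => e e0; rewrite addr0.
have e1 : 0 < e / (1 + L2norm (b i)) by rewrite divr_gt0 // ltr_pwDl // L2norm_ge0.
have [k0 hk] := small _ e1.
pose k := maxn k0 i.+1.
have iM : (i < M k)%N.
  apply: leq_trans (leq_maxr k0 i.+1) _; rewrite -/k /M.
  apply: (@leq_trans k.+1) => //; rewrite -[leqLHS]card_ord -sum1_card.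
  exact: leq_sum.
have -> : ip x (b i) - a i = ip (fun t => x t - u k t) (b i).
  by rewrite ipB // ip_partial_sum_basis iM.
apply: le_trans (CS_ip (L2B hx (hu k)) (hb i)) _.
apply: le_trans (ler_wpM2r (L2norm_ge0 _ _) (le_trans (xu k) (hk k (leq_maxl _ _)))) _.
by rewrite mulrAC ler_pdivrMr ?ltr_pwDl ?L2norm_ge0 // ler_pM2l // lerDr.
Qed.

Definition syn (a : H) : R -> R[i] := s2val (cid2 (riesz_fischer a)).

Lemma L2_syn (a : H) : L2 (syn a). Proof. exact: (s2valP (cid2 (riesz_fischer a))). Qed.
Hint Resolve L2_syn : core.

Lemma ip_syn (a : H) i : ip (syn a) (b i) = a i.
Proof. by have [+ _] := s2valP' (cid2 (riesz_fischer a)); exact. Qed.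

Lemma syn_approx (a : H) e : 0 < e -> exists N, L2norm (fun t => syn a t - partial_sum a N t) <= e.
Proof. by have [_] := s2valP' (cid2 (riesz_fischer a)); exact. Qed.

Lemma cf_syn (a : H) : cf (syn a) = a.
Proof. by apply: ell2_ext => i; rewrite cfE // ip_syn. Qed.

Lemma cf_aeeq x y : L2 x -> L2 y -> aeeq x y -> cf x = cf y.
Proof.
move=> hx hy e; apply: ell2_ext => i; rewrite !cfE //.
by apply: ip_aeeq => //; exact: aeeq_refl.
Qed.

Lemma cfD x y : L2 x -> L2 y -> cf (fun t => x t + y t) = cf x + cf y.
Proof.
move=> hx hy; have h := L2D hx hy.
by apply: ell2_ext => i; rewrite lcoefD !cfE // ipD.
Qed.

Lemma cfZ z x : L2 x -> cf (fun t => z * x t) = z *: cf x.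
Proof.
move=> hx; have h := L2Z z hx.
by apply: ell2_ext => i; rewrite lcoefZ !cfE // ipZ.
Qed.

Lemma cfB x y : L2 x -> L2 y -> cf (fun t => x t - y t) = cf x - cf y.
Proof.
move=> hx hy; have h := L2B hx hy.
by apply: ell2_ext => i; rewrite lcoefB !cfE // ipB.
Qed.

Lemma cf_inj x y : L2 x -> L2 y -> cf x = cf y -> aeeq x y.
Proof.
move=> hx hy e; have [_ _ comp] := onb; have h := L2B hx hy.
have : aeeq (fun t => x t - y t) (fun=> 0).
  by apply: comp => // i; rewrite -cfE // cfB // e subrr.
move/aeeqP => h0; apply/aeeqP; move: h0; apply: ae_S => t h0 Dt.
by apply/eqP; rewrite -subr_eq0 h0.
Qed.

Lemma syn_cf x : L2 x -> aeeq (syn (cf x)) x.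
Proof. by move=> hx; apply: cf_inj => //; exact: cf_syn. Qed.

Lemma nrm_cf x : L2 x -> nrm (cf x) = L2norm x.
Proof.
move=> hx; apply/eqP; rewrite eq_le; apply/andP; split.
  apply: nrm_le; first exact: L2norm_ge0.
  by move=> n; under eq_bigr do rewrite cfE //; exact: bessel.
rewrite -(L2norm_aeeq (L2_syn (cf x)) hx (syn_cf hx)).
apply/ler_addgt0Pr => e e0; have [N hN] := syn_approx (cf x) e0.
pose proof (L2normD (L2_partial_sum (cf x) N) (L2B (L2_syn (cf x)) (L2_partial_sum (cf x) N))) as h.
move: h; under eq_fun do rewrite addrC subrK; move/le_trans; apply; apply: lerD => //.
rewrite -(ler_pXn2r (ltn0Sn 1)) ?nnegrE ?L2norm_ge0 ?nrm_ge0 // L2norm_partial_sum.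
exact: psum_nrm.
Qed.

Lemma is_ell2J (a : nat -> R[i]) : is_ell2 a -> is_ell2 (fun i => (a i)^*).
Proof. by move=> ha; apply: (is_ell2_le (M := 1) ha) => i; rewrite cabsJ mul1r. Qed.

Lemma csummable_cf x y : csummable (fun i => cf x i * (cf y i)^*).
Proof.
under eq_fun do rewrite mulrC.
by apply: csummable_CS; apply: is_ell2J; exact: coefP.
Qed.

(** Both sides are continuous in x and agree on partial sums; the error is controlled by the
    distance from x to a partial sum. *)
Lemma ip_cf x y : L2 x -> L2 y -> ip x y = csum (fun i => cf x i * (cf y i)^*).
Proof.
move=> hx hy; apply/eqP; rewrite -subr_eq0 -cabs_eq0 eq_le cabs_ge0 andbT.
apply/ler_addgt0Pl => e e0; rewrite addr0.
have e1 : 0 < e / (1 + 2 * L2norm y) by rewrite divr_gt0 // ltr_pwDl // mulr_ge0 // L2norm_ge0.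
have [N hN] := syn_approx (cf x) e1.
set s := partial_sum (cf x) N in hN; have hs : L2 s by exact: L2_partial_sum.
have hN' : L2norm (fun t => x t - s t) <= e / (1 + 2 * L2norm y).
  apply: le_trans hN; rewrite (L2norm_aeeq (y := fun t => syn (cf x) t - s t)) //; try exact: L2B.
  by apply: (aeeq_map2 (fun u v => u - v)); [apply: aeeq_sym; exact: syn_cf|exact: aeeq_refl].
have hd := L2B hx hs.
have Es : ip s y = csum (fun i => cf s i * (cf y i)^*).
  rewrite ip_partial_sum // (csum_fin (N := N)) => [|i Ni]; last first.
    by rewrite cfE // ip_partial_sum_basis ltnNge Ni mul0r.
  by apply: eq_bigr => i _; rewrite (cfE _ hs) (cfE _ hy) ip_partial_sum_basis ltn_ord.
have -> : ip x y - csum (fun i => cf x i * (cf y i)^*) =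
  ip (fun t => x t - s t) y - csum (fun i => cf (fun t => x t - s t) i * (cf y i)^*).
  rewrite (ipB hx hs hy) Es (cfB hx hs).
  rewrite (_ : (fun i => (cf x - cf s) i * (cf y i)^*) =
    (fun i => cf x i * (cf y i)^* - cf s i * (cf y i)^*)); last first.
    by apply/funext => i; rewrite lcoefB mulrBl.
  by rewrite (csumB (csummable_cf x y) (csummable_cf s y)) opprB addrA subrK.
apply: le_trans (cabsB _ _) _.
pose proof (CS_ip hd hy) as h1.
have h2 : cabs (csum (fun i => cf (fun t => x t - s t) i * (cf y i)^*)) <= L2norm y * L2norm (fun t => x t - s t).
  under eq_fun do rewrite mulrC.
  rewrite -(nrm_cf hd); apply: csum_CS; first exact: L2norm_ge0.
  by move=> n; under eq_bigr do rewrite cabsJ; rewrite -(nrm_cf hy); exact: psum_nrm.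
move: h1 h2 hN'; set u := L2norm _; set v := L2norm _ => h1 h2.
rewrite ler_pdivlMr; last by rewrite ltr_pwDl // mulr_ge0 // L2norm_ge0.
by have := L2norm_ge0 omega (fun t => x t - s t); rewrite -/u; nra.
Qed.

Opaque cf syn.

(** The operator that acts on coordinates as T. Synthesis picks a representative, so identities
    between such operators hold up to [aeeq]. *)
Definition lift (T : H -> H) (x : R -> R[i]) : R -> R[i] := syn (T (cf x)).

Lemma cf_lift T x : cf (lift T x) = T (cf x). Proof. exact: cf_syn. Qed.

Lemma bounded_lift (T : H -> H) M :
  (forall z (a c : H), T (z *: a + c) = z *: T a + T c) ->
  (forall a : H, nrm (T a) <= M * nrm a) -> bounded_op omega (lift T).
Proof.
move=> linT TM; split=> [x _|z x y hx hy|]; first exact: L2_syn.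
  have hz := L2Z z hx; have hxy := L2D hz hy.
  have := cf_lift T (fun t => z * x t + y t); rewrite (cfD hz hy) (cfZ z hx) linT.
  have : L2 (lift T (fun t => z * x t + y t)) by exact: L2_syn.
  have := cf_lift T x; have : L2 (lift T x) by exact: L2_syn.
  have := cf_lift T y; have : L2 (lift T y) by exact: L2_syn.
  move: (lift T _) (lift T x) (lift T y) => v w u hv ev hw ew hu eu.
  apply: (cf_inj hu (L2D (L2Z z hw) hv)).
  by rewrite (cfD (L2Z z hw) hv) (cfZ z hw) eu ev ew.
exists M => x hx; have h : L2 (lift T x) by exact: L2_syn.
by rewrite -(nrm_cf h) cf_lift -(nrm_cf hx).
Qed.

End OrthonormalBasis.

(** * Absolutely continuous functions *)

Section Primitives.
Context {R : realType} (omega : R) {omega_pos : positive_length omega}.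
Let omega_gt0 : 0 < omega := omega_pos.
Notation mu := (@lebesgue_measure R).
Notation D := (`[0, omega]%classic : set R).
Notation L2 := (@L2 R omega).
Notation L2norm := (@L2norm R omega).
Notation has_deriv := (@has_deriv R omega).
Implicit Types (f g F G : R -> R[i]) (z : R[i]).
Let mD : measurable D := measurable_D omega.

Lemma DP t : D t <-> 0 <= t <= omega.
Proof. by rewrite /= in_itv /=. Qed.

Lemma has_derivP f t l : has_deriv f t l <->
  forall e, 0 < e -> exists2 d, 0 < d & forall s, D s -> `|s - t| < d ->
    cabs (f s - f t - (s - t)%:C * l) <= e * `|s - t|.
Proof.
have key s : s != t -> cabs (f s - f t - (s - t)%:C * l) =
    cabs (((s - t)^-1)%:C * (f s - f t) - l) * `|s - t|.
  move=> st; rewrite -[`|s - t|]cabsR -cabsM; congr cabs; rewrite mulrBl.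
  have n0 : (s - t)%:C != 0 :> R[i] by rewrite -cabs_eq0 cabsR normr_eq0 subr_eq0.
  by rewrite fmorphV mulrAC mulVf // mul1r [l * _]mulrC.
split=> [/cvgrPdist_lt h e e0|h].
  have := h e e0; rewrite /within /= near_withinE /dnbhs /= => -[d /= d0 hd].
  exists d => // s Ds sd; have [->|st] := eqVneq s t.
    by rewrite !subrr mul0r subrr cabs0 normr0 mulr0.
  rewrite key // ler_wpM2r // ltW //.
  have := hd s; rewrite /ball_ /= distrC => /(_ sd st Ds).
  by rewrite sub0r normrN ger0_norm // cabs_ge0.
apply/cvgrPdist_lt => e e0; have [d d0 hd] := h (e / 2) (divr_gt0 e0 (ltr0n _ 2)).
exists d => //= s; rewrite /ball_ /= distrC => sd st Ds.
rewrite sub0r normrN ger0_norm ?cabs_ge0 //.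
have := hd s Ds sd; rewrite key // ler_pM2r ?normr_gt0 ?subr_eq0 //.
by move=> /le_lt_trans; apply; lra.
Qed.

(** A factor of modulus 1 rotates the integral onto the positive axis, where real parts can be
    compared. *)
Lemma cabs_cintegral (A : set R) f : measurable A -> cintble A f ->
  cabs (cintegral A f) <= \int[mu]_(t in A) cabs (f t).
Proof.
move=> mA hf; have [->|n0] := eqVneq (cintegral A f) 0.
  by rewrite cabs0; apply: Rintegral_ge0 => t _; exact: cabs_ge0.
set I := cintegral A f in n0 *; pose z := (I^* / (cabs I)%:C).
have cI : 0 < cabs I by rewrite cabs_gt0.
have cz : cabs z = 1 by rewrite cabsM cabsJ cabsV cabsR gtr0_norm // divff // gt_eqF.
have -> : cabs I = complex.Re (cintegral A (fun t => z * f t)).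
  rewrite cintegralZ // -/I /z mulrAC [_^* * _]mulrC mulcJ -fmorphV -rmorphM /=.
  by rewrite expr2 -mulrA divff ?mulr1 // gt_eqF.
rewrite Re_cintegral; apply: le_Rintegral => //.
- by have [] := cintbleZ z mA hf.
- exact: integrable_cabs.
- move=> t _; apply: le_trans (ler_norm _) (le_trans (Re_le_cabs _) _).
  by rewrite cabsM cz mul1r.
Qed.

Definition pint f t := cintegral `[0, t] f.

(** The single notion of regularity used below: for square-integrable f it yields absolute
    continuity, the almost everywhere derivative and integration by parts, and end-point values are
    plain values of F. *)
Definition primitive F f := forall t, D t -> F t = F 0 + pint f t.

Lemma cintble_sub (A : set R) f : measurable A -> A `<=` D -> cintble D f -> cintble A f.
Proof. by move=> mA AD [hr hi]; split; [move: hr|move: hi]; exact: integrableS. Qed.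

Lemma sub_D s t : 0 <= s -> t <= omega -> `]s, t] `<=` D.
Proof.
move=> s0 to u /=; rewrite !in_itv /= => /andP[su ut].
by rewrite (le_trans s0 (ltW su)) (le_trans ut).
Qed.

Lemma subc_D t : t <= omega -> `[0, t] `<=` D.
Proof. by move=> to u /=; rewrite !in_itv /= => /andP[-> /le_trans]; exact. Qed.

Lemma pintB f s t : cintble D f -> 0 <= s -> s <= t -> t <= omega ->
  pint f t - pint f s = cintegral `]s, t] f.
Proof.
move=> hf s0 st to; have [hr hi] := cintble_sub (measurable_itv _) (subc_D to) hf.
rewrite /pint /cintegral; apply/eqP; rewrite eq_complex /=; apply/andP; split; apply/eqP.
  by rewrite -(Rintegral_itvB hr) ?bnd_simp.
by rewrite -(Rintegral_itvB hi) ?bnd_simp.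
Qed.

Lemma pint0 f : pint f 0 = 0.
Proof. by rewrite /pint /cintegral set_itv1 !Rintegral_set1. Qed.

Lemma pint_lip f s t M : cintble D f -> 0 <= s -> s <= t -> t <= omega ->
  (forall u, s < u <= t -> cabs (f u) <= M) -> cabs (pint f t - pint f s) <= M * (t - s).
Proof.
move=> hf s0 st to fM; have m : measurable `]s, t] by exact: measurable_itv.
have h := cintble_sub m (sub_D s0 to) hf.
have muE : mu `]s, t] = (t - s)%:E.
  rewrite lebesgue_measure_itv /= lte_fin -EFinD; case: ltP => // ts.
  by have -> : t = s; [apply/eqP; rewrite eq_le ts st|rewrite subrr].
have muf : (mu `]s, t] < +oo)%E by rewrite muE ltry.
rewrite pintB //; apply: le_trans (cabs_cintegral m h) _.
have -> : M * (t - s) = \int[mu]_(u in `]s, t]) M.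
  by rewrite Rintegral_cst //; congr (_ * _); have := congr1 fine muE.
apply: le_Rintegral => //; first exact: integrable_cabs.
  exact: integrable_cst_fin.
Qed.

Lemma pintD f g t : t <= omega -> cintble D f -> cintble D g ->
  pint (fun u => f u + g u) t = pint f t + pint g t.
Proof. by move=> to hf hg; apply: cintegralD => //; apply: cintble_sub (subc_D to) _. Qed.

Lemma pintZ f z t : t <= omega -> cintble D f -> pint (fun u => z * f u) t = z * pint f t.
Proof. by move=> to hf; apply: cintegralZ => //; apply: cintble_sub (subc_D to) _. Qed.

Lemma pint_cst z t : 0 <= t -> pint (fun=> z) t = t%:C * z.
Proof.
move=> t0; have muE : mu `[0, t] = t%:E.
  rewrite lebesgue_measure_itv /= lte_fin oppr0 addr0; case: ltP => // ts.
  by have -> : t = 0 by apply/eqP; rewrite eq_le ts t0.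
have E c : \int[mu]_(u in `[0, t]) c = t * c.
  by rewrite Rintegral_cst // mulrC; congr (_ * _); have := congr1 fine muE.
rewrite /pint /cintegral !E; apply/eqP; rewrite eq_complex /=.
by case: z => a b /=; rewrite !mul0r subr0 addr0 !eqxx.
Qed.

Lemma cintble_cst z : cintble D (fun=> z).
Proof. by apply: L2_cintble; exact: L2_cst. Qed.

Definition cont_on F := forall t, D t -> forall e, 0 < e -> exists2 d, 0 < d &
  forall s, D s -> `|s - t| < d -> cabs (F s - F t) <= e.

Lemma cont_on_cmf F : cont_on F -> cmf D F.
Proof.
move=> cF.
have key (h : R[i] -> R) : (forall z w, `|h z - h w| <= cabs (z - w)) ->
    measurable_fun D (fun t => h (F t)).
  move=> hz; apply: (@subspace_continuous_measurable_fun R D (fun t => h (F t)) mD).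
  apply/subspace_continuousP => t Dt; apply/cvgrPdist_le => e e0.
  have [d d0 hd] := cF t Dt e e0.
  rewrite near_withinE; exists d => //= s; rewrite /ball_ /= => sd Ds.
  rewrite distrC; apply: le_trans (hz _ _) _; apply: hd => //.
  by rewrite distrC.
split.
  by apply: (key (@complex.Re R)) => -[a b] [c d] /=; exact: (Re_le_cabs ((a +i* b) - (c +i* d))).
by apply: (key (@complex.Im R)) => -[a b] [c d] /=; exact: (Im_le_cabs ((a +i* b) - (c +i* d))).
Qed.

Lemma has_deriv_pint f t : cintble D f -> D t ->
  (forall e, 0 < e -> exists2 d, 0 < d & forall s, D s -> `|s - t| < d -> cabs (f s - f t) <= e) ->
  has_deriv (pint f) t (f t).
Proof.
move=> hf Dt cf; apply/has_derivP => e e0; have [d d0 hd] := cf e e0.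
exists d => // s Ds sd; have /DP/andP[t0 to] := Dt; have /DP/andP[s0 so] := Ds.
have hg : cintble D (fun u => f u + - f t) by apply: cintbleD => //; exact: cintble_cst.
have E u : D u -> pint (fun u => f u + - f t) u = pint f u - u%:C * f t.
  move=> /DP/andP[u0 uo]; rewrite pintD //; last exact: cintble_cst.
  by rewrite pint_cst // mulrN.
have -> : pint f s - pint f t - (s - t)%:C * f t =
    pint (fun u => f u + - f t) s - pint (fun u => f u + - f t) t.
  by rewrite !E // rmorphB /=; ring.
have [st|ts] := leP t s.
  rewrite ger0_norm ?subr_ge0 //; apply: pint_lip => // u /andP[tu us].
  apply: hd; first by rewrite /= in_itv /= (le_trans t0 (ltW tu)) (le_trans us).
  by apply: le_lt_trans sd; rewrite !ger0_norm ?subr_ge0 ?(ltW tu) // lerD2r.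
rewrite ler0_norm ?subr_le0 ?(ltW ts) // opprB cabs_distC; apply: pint_lip => //; first exact: ltW.
move=> u /andP[su ut].
apply: hd; first by rewrite /= in_itv /= (le_trans s0 (ltW su)) (le_trans ut).
apply: le_lt_trans sd; rewrite !ler0_norm ?subr_le0 ?(ltW ts) //.
by rewrite !opprB lerD2l lerN2 ltW.
Qed.

(** Lebesgue differentiation for f extended by 0: inside the interval the integral from minus
    infinity equals the one from 0, and a two-sided derivative restricts to the one relative to the
    interval. *)
Lemma real_ae_deriv (f : R -> R) : mu.-integrable D (EFin \o f) ->
  {ae mu, forall t, D t -> forall e, 0 < e -> exists2 d, 0 < d &
    forall s, D s -> `|s - t| < d ->
    `|\int[mu]_(u in `[0, s]) f u - \int[mu]_(u in `[0, t]) f u - (s - t) * f t| <= e * `|s - t|}.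
Proof.
move=> hf; pose g := f \_ D.
have ig : mu.-integrable setT (EFin \o g).
  by rewrite /g -restrict_EFin -integrable_mkcond.
have E s : D s -> \int[mu]_(u in `[0, s]) f u = \int[mu]_(u in `]-oo, s]) g u.
  move=> /DP/andP[_ so]; rewrite Rintegral_mkcond [RHS]Rintegral_mkcond; congr Rintegral.
  apply/funext => u; rewrite /g !patchE.
  have -> : (u \in `[0, s]%classic) = (u \in `]-oo, s]%classic) && (u \in D).
    rewrite !mem_setE !in_itv /= andbC; case: (leP u s) => us; rewrite ?andbF //=.
    by rewrite (le_trans us so) !andbT.
  by case: (u \in `]-oo, s]%classic).
have iy y : mu.-integrable `]-oo, y] (EFin \o g) by exact: integrableS ig.
have := FTC1Ny iy (integrable_locally mD hf); apply: ae_S => t [dv dE] Dt e e0.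
pose F := (fun x : R => \int[mu]_(u in `]-oo, x]) g u); rewrite -/F in dv dE.
have dF : derive F t 1 = g t by rewrite -derive1E.
 have := dv; rewrite /derivable => cv.
have : (h^-1 *: (F (h *: 1 + t) - F t)) @[h --> 0^'] --> g t by rewrite -dF; exact: cv.
move/cvgrPdist_le => /(_ e e0)[d /= d0 hd].
exists d => // s Ds sd; rewrite !E // -!/(F _).
have -> : f t = g t by rewrite /g patchE mem_set.
have [->|st] := eqVneq s t; first by rewrite !subrr mul0r subrr normr0 mulr0.
have n0 : s - t != 0 by rewrite subr_eq0.
have := hd (s - t); rewrite /ball_ /= sub0r normrN => /(_ sd n0).
rewrite /GRing.scale /= mulr1 subrK distrC => h1.
have -> : F s - F t - (s - t) * g t = ((s - t)^-1 * (F s - F t) - g t) * (s - t).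
  by field.
by rewrite normrM ler_wpM2r.
Qed.

Lemma ae_has_deriv_pint f : cintble D f ->
  {ae mu, forall t, D t -> has_deriv (pint f) t (f t)}.
Proof.
move=> hf; have [hr hi] := hf.
move: (real_ae_deriv hr) (real_ae_deriv hi); apply: ae_S2 => t dr di Dt.
apply/has_derivP => e e0; have e2 : 0 < e / 2 by rewrite divr_gt0.
have [d1 d10 h1] := dr Dt _ e2; have [d2 d20 h2] := di Dt _ e2.
exists (Num.min d1 d2) => [|s Ds]; first by rewrite lt_min d10.
rewrite lt_min => /andP[s1 s2]; apply: le_trans (cabs_le_ReIm _) _.
have -> : complex.Re (pint f s - pint f t - (s - t)%:C * f t) =
  \int[mu]_(u in `[0, s]) complex.Re (f u) - \int[mu]_(u in `[0, t]) complex.Re (f u) - (s - t) * complex.Re (f t).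
  by rewrite /pint /cintegral; case: (f t) => a b /=; ring.
have -> : complex.Im (pint f s - pint f t - (s - t)%:C * f t) =
  \int[mu]_(u in `[0, s]) complex.Im (f u) - \int[mu]_(u in `[0, t]) complex.Im (f u) - (s - t) * complex.Im (f t).
  by rewrite /pint /cintegral; case: (f t) => a b /=; ring.
by have := lerD (h1 s Ds s1) (h2 s Ds s2); rewrite -mulrDl -splitr.
Qed.

End Primitives.

(** * Absolute continuity and primitives *)

Section AbsoluteContinuity.
Context {R : realType} (omega : R) {omega_pos : positive_length omega}.
Let omega_gt0 : 0 < omega := omega_pos.
Notation mu := (@lebesgue_measure R).
Notation D := (`[0, omega]%classic : set R).
Notation L2 := (@L2 R omega).
Notation L2norm := (@L2norm R omega).
Notation has_deriv := (@has_deriv R omega).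
Notation cont_on := (@cont_on R omega).
Notation primitive := (@primitive R omega).
Implicit Types (f g F G : R -> R[i]) (z : R[i]) (s : seq (R * R)).
Let mD : measurable D := measurable_D omega.
Let DP t : D t <-> 0 <= t <= omega. Proof. exact: DP. Qed.

Let L2i f : L2 f -> cintble D f. Proof. exact: L2_cintble. Qed.
Let ae_pint f : cintble D f -> {ae mu, forall t, D t -> has_deriv (pint f) t (f t)}.
Proof. exact: ae_has_deriv_pint. Qed.

Definition subdivision (T : R) s := (forall p, p \in s -> [/\ 0 <= p.1, p.1 <= p.2 & p.2 <= T]) /\
  pairwise (fun p p' => (p.2 <= p'.1) || (p'.2 <= p.1)) s.

(* The points up to which the variation of [h] is at most [e] times the length, apart from
   its variation over disjoint intervals covering [N], form a set that contains its
   supremum and extends beyond it. *)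
Lemma has_deriv0_cst (h : R -> R[i]) (N : set R) :
  (forall t, D t -> ~ N t -> has_deriv h t 0) ->
  (forall e, 0 < e -> exists W, [/\ open W, D `&` N `<=` W &
     forall s, subdivision omega s -> ((\sum_(p <- s) (p.2 - p.1))%:E <= mu W)%E ->
       \sum_(p <- s) cabs (h p.2 - h p.1) <= e]) ->
  forall t, D t -> h t = h 0.
Proof.
move=> dh hN T /DP/andP[T0 To]; apply/eqP; rewrite -subr_eq0 -cabs_eq0 eq_le cabs_ge0 andbT.
apply/ler_addgt0Pl => e' e'0; rewrite addr0.
pose e := e' / (1 + omega).
have e0 : 0 < e by rewrite divr_gt0 // ltr_pwDl // ltW.
have [W [oO NO hO]] := hN e e0; have mO : measurable W by exact: open_measurable.
pose P t := exists s, [/\ subdivision t s, ((\sum_(p <- s) (p.2 - p.1))%:E <= mu (W `&` `[0%R, t]))%E &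
  cabs (h t - h 0) <= e * t + \sum_(p <- s) cabs (h p.2 - h p.1)].
have mI (a : R) : measurable (W `&` `[0%R, a]) by exact: measurableI.
have extA t t' : P t -> 0 <= t -> t <= t' -> cabs (h t' - h t) <= e * (t' - t) -> P t'.
  move=> [s [[s1 s2] sO sh]] t0 tt' ht; exists s; split.
  - by split=> // p /s1[p1 p2 p3]; split => //; exact: le_trans tt'.
  - apply: le_trans sO _; apply: le_measure; [rewrite inE; exact: mI|rewrite inE; exact: mI|].
    by apply: setIS => u /=; rewrite !in_itv /= => /andP[-> /le_trans]; exact.
  - apply: le_trans (cabs_distD (h t) _ _) _; lra.
have extB t t' : P t -> 0 <= t -> t <= t' -> (forall u, t < u <= t' -> W u) -> P t'.
  move=> [s [[s1 s2] sO sh]] t0 tt' tO; exists ((t, t') :: s); split.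
  - split; last first.
      rewrite /= s2 andbT; apply/allP => p /s1[p1 p2 p3] /=; apply/orP; right; exact: p3.
    move=> p; rewrite inE => /orP[/eqP ->|/s1[p1 p2 p3]] //=; split => //; exact: le_trans tt'.
  - rewrite big_cons /=.
    have muI : mu `]t, t'] = (t' - t)%:E.
      rewrite lebesgue_measure_itv /= lte_fin -EFinD; case: ltP => // ts.
      by have -> : t = t'; [apply/eqP; rewrite eq_le ts tt'|rewrite subrr].
    rewrite EFinD addeC -muI; apply: le_trans (leeD sO (le_refl _)) _.
    have -> : (mu (W `&` `[0%R, t]) + mu `]t, t'] = mu ((W `&` `[0%R, t]) `|` `]t, t']))%E.
      apply/esym; apply: measureU; [exact: mI|exact: measurable_itv|].
      apply/seteqP; split=> // u /= [[_]]; rewrite !in_itv /= => /andP[_ ut] /andP[tu _].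
      by move: (lt_le_trans tu ut); rewrite ltxx.
    have mU : measurable (W `&` `[0, t] `|` `]t, t']) by apply: measurableU.
    apply: le_measure; [rewrite inE; exact: mU|rewrite inE; exact: mI|].
    move=> u [[Ou]|] /=; rewrite !in_itv /=.
      by move=> /andP[-> ut]; split => //; exact: le_trans tt'.
    move=> /andP[tu ut']; split; first by apply: tO; rewrite tu.
    by rewrite ut' (le_trans t0 (ltW tu)).
  - rewrite big_cons /=; apply: le_trans (cabs_distD (h t) _ _) _.
    have : e * t <= e * t' by rewrite ler_pM2l.
    by lra.
pose S := [set t | 0 <= t <= T /\ P t].
have S0 : S 0.
  split; first by rewrite lexx.
  by exists [::]; split; rewrite ?big_nil ?subrr ?cabs0 ?mulr0 ?addr0 //; split.
have Sub : has_ubound S by exists T => t [/andP[]].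
have Sne : S !=set0 by exists 0.
pose c := sup S.
have c0 : 0 <= c by exact: ub_le_sup.
have cT : c <= T by apply: ge_sup => // t [/andP[]].
have Dc : D c by apply/DP; rewrite c0 (le_trans cT).
have near d : 0 < d -> exists2 t, P t & [/\ 0 <= t, t <= c & c - d < t].
  move=> d0; have [t [tT Pt] ct] := sup_adherent d0 (conj Sne Sub).
  exists t => //; case/andP: tT => t0 tT; split => //.
  by apply: ub_le_sup => //; split => //; rewrite t0.
(* Beyond the supremum c one moves through an interval contained in W if c is exceptional, and by
   the zero derivative at c otherwise. *)
have step : exists2 d, 0 < d & forall t', D t' -> c <= t' -> t' < c + d -> P t'.
  have [Nc|nNc] := pselect (N c).
    have /oO : W c by apply: NO.
    rewrite /interior /= -nbhs_ballE => -[d /= d0 hd].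
    exists d => // t' Dt' ct' t'd; have [t Pt [t0 tc ct]] := near d d0.
    apply: (extB t t' Pt t0 (le_trans tc ct')) => u /andP[tu ut'].
    apply: hd; rewrite /ball /= ltr_norml; apply/andP; split; lra.
  have /has_derivP/(_ _ e0)[d d0 hd] := dh c Dc nNc.
  exists d => // t' Dt' ct' t'd; have [t Pt [t0 tc ct]] := near d d0.
  have Dt : D t by apply/DP; rewrite t0 (le_trans tc (le_trans cT To)).
  have Pc : P c.
    apply: (extA t c Pt t0 tc).
    have := hd t Dt; rewrite ler0_norm ?subr_le0 // mulr0 subr0 opprB cabs_distC; apply; lra.
  apply: (extA c t' Pc c0 ct').
  have := hd t' Dt'; rewrite ger0_norm ?subr_ge0 // mulr0 subr0; apply; lra.
have [d d0 hd] := step.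
have PT : P T.
  have [cT'|Tc] := ltP c T; last by apply: hd; [apply/DP; rewrite T0|exact: cT|apply: le_lt_trans Tc _; rewrite ltrDl].
  pose t' := Num.min (c + d / 2) T.
  have ct' : c < t' by rewrite lt_min cT' andbT ltrDl divr_gt0.
  have t'T : t' <= T by rewrite ge_min lexx orbT.
  have t'd : t' < c + d by apply: (@le_lt_trans _ _ (c + d / 2)); rewrite ?ge_min ?lexx // ltrD2l; lra.
  have Dt' : D t' by apply/DP; rewrite (le_trans c0 (ltW ct')) (le_trans t'T).
  have St' : S t' by split; [rewrite (le_trans c0 (ltW ct'))|exact: (hd t' Dt' (ltW ct') t'd)].
  by have := ub_le_sup Sub St'; rewrite -/c leNgt ct'.
have [s [[s1 s2] sO sh]] := PT.
have := hO s; have hs : subdivision omega s.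
  by split=> // p /s1[p1 p2 p3]; split => //; exact: le_trans To.
move=> /(_ hs) hle; have {}hle : \sum_(p <- s) cabs (h p.2 - h p.1) <= e.
  apply: hle; apply: le_trans sO _; apply: le_measure; [rewrite inE; exact: mI|rewrite inE; exact: mO|exact: subIsetl].
have : e * T <= e * omega by rewrite ler_pM2l.
have : e * (1 + omega) = e' by rewrite /e divfK // gt_eqF // ltr_pwDl // ltW.
by rewrite mulrDr mulr1; lra.
Qed.

Lemma has_derivB f g t l k : has_deriv f t l -> has_deriv g t k ->
  has_deriv (fun u => f u - g u) t (l - k).
Proof.
move=> /has_derivP hf /has_derivP hg; apply/has_derivP => e e0.
have e2 : 0 < e / 2 by rewrite divr_gt0.
have [d1 d10 h1] := hf _ e2; have [d2 d20 h2] := hg _ e2.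
exists (Num.min d1 d2) => [|s Ds]; first by rewrite lt_min d10.
rewrite lt_min => /andP[s1 s2].
have -> : f s - g s - (f t - g t) - (s - t)%:C * (l - k) =
  (f s - f t - (s - t)%:C * l) - (g s - g t - (s - t)%:C * k) by ring.
apply: le_trans (cabsB _ _) _.
by have := lerD (h1 s Ds s1) (h2 s Ds s2); rewrite -mulrDl -splitr.
Qed.

Lemma has_deriv_cont f t l : has_deriv f t l -> forall e, 0 < e ->
  exists2 d, 0 < d & forall s : R, D s -> `|s - t| < d -> cabs (f s - f t) <= e.
Proof.
move=> /has_derivP hf e e0; have [d d0 hd] := hf 1 ltr01.
have q0 : 0 < 1 + cabs l by rewrite ltr_pwDl // cabs_ge0.
exists (Num.min d (e / (1 + cabs l))) => [|s Ds]; first by rewrite lt_min d0 divr_gt0.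
rewrite lt_min => /andP[sd]; rewrite ltr_pdivlMr // => se.
have := cabsD (f s - f t - (s - t)%:C * l) ((s - t)%:C * l); rewrite subrK cabsM cabsR.
by have := hd s Ds sd; move: se; rewrite mulrDr mulr1 mul1r; lra.
Qed.

Lemma has_derivM f g t l k : has_deriv f t l -> has_deriv g t k ->
  has_deriv (fun u => f u * g u) t (l * g t + f t * k).
Proof.
move=> hf hg; have cg := has_deriv_cont hg.
move/has_derivP : hf => hf; move/has_derivP : hg => hg; apply/has_derivP => e e0.
pose q := 1 + cabs l + cabs (f t) + cabs (g t) + 1.
have c1 := cabs_ge0 l; have c2 := cabs_ge0 (f t); have c3 := cabs_ge0 (g t).
have q0 : 0 < q by rewrite /q; lra.
have eq : 0 < e / (3 * q) by rewrite divr_gt0 // mulr_gt0.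
have [d1 d10 h1] := hf _ eq; have [d2 d20 h2] := hg _ eq.
have m0 : 0 < Num.min 1 (e / (3 * q)) by rewrite lt_min ltr01.
have [d3 d30 h3] := cg _ m0.
exists (Num.min d1 (Num.min d2 d3)) => [|s Ds]; first by rewrite !lt_min d10 d20.
rewrite !lt_min => /andP[s1 /andP[s2 s3]].
have {h1}h1 := h1 s Ds s1; have {h2}h2 := h2 s Ds s2.
have := h3 s Ds s3; rewrite le_min => /andP[h31 h32].
have -> : f s * g s - f t * g t - (s - t)%:C * (l * g t + f t * k) =
  (f s - f t - (s - t)%:C * l) * g s + ((s - t)%:C * l * (g s - g t) +
    f t * (g s - g t - (s - t)%:C * k)) by ring.
apply: le_trans (cabsD _ _) _; apply: le_trans (lerD (lexx _) (cabsD _ _)) _.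
rewrite !cabsM cabsR.
have gs : cabs (g s) <= 1 + cabs (g t).
  by have := cabsD (g s - g t) (g t); rewrite subrK; lra.
have E : e = (e / (3 * q)) * (3 * q) by rewrite divfK // gt_eqF // mulr_gt0.
rewrite [X in _ <= X * _]E; set v := `|s - t|; have v0 : 0 <= v by exact: normr_ge0.
move: (e / (3 * q)) eq h1 h2 h32 => r r0 h1 h2 h32.
have b1 : cabs (f s - f t - (s - t)%:C * l) * cabs (g s) <= r * v * (1 + cabs (g t)).
  by apply: ler_pM => //; rewrite cabs_ge0.
have b2 : v * cabs l * cabs (g s - g t) <= v * cabs l * r.
  by apply: ler_wpM2l => //; rewrite mulr_ge0.
have b3 : cabs (f t) * cabs (g s - g t - (s - t)%:C * k) <= cabs (f t) * (r * v).
  exact: ler_wpM2l.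
have rv : 0 <= r * v by rewrite mulr_ge0 // ltW.
rewrite /q; move: b1 b2 b3 rv c1 c2 c3; set x := cabs l; set y := cabs (f t); set w := cabs (g t).
have -> : r * (3 * (1 + x + y + w + 1)) * v = r * v * (3 * (1 + x + y + w + 1)) by ring.
have -> : v * x * r = r * v * x by ring.
rewrite [y * (r * v)]mulrC; set m := r * v; nra.
Qed.

Definition AC F := @abs_continuous R omega F.

Lemma ACP F : AC F <-> forall e, 0 < e -> exists2 d, 0 < d & forall s, subdivision omega s ->
  \sum_(p <- s) (p.2 - p.1) < d -> \sum_(p <- s) cabs (F p.2 - F p.1) < e.
Proof.
split=> h e e0; have [d d0 hd] := h e e0; exists d => // s; first by case; exact: hd.
by move=> s1 s2; apply: hd.
Qed.

Lemma ACB F G : AC F -> AC G -> AC (fun t => F t - G t).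
Proof.
move=> /ACP hF /ACP hG; apply/ACP => e e0.
have e2 : 0 < e / 2 by rewrite divr_gt0.
have [d1 d10 h1] := hF _ e2; have [d2 d20 h2] := hG _ e2.
exists (Num.min d1 d2) => [|s hs]; first by rewrite lt_min d10.
rewrite lt_min => /andP[s1 s2].
apply: (@le_lt_trans _ _ (\sum_(p <- s) (cabs (F p.2 - F p.1) + cabs (G p.2 - G p.1)))).
  apply: ler_sum => p _; apply: le_trans (cabsB _ _).
  by rewrite le_eqVlt; apply/orP; left; apply/eqP; congr cabs; ring.
by rewrite big_split /=; have := h1 s hs s1; have := h2 s hs s2; lra.
Qed.

Lemma AC_cont F : AC F -> cont_on F.
Proof.
move=> /ACP hF t Dt e e0; have [d d0 hd] := hF e e0; exists d => // s Ds sd.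
have /DP/andP[t0 to] := Dt; have /DP/andP[s0 so] := Ds.
have [st|ts] := leP s t.
  have := hd [:: (s, t)]; rewrite !big_cons !big_nil !addr0 /= cabs_distC => h; apply/ltW/h.
    by split => //= p; rewrite inE => /eqP ->.
  by move: sd; rewrite ler0_norm ?subr_le0 // opprB.
have := hd [:: (t, s)]; rewrite !big_cons !big_nil !addr0 /= => h; apply/ltW/h.
  by split => //= p; rewrite inE => /eqP ->; split => //; exact: ltW.
by move: sd; rewrite gtr0_norm ?subr_gt0.
Qed.

Lemma ACM F G B : AC F -> AC G -> (forall t, D t -> cabs (F t) <= B /\ cabs (G t) <= B) ->
  AC (fun t => F t * G t).
Proof.
move=> /ACP hF /ACP hG FG; apply/ACP => e e0.
have B0 : 0 <= B by have [] := FG 0 _; [apply/DP; rewrite lexx ltW|move=> /(le_trans (cabs_ge0 _))].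
have e2 : 0 < e / (2 * (1 + B)) by rewrite divr_gt0 // mulr_gt0 // ltr_pwDl.
have [d1 d10 h1] := hF _ e2; have [d2 d20 h2] := hG _ e2.
exists (Num.min d1 d2) => [|s hs]; first by rewrite lt_min d10.
rewrite lt_min => /andP[s1 s2].
apply: (@le_lt_trans _ _ (B * \sum_(p <- s) cabs (F p.2 - F p.1) + B * \sum_(p <- s) cabs (G p.2 - G p.1))).
  rewrite !mulr_sumr -big_split /= big_seq [leRHS]big_seq; apply: ler_sum => p ps.
  have [p1 p2 p3] := hs.1 p ps.
  have D1 : D p.1 by apply/DP; rewrite p1 (le_trans p2).
  have D2 : D p.2 by apply/DP; rewrite (le_trans p1 p2).
  have -> : F p.2 * G p.2 - F p.1 * G p.1 = G p.2 * (F p.2 - F p.1) + F p.1 * (G p.2 - G p.1) by ring.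
  apply: le_trans (cabsD _ _) _; rewrite !cabsM; apply: lerD; apply: ler_wpM2r; rewrite ?cabs_ge0 //.
    by case: (FG _ D2).
  by case: (FG _ D1).
have := h1 s hs s1; have := h2 s hs s2.
set a := \sum_(p <- s) _; set b := \sum_(p <- s) _ => ha hb.
apply: (@le_lt_trans _ _ (B * (e / (1 + B)))).
  rewrite -mulrDr ler_wpM2l //.
  have -> : e / (1 + B) = e / (2 * (1 + B)) + e / (2 * (1 + B)) by field; rewrite gt_eqF // ltr_pwDl.
  lra.
by rewrite mulrA ltr_pdivrMr ?ltr_pwDl // mulrC ltr_pM2l //; lra.
Qed.

(** The half-open intervals of a subdivision are disjoint, so their integrals add up to the integral
    over a subset of the whole interval. *)
Lemma sum_integral_subdivision (f : R -> \bar R) s : measurable_fun D f ->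
  (forall t, D t -> 0 <= f t)%E -> subdivision omega s ->
  (\sum_(p <- s) \int[mu]_(t in `]p.1, p.2]) f t <= \int[mu]_(t in D) f t)%E.
Proof.
move=> mf f0 [s1 s2].
pose U s := [set t | exists2 p, p \in s & p.1 < t <= p.2].
have sub s' : {subset s' <= s} -> U s' `<=` D.
  move=> ss t /= [p /ss/s1[p1 p2 p3] /andP[pt tp]]; rewrite in_itv /=.
  by rewrite (le_trans p1 (ltW pt)) (le_trans tp).
have UE p s' : U (p :: s') = `]p.1, p.2] `|` U s'.
  apply/seteqP; split=> t /=.
    by move=> [p']; rewrite inE => /orP[/eqP ->|ps] h; [left; rewrite in_itv|right; exists p'].
  case; first by rewrite in_itv /= => h; exists p => //; rewrite inE eqxx.
  by move=> [p' ps h]; exists p' => //; rewrite inE ps orbT.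
have mU s' : measurable (U s').
  elim: s' => [|p s' IH]; last by rewrite UE; apply: measurableU.
  have -> : U [::] = set0 by apply/seteqP; split=> t // -[].
  exact: measurable0.
have main s' : {subset s' <= s} -> pairwise (fun p p' => (p.2 <= p'.1) || (p'.2 <= p.1)) s' ->
   (\sum_(p <- s') \int[mu]_(t in `]p.1, p.2]) f t = \int[mu]_(t in U s') f t)%E.
  elim: s' => [|p s' IH] ss.
    have -> : U [::] = set0 by apply/seteqP; split=> t // -[].
    by rewrite big_nil integral_set0.
  rewrite /= => /andP[/allP pp ps]; rewrite big_cons IH // => [|q qs]; last by apply: ss; rewrite inE qs orbT.
  rewrite UE; apply/esym; apply: ge0_integral_setU; [exact: measurable_itv|exact: mU| | |].
  - by rewrite -UE; apply: measurable_funS mf => //; exact: sub.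
  - by move=> t Ut; apply: f0; apply: sub ss _ _; rewrite UE.
  - rewrite disj_set2E; apply/eqP/seteqP; split => // t /= [].
    rewrite in_itv /= => /andP[pt tp] [q qs /andP[qt tq]].
    have /orP[h|h] := pp q qs.
      by move: (lt_le_trans qt (le_trans tp h)); rewrite ltxx.
    by move: (lt_le_trans pt (le_trans tq h)); rewrite ltxx.
by rewrite main //; apply: ge0_subset_integral; [exact: mU|exact: mD|exact: mf|exact: f0|exact: sub].
Qed.

(** Pointwise |f| <= r |f|^2 + 1/r. Over a subdivision the first term contributes at most r times
    the integral of |f|^2, small by the choice of r; the second contributes the total length divided
    by r. *)
Lemma AC_pint f : L2 f -> AC (pint f).
Proof.
move=> hf; have If := L2i hf; apply/ACP => e e0.
pose B := omega * L2norm f ^+ 2; have B0 : 0 <= B by rewrite mulr_ge0 ?sqr_ge0 // ltW.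
pose r := e / (2 * (1 + B)).
have r0 : 0 < r by rewrite divr_gt0 // mulr_gt0 // ltr_pwDl.
exists (e * r / 2) => [|s hs ss]; first by rewrite divr_gt0 // mulr_gt0.
have mf := cmf_cabs2 (L2_cmf hf).
pose phi t := (r * cabs (f t) ^+ 2)%:E.
have phi0 t : (0 <= phi t)%E by rewrite lee_fin mulr_ge0 ?exprn_ge0 ?cabs_ge0 // ltW.
have mphi : measurable_fun D phi by apply/measurable_EFinP; exact: measurable_funM.
have step p : p \in s -> ((cabs (pint f p.2 - pint f p.1))%:E <=
    \int[mu]_(t in `]p.1, p.2]) phi t + (r^-1 * (p.2 - p.1))%:E)%E.
  move=> /hs.1[p1 p2 p3]; have m : measurable `]p.1, p.2] by exact: measurable_itv.
  have hp := cintble_sub m (sub_D p1 p3) If.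
  have ip : mu.-integrable `]p.1, p.2] (EFin \o (fun t => cabs (f t))) by exact: integrable_cabs.
  rewrite (pintB If p1 p2 p3); apply: le_trans (_ : (\int[mu]_(t in `]p.1, p.2]) (cabs (f t))%:E <= _)%E).
    rewrite -[leRHS]fineK; last by apply: integrable_fin_num.
    by rewrite lee_fin; exact: cabs_cintegral.
  have mp : measurable_fun `]p.1, p.2] phi by apply: measurable_funS mphi => //; exact: sub_D.
  have -> : ((r^-1 * (p.2 - p.1))%:E = \int[mu]_(t in `]p.1, p.2]) (r^-1)%:E)%E.
    rewrite integral_cst //= EFinM; congr (_ * _)%E.
    rewrite lebesgue_measure_itv /= lte_fin -EFinD; case: ltP => // ts.
    by have -> : p.1 = p.2; [apply/eqP; rewrite eq_le ts p2|rewrite subrr].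
  rewrite -ge0_integralD //; last by move=> t _; rewrite lee_fin invr_ge0 ltW.
  apply: ge0_le_integral => //.
  - by move=> t _; rewrite lee_fin cabs_ge0.
  - by apply: measurable_int ip.
  - by apply: emeasurable_funD.
  - move=> t _; rewrite /phi -EFinD lee_fin.
    have h := sqr_ge0 (r * cabs (f t) - 1).
    rewrite -(ler_pM2l r0) mulrDr divff ?gt_eqF // mulrA -expr2 -exprMn.
    by have := sqr_ge0 (r * cabs (f t)); set v := r * cabs (f t) in h *; nra.
rewrite -lte_fin -sumEFin.
apply: (@le_lt_trans _ _ (r * B + r^-1 * \sum_(p <- s) (p.2 - p.1))%:E); last first.
  rewrite lte_fin.
  have h1 : r * B <= e / 2.
    rewrite /r mulrAC ler_pdivrMr ?mulr_gt0 // ?ltr_pwDl //.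
    have -> : e / 2 * (2 * (1 + B)) = e * (1 + B) by field.
    by rewrite ler_pM2l // lerDr.
  have h2 : r^-1 * \sum_(p <- s) (p.2 - p.1) < e / 2.
    by rewrite mulrC ltr_pdivrMr // mulrAC.
  lra.
apply: (@le_trans _ _ (\sum_(p <- s) (\int[mu]_(t in `]p.1, p.2]) phi t + (r^-1 * (p.2 - p.1))%:E))%E).
  by rewrite big_seq [leRHS]big_seq; apply: lee_sum => p; exact: step.
rewrite big_split /= EFinD; apply: leeD.
  have -> : ((r * B)%:E = \int[mu]_(t in D) phi t)%E.
    rewrite /phi; under eq_integral do rewrite EFinM.
    rewrite ge0_integralZl //=.
    - by rewrite integral_sqr.
    - exact/measurable_EFinP.
    - by move=> t _; rewrite lee_fin exprn_ge0 ?cabs_ge0.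
    - by rewrite lee_fin ltW.
  exact: sum_integral_subdivision.
by rewrite sumEFin mulr_sumr.
Qed.

Lemma AC_ext F G : (forall t, D t -> F t = G t) -> AC F -> AC G.
Proof.
move=> FG /ACP hF; apply/ACP => e e0; have [d d0 hd] := hF e e0; exists d => // s hs ss.
apply: le_lt_trans (hd s hs ss); rewrite big_seq [leRHS]big_seq; apply: ler_sum => p ps.
have [p1 p2 p3] := hs.1 p ps.
have D1 : D p.1 by apply/DP; rewrite p1 (le_trans p2).
have D2 : D p.2 by apply/DP; rewrite (le_trans p1 p2).
by rewrite !FG.
Qed.

Lemma has_deriv_ext F G t l : (forall t, D t -> F t = G t) -> D t ->
  has_deriv F t l -> has_deriv G t l.
Proof.
move=> FG Dt /has_derivP h; apply/has_derivP => e e0; have [d d0 hd] := h e e0.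
by exists d => // s Ds sd; rewrite -!FG //; exact: hd.
Qed.

(** F - pint f is absolutely continuous and has derivative 0 off a null set. Outer regularity
    encloses that set in an open W whose measure is below the delta of absolute continuity, which is
    the hypothesis of [has_deriv0_cst]. *)
Lemma primitive_of_AC F f : AC F -> {ae mu, forall t, D t -> has_deriv F t (f t)} ->
  L2 f -> primitive F f.
Proof.
move=> aF dF hf t Dt.
have dh := ae_pint (L2i hf).
have : {ae mu, forall t, D t -> has_deriv (fun u => F u - pint f u) t 0}.
  move: dF dh; apply: ae_S2 => u d1 d2 Du.
  by rewrite -(subrr (f u)); apply: has_derivB; [exact: d1|exact: d2].
move=> [N [mN N0 sN]].
have aH : AC (fun u => F u - pint f u) by apply: ACB => //; exact: AC_pint.
suff : F t - pint f t = F 0 - pint f 0.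
  by rewrite pint0 subr0 => <-; rewrite subrK.
apply: (@has_deriv0_cst (fun u => F u - pint f u) N) => // [u Du nNu|e e0].
  by apply: contrapT => h; apply: nNu; apply: sN => /= h'; exact: h (h' Du).
move/ACP : aH => /(_ e e0)[d d0 hd].
have [|W [oW NW hW]] := @lebesgue_regularity_outer R N d mN _ d0.
    by apply: le_lt_trans (ltry 0); rewrite le_eqVlt; apply/orP; left; apply/eqP; exact: N0.
exists W; split => // [|s hs ss]; first by move=> u [_ /NW].
apply/ltW/hd => //; rewrite -lte_fin; apply: le_lt_trans ss _.
have mW : measurable W by exact: open_measurable.
apply: le_lt_trans hW; rewrite -[leRHS]add0e -N0.
rewrite -measureU //; last first.
  by apply/seteqP; split=> // u [Nu [_ nNu]].
  by apply: measurableD.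
apply: le_measure; rewrite ?inE //; first by apply: measurableU => //; exact: measurableD.
by move=> u Wu; have [?|?] := pselect (N u); [left|right].
Qed.

Lemma primitive_of_deriv F f : (forall t, D t -> has_deriv F t (f t)) -> cont_on f ->
  cintble D f -> primitive F f.
Proof.
move=> dF cf If t Dt.
suff : F t - pint f t = F 0 - pint f 0.
  by rewrite pint0 subr0 => <-; rewrite subrK.
apply: (@has_deriv0_cst (fun u => F u - pint f u) set0) => // [u Du _|e e0].
  rewrite -(subrr (f u)); apply: has_derivB; first exact: dF.
  by apply: has_deriv_pint => //; exact: cf.
(* There are no exceptional points; a subdivision of total length 0 consists of degenerate
   intervals. *)
exists set0; split => // s hs.
rewrite measure0 lee_fin => ss; rewrite big_seq big1 ?(ltW e0) // => p ps.
have nn q : q \in s -> 0 <= q.2 - q.1 by move=> /hs.1[_ h _]; rewrite subr_ge0.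
have : p.2 - p.1 <= 0.
  apply: le_trans ss; rewrite (big_rem p) //= lerDl big_seq; apply: sumr_ge0 => q qs.
  by apply: nn; exact: mem_rem qs.
have [_ h _] := hs.1 p ps; rewrite subr_le0 => h'.
have -> : p.2 = p.1 by apply/eqP; rewrite eq_le h'.
by rewrite subrr cabs0.
Qed.

Lemma primitive_AC F f : L2 f -> primitive F f -> AC F.
Proof.
move=> hf pF; apply: (@AC_ext (fun t => pint f t - (- F 0))).
  by move=> t Dt; rewrite opprK addrC -pF.
apply: ACB; first exact: AC_pint.
apply/ACP => e e0; exists 1 => // s _ _; rewrite big1 // => p _.
by rewrite subrr cabs0.
Qed.

Lemma primitive_cont F f : L2 f -> primitive F f -> cont_on F.
Proof. by move=> hf pF; apply: AC_cont; exact: primitive_AC pF. Qed.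

Lemma primitive_bound F f : L2 f -> primitive F f -> exists B, forall t, D t -> cabs (F t) <= B.
Proof.
move=> hf pF; exists (cabs (F 0) + \int[mu]_(t in D) cabs (f t)) => t Dt.
have /DP/andP[t0 to] := Dt; have If := L2i hf.
rewrite pF //; apply: le_trans (cabsD _ _) _; rewrite lerD2l.
have ht := cintble_sub (measurable_itv _) (subc_D to) If.
apply: le_trans (cabs_cintegral (measurable_itv _) ht) _.
have mt : measurable `[0, t] by exact: measurable_itv.
have i1 := integrable_cabs mt ht.
have i2 := integrable_cabs mD If.
rewrite /Rintegral -lee_fin !fineK; [|exact: integrable_fin_num|exact: integrable_fin_num].
apply: ge0_subset_integral => //.
- exact: measurable_int i2.
- by move=> u _; rewrite lee_fin cabs_ge0.
- exact: subc_D.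
Qed.

Lemma primitive_L2 F f : L2 f -> primitive F f -> L2 F.
Proof.
move=> hf pF; have [B hB] := primitive_bound hf pF.
by apply: (L2_bounded _ hB); apply: cont_on_cmf; exact: primitive_cont pF.
Qed.

Lemma primitive_ae F f : L2 f -> primitive F f -> {ae mu, forall t, D t -> has_deriv F t (f t)}.
Proof.
move=> hf pF; have := ae_pint (L2i hf); apply: ae_S => t h Dt.
apply: (@has_deriv_ext (fun t => pint f t - (- F 0))) => // [u Du|].
  by rewrite opprK addrC -pF.
rewrite -[f t]subr0; apply: has_derivB; first exact: h.
by apply/has_derivP => e e0; exists 1 => // s _ _; rewrite subrr mulr0 subr0 cabs0 mulr_ge0 // ltW.
Qed.

Lemma primitive_deriv F f t : cintble D f -> cont_on f -> primitive F f -> D t -> has_deriv F t (f t).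
Proof.
move=> If cf pF Dt.
apply: (@has_deriv_ext (fun t => pint f t - (- F 0))) => // [u Du|].
  by rewrite opprK addrC -pF.
rewrite -[f t]subr0; apply: has_derivB; first by apply: has_deriv_pint => //; exact: cf.
by apply/has_derivP => e e0; exists 1 => // s _ _; rewrite subrr mulr0 subr0 cabs0 mulr_ge0 // ltW.
Qed.

(** The product F G is absolutely continuous with the Leibniz derivative almost everywhere, hence a
    primitive of that derivative. *)
Lemma integration_by_parts F f G g : L2 f -> L2 g -> primitive F f -> primitive G g ->
  cintegral D (fun t => f t * G t + F t * g t) = F omega * G omega - F 0 * G 0.
Proof.
move=> hf hg pF pG.
have [B1 hB1] := primitive_bound hf pF; have [B2 hB2] := primitive_bound hg pG.
have mF := cont_on_cmf (primitive_cont hf pF); have mG := cont_on_cmf (primitive_cont hg pG).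
have h : L2 (fun t => f t * G t + F t * g t).
  apply: L2D; first exact: L2_mulb hB2.
  by under eq_fun do rewrite mulrC; exact: L2_mulb hB1.
have p : primitive (fun t => F t * G t) (fun t => f t * G t + F t * g t).
  apply: primitive_of_AC => //.
    apply: (@ACM _ _ (Num.max B1 B2)); [exact: primitive_AC pF|exact: primitive_AC pG|].
    by move=> t Dt; rewrite !le_max hB1 ?hB2 ?orbT.
  move: (primitive_ae hf pF) (primitive_ae hg pG); apply: ae_S2 => t d1 d2 Dt.
  by apply: has_derivM; [exact: d1|exact: d2].
have Dw : D omega by apply/DP; rewrite lexx ltW.
by rewrite (p omega Dw) [X in _ = X - _]addrC addrK.
Qed.

End AbsoluteContinuity.

(** * Sobolev functions as chains of primitives *)

Section SobolevChain.
Context {R : realType} (omega : R) {omega_pos : positive_length omega}.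
Let omega_gt0 : 0 < omega := omega_pos.
Notation D := (`[0, omega]%classic : set R).
Notation L2 := (@L2 R omega).
Notation primitive := (@primitive R omega).
Implicit Type Y : nat -> R -> R[i].

Lemma chain_L2 r Y : (forall j, (j < r)%N -> primitive (Y j) (Y j.+1)) -> L2 (Y r) ->
  forall j, (j <= r)%N -> L2 (Y j).
Proof.
move=> pY hr; have H i : (i <= r)%N -> L2 (Y (r - i)%N).
  elim: i => [|i IH] ir; first by rewrite subn0.
  have e : (r - i)%N = (r - i.+1).+1 by lia.
  apply: (@primitive_L2 _ _ _ _ (Y (r - i.+1).+1)); last by apply: pY; lia.
  by rewrite -e; apply: IH; lia.
by move=> j jr; have := H (r - j)%N (leq_subr _ _); rewrite subKn.
Qed.

(** Descending induction from the top derivative: the top step uses absolute continuity, the others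
    the derivatives at every point. Square-integrability descends because a primitive of a function
    of L_2 is bounded. *)
Lemma sobolevP r Y : (0 < r)%N -> sobolev omega r Y <->
  (forall j, (j < r)%N -> primitive (Y j) (Y j.+1)) /\ L2 (Y r).
Proof.
move=> r0; split=> [[dY aY aeY hr]|[pY hr]].
  split=> //.
  have top : primitive (Y r.-1) (Y r).
    apply: primitive_of_AC => //; apply: ae_S aeY => t h Dt; exact: h.
  have cY j : (j < r)%N -> cont_on omega (Y j).
    move=> jr; have [->|jn] := eqVneq j r.-1; first by apply: AC_cont.
    move=> t Dt; apply: (@has_deriv_cont _ _ _ _ (Y j.+1 t)); apply: dY; first lia.
    exact: Dt.
  have H i : (i <= r)%N -> L2 (Y (r - i)%N) /\ ((0 < i)%N -> primitive (Y (r - i)%N) (Y (r - i).+1)).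
    elim: i => [|i IH] ir; first by rewrite subn0.
    have [|hi _] := IH; first lia.
    have e : (r - i)%N = (r - i.+1).+1 by lia.
    have p : primitive (Y (r - i.+1)%N) (Y (r - i.+1).+1).
      have [i0|i0] := posnP i; first by rewrite i0 subn1 prednK.
      apply: primitive_of_deriv.
      - by move=> t Dt; apply: dY; [lia|exact: Dt].
      - by apply: cY; lia.
      - by rewrite -e; exact: L2_cintble.
    by split=> // ; apply: primitive_L2 p; rewrite -e.
  move=> j jr; have [_] := H (r - j)%N (leq_subr _ _).
  by rewrite subKn ?(ltnW jr) // subn_gt0; exact.
have hY := chain_L2 pY hr; split => //.
- move=> j jr t Dt; apply: primitive_deriv.
  + by apply: L2_cintble; apply: hY; lia.
  + by apply: (@primitive_cont _ _ _ _ (Y j.+2)); [apply: hY; lia|apply: pY; lia].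
  + by apply: pY; lia.
  + exact: Dt.
- apply: (@primitive_AC _ _ _ _ (Y r)) => //.
  by have := pY r.-1; rewrite prednK // => /(_ (leqnn r)).
- have p : primitive (Y r.-1) (Y r) by have := pY r.-1; rewrite prednK // => /(_ (leqnn r)).
  by apply: ae_S (primitive_ae hr p) => t h Dt; apply: h; exact: Dt.
Qed.

End SobolevChain.

(** * Step functions as limits of polynomials *)

Section StepApproximation.
Context {R : realType} (omega : R) {omega_pos : positive_length omega}.
Let omega_gt0 : 0 < omega := omega_pos.
Notation mu := (@lebesgue_measure R).
Notation D := (`[0, omega]%classic : set R).
Implicit Types (y : R -> R[i]) (g : R -> R).
Let mD : measurable D := measurable_D omega.

Lemma bernoulli (x : R) n : 0 <= x -> 1 + n%:R * x <= (1 + x) ^+ n.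
Proof.
move=> x0; elim: n => [|n IH]; first by rewrite expr0 mul0r addr0.
rewrite exprS -natr1; have := ler_wpM2l (addr_ge0 ler01 x0) IH; apply: le_trans.
have : 0 <= n%:R * x * x by rewrite !mulr_ge0.
by lra.
Qed.

Lemma bernoulliN (x : R) n : 0 <= x <= 1 -> 1 - n%:R * x <= (1 - x) ^+ n.
Proof.
move=> /andP[x0 x1]; elim: n => [|n IH]; first by rewrite expr0 mul0r subr0.
have h : 0 <= 1 - x by rewrite subr_ge0.
rewrite exprS -natr1; have := ler_wpM2l h IH; apply: le_trans.
have : 0 <= n%:R * x * x by rewrite !mulr_ge0.
by lra.
Qed.

Lemma nat_geometric_cvg0 (r : R) : 0 <= r < 1 -> n%:R * r ^+ n @[n --> \oo] --> (0 : R).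
Proof.
(* r^n = s^n s^n: one factor absorbs n, the other tends to 0. *)
move=> /andP[r0 r1]; pose s := Num.sqrt r.
have s0 : 0 <= s by exact: sqrtr_ge0.
have s1 : s < 1 by rewrite -(ltr_pXn2r (ltn0Sn 1)) ?nnegrE // sqr_sqrtr // expr1n.
have q0 : 0 < 1 - s by rewrite subr_gt0.
have b n : n%:R * s ^+ n <= (1 - s)^-1.
  rewrite -[leRHS]mul1r ler_pdivlMr //.
  have : n%:R * s ^+ n * (1 - s) <= 1 - s ^+ n.
    elim: n => [|n IH]; first by rewrite mul0r mul0r expr0 subrr.
    have -> : n.+1%:R * s ^+ n.+1 * (1 - s) = s * (n%:R * s ^+ n * (1 - s)) + s ^+ n.+1 * (1 - s).
      by rewrite -natr1 exprS; ring.
    have := ler_wpM2l s0 IH.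
    have h : s ^+ n <= 1 by rewrite exprn_ile1 // ltW.
    have : 0 <= (1 - s ^+ n) * (1 - s) by rewrite mulr_ge0 ?subr_ge0 // ltW.
    have h2 : 0 <= s ^+ n by rewrite exprn_ge0.
    rewrite exprS; set v := s ^+ n in h h2 *; nra.
  by have : 0 <= s ^+ n; [rewrite exprn_ge0|lra].
apply: (@squeeze_cvgr _ _ _ _ (fun=> 0) (fun n => (1 - s)^-1 * s ^+ n)).
- apply: nearW => n; rewrite mulr_ge0 ?exprn_ge0 //=.
  have -> : r ^+ n = s ^+ n * s ^+ n by rewrite -exprMn -expr2 sqr_sqrtr.
  by rewrite mulrA ler_wpM2r ?exprn_ge0.
- exact: cvg_cst.
- exact: geometric_cvg0.
Qed.

(* The polynomials of Brosowski and Deutsch's proof of the Stone-Weierstrass theorem. *)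
Definition steep n (v : R) := (1 - v ^+ n) ^+ (n * 2 ^ n).

Lemma steep01 n v : 0 <= v <= 1 -> 0 <= steep n v <= 1.
Proof.
move=> /andP[v0 v1]; have h : 0 <= v ^+ n <= 1 by rewrite exprn_ge0 //= exprn_ile1.
case/andP: h => h0 h1; rewrite /steep exprn_ge0 ?subr_ge0 //= exprn_ile1 ?subr_ge0 //.
by rewrite lerBlDr lerDl.
Qed.

(** Put N = n 2^n. For v < 1/2, Bernoulli's inequality gives the lower bound 1 - n (2 v)^n. For v >=
    1/2, (1 - v^n)^N (1 + v^n)^N <= 1, where the second factor is at least 1 + n; the point 1/2
    itself thus has limit 0. *)
Lemma steep_cvg v : 0 <= v <= 1 ->
  steep n v @[n --> \oo] --> ((v < 2^-1)%R%:R : R).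
Proof.
move=> /andP[v0 v1]; case: ltP => hv /=.
  apply: (@squeeze_cvgr _ _ _ _ (fun n => 1 - n%:R * (2 * v) ^+ n) (fun=> 1)).
  - apply: nearW => n; rewrite /steep.
    have h : 0 <= v ^+ n <= 1 by rewrite exprn_ge0 //= exprn_ile1.
    have := bernoulliN (n * 2 ^ n) h; rewrite natrM natrX -mulrA -exprMn => -> /=.
    have v01 : 0 <= v <= 1 by rewrite v0.
    by have /andP[] := steep01 n v01.
  - rewrite -[X in _ --> X]subr0; apply: cvgB; first exact: cvg_cst.
    apply: nat_geometric_cvg0; apply/andP; split; first by rewrite mulr_ge0.
    by rewrite mulrC -ltr_pdivlMr // mul1r.
  - exact: cvg_cst.
apply: (@squeeze_cvgr _ _ _ _ (fun=> 0) (fun n => n.+1%:R^-1)).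
- apply: nearW => n; have v01 : 0 <= v <= 1 by rewrite v0.
  have /andP[-> _] := steep01 n v01.
  have h0 : 0 <= v ^+ n by rewrite exprn_ge0.
  have h1 : v ^+ n <= 1 by rewrite exprn_ile1.
  have q : 1 + n%:R <= (1 + v ^+ n) ^+ (n * 2 ^ n).
    apply: le_trans (bernoulli _ h0); rewrite lerD2l natrM natrX -mulrA -exprMn.
    rewrite ler_peMr // exprn_ege1 //.
    by move: hv; rewrite -[_^-1]mul1r ler_pdivrMr // mulrC.
  rewrite -[n.+1%:R^-1]mul1r ler_pdivlMr ?ltr0Sn // -natr1 addrC /=.
  apply: le_trans (ler_wpM2l _ q) _.
    by rewrite /steep exprn_ge0 // subr_ge0.
  rewrite /steep -exprMn exprn_ile1 //.
    by rewrite mulr_ge0 // ?subr_ge0 // addr_ge0.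
  rewrite -subr_sqr expr1n lerBlDr lerDl; exact: sqr_ge0.
- exact: cvg_cst.
- exact: (@cvg_harmonic R).
Qed.

(** Orthogonality to the powers of g extends to polynomials in g, in particular to [steep n] of an
    affine function of g, and by dominated convergence to the indicator function of g > u0. *)
Lemma step_integral y g (u0 : R) : cintble D y -> measurable_fun D g ->
  (forall t, D t -> -1 <= g t <= 1) -> -1 <= u0 <= 1 ->
  (forall j, cintegral D (fun t => y t * (g t ^+ j)%:C) = 0) ->
  cintegral D (fun t => y t * ((u0 < g t)%R%:R : R)%:C) = 0.
Proof.
move=> iy mg g1 /andP[ua ub] y0.
(* Affine in g, with values in [0, 1], and below 1/2 exactly where g exceeds u0. *)
pose v t := 2^-1 - (g t - u0) / 4.
have v01 t : D t -> 0 <= v t <= 1 by move=> /g1 /andP[? ?]; rewrite /v; apply/andP; split; lra.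
have vlt t : (u0 < g t) = (v t < 2^-1) by rewrite /v; apply/idP/idP => ?; lra.
pose F n t := y t * (steep n (v t))%:C.
have F0 n : cintegral D (F n) = 0.
  pose p : {poly R} := (1 - ((2^-1 + u0 / 4)%:P - (4^-1)%:P * 'X) ^+ n) ^+ (n * 2 ^ n).
  have E t : steep n (v t) = \sum_(i < size p) p`_i * g t ^+ i.
    rewrite -horner_coef /p !(hornerE, horner_exp) /steep /v; congr ((1 - _ ^+ _) ^+ _).
    by ring.
  rewrite (@eq_cintegral _ _ _ (fun t => \sum_(i < size p) (p`_i)%:C * (y t * (g t ^+ i)%:C))); last first.
    move=> t _; rewrite /F E rmorph_sum mulr_sumr; apply: eq_bigr => i _.
    by rewrite rmorphM /= mulrCA.
  have iyg (i : nat) : cintble D (fun t => y t * (g t ^+ i)%:C).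
    apply: (@cintble_le _ D _ (fun t => cabs (y t))) => //.
    - by apply: cmfM; [exact: cintble_cmf|apply: cmf_real; exact: measurable_funX].
    - exact: integrable_cabs.
    - move=> t /g1 gt1; rewrite cabsM cabsR normrX ler_piMr ?cabs_ge0 // exprn_ile1 //.
      by rewrite ler_norml.
  rewrite (@cintegral_sum _ D _ (fun i t => (p`_i)%:C * (y t * (g t ^+ i)%:C))) // => [|i]; last exact: cintbleZ.
  by rewrite big1 // => i _; rewrite cintegralZ // y0 mulr0.
have mv n : measurable_fun D (fun t => steep n (v t)).
  apply: measurable_funX; apply: measurable_funB => //; apply: measurable_funX.
  by apply: measurable_funB => //; apply: measurable_funM => //; exact: measurable_funB.
have FB n t : D t -> cabs (F n t) <= cabs (y t).
  move=> /v01 h; rewrite cabsM cabsR ler_piMr ?cabs_ge0 //.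
  by have /andP[s0 s1] := steep01 n h; rewrite ger0_norm.
have Fc t : D t -> ctends (F ^~ t) (y t * ((u0 < g t)%R%:R : R)%:C).
  move=> /v01 h; apply: ctendsZ; rewrite vlt.
  by apply: ctends_ReIm => /=; [exact: steep_cvg|exact: cvg_cst].
have [_ h] := cintegral_dct mD (fun n => cmfM (cintble_cmf iy) (cmf_real (mv n))) (integrable_cabs mD iy) FB Fc.
apply: ctends_uniq h _; apply/ctendsP => e e0; exists 0%N => n _.
by rewrite F0 subrr cabs0.
Qed.

Lemma cintegral_ind y (A : set R) (b : R -> bool) :
  (forall t, D t -> b t <-> A t) -> A `<=` D ->
  cintegral D (fun t => y t * ((b t)%:R : R)%:C) = cintegral A y.
Proof.
move=> bA AD; rewrite /cintegral /=; congr (_ +i* _).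
  rewrite Rintegral_mkcond [RHS]Rintegral_mkcond; congr Rintegral; apply/funext => t.
  rewrite !patchE; have [tA|tA] := boolP (t \in A).
    have Dt : D t by apply: AD; exact: set_mem.
    rewrite (mem_set Dt); have -> : b t by apply/bA => //; exact: set_mem.
    by rewrite mulr1.
  case: ifP => // /set_mem Dt; have -> : b t = false.
    by apply/negbTE; apply: contra tA => /bA h; apply: mem_set; exact: h.
  by rewrite mulr0.
rewrite Rintegral_mkcond [RHS]Rintegral_mkcond; congr Rintegral; apply/funext => t.
rewrite !patchE; have [tA|tA] := boolP (t \in A).
  have Dt : D t by apply: AD; exact: set_mem.
  rewrite (mem_set Dt); have -> : b t by apply/bA => //; exact: set_mem.
  by rewrite mulr1.
case: ifP => // /set_mem Dt; have -> : b t = false.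
  by apply/negbTE; apply: contra tA => /bA h; apply: mem_set; exact: h.
by rewrite mulr0.
Qed.

Lemma pint_open y t : cintble D y -> t <= omega ->
  cintegral `[0, t[ y = pint y t /\ cintegral `]0, t[ y = pint y t.
Proof.
move=> iy to; have [hr hi] := cintble_sub (measurable_itv _) (subc_D to) iy.
have sub1 : `[0, t[ `<=` `[0, t] by apply: subset_itvl; rewrite bnd_simp.
have sub2 : `]0, t[ `<=` `[0, t] by apply: subset_itv; rewrite bnd_simp.
have sub3 : `]0, t] `<=` `[0, t] by apply: subset_itvr; rewrite bnd_simp.
split; rewrite /pint /cintegral; congr (_ +i* _).
- by rewrite Rintegral_itv_bndo_bndc //; apply: integrableS hr.
- by rewrite Rintegral_itv_bndo_bndc //; apply: integrableS hi.
- by rewrite Rintegral_itv_bndo_bndc ?Rintegral_itv_obnd_cbnd //; apply: integrableS hr.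
- by rewrite Rintegral_itv_bndo_bndc ?Rintegral_itv_obnd_cbnd //; apply: integrableS hi.
Qed.

(** Almost everywhere y is the derivative of its integral function, which is constant. *)
Lemma pint_eq0 y : cintble D y -> (forall t, D t -> pint y t = 0) -> aeeq omega y (fun=> 0).
Proof.
move=> iy y0; apply/aeeqP.
pose proof (ae_has_deriv_pint iy) as h; apply: ae_S h => t h Dt.
have /DP/andP[t0 to] := Dt.
apply/eqP; rewrite -cabs_eq0 eq_le cabs_ge0 andbT; apply/ler_addgt0Pl => e e0; rewrite addr0.
have /has_derivP/(_ e e0)[d d0 hd] := h Dt.
have [s [Ds sd st]] : exists s, [/\ D s, `|s - t| < d & s != t].
  have [tw|wt] := ltP t omega.
    exists (Num.min (t + d / 2) omega); have h1 : t < Num.min (t + d / 2) omega.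
      by rewrite lt_min tw andbT ltrDl divr_gt0.
    split; last by rewrite gt_eqF.
      by apply/DP; rewrite (le_trans t0 (ltW h1)) ge_min lexx orbT.
    rewrite gtr0_norm ?subr_gt0 // ltrBlDl.
    by apply: (@le_lt_trans _ _ (t + d / 2)); rewrite ?ge_min ?lexx // ltrD2l; lra.
  have tE : t = omega by apply/eqP; rewrite eq_le to wt.
  exists (Num.max (t - d / 2) 0); have h1 : Num.max (t - d / 2) 0 < t.
    by rewrite gt_max tE omega_gt0 andbT ltrBlDr ltrDl divr_gt0.
  split; last by rewrite lt_eqF.
    by apply/DP; rewrite le_max lexx orbT /= (le_trans (ltW h1)).
  rewrite ltr0_norm ?subr_lt0 // opprB ltrBlDr -ltrBlDl.
  by apply: (@lt_le_trans _ _ (t - d / 2)); rewrite ?le_max ?lexx // ltrD2l; lra.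
have := hd s Ds sd; rewrite !y0 // subrr sub0r cabsN cabsM cabsR mulrC ler_pM2r //.
by rewrite normr_gt0 subr_eq0.
Qed.

End StepApproximation.

(** * Fourier bases *)

Section FourierBases.
Context {R : realType} (omega : R) {omega_pos : positive_length omega}.
Let omega_gt0 : 0 < omega := omega_pos.
Notation mu := (@lebesgue_measure R).
Notation D := (`[0, omega]%classic : set R).
Notation L2 := (@L2 R omega).
Notation ip := (@ip R omega).
Notation aeeq := (@aeeq R omega).
Implicit Types (x y : R -> R[i]).
Let mD : measurable D := measurable_D omega.
Let pi0 : 0 < pi :> R := @pi_gt0 R.
Let omega_neq0 : omega != 0. Proof. by rewrite gt_eqF. Qed.
Let L2i x : L2 x -> cintble D x. Proof. exact: L2_cintble. Qed.

(* In this order the eigenfunctions of a common eigenvalue are consecutive. *)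
Definition bidx (bc : bcond) (i : nat) : int :=
  match bc with
  | Per => if odd i then - (uphalf i)%:Z else i./2%:Z
  | Ap => if odd i then i./2%:Z else - i./2%:Z - 1
  | Dir => 0
  end.

Definition bas (bc : bcond) (i : nat) : R -> R[i] :=
  if bc is Dir then efun_dir omega i.+1 else efun omega bc (bidx bc i).

Lemma bidx_inj bc : bc <> Dir -> injective (bidx bc).
Proof.
move=> bcD i j; have := odd_double_half i; have := odd_double_half j.
case: bc bcD => // _; rewrite /bidx ?uphalf_half; case: (odd i); case: (odd j) => /=; lia.
Qed.

Lemma bidx_surj bc n : bc <> Dir -> exists i, bidx bc i = n.
Proof.
case: bc => // _; case: n => n.
- by exists n.*2; rewrite /bidx odd_double doubleK.
- by exists n.*2.+1; rewrite /bidx /= odd_double /= ?uphalf_double ?doubleK NegzE.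
- by exists n.*2.+1; rewrite /bidx /= odd_double /= uphalf_double.
- by exists n.*2; rewrite /bidx /= odd_double /= doubleK NegzE -addn1 PoszD opprD.
Qed.

Lemma cexp_i_pi : cexp_i (pi : R) = -1.
Proof. by rewrite /cexp_i cospi sinpi; apply/eqP; rewrite eq_complex /= oppr0 !eqxx. Qed.

Lemma cexp_i_2piZ (n : int) : cexp_i (2 * pi * n%:~R : R) = 1.
Proof.
have h (m : nat) : cexp_i (2 * pi * m%:R : R) = 1.
  by rewrite mulrC -cexp_iX cexp_i_2pi expr1n.
case: n => n; first exact: h.
by rewrite NegzE rmorphN /= mulrN -cexp_iV -pmulrn h invr1.
Qed.

Lemma sin_natpi (n : nat) : sin (pi * n%:R : R) = 0.
Proof.
have := cexp_iX (pi : R) n; rewrite cexp_i_pi mulrC => /(congr1 (@complex.Im R)) /= <-.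
by rewrite -signr_odd; case: (odd n); rewrite /= ?oppr0.
Qed.

Lemma efunM bc n p t : efun omega bc n t * (efun omega bc p t)^* =
  cexp_i (2 * pi * (p - n)%:~R / omega * t).
Proof.
rewrite /efun -cexp_iN -cexp_iD; congr cexp_i.
rewrite !(rmorphD, rmorphM, rmorphN) /=.
by field.
Qed.

Lemma cabs_efun bc n t : cabs (efun omega bc n t) = 1.
Proof. exact: cabs_cexp_i. Qed.

Lemma cmf_efun bc n : cmf D (efun omega bc n).
Proof.
have := @cmf_cexp_i R D (- (pi * (2 * n + (theta bc)%:Z)%:~R / omega)) mD; congr cmf.
by apply/funext => t; rewrite /efun; congr cexp_i; ring.
Qed.

Lemma L2_efun bc n : L2 (efun omega bc n).
Proof.
apply: (@L2_bounded _ _ _ _ 1); first exact: cmf_efun.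
by move=> t _; rewrite cabs_efun.
Qed.

Lemma ip_efun bc n p : ip (efun omega bc n) (efun omega bc p) = (n == p)%:R.
Proof.
rewrite ipE (@eq_cintegral _ _ _ (fun t => cexp_i (2 * pi * (p - n)%:~R / omega * t))); last first.
  by move=> t _; rewrite efunM.
have [->|np] := eqVneq n p.
  rewrite subrr mulr0 mul0r.
  rewrite (@eq_cintegral _ _ _ (fun=> (1 : R)%:C)); last by move=> t _; rewrite mul0r cexp_i0.
  rewrite (cintegral_real D (fun=> 1)) Rintegral_cst // mul1r.
  have -> : fine (mu D) = omega by rewrite mu_D.
  by rewrite -rmorphM /= mulVf.
rewrite integral_cexp_i ?mulr0 //.
  have pn : 2 * pi != 0 :> R by rewrite gt_eqF // mulr_gt0.
  by rewrite mulf_neq0 ?invr_eq0 // mulf_neq0 // intr_eq0 subr_eq0 eq_sym.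
by rewrite divfK // cexp_i_2piZ.
Qed.

Lemma L2_efun_dir n : L2 (efun_dir omega n).
Proof.
apply: (@L2_bounded _ _ _ _ (Num.sqrt 2)).
  apply: cmf_real; apply: measurable_funM => //.
  apply: (measurableT_comp (@measurable_sin R)).
  by apply: measurable_funM => //; apply: measurable_funM.
move=> t _; rewrite cabsR normrM ger0_norm ?sqrtr_ge0 // ler_piMr ?sqrtr_ge0 //.
by rewrite ler_norml sin_geN1 sin_le1.
Qed.

Lemma integral_cos_nat (m : nat) :
  \int[mu]_(t in D) cos (pi * m%:R / omega * t) = (if m == 0%N then omega else 0).
Proof.
case: eqP => [->|/eqP m0].
  under eq_Rintegral do rewrite mulr0 !mul0r cos0.
  rewrite Rintegral_cst // mul1r.
  by have -> : fine (mu D) = omega by rewrite mu_D.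
set a := pi * m%:R / omega.
have a0 : a != 0 by rewrite /a !mulf_neq0 ?invr_eq0 ?pnatr_eq0 // gt_eqF.
have ds (x : R) : is_derive x (1 : R) (fun t => a^-1 * sin (a * t)) (cos (a * x)).
  have d1 : is_derive x (1 : R) (fun t : R => a * t) a.
    by apply: is_derive_eq; rewrite /GRing.scale /= mulr1.
  have d2 := is_derive1_comp (is_derive_sin (a * x)) d1.
  have d3 := is_deriveZ (a^-1) d2.
  by apply: (is_derive_eq d3); rewrite /GRing.scale /= mulrCA mulVf // mulr1.
rewrite (Rintegral_derive omega_gt0 ds).
  by rewrite mulr0 sin0 mulr0 subr0 /a divfK // sin_natpi mulr0.
move=> x; apply: continuous_comp; last exact: continuous_cos.
by apply: cvgM; [exact: cvg_cst|exact: cvg_id].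
Qed.

Lemma ip_efun_dir n p : ip (efun_dir omega n.+1) (efun_dir omega p.+1) = (n == p)%:R.
Proof.
wlog np : n p / (p <= n)%N => [h|].
  have [/h //|/ltnW/h e] := leqP p n.
  rewrite (ipJ (L2_efun_dir _) (L2_efun_dir _)) e eq_sym; case: eqP => _.
    exact: conj_one.
  exact: conjc0.
pose s t := pi / omega * t.
have E t : efun_dir omega n.+1 t * (efun_dir omega p.+1 t)^* =
   (cos (pi * (n - p)%:R / omega * t) - cos (pi * (n + p).+2%:R / omega * t))%:C.
  rewrite /efun_dir conj_real -rmorphM; congr (_%:C).
  have -> : pi * (n - p)%:R / omega * t = pi * n.+1%:R * t / omega - pi * p.+1%:R * t / omega.
    by rewrite natrB // -[n.+1%:R]natr1 -[p.+1%:R]natr1; field.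
  have -> : pi * (n + p).+2%:R / omega * t = pi * n.+1%:R * t / omega + pi * p.+1%:R * t / omega.
    have -> : (n + p).+2 = (n.+1 + p.+1)%N by rewrite addSn addnS.
    by rewrite natrD; field.
  rewrite cosB cosD mulrACA -expr2 sqr_sqrtr //; ring.
rewrite ipE (eq_cintegral (fun t _ => E t)) cintegral_real -rmorphM /=.
have ic (m : nat) : mu.-integrable D (EFin \o (fun t => cos (pi * m%:R / omega * t))).
  have [] // : cintble D (fun t => cexp_i (pi * m%:R / omega * t)).
  apply: (@cintble_bounded _ D _ 1) => //; [exact: mu_D_fin|exact: cmf_cexp_i|].
  by move=> t _; rewrite cabs_cexp_i.
rewrite RintegralB // !integral_cos_nat /= subr0 subn_eq0.
have -> : (n <= p)%N = (n == p) by rewrite eqn_leq np andbT.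
by case: eqP => _; rewrite ?mulVf ?mulr0.
Qed.

Lemma L2_bas bc i : L2 (bas bc i).
Proof. by case: bc; [exact: L2_efun|exact: L2_efun|exact: L2_efun_dir]. Qed.

Lemma ip_bas bc i j : ip (bas bc i) (bas bc j) = (i == j)%:R.
Proof.
have P : bc <> Dir -> ip (efun omega bc (bidx bc i)) (efun omega bc (bidx bc j)) = (i == j)%:R.
  by move=> bcD; rewrite ip_efun (inj_eq (bidx_inj bcD)).
by case: bc P => P; [apply: P|apply: P|exact: ip_efun_dir].
Qed.

Lemma cabs_bas bc i t : cabs (bas bc i t) <= Num.sqrt 2.
Proof.
have h : 1 <= Num.sqrt 2 :> R by rewrite -[X in X <= _]sqrtr1 ler_sqrt // ler1n.
case: bc; rewrite /bas ?cabs_efun //.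
rewrite /efun_dir cabsR normrM ger0_norm ?sqrtr_ge0 // ler_piMr ?sqrtr_ge0 //.
by rewrite ler_norml sin_geN1 sin_le1.
Qed.

Lemma ae_neq (a : R) : {ae mu, forall t, t != a}.
Proof.
exists [set a]; split; [exact: measurable_set1|exact: lebesgue_measure_set1|].
by move=> t /= /negP; rewrite negbK => /eqP.
Qed.

Lemma cexp_real_cos (s : R) : (cos s)%:C = 2^-1 * (cexp_i s + cexp_i (- s)).
Proof.
have -> : (2^-1 : R[i]) = (2^-1)%:C by rewrite fmorphV rmorph_nat.
apply/eqP; rewrite /cexp_i cosN sinN eq_complex /= subrr !mul0r !mulr0 subr0 addr0 eqxx andbT.
by apply/eqP; field.
Qed.

(* [0, t] is the set where [cos (2 * pi * u / omega - al) >= cos al], [al = pi * t / omega],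
   so that its indicator function is a limit of trigonometric polynomials. *)
Lemma exp_complete y : cintble D y ->
  (forall n : int, cintegral D (fun t => y t * cexp_i (2 * pi * n%:~R / omega * t)) = 0) ->
  aeeq y (fun=> 0).
Proof.
move=> iy y0; apply: pint_eq0 => // t /DP/andP[t0 to].
have [t00|t00] := eqVneq t 0; first by rewrite t00 pint0.
have tp : 0 < t by rewrite lt_neqAle eq_sym t00.
pose al := pi * t / omega.
have al0 : 0 < al by rewrite /al divr_gt0 // mulr_gt0.
have al1 : al <= pi by rewrite /al ler_pdivrMr // ler_pM2l.
pose g u := cos (2 * pi / omega * u - al).
have mg : measurable_fun D g.
  apply: (measurableT_comp (@measurable_cos R)).
  by apply: measurable_funB => //; exact: measurable_funM.
have g1 u : D u -> -1 <= g u <= 1 by move=> _; rewrite /g cos_geN1 cos_le1.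
have c1 : -1 <= cos al <= 1 by rewrite cos_geN1 cos_le1.
(* Multiplication by g shifts the frequencies by one in both directions, so orthogonality to all
   exponentials is inherited by their products with powers of g. *)
have step j : forall n : int, cintegral D (fun u => y u * (cexp_i (2 * pi * n%:~R / omega * u) * (g u ^+ j)%:C)) = 0.
  have ib j' (n : int) : cintble D (fun u => y u * (cexp_i (2 * pi * n%:~R / omega * u) * (g u ^+ j')%:C)).
    apply: (@cintble_le _ D _ (fun u => cabs (y u))) => //.
    - apply: cmfM; first exact: cintble_cmf.
      by apply: cmfM; [exact: cmf_cexp_i|apply: cmf_real; exact: measurable_funX].
    - exact: integrable_cabs.
    - move=> u /g1 gu; rewrite !cabsM cabs_cexp_i mul1r cabsR normrX ler_piMr ?cabs_ge0 // exprn_ile1 //.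
      by rewrite ler_norml.
  elim: j => [|j IH] n.
    rewrite -[RHS](y0 n); apply: eq_cintegral => u _.
    by rewrite expr0 mulr1.
  rewrite (@eq_cintegral _ _ _ (fun u =>
    2^-1 * cexp_i (- al) * (y u * (cexp_i (2 * pi * (n + 1)%:~R / omega * u) * (g u ^+ j)%:C)) +
    2^-1 * cexp_i al * (y u * (cexp_i (2 * pi * (n - 1)%:~R / omega * u) * (g u ^+ j)%:C)))).
    by rewrite cintegralD ?cintegralZ ?IH ?mulr0 ?addr0 //; exact: cintbleZ.
  move=> u _; rewrite exprS rmorphM /= {1}/g cexp_real_cos.
  have -> : cexp_i (2 * pi * (n + 1)%:~R / omega * u) =
     cexp_i (2 * pi * n%:~R / omega * u) * cexp_i (2 * pi / omega * u).
    by rewrite -cexp_iD; congr cexp_i; rewrite rmorphD /=; field.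
  have -> : cexp_i (2 * pi * (n - 1)%:~R / omega * u) =
     cexp_i (2 * pi * n%:~R / omega * u) * cexp_i (- (2 * pi / omega * u)).
    by rewrite -cexp_iD; congr cexp_i; rewrite rmorphB /=; field.
  rewrite cexp_iD opprB [al - _]addrC cexp_iD.
  by ring.
have := step_integral iy mg g1 c1.
rewrite -(pint_open iy to).2 => h.
rewrite -(@cintegral_ind _ omega y `]0, t[ (fun u => cos al < g u)).
- apply: h => j; rewrite -[RHS](step j 0); apply: eq_cintegral => u _.
  by rewrite mulr0 !mul0r cexp_i0 mul1r.
- move=> u /DP/andP[u0 uo] /=; rewrite in_itv /= /g.
  set s := 2 * pi / omega * u - al.
  have sE : s = 2 * pi / omega * u - al by [].
  have q0 : 0 < pi / omega by rewrite divr_gt0.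
  have alE : al = pi / omega * t by rewrite /al mulrAC.
  have uE : 2 * pi / omega * u = 2 * (pi / omega * u) by ring.
  have uu : pi / omega * u <= pi by rewrite mulrAC ler_pdivrMr // ler_pM2l.
  have u0' : 0 <= pi / omega * u by rewrite mulr_ge0 // ltW.
  have e1 : (0 < u) = (- al < s) by rewrite sE uE ltrBrDl subrr pmulr_rgt0 // pmulr_rgt0.
  have e2 : (u < t) = (s < al).
    by rewrite -(ltr_pM2l q0) -alE sE uE; apply/idP/idP => ?; lra.
  rewrite e1 e2 -ltr_norml.
  have sl : - al <= s by rewrite sE uE; lra.
  have sr : s <= 2 * pi - al by rewrite sE uE; lra.
  have ipi (w : R) : 0 <= w -> w <= pi -> w \in `[0, pi] by move=> ? ?; rewrite in_itv /=; apply/andP.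
  have [sal|als] := leP s al.
    have ns : `|s| <= al by rewrite ler_norml sl.
    have -> : cos s = cos `|s|.
      by case: (ler0P s) => _; rewrite ?cosN.
    rewrite ltr_cos ?ipi // ?(ltW al0) //; first exact: le_trans ns al1.
  have sn : `|s| = s by rewrite gtr0_norm // (lt_trans al0).
  rewrite sn; split; last by move/(lt_trans als); rewrite ltxx.
  (* Past pi the cosine increases again, and s is reflected to 2 pi - s, which is still at least
     al. *)
  have [spi|pis] := leP s pi.
    by rewrite ltr_cos ?ipi // ?(ltW al0) // ?(ltW (lt_trans al0 als)).
  have -> : cos s = cos (2 * pi - s).
    have := cexp_iD (2 * pi) (- s); rewrite cexp_i_2pi mul1r => /(congr1 (@complex.Re R)) /= ->.
    by rewrite cosN.
  by rewrite ltr_cos ?ipi // ?(ltW al0) //; lra.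
- by move=> u /=; rewrite !in_itv /= => /andP[u0 ut]; rewrite (ltW u0) (le_trans (ltW ut)).
Qed.

(** x sin (pi t / omega) is orthogonal to the powers of cos (pi t / omega), since sin (n s) cos s is
    a combination of sines. The cosine decreases on [0, pi], so its superlevel sets are initial
    intervals, and the sine vanishes only at the end points. *)
Lemma sin_complete x : L2 x ->
  (forall n : nat, cintegral D (fun t => x t * (sin (pi * n%:R / omega * t))%:C) = 0) ->
  aeeq x (fun=> 0).
Proof.
move=> hx x0; have ix := L2i hx.
pose g u := cos (pi / omega * u).
have mg : measurable_fun D g by apply: (measurableT_comp (@measurable_cos R)); exact: measurable_funM.
have ms (n : nat) : measurable_fun D (fun u : R => sin (pi * n%:R / omega * u)).
  by apply: (measurableT_comp (@measurable_sin R)); exact: measurable_funM.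
have g1 u : D u -> -1 <= g u <= 1 by move=> _; rewrite /g cos_geN1 cos_le1.
have ib j (n : nat) : cintble D (fun u => x u * ((sin (pi * n%:R / omega * u))%:C * (g u ^+ j)%:C)).
  apply: (@cintble_le _ D _ (fun u => cabs (x u))) => //.
  - apply: cmfM; first exact: cintble_cmf.
    by apply: cmfM; apply: cmf_real => //; exact: measurable_funX.
  - exact: integrable_cabs.
  - move=> u /g1 gu; rewrite !cabsM !cabsR normrX ler_piMr ?cabs_ge0 // mulr_ile1 //.
      by rewrite ler_norml sin_geN1 sin_le1.
    by rewrite exprn_ile1 // ler_norml.
have step j : forall n : nat, cintegral D (fun u => x u * ((sin (pi * n%:R / omega * u))%:C * (g u ^+ j)%:C)) = 0.
  elim: j => [|j IH] n.
    by rewrite -[RHS](x0 n); apply: eq_cintegral => u _; rewrite expr0 mulr1.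
  case: n => [|n].
    rewrite -[RHS](x0 0%N); apply: eq_cintegral => u _.
    by rewrite mulr0 !mul0r sin0 mul0r.
  rewrite (@eq_cintegral _ _ _ (fun u =>
    2^-1 * (x u * ((sin (pi * n.+2%:R / omega * u))%:C * (g u ^+ j)%:C)) +
    2^-1 * (x u * ((sin (pi * n%:R / omega * u))%:C * (g u ^+ j)%:C)))).
    by rewrite cintegralD ?cintegralZ ?IH ?mulr0 ?addr0 //; exact: cintbleZ.
  move=> u _; have -> : sin (pi * n.+2%:R / omega * u) =
     sin (pi * n.+1%:R / omega * u + pi / omega * u).
    by congr sin; rewrite -[n.+2%:R]natr1; field.
  have -> : sin (pi * n%:R / omega * u) =
     sin (pi * n.+1%:R / omega * u - pi / omega * u).
    by congr sin; rewrite -[n.+1%:R]natr1; field.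
  rewrite sinD sinB exprS /g.
  by rewrite !(rmorphM, rmorphD, rmorphN) /=; field.
pose y u := x u * (sin (pi / omega * u))%:C.
have iy : cintble D y.
  have := ib 0%N 1%N; congr (cintble D _); apply/funext => u.
  by rewrite expr0 mulr1 mulr1.
have y0 : aeeq y (fun=> 0).
  apply: pint_eq0 => // t /DP/andP[t0 to].
  have := step_integral iy mg g1.
  move=> /(_ (cos (pi / omega * t))); rewrite cos_geN1 cos_le1 => /(_ isT) h.
  rewrite -(pint_open iy to).1.
  rewrite -(@cintegral_ind _ omega y `[0, t[ (fun u => cos (pi / omega * t) < g u)).
  - apply: h => j; rewrite -[RHS](step j 1%N); apply: eq_cintegral => u _.
    by rewrite /y mulr1 mulrA.
  - move=> u /DP/andP[u0 uo] /=; rewrite in_itv /= u0 /= /g.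
    have q0 : 0 < pi / omega by rewrite divr_gt0.
    have I (w : R) : 0 <= w -> w <= omega -> pi / omega * w \in `[0, pi].
      move=> w0 wo; rewrite in_itv /= mulr_ge0 ?(ltW q0) //=.
      by rewrite mulrAC ler_pdivrMr // ler_pM2l.
    by rewrite ltr_cos ?I // ltr_pM2l.
  - by move=> u /=; rewrite !in_itv /= => /andP[u0 ut]; rewrite u0 (le_trans (ltW ut)).
apply/aeeqP; move/aeeqP : y0 => y0.
have nz : {ae mu, forall t, t != 0 /\ t != omega}.
  by move: (ae_neq 0) (ae_neq omega); apply: ae_S2.
move: y0 nz; apply: ae_S2 => t yt [t0 to] Dt; have /DP/andP[t0' to'] := Dt.
have /eqP := yt Dt; rewrite /y mulf_eq0 => /orP[/eqP //|].
rewrite -cabs_eq0 cabsR normr_eq0 => /eqP s0.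
have : 0 < sin (pi / omega * t).
  apply: sin_gt0_pi; apply/andP; split.
    by rewrite mulr_gt0 ?divr_gt0 // lt_neqAle eq_sym t0.
  by rewrite mulrAC ltr_pdivrMr // ltr_pM2l // lt_neqAle to.
by rewrite s0 ltxx.
Qed.

Lemma bas_onb bc : orthonormal_basis omega (bas bc).
Proof.
split; [exact: L2_bas|exact: ip_bas|move=> x hx x0].
have P : bc <> Dir -> aeeq x (fun=> 0).
  move=> bcD.
  have all0 n : ip x (efun omega bc n) = 0.
    have [i <-] := bidx_surj n bcD; rewrite -[RHS](x0 i).
    by case: bc bcD {x0}.
  (* This factor removes the shift [theta] from the antiperiodic exponentials; in the periodic case
     it is 1. *)
  pose f t := cexp_i (pi * (theta bc)%:R / omega * t).
  have hy : L2 (fun t => x t * f t).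
    apply: (L2_mulb (M := 1) hx); first exact: cmf_cexp_i.
    by move=> t _; rewrite cabs_cexp_i.
  have : aeeq (fun t => x t * f t) (fun=> 0).
    apply: exp_complete; first exact: L2i.
    move=> n; have := all0 n; rewrite ipE => /eqP; rewrite mulf_eq0 => /orP[/eqP h|/eqP h].
      by move: h => /(congr1 (@complex.Re R)) /= /eqP; rewrite invr_eq0 (negbTE omega_neq0).
    rewrite -[RHS]h; apply: eq_cintegral => t _; rewrite -mulrA; congr (_ * _).
    rewrite /f /efun -cexp_iD -cexp_iN; congr cexp_i.
    by rewrite opprK rmorphD rmorphM /= -pmulrn; field.
  move/aeeqP => h; apply/aeeqP; apply: ae_S h => t h /h /eqP.
  by rewrite mulf_eq0 -[f t == 0]cabs_eq0 cabs_cexp_i oner_eq0 orbF => /eqP.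
have [bcD|bcD] := pselect (bc = Dir); last exact: P.
rewrite bcD in x0.
apply: sin_complete => // -[|n].
  rewrite (@eq_cintegral _ _ _ (fun=> 0)) ?cintegral0 // => t _.
  by rewrite mulr0 !mul0r sin0 mulr0.
have := x0 n; rewrite ipE => /eqP; rewrite mulf_eq0 => /orP[/eqP h|/eqP h].
  by move: h => /(congr1 (@complex.Re R)) /= /eqP; rewrite invr_eq0 (negbTE omega_neq0).
have i1 : cintble D (fun t => x t * (sin (pi * n.+1%:R / omega * t))%:C).
  have [hs _] := L2P omega x; apply: (@cintble_le _ D _ (fun u => cabs (x u))) => //.
  - apply: cmfM; first exact: cintble_cmf (L2i hx).
    by apply: cmf_real; apply: (measurableT_comp (@measurable_sin R)); exact: measurable_funM.
  - by apply: integrable_cabs => //; exact: L2i.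
  - move=> t _; rewrite cabsM cabsR ler_piMr ?cabs_ge0 //.
    by rewrite ler_norml sin_geN1 sin_le1.
have s2 : (Num.sqrt 2 : R) != 0 by rewrite gt_eqF // sqrtr_gt0.
have s2C : ((Num.sqrt 2 : R)%:C : R[i]) != 0 by rewrite -cabs_eq0 cabsR normr_eq0.
apply: (mulfI s2C); rewrite mulr0 -cintegralZ // -[RHS]h; apply: eq_cintegral => t _.
rewrite /efun_dir conj_real rmorphM /= mulrCA; congr (_ * (_ * (sin _)%:C)).
by field.
Qed.

End FourierBases.

Opaque cf syn.

(** * The operator L_bc in coordinates *)

Section DifferentialOperator.
Context {R : realType} (omega : R) {omega_pos : positive_length omega}.
Let omega_gt0 : 0 < omega := omega_pos.
Variables (bc : bcond).
Notation mu := (@lebesgue_measure R).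
Notation D := (`[0, omega]%classic : set R).
Notation L2 := (@L2 R omega).
Notation L2norm := (@L2norm R omega).
Notation ip := (@ip R omega).
Notation aeeq := (@aeeq R omega).
Notation primitive := (@primitive R omega).
Notation H := (ell2 R).
Notation b := (bas omega bc).
Notation cfb := (cf omega b).
Implicit Types (x y f g F G : R -> R[i]) (z : R[i]).
Let mD : measurable D := measurable_D omega.
Let pi0 : 0 < pi :> R := @pi_gt0 R.
Let omega_neq0 : omega != 0. Proof. by rewrite gt_eqF. Qed.
Let L2i x : L2 x -> cintble D x. Proof. exact: L2_cintble. Qed.
Let onb : orthonormal_basis omega b. Proof. exact: bas_onb. Qed.
Let L2b i : L2 (b i). Proof. exact: L2_bas. Qed.
Let D0 : D 0. Proof. by apply/DP; rewrite lexx ltW. Qed.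
Let Dw : D omega. Proof. by apply/DP; rewrite lexx ltW. Qed.

(** The integer frequency of the i-th basis function, up to sign; the eigenvalue is
    [nu i ^+ (2 * k)]. *)
Definition freq (i : nat) : nat :=
  match bc with Per => 2 * uphalf i | Ap => 2 * i./2 + 1 | Dir => i.+1 end.

Definition nu (i : nat) : R := pi * (freq i)%:R / omega.

Lemma primitive_lin z F f G g : cintble D f -> cintble D g -> primitive F f -> primitive G g ->
  primitive (fun t => z * F t + G t) (fun t => z * f t + g t).
Proof.
move=> hf hg pF pG t Dt; have /DP/andP[_ to] := Dt.
rewrite (pF t Dt) (pG t Dt) (@pintD _ omega) ?(@pintZ _ omega) //; last exact: cintbleZ.
by ring.
Qed.

Lemma primitive_real (F f : R -> R) : (forall x : R, is_derive x (1 : R) F (f x)) ->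
  continuous f -> primitive (fun t => (F t)%:C) (fun t => (f t)%:C).
Proof.
move=> dF cf t /DP/andP[t0 _]; have [->|tn0] := eqVneq t 0; first by rewrite pint0 addr0.
have tp : 0 < t by rewrite lt_neqAle eq_sym tn0.
by rewrite /pint cintegral_real (Rintegral_derive tp dF) // -rmorphD /= addrC subrK.
Qed.

Let is_d (a x : R) : is_derive x (1 : R) (fun t : R => a * t) a.
Proof. by apply: is_derive_eq; rewrite /GRing.scale /= mulr1. Qed.

Let cont_lin (a : R) : continuous (fun t : R => a * t).
Proof. by move=> x; apply: cvgM; [exact: cvg_cst|exact: cvg_id]. Qed.

Lemma primitive_sin (a r : R) :
  primitive (fun t => (r * sin (a * t))%:C) (fun t => (r * a * cos (a * t))%:C).
Proof.
apply: primitive_real => [x|x].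
  have d3 := is_deriveZ r (is_derive1_comp (is_derive_sin (a * x)) (is_d a x)).
  by apply: (is_derive_eq d3); rewrite /GRing.scale /=; ring.
apply: cvgM; first exact: cvg_cst.
by apply: continuous_comp; [exact: cont_lin|exact: continuous_cos].
Qed.

Lemma primitive_cos (a r : R) :
  primitive (fun t => (r * cos (a * t))%:C) (fun t => (r * - a * sin (a * t))%:C).
Proof.
apply: primitive_real => [x|x].
  have d3 := is_deriveZ r (is_derive1_comp (is_derive_cos (a * x)) (is_d a x)).
  by apply: (is_derive_eq d3); rewrite /GRing.scale /=; ring.
apply: cvgM; first exact: cvg_cst.
by apply: continuous_comp; [exact: cont_lin|exact: continuous_sin].
Qed.

Lemma L2_trig (h : R -> R) (r a : R) : measurable_fun setT h -> (forall s, -1 <= h s <= 1) ->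
  L2 (fun t => (r * h (a * t))%:C).
Proof.
move=> mh h1; apply: (@L2_bounded _ _ _ _ `|r|).
  apply: cmf_real; apply: measurable_funM => //; apply: (measurableT_comp mh).
  exact: measurable_funM.
by move=> t _; rewrite cabsR normrM ler_piMr // ler_norml.
Qed.

Let sin1 (s : R) : -1 <= sin s <= 1. Proof. by rewrite sin_geN1 sin_le1. Qed.
Let cos1 (s : R) : -1 <= cos s <= 1. Proof. by rewrite cos_geN1 cos_le1. Qed.

Lemma primitive_cexp (a : R) (r : R[i]) : primitive (fun t => r * cexp_i (a * t)) (fun t => ('i%C * a%:C * r) * cexp_i (a * t)).
Proof.
have E s : cexp_i s = 'i%C * (1 * sin s)%:C + (1 * cos s)%:C :> R[i].
  by apply/eqP; rewrite /cexp_i eq_complex /=; apply/andP; split; apply/eqP; ring.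
have h1 : cintble D (fun t => (1 * a * cos (a * t))%:C) by apply: L2i; apply: L2_trig => //; exact: measurable_cos.
have h2 : cintble D (fun t => (1 * - a * sin (a * t))%:C) by apply: L2i; apply: L2_trig => //; exact: measurable_sin.
have h := primitive_lin 'i%C h1 h2 (primitive_sin a 1) (primitive_cos a 1).
have h12 : cintble D (fun t => 'i%C * (1 * a * cos (a * t))%:C + (1 * - a * sin (a * t))%:C).
  by apply: cintbleD => //; exact: cintbleZ.
have z0 : primitive (fun=> 0) (fun=> 0).
  by move=> t _; rewrite /pint cintegral0 addr0.
have cst0 : cintble D (fun=> 0 : R[i]) by apply: L2i; exact: L2_cst.
have := primitive_lin r h12 cst0 h z0.
have -> : (fun t => r * ('i%C * (1 * sin (a * t))%:C + (1 * cos (a * t))%:C) + 0) = (fun t => r * cexp_i (a * t)).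
  by apply/funext => t; rewrite addr0 E.
have -> // : (fun t => r * ('i%C * (1 * a * cos (a * t))%:C + (1 * - a * sin (a * t))%:C) + 0) =
   (fun t => ('i%C * a%:C * r) * cexp_i (a * t)).
apply/funext => t; rewrite addr0 E !mul1r rmorphM /= rmorphM rmorphN /=.
have i2 : 'i%C * 'i%C = -1 :> R[i] by apply/eqP; rewrite eq_complex /=; apply/andP; split; apply/eqP; ring.
have -> : 'i%C * a%:C * r * ('i%C * (sin (a * t))%:C + (cos (a * t))%:C) =
  r * (a%:C * ('i%C * 'i%C) * (sin (a * t))%:C + 'i%C * a%:C * (cos (a * t))%:C) by ring.
by rewrite i2; ring.
Qed.

Definition bnd F := match bc with
  | Per => F 0 = F omega | Ap => F 0 = - F omega | Dir => F 0 = 0 /\ F omega = 0 end.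

(** The conditions on the derivatives of orders 2j and 2j + 1 together; Dirichlet conditions
    restrict the even orders only. *)
Definition bnd2 F G := bnd F /\ (bc <> Dir -> bnd G).

(** The conjugate basis functions solve G'' = -nu^2 G under the same boundary conditions: they are
    the test functions for the integrations by parts. *)
Lemma bas_ode i : exists G1, [/\ primitive (fun t => (b i t)^*) G1,
  primitive G1 (fun t => - (nu i ^+ 2)%:C * (b i t)^*), L2 G1 & bnd2 (fun t => (b i t)^*) G1].
Proof.
have P : bc <> Dir -> exists2 a : R, a ^+ 2 = nu i ^+ 2 &
   (fun t => (b i t)^*) = (fun t => 1 * cexp_i (a * t)) /\
   cexp_i (a * omega) = if bc is Per then 1 else -1.
  move=> bcD; pose mm : int := 2 * bidx bc i + (theta bc)%:Z.
  have me : (fun t => (b i t)^*) = (fun t => 1 * cexp_i (pi * mm%:~R / omega * t)).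
    apply/funext => t; rewrite mul1r; have -> : b i t = efun omega bc (bidx bc i) t by case: bc bcD.
    by rewrite /efun -cexp_iN opprK; congr cexp_i; rewrite /mm; ring.
  exists (pi * mm%:~R / omega).
    have -> : nu i = pi * (`|mm|%N)%:R / omega.
      rewrite /nu /mm /freq; congr (pi * _%:R / omega).
      have := odd_double_half i; rewrite /bidx uphalf_half.
      by case: bc bcD => //= _; case: (odd i) => /=; lia.
    rewrite !exprMn; congr (_ * _ * _).
    by case: (mm) => n //; rewrite NegzE rmorphN sqrrN.
  split => //; rewrite divfK // /mm rmorphD rmorphM /= mulrDr mulrA [pi * 2]mulrC cexp_iD cexp_i_2piZ mul1r.
  by case: bc bcD => //= _; rewrite ?mulr0 ?cexp_i0 ?mulr1 ?cexp_i_pi.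
have Pc (a : R) (r : R[i]) : L2 (fun t => r * cexp_i (a * t)).
  by apply: L2Z; apply: (@L2_bounded _ _ _ _ 1); [exact: cmf_cexp_i|move=> t _; rewrite cabs_cexp_i].
have [bcD|bcD] := pselect (bc = Dir).
  exists (fun t => (Num.sqrt 2 * (nu i) * cos (nu i * t))%:C).
  have e t : (b i t)^* = (Num.sqrt 2 * sin (nu i * t))%:C.
    rewrite /bas bcD /efun_dir conj_real /nu /freq bcD; congr ((_ * sin _)%:C); ring.
  rewrite (_ : (fun t => (b i t)^*) = (fun t => (Num.sqrt 2 * sin (nu i * t))%:C)); last exact/funext.
  split.
  - exact: primitive_sin.
  - have := primitive_cos (nu i) (Num.sqrt 2 * nu i); congr primitive; apply/funext => t.
    by rewrite e -rmorphN -rmorphM; congr (_%:C); ring.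
  - by apply: L2_trig => //; exact: measurable_cos.
  - split; last by rewrite bcD.
    rewrite /bnd bcD mulr0 sin0 mulr0; split => //.
    by rewrite /nu /freq bcD divfK // sin_natpi mulr0.
have [a a2 [ae aw]] := P bcD; rewrite ae.
exists (fun t => ('i%C * a%:C * 1) * cexp_i (a * t)); split.
- exact: primitive_cexp.
- have := primitive_cexp a ('i%C * a%:C * 1); congr primitive; apply/funext => t.
  have -> : (b i t)^* = 1 * cexp_i (a * t) by rewrite -(congr1 (fun h => h t) ae).
  rewrite -a2 rmorphXn /= mul1r mulr1.
  have i2 : 'i%C * 'i%C = -1 :> R[i] by apply/eqP; rewrite eq_complex /=; apply/andP; split; apply/eqP; ring.
  have -> : 'i%C * a%:C * ('i%C * a%:C) = ('i%C * 'i%C) * a%:C ^+ 2 :> R[i] by ring.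
  by rewrite i2 mulN1r.
- exact: Pc.
- by split=> [|_]; rewrite /bnd; case: bc bcD aw => // _ aw; rewrite mulr0 cexp_i0 aw ?mulrN ?opprK.
Qed.

(** Two integrations by parts. In each boundary term either one factor vanishes, or the products at
    the two ends agree, the two antiperiodic signs cancelling. *)
Lemma two_derivatives Z0 Z1 g i : L2 g -> primitive Z0 Z1 -> primitive Z1 g -> bnd2 Z0 Z1 ->
  ip g (b i) = - (nu i ^+ 2)%:C * ip Z0 (b i).
Proof.
move=> hg p0 p1 bz; have [G1 [q0 q1 hG1 bG]] := bas_ode i.
have h1 : L2 Z1 by apply: primitive_L2 p1.
have h0 : L2 Z0 by apply: primitive_L2 p0.
have hb : L2 (fun t => (b i t)^*) by apply: L2J.
have hb' : L2 (fun t => - (nu i ^+ 2)%:C * (b i t)^*) by exact: L2Z.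
pose proof (integration_by_parts hg hG1 p1 q0) as e1.
pose proof (integration_by_parts h1 hb' p0 q1) as e2.
have [b1 b2] : Z1 omega * (b i omega)^* - Z1 0 * (b i 0)^* = 0 /\ Z0 omega * G1 omega - Z0 0 * G1 0 = 0.
  move: bz bG; rewrite /bnd2 /bnd; case: bc => -[+ +] [+ +].
  - by move=> -> h -> h'; rewrite h // h' // !subrr.
  - by move=> -> h -> h'; rewrite h // h' // !mulrNN !subrr.
  - by move=> [-> ->] _ [-> ->] _; rewrite !mulr0 !mul0r !subrr.
rewrite !ipE [RHS]mulrCA -[X in _ = _ * X]cintegralZ //; last exact: ip_intble.
congr (_ * _).
have i1 : cintble D (fun t => g t * (b i t)^*) by apply: ip_intble.
have i2 : cintble D (fun t => Z1 t * G1 t).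
  by have := ip_intble h1 (L2J hG1); congr cintble; apply/funext => t; rewrite conj_inv.
have i3 : cintble D (fun t => Z0 t * (- (nu i ^+ 2)%:C * (b i t)^*)).
  have := ip_intble h0 (L2J hb'); congr cintble; apply/funext => t; rewrite conj_inv //.
rewrite b1 cintegralD // in e1; rewrite b2 cintegralD // in e2.
have -> : cintegral D (fun t => - (nu i ^+ 2)%:C * (Z0 t * (b i t)^*)) =
   cintegral D (fun t => Z0 t * (- (nu i ^+ 2)%:C * (b i t)^*)).
  by apply: eq_cintegral => t _; rewrite mulrCA.
by move/eqP: e1; move/eqP: e2; rewrite !addr_eq0 => /eqP -> /eqP ->; rewrite opprK.
Qed.

Definition chain r (Y : nat -> R -> R[i]) :=
  (forall j, (j < r)%N -> primitive (Y j) (Y j.+1)) /\ L2 (Y r).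

Lemma satisfies_bcP k Y : (0 < k)%N -> satisfies_bc omega k bc Y <->
  forall j, (j < k)%N -> bnd2 (Y (2 * j)%N) (Y (2 * j).+1).
Proof.
move=> k0; have P (Q : nat -> Prop) : (forall j, (j <= (2 * k).-1)%N -> Q j) <->
    forall j, (j < k)%N -> Q (2 * j)%N /\ Q (2 * j).+1.
  split=> h j jk; first by split; apply: h; lia.
  have [h1 h2] := h j./2 ltac:(lia).
  have := odd_double_half j; rewrite -mul2n; case: (odd j) => /= <-; first by rewrite add1n.
  by rewrite add0n.
rewrite /satisfies_bc /bnd2 /bnd; case: bc.
- by rewrite P; split=> h j jk; have [h1 h2] := h j jk; split => //; apply: h2.
- by rewrite P; split=> h j jk; have [h1 h2] := h j jk; split => //; apply: h2.
- split=> [h j jk|h j jk]; last by have [] : _ /\ _ := h j ltac:(lia).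
  by split=> //; apply: h; lia.
Qed.

Lemma chain_coefs r Y i : chain (2 * r) Y -> (forall j, (j < r)%N -> bnd2 (Y (2 * j)%N) (Y (2 * j).+1)) ->
  ip (Y (2 * r)%N) (b i) = (- (nu i ^+ 2)%:C) ^+ r * ip (Y 0%N) (b i).
Proof.
elim: r => [|r IH] [pY hY] bY; first by rewrite muln0 expr0 mul1r.
have e : (2 * r.+1)%N = (2 * r).+2 by lia.
rewrite e in pY hY *.
have hL := chain_L2 pY hY.
rewrite (@two_derivatives (Y (2 * r)%N) (Y (2 * r).+1)) //.
- rewrite IH ?exprS ?mulrA //; first by split=> [j jr|]; [apply: pY; lia|apply: hL; lia].
  by move=> j jr; apply: bY; lia.
- by apply: pY; lia.
- by apply: pY; lia.
- by apply: bY; lia.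
Qed.

Lemma pint_L2 f : L2 f -> primitive (pint f) f /\ L2 (pint f).
Proof.
move=> hf; have p : primitive (pint f) f by move=> t _; rewrite pint0 add0r.
by split=> //; apply: primitive_L2 p.
Qed.

Lemma shift_primitive z f : L2 f -> primitive (fun t => z + pint f t) f /\ L2 (fun t => z + pint f t).
Proof.
move=> hf; have p : primitive (fun t => z + pint f t) f by move=> t _; rewrite pint0 addr0.
by split=> //; apply: primitive_L2 p.
Qed.

Lemma ip_const z i : ip (fun=> z) (b i) = z * ip (fun=> 1) (b i).
Proof.
have h1 : L2 (fun=> 1) by exact: L2_cst.
have -> : (fun=> z) = (fun t : R => z * 1) by apply/funext => t; rewrite mulr1.
by rewrite (ipZ z h1 (L2b i)).
Qed.

Lemma two_antiderivatives g (a : H) : L2 g -> (forall i, ip g (b i) = - (nu i ^+ 2)%:C * a i) ->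
  exists Z0 Z1, [/\ primitive Z0 Z1, primitive Z1 g, L2 Z0, bnd2 Z0 Z1 &
    forall i, ip Z0 (b i) = a i].
Proof.
move=> hg ga.
suff [al [be [h hP]]] : exists al be : R[i],
    bnd2 (fun t => be + pint (fun u => al + pint g u) t) (fun t => al + pint g t) /\
    forall i, nu i = 0 -> ip (fun t => be + pint (fun u => al + pint g u) t) (b i) = a i.
  have [p1 h1] := shift_primitive al hg; have [p0 h0] := shift_primitive be h1.
  exists (fun t => be + pint (fun u => al + pint g u) t), (fun t => al + pint g t); split => // i.
  have [n0|n0] := eqVneq (nu i) 0; first exact: hP.
  pose proof (@two_derivatives _ _ _ i hg p0 p1 h) as e; move: e; rewrite ga.
  have nz : - (nu i ^+ 2)%:C != 0 :> R[i] by rewrite oppr_eq0 -cabs_eq0 cabsR normr_eq0 expf_neq0.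
  by move/(mulfI nz) => ->.
have [_ hp] := pint_L2 hg; have [_ hpp] := pint_L2 hp.
have pE al : pint (fun u => al + pint g u) omega = omega%:C * al + pint (pint g) omega.
  rewrite (@pintD _ omega) //; [|exact: L2i (L2_cst al)|exact: L2i].
  by rewrite pint_cst // ltW.
have oC : omega%:C != 0 :> R[i] by rewrite -cabs_eq0 cabsR normr_eq0.
have nu_pos i : (0 < freq i)%N -> nu i != 0.
  by move=> f0; rewrite /nu !mulf_neq0 ?invr_eq0 ?pnatr_eq0 -?lt0n // gt_eqF.
rewrite /bnd2 /bnd; case E : bc.
- have b00 : b 0%N = (fun=> 1).
    apply/funext => t; rewrite /bas E /efun (_ : 2 * bidx Per 0 + (theta Per)%:Z = 0) //.
    by rewrite mulr0 !mul0r oppr0 cexp_i0.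
  have ip1 : ip (fun=> 1) (b 0%N) = 1 by have [_ o _] := onb; rewrite -{1}b00 o eqxx.
  have g0 : pint g omega = 0.
    have n00 : nu 0%N = 0 by rewrite /nu /freq E /= mulr0 mul0r.
    have := ga 0%N; rewrite n00 b00 expr0n oppr0 mul0r ipE => /eqP.
    rewrite mulf_eq0 => /orP[|/eqP h].
      by rewrite -cabs_eq0 cabsR normr_eq0 invr_eq0 (negbTE omega_neq0).
    by rewrite -[RHS]h; apply: eq_cintegral => t _; rewrite [X in _ * X]conj_one mulr1.
  pose al := - (pint (pint g) omega / omega%:C); pose Z t := pint (fun u => al + pint g u) t.
  have [_ hal] := shift_primitive al hg.
  have [_ hZ] := pint_L2 hal.
  exists al, (a 0%N - ip Z (b 0%N)); split.
    split=> [|_]; last by rewrite pint0 g0.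
    by rewrite pint0 pE /al mulrN mulrCA divff // mulr1 addNr.
  move=> i ni; have -> : i = 0%N.
    apply/eqP; rewrite -leqn0 leqNgt; apply/negP => i0.
    by have := nu_pos i; rewrite ni eqxx /freq E => /(_ ltac:(lia)).
  have -> : bas omega Per 0%N = b 0%N by rewrite E.
  have hc : L2 (fun=> a 0%N - ip Z (b 0%N)) by exact: L2_cst.
  have -> : ip (fun t => a 0%N - ip Z (b 0%N) + pint (fun u => al + pint g u) t) (b 0%N) =
     ip (fun=> a 0%N - ip Z (b 0%N)) (b 0%N) + ip Z (b 0%N) by exact: (ipD hc hZ (L2b 0%N)).
  by rewrite ip_const ip1 mulr1 subrK.
- pose al := - (pint g omega / 2).
  exists al, (- (pint (fun u => al + pint g u) omega / 2)); split.
    split=> [|_]; rewrite ?pint0 ?addr0 /al; last by field.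
    by set u := pint _ _; field.
  by move=> i ni; have := nu_pos i; rewrite ni eqxx /freq E => /(_ ltac:(lia)).
- exists (- (pint (pint g) omega / omega%:C)), 0; split.
    split=> //; rewrite !add0r pint0 pE; split => //.
    by rewrite mulrN mulrCA divff // mulr1 addNr.
  by move=> i ni; have := nu_pos i; rewrite ni eqxx /freq E => /(_ ltac:(lia)).
Qed.

Lemma chain_exists r : forall g (a : H), L2 g -> (forall i, ip g (b i) = (- (nu i ^+ 2)%:C) ^+ r * a i) ->
  exists Y, [/\ chain (2 * r) Y, forall j, (j < r)%N -> bnd2 (Y (2 * j)%N) (Y (2 * j).+1),
    Y (2 * r)%N = g & forall i, ip (Y 0%N) (b i) = a i].
Proof.
elim: r => [|r IH] g a hg ga.
  by exists (fun=> g); split => // i; rewrite ga mul1r.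
pose a' i := (- (nu i ^+ 2)%:C) ^+ r * a i.
have ha' : is_ell2 a'.
  (* The intermediate coefficients are dominated by the outer ones: v^r |a| <= |a| + v^(r + 1) |a|,
     according to whether v <= 1 or v > 1. *)
  have hs : is_ell2 (fun i => (cabs (a i))%:C + (cabs (ip g (b i)))%:C).
    apply: is_ell2D.
      by apply: (is_ell2_le (M := 1) (coefP a)) => i; rewrite cabsR ger0_norm ?cabs_ge0 ?mul1r.
    apply: (is_ell2_le (M := 1) (is_ell2_coefs onb hg)) => i.
    by rewrite cabsR ger0_norm ?cabs_ge0 ?mul1r.
  apply: (is_ell2_le (M := 1) hs) => i; rewrite mul1r -rmorphD cabsR ger0_norm ?addr_ge0 ?cabs_ge0 //.
  rewrite ga /a' !cabsM !cabsX !cabsN cabsR; set v := `|_|; have v0 : 0 <= v by exact: normr_ge0.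
  have ca := cabs_ge0 (a i).
  have [v1|v1] := leP v 1.
    have h1 : v ^+ r * cabs (a i) <= cabs (a i) by rewrite ler_piMl // exprn_ile1.
    have h2 : 0 <= v ^+ r.+1 * cabs (a i) by rewrite mulr_ge0 // exprn_ge0.
    lra.
  have h1 : v ^+ r * cabs (a i) <= v ^+ r.+1 * cabs (a i).
    by rewrite ler_wpM2r // exprS ler_peMl ?exprn_ge0 // ltW.
  lra.
have [Z0 [Z1 [p0 p1 h0 bZ Za]]] := @two_antiderivatives g (Ell2 ha') hg
   ltac:(by move=> i; rewrite ga exprS -mulrA).
have [Y [[pY hY] bY Yr Ya]] := IH Z0 a h0 (fun i => Za i).
pose Y' j := if (j <= 2 * r)%N then Y j else if j == (2 * r).+1 then Z1 else g.
have e : (2 * r.+1)%N = (2 * r).+2 by lia.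
have E1 j : (j <= 2 * r)%N -> Y' j = Y j by rewrite /Y' => ->.
have E2 : Y' (2 * r).+1 = Z1 by rewrite /Y' ltnn eqxx.
have E3 : Y' (2 * r).+2 = g by rewrite /Y' leqNgt ltnW //= eqn_leq ltnn.
exists Y'; rewrite e; split => //.
- split; last by rewrite E3.
  move=> j jr; have [j1|j1] := ltnP j (2 * r).
    by rewrite !E1 ?(ltnW j1) //; apply: pY.
  have [->|j2] := eqVneq j (2 * r)%N; first by rewrite E1 // Yr E2.
  have -> : j = (2 * r).+1 by lia.
  by rewrite E2 E3.
- move=> j jr; have [j1|j1] := ltnP j r.
    rewrite !E1; [exact: bY|lia|lia].
  have -> : j = r by lia.
  by rewrite E1 // Yr E2.
Qed.

End DifferentialOperator.

(** * Blocks of indices with a common eigenvalue *)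

Section Blocks.
Variable bc : bcond.

Definition blkb (i : nat) : nat :=
  match bc with Per => uphalf i | Ap => i./2 | Dir => i.+1 end.

Lemma blkb_le i : (blkb i <= i.+1)%N.
Proof. by have := odd_double_half i; rewrite /blkb ?uphalf_half; case: bc; case: (odd i) => /=; lia. Qed.

Lemma blkb_eq i j : blkb i = blkb j -> (i <= j.+1)%N.
Proof.
have := odd_double_half i; have := odd_double_half j.
by rewrite /blkb ?uphalf_half; case: bc; case: (odd i); case: (odd j) => /=; lia.
Qed.

Lemma blkb_cut i n : (blkb i <= n)%N = (i < head_bound bc n)%N.
Proof.
have := odd_double_half i.
by rewrite /blkb /head_bound ?uphalf_half; case: bc; case: (odd i) => /=; lia.
Qed.

Lemma head_bound_le n : (head_bound bc n <= 2 * n + 2)%N.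
Proof. by rewrite /head_bound; case: bc; lia. Qed.

End Blocks.

(** * The matrix of L_bc and its spectral gaps *)

Section Coordinates.
Context {R : realType} (omega : R) {omega_pos : positive_length omega}.
Let omega_gt0 : 0 < omega := omega_pos.
Variables (bc : bcond) (k : nat) (q : R -> R[i]).
Hypothesis k_gt1 : (1 < k)%N.
Hypothesis L2q : @L2 R omega q.
Notation mu := (@lebesgue_measure R).
Notation D := (`[0, omega]%classic : set R).
Notation L2 := (@L2 R omega).
Notation L2norm := (@L2norm R omega).
Notation ip := (@ip R omega).
Notation aeeq := (@aeeq R omega).
Notation primitive := (@primitive R omega).
Notation H := (ell2 R).
Notation b := (bas omega bc).
Notation blk := (blkb bc).
Notation cfb := (cf omega b).
Notation nub := (nu omega bc).
Implicit Types (x y f g F G : R -> R[i]) (z : R[i]).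
Let mD : measurable D := measurable_D omega.
Let pi0 : 0 < pi :> R := @pi_gt0 R.
Let omega_neq0 : omega != 0. Proof. by rewrite gt_eqF. Qed.
Let L2i x : L2 x -> cintble D x. Proof. exact: L2_cintble. Qed.
Let onb : orthonormal_basis omega b. Proof. exact: bas_onb. Qed.
Let L2b i : L2 (b i). Proof. exact: L2_bas. Qed.

Definition Qb i j := ip (fun t => q t * b j t) (b i).
Definition lamb i : R := nub i ^+ (2 * k).
Lemma cmf_b i : cmf D (b i). Proof. by have := L2_cmf (L2b i). Qed.

Lemma L2_qb j : L2 (fun t => q t * b j t).
Proof. by apply: (L2_mulb L2q (cmf_b j)) => t _; exact: cabs_bas. Qed.

Lemma L2_qbJ j : L2 (fun t => (q t)^* * b j t).
Proof. by apply: (L2_mulb (L2J L2q) (cmf_b j)) => t _; exact: cabs_bas. Qed.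

Lemma L2norm_mulb f h B : L2 f -> cmf D h -> 0 <= B -> (forall t, D t -> cabs (h t) <= B) ->
  L2norm (fun t => f t * h t) <= B * L2norm f.
Proof.
move=> hf mh B0 hB; have hm := L2_mulb hf mh hB.
rewrite -(ler_pXn2r (ltn0Sn 1)) ?nnegrE ?mulr_ge0 ?L2norm_ge0 // exprMn.
rewrite -lee_fin -(@lee_pmul2l _ omega%:E) //= -!EFinM -integral_sqr // mulrCA EFinM -integral_sqr //.
have [_ i1] := iffLR (L2P omega _) hf; have [_ i2] := iffLR (L2P omega _) hm.
rewrite -ge0_integralZl //.
- apply: ge0_le_integral => //.
  + by move=> t _; rewrite lee_fin exprn_ge0 ?cabs_ge0.
  + exact: measurable_int i2.
  + by apply: measurable_funeM; exact: measurable_int i1.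
  + move=> t Dt; rewrite -EFinM lee_fin cabsM exprMn mulrC ler_wpM2r ?exprn_ge0 ?cabs_ge0 //.
    by rewrite lerXn2r ?nnegrE ?cabs_ge0 ?hB.
- exact: measurable_int i1.
- by move=> t _; rewrite lee_fin exprn_ge0 ?cabs_ge0.
- by rewrite lee_fin exprn_ge0.
Qed.

(** sqrt 2 bounds the basis functions; the summand 1 keeps the constant positive when q = 0. *)
Definition Mq : R := Num.sqrt 2 * L2norm q + 1.

Lemma Mq_gt0 : 0 < Mq.
Proof. by rewrite ltr_wpDl // mulr_ge0 ?sqrtr_ge0 // L2norm_ge0. Qed.

Lemma Qb_col j n : \sum_(i < n) cabs (Qb i j) ^+ 2 <= Mq ^+ 2.
Proof.
apply: le_trans (bessel onb n (L2_qb j)) _.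
rewrite lerXn2r ?nnegrE ?L2norm_ge0 ?(ltW Mq_gt0) //.
apply: le_trans (L2norm_mulb L2q (cmf_b j) (sqrtr_ge0 2) (fun t _ => cabs_bas omega bc j t)) _.
by rewrite lerDl.
Qed.

Lemma lambE i : lamb i = eigval0 omega k bc (blk i).
Proof. by rewrite /lamb /nu /freq /eigval0 /blkb; case: bc => //=; rewrite addn0. Qed.

Lemma freq_bounds i : (i <= freq bc i <= i.+1)%N.
Proof. by have := odd_double_half i; rewrite /freq ?uphalf_half; case: bc; case: (odd i) => /=; lia. Qed.

Lemma freq_blk i j : blk i != blk j -> (freq bc i != freq bc j) /\ odd (freq bc i) = odd (freq bc j) \/ bc = Dir /\ i != j.
Proof.
rewrite /freq /blkb; case: bc => h.
- by left; split; [lia|rewrite !mul2n !odd_double].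
- by left; split; [lia|rewrite !mul2n !oddD !odd_double].
- by right; split => //; lia.
Qed.

(** Half of the leading constant of the eigenvalues: the factor 2 is spent on |i - j| <= 2 |freq i -
    freq j|. *)
Definition c0 : R := (pi / omega) ^+ (2 * k) / 2.

Lemma c0_gt0 : 0 < c0. Proof. by rewrite /c0 divr_gt0 // exprn_gt0 // divr_gt0. Qed.

Lemma lamb_freq i : lamb i = 2 * c0 * (freq bc i)%:R ^+ (2 * k).
Proof.
rewrite /lamb /nu /c0 mulrAC exprMn [2 * _]mulrC divfK //.
Qed.

(** u^(2k) - v^(2k) >= (u - v) u^(2k - 1) for frequencies u > v. Frequencies lie between i and i +
    1, so j <= i could still allow u = v - 1; outside the Dirichlet case equal parity excludes
    it. *)
Lemma lamb_gap i j : blk i != blk j ->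
  c0 * `|i%:R - j%:R| * (maxn i j)%:R ^+ (2 * k - 4).+3 <= `|lamb i - lamb j|.
Proof.
have e : (2 * k - 4).+3 = (2 * k).-1 by lia.
rewrite e; wlog ij : i j / (j <= i)%N => [h|bij].
  move=> bij; have [ji|ij] : (j <= i)%N \/ (i <= j)%N by lia.
    exact: h.
  by rewrite distrC maxnC [X in _ <= X]distrC; apply: h; rewrite // eq_sym.
have ff : (freq bc j < freq bc i)%N /\ (i - j <= 2 * (freq bc i - freq bc j))%N.
  have := freq_bounds i; have := freq_bounds j; have := freq_blk bij.
  have := odd_double_half (freq bc i); have := odd_double_half (freq bc j).
  case=> [] ; case: (freq_blk bij) => [[f1 f2]|[bD f1]]; last by rewrite /freq bD; lia.
  by move: f1 f2; move: (freq bc i) (freq bc j) => u v; case: (odd u); case: (odd v) => //=; lia.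
rewrite !lamb_freq (maxn_idPl ij) -mulrBr normrM gtr0_norm ?mulr_gt0 ?c0_gt0 //.
rewrite -mulrA mulrAC [2 * c0]mulrC -!mulrA ler_pM2l ?c0_gt0 //.
set u := freq bc i; set v := freq bc j.
have [vu iju] := ff; have /andP[iu _] := freq_bounds i.
have k2 : (2 * k)%N = (2 * k).-1.+1 by lia.
have h1 : v%:R ^+ (2 * k) <= v%:R * u%:R ^+ (2 * k).-1 :> R.
  by rewrite {1}k2 exprS ler_wpM2l // lerXn2r ?nnegrE // ler_nat ltnW.
have h2 : (u%:R - v%:R) * u%:R ^+ (2 * k).-1 <= u%:R ^+ (2 * k) - v%:R ^+ (2 * k) :> R.
  have uk : u%:R ^+ (2 * k) = u%:R * u%:R ^+ (2 * k).-1 :> R by rewrite {1}k2 exprS.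
  by rewrite mulrBl uk; lra.
have h0 : 0 <= (u%:R - v%:R) * u%:R ^+ (2 * k).-1 :> R.
  by rewrite mulr_ge0 ?exprn_ge0 // subr_ge0 ler_nat ltnW.
rewrite ger0_norm ?(le_trans h0) // ger0_norm ?subr_ge0 ?ler_nat //.
have E : (i%:R - j%:R) * i%:R ^+ (2 * k).-1 <= 2 * (u%:R ^+ (2 * k) - v%:R ^+ (2 * k)) :> R.
  apply: le_trans (ler_wpM2l (ler0n _ 2) h2); rewrite mulrA.
  apply: ler_pM; rewrite ?exprn_ge0 ?subr_ge0 ?ler_nat //.
    by rewrite -!natrB ?(ltnW vu) // -natrM ler_nat.
  by rewrite lerXn2r ?nnegrE // ler_nat.
  by rewrite mulrA; move: E; set x := _ * _ ^+ _; set y := _ ^+ _ - _; lra.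
all: by rewrite exprn_gt0 // divr_gt0.
Qed.

Lemma lamb_low i : c0 * i%:R ^+ 2 <= lamb i.
Proof.
rewrite lamb_freq; have c := c0_gt0; have [->|i0] := posnP i.
  rewrite expr0n mulr0; apply: mulr_ge0; last exact: exprn_ge0.
  by apply: mulr_ge0 => //; exact: ltW.
have /andP[fi _] := freq_bounds i.
have -> : 2 * c0 * (freq bc i)%:R ^+ (2 * k) = c0 * (2 * (freq bc i)%:R ^+ (2 * k)) by ring.
rewrite ler_pM2l //.
have h : i%:R ^+ 2 <= (freq bc i)%:R ^+ (2 * k) :> R.
  apply: (@le_trans _ _ (i%:R ^+ (2 * k))); last by rewrite lerXn2r ?nnegrE // ler_nat.
  by rewrite ler_weXn2l ?ler1n //; lia.
by apply: le_trans h _; rewrite ler_peMl ?exprn_ge0 // ler1n.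
Qed.

(** Parseval's identity is applied to Y and conj(q) b i, both square-integrable, after moving q to
    the second factor. *)
Lemma ip_q Y i : L2 Y -> L2 (fun t => q t * Y t) ->
  ip (fun t => q t * Y t) (b i) = csum (fun j => Qb i j * cfb Y j).
Proof.
move=> hY hqY.
have -> : ip (fun t => q t * Y t) (b i) = ip Y (fun t => (q t)^* * b i t).
  rewrite !ipE; congr (_ * _); apply: eq_cintegral => t _.
  by rewrite rmorphM /= conj_inv mulrA [Y t * q t]mulrC.
rewrite (ip_cf onb hY (L2_qbJ i)); congr csum; apply/funext => j.
rewrite [RHS]mulrC; congr (_ * _); rewrite (cfE onb j (L2_qbJ i)) -(ipJ (L2_qbJ i) (L2b j)) /Qb.
rewrite !ipE; congr (_ * _); apply: eq_cintegral => t _.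
by rewrite rmorphM /= conj_inv mulrA [b j t * q t]mulrC.
Qed.

Lemma mul_q_L2 Y0 Y1 : L2 Y1 -> primitive Y0 Y1 -> L2 (fun t => q t * Y0 t).
Proof.
move=> h1 p; have [B hB] := primitive_bound h1 p.
by apply: (L2_mulb L2q _ hB); apply: cont_on_cmf; exact: primitive_cont p.
Qed.

(** The sign (-1)^k cancels the one in (-nu^2)^k. [chain_coefs] reads off the coefficients;
    conversely [chain_exists] rebuilds the derivatives, with their boundary conditions, from decay
    of the coefficients alone. *)
Lemma Lbc_coord y f : L2 y -> L2 f ->
  Lbc omega k q bc y f <-> Lgraph lamb Qb (cfb y) (cfb f).
Proof.
move=> hy hf; have k0 : (0 < k)%N by lia.
have k2 : (0 < 2 * k)%N by lia.
have nuk i : (- (nub i ^+ 2)%:C) ^+ k = (-1) ^+ k * (lamb i)%:C.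
  have -> : - (nub i ^+ 2)%:C = -1 * (nub i ^+ 2)%:C :> R[i] by rewrite mulN1r.
  by rewrite exprMn /lamb exprM [X in _ = _ * X]rmorphXn.
have m1k : (-1) ^+ k * (-1) ^+ k = 1 :> R[i] by rewrite -exprMn mulrNN mulr1 expr1n.
split=> [[Y [sY bY yY fY]]|[w ws fw]].
  have [pY hYk] := (sobolevP Y k2).1 sY.
  have b2 : forall j, (j < k)%N -> bnd2 omega bc (Y (2 * j)%N) (Y (2 * j).+1) by exact/satisfies_bcP.
  have hL := chain_L2 pY hYk.
  have h0 : L2 (Y 0%N) by apply: hL.
  have hq : L2 (fun t => q t * Y 0%N t) by apply: (@mul_q_L2 _ (Y 1%N)); [apply: hL|apply: pY].
  have ey : cfb y = cfb (Y 0%N) by apply: cf_aeeq.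
  have hk := L2Z ((-1) ^+ k) hYk.
  have ef : cfb f = cfb (fun t => (-1) ^+ k * Y (2 * k)%N t - q t * Y 0%N t).
    by apply: cf_aeeq => //; exact: L2B.
  have C i : ip (Y (2 * k)%N) (b i) = (-1) ^+ k * (lamb i)%:C * ip (Y 0%N) (b i).
    by rewrite (@chain_coefs _ _ _ bc k Y i) // nuk.
  exists ((-1) ^+ k *: cfb (Y (2 * k)%N)).
    move=> i; rewrite lcoefZ (cfE onb i hYk) C ey (cfE onb i h0) !mulrA m1k mul1r //.
  move=> i; rewrite ef (cfB onb hk hq) (cfZ onb _ hYk) lcoefB /Qact ey; congr (_ - _).
  by rewrite (cfE onb i hq) (ip_q i h0 hq).
have [g hg gE] : exists2 g, L2 g & cfb g = (-1) ^+ k *: w.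
  by exists (syn onb ((-1) ^+ k *: w)); [exact: L2_syn|exact: cf_syn].
have ga i : ip g (b i) = (- (nub i ^+ 2)%:C) ^+ k * cfb y i.
  by rewrite -(cfE onb i hg) gE lcoefZ ws nuk mulrA.
have [Y [[pY hY] bY Yk Y0]] := chain_exists hg ga.
have hL := chain_L2 pY hY; have h0 : L2 (Y 0%N) by apply: hL.
have hq : L2 (fun t => q t * Y 0%N t) by apply: (@mul_q_L2 _ (Y 1%N)); [apply: hL|apply: pY].
have e0 : cfb (Y 0%N) = cfb y by apply: ell2_ext => i; rewrite (cfE onb i h0) Y0.
have hk := L2Z ((-1) ^+ k) hY.
exists Y; split.
- exact/(sobolevP Y k2).
- exact/satisfies_bcP.
- by apply: (cf_inj onb hy h0).
- apply: (cf_inj onb hf (L2B hk hq)); apply: ell2_ext => i.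
  rewrite fw (cfB onb hk hq) (cfZ onb _ hY) lcoefB lcoefZ; congr (_ - _).
    by rewrite Yk gE lcoefZ mulrA m1k mul1r.
  by rewrite (cfE onb i hq) (ip_q i h0 hq) -e0.
Qed.

Lemma ell2_coef_small (a : nat -> R[i]) (e : R) : is_ell2 a -> 0 < e ->
  exists N, forall i, (N <= i)%N -> cabs (a i) <= e.
Proof.
move=> ha e0; pose x := Ell2 ha.
have e2 : 0 < e ^+ 2 / 2 by rewrite divr_gt0 // exprn_gt0.
have /cvgrPdist_le/(_ _ e2)[N _ hN] := @cvg_nrm _ x; exists N => i Ni.
rewrite -(ler_pXn2r (ltn0Sn 1)) ?nnegrE ?cabs_ge0 ?(ltW e0) //.
have aux (s v w d : R) : `|w - s| <= d / 2 -> `|w - (s + v)| <= d / 2 -> v <= d.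
  move=> h1 h2; have -> : v = (w - s) - (w - (s + v)) by ring.
  apply: le_trans (ler_norm _) _; apply: le_trans (ler_normB _ _) _.
  by rewrite [d]splitr; exact: lerD.
have h1 := hN i Ni; have h2 := hN i.+1 (leqW Ni); rewrite /= big_ord_recr /= in h2.
exact: aux h1 h2.
Qed.

(** Square-summable coefficients tend to 0. The periodic basis serves for every [bc], because the
    entries of Q inside a block are combinations of periodic Fourier coefficients of q. *)
Lemma riemann_lebesgue (e : R) : 0 < e -> exists N, forall n : int, (N <= `|n|)%N ->
  cabs (ip q (efun omega Per n)) <= e.
Proof.
move=> e0; have onbP : orthonormal_basis omega (bas omega Per) by exact: bas_onb.
have [N hN] := ell2_coef_small (is_ell2_coefs onbP L2q) e0.
exists N => n Nn; have [|i ni] := @bidx_surj Per n; first by [].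
rewrite -ni; apply: hN; apply: leq_trans Nn _; rewrite -ni /bidx.
by have := odd_double_half i; rewrite uphalf_half; case: (odd i) => /=; lia.
Qed.

(** The diagonal entries are the mean of q, minus in the Dirichlet case half the sum of two Fourier
    coefficients by 2 sin^2 s = 1 - cos (2 s). The other entries of a block are Fourier coefficients
    whose frequency grows with the block. *)
Lemma Qb_block (e : R) : 0 < e -> exists N, forall i l, (N <= i)%N -> blk i = blk l ->
  cabs (Qb i l - (i == l)%:R * mean omega q) <= e.
Proof.
move=> e0; have [N hN] := riemann_lebesgue e0; exists N.+1 => i l Ni il.
have qe n : ip q (efun omega Per n) = (omega^-1)%:C * cintegral D (fun t => q t * cexp_i (2 * pi * n%:~R / omega * t)).
  rewrite ipE; congr (_ * _); apply: eq_cintegral => t _; rewrite /efun -cexp_iN opprK; congr (_ * cexp_i _).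
  by rewrite addr0 rmorphM /=; ring.
have iq n : cintble D (fun t => q t * cexp_i (2 * pi * n%:~R / omega * t)).
  pose proof (ip_intble L2q (L2_efun Per n)) as hn; move: hn; congr cintble; apply/funext => t.
  by rewrite /efun -cexp_iN opprK; congr (_ * cexp_i _); rewrite addr0 rmorphM /=; ring.
have [bcD|bcD] := pselect (bc = Dir).
  have <- : i = l by move: il; rewrite /blkb bcD => -[].
  rewrite eqxx mul1r.
  have E : Qb i i = mean omega q - 2^-1 * (ip q (efun omega Per i.+1) + ip q (efun omega Per (- i.+1%:Z))).
    rewrite /Qb ipE !qe /mean -mulrDr -cintegralD // mulrCA -mulrBr; congr (_ * _).
    rewrite -cintegralZ //; last exact: cintbleD.
    rewrite -cintegralB //; [|exact: L2i|by apply: cintbleZ => //; exact: cintbleD].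
    apply: eq_cintegral => t _; rewrite -mulrDr.
    have -> : 2 * pi * (- i.+1%:Z)%:~R / omega * t = - (2 * pi * i.+1%:Z%:~R / omega * t).
      by rewrite rmorphN /=; ring.
    rewrite mulrCA -cexp_real_cos -[X in X - _]mulr1 -mulrBr -mulrA; congr (_ * _).
    rewrite /bas bcD /efun_dir conj_real -!rmorphM.
    have -> : (1 : R[i]) = (1 : R)%:C by [].
    rewrite -rmorphB; congr (_%:C).
    set s := pi * i.+1%:R * t / omega.
    have -> : 2 * pi * i.+1%:Z%:~R / omega * t = s + s by rewrite /s -pmulrn; ring.
    have := cos2Dsin2 s; rewrite cosD mulrACA -!expr2 sqr_sqrtr // => h.
    lra.
  rewrite E addrC addKr cabsN cabsM.
  have -> : cabs (2^-1 : R[i]) = 2^-1.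
    have -> : (2^-1 : R[i]) = (2^-1)%:C by rewrite fmorphV rmorph_nat.
    by rewrite cabsR ger0_norm // invr_ge0.
  have h1 := hN i.+1%:Z ltac:(lia); have h2 := hN (- i.+1%:Z) ltac:(lia).
  have := cabsD (ip q (efun omega Per i.+1)) (ip q (efun omega Per (- i.+1%:Z))).
  lra.
have bE j t : b j t = efun omega bc (bidx bc j) t by case: bc bcD.
have E : Qb i l = ip q (efun omega Per (bidx bc i - bidx bc l)).
  rewrite /Qb qe ipE; congr (_ * _); apply: eq_cintegral => t _; rewrite -mulrA !bE efunM.
  by [].
have [il'|il'] := eqVneq i l.
  rewrite mul1r E il' subrr qe /mean (@eq_cintegral _ _ _ q) ?subrr ?cabs0 ?(ltW e0) // => t _.
  by rewrite mulr0 !mul0r cexp_i0 mulr1.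
rewrite mul0r subr0 E; apply: hN.
have := odd_double_half i; have := odd_double_half l; move: il; rewrite /blkb /bidx ?uphalf_half.
by case: bc bcD => //= _; move/eqP: il'; case: (odd i); case: (odd l) => /=; lia.
Qed.

End Coordinates.

(** * Transfer to L_2[0, omega] *)

Section Transfer.
Context {R : realType} (omega : R) {omega_pos : positive_length omega}.
Variables (k : nat) (q : R -> R[i]) (bc : bcond) (b : nat -> R -> R[i]).
Notation L2 := (@L2 R omega).
Notation L2norm := (@L2norm R omega).
Notation ip := (@ip R omega).
Notation aeeq := (@aeeq R omega).
Notation H := (ell2 R).
Hypothesis onb : orthonormal_basis omega b.
Notation cfb := (cf omega b).
Variables (lam : nat -> R) (U V D : {linear H -> H}).
Hypothesis UV : forall x, U (V x) = x.
Hypothesis VU : forall x, V (U x) = x.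
Hypothesis U_nrm : forall x, nrm (U x) <= 2 * nrm x.
Hypothesis V_nrm : forall x, nrm (V x) <= 2 * nrm x.
Notation S := (Sgraph lam D).
Hypothesis L_S : forall y f, L2 y -> L2 f ->
  Lbc omega k q bc y f <-> S (V (cfb y)) (V (cfb f)).
Hypothesis dichotomy : forall z, eigenvalue_S lam D z \/ exists Rz, is_Sresolvent lam D z Rz.
Implicit Types (x y f : R -> R[i]) (z : R[i]).

Definition conjugate (T : H -> H) : (R -> R[i]) -> R -> R[i] :=
  lift onb (fun a => U (T (V a))).

Lemma cf_conjugate T x : cfb (conjugate T x) = U (T (V (cfb x))).
Proof. exact: cf_lift. Qed.

Lemma L2_conjugate T x : L2 (conjugate T x). Proof. exact: L2_syn. Qed.

Lemma bounded_conjugate (T : {linear H -> H}) M : 0 <= M ->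
  (forall a, nrm (T a) <= M * nrm a) -> bounded_op omega (conjugate T).
Proof.
move=> M0 hT; apply: (@bounded_lift _ _ _ _ onb _ (2 * (M * 2))) => [z a c|a].
  by rewrite !linearP.
apply: le_trans (U_nrm _) _; rewrite -!mulrA ler_wpM2l //.
by apply: le_trans (hT _) _; rewrite ler_wpM2l.
Qed.

Lemma is_resolvent_conjugate z Rz : is_Sresolvent lam D z Rz ->
  is_resolvent omega k q bc z (conjugate Rz).
Proof.
move=> [[C hC] hR]; split.
  apply: (@bounded_conjugate Rz `|C|) => // a; apply: le_trans (hC a) _.
  by rewrite ler_wpM2r ?nrm_ge0 // ler_norm.
move=> f y hf hy; have hz := L2Z z hy.
have e : V (cfb (fun t => z * y t - f t)) = z *: V (cfb y) - V (cfb f).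
  by rewrite (cfB onb hz hf) (cfZ onb z hy) linearB linearZ.
split=> h.
  apply/(L_S hy (L2B hz hf)); rewrite e; apply/hR.
  have <- : cfb (conjugate Rz f) = cfb y by apply: (cf_aeeq onb _ hy h); exact: L2_conjugate.
  by rewrite cf_conjugate VU.
apply: (cf_inj onb _ hy); first exact: L2_conjugate.
rewrite cf_conjugate; have /hR <- : S (V (cfb y)) (z *: V (cfb y) - V (cfb f)).
  by rewrite -e; apply/(L_S hy (L2B hz hf)).
exact: UV.
Qed.

Lemma cf0 : cfb (fun=> 0) = 0.
Proof.
have h0 : L2 (fun=> 0) by exact: L2_cst.
by apply: ell2_ext => i; rewrite (cfE onb i h0) ip0l.
Qed.

(** A resolvent at an eigenvalue would send 0 both to 0 and to an eigenvector; at any other point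
    [dichotomy] supplies a resolvent, which is transported by conjugation. *)
Lemma spectrumE : spectrum omega k q bc = [set z | eigenvalue_S lam D z].
Proof.
apply/seteqP; split=> z /=.
  move=> h; have [//|[Rz hR]] := dichotomy z.
  by case: h; exists (conjugate Rz); exact: is_resolvent_conjugate.
move=> [x x0 Sx] [T [_ hT]]; apply: x0.
have h0 : L2 (fun=> 0) by exact: L2_cst.
have hy : L2 (syn onb (U x)) by exact: L2_syn.
have ey : cfb (syn onb (U x)) = U x by exact: cf_syn.
move: (syn onb (U x)) hy ey => y hy ey.
have hz := L2Z z hy.
have Ly : Lbc omega k q bc y (fun t => z * y t - 0).
  apply/(L_S hy (L2B hz h0)).
  by rewrite (cfB onb hz h0) (cfZ onb z hy) cf0 subr0 linearZ ey VU.
have hz0 := L2Z z h0.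
have L0 : Lbc omega k q bc (fun=> 0) (fun t => z * 0 - 0).
  apply/(L_S h0 (L2B hz0 h0)); rewrite (cfB onb hz0 h0) (cfZ onb z h0) cf0 subr0 scaler0 linear0.
  by apply/SgraphP => i; rewrite linear0 !lcoefE mulr0 subr0.
have /(hT _ _ h0 hy) e1 := Ly; have /(hT _ _ h0 h0) e2 := L0.
have e : aeeq y (fun=> 0) by apply: aeeq_trans e2; apply: aeeq_sym.
have := cf_aeeq onb hy h0 e; rewrite ey cf0 => Ux.
by rewrite -(VU x) Ux linear0.
Qed.

(** The contour is one circle of radius between rho and 1/tau. Pairing with y makes the weak
    integral scalar; its integrand has the expansion of [laurent], and the residue is the pairing of
    y with the conjugate of E. *)
Lemma riesz_projection_conjugate (W : set R[i]) c (r rho tau C : R) (E T N0 : {linear H -> H}) :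
  spectral_data lam D c E T N0 -> (forall v, nrm (E v) <= C * nrm v) ->
  power_bound E N0 rho -> 0 <= rho < r -> 0 <= tau ->
  (forall v, nrm (T v) <= tau * nrm v) -> tau * r < 1 ->
  W = [set z | eigenvalue_S lam D z /\ cabs (z - c) < r] ->
  riesz_projection omega k q bc W (conjugate E).
Proof.
move=> dat hE pb /andP[rho0 rhor] tau0 hT taur WE.
have r0 : 0 < r by exact: le_lt_trans rhor.
have hE' v : nrm (E v) <= `|C| * nrm v.
  by apply: le_trans (hE v) _; rewrite ler_wpM2r ?nrm_ge0 // ler_norm.
split; first by apply: bounded_conjugate hE'.
have onc z : cabs (z - c) = r -> exists Rz, is_Sresolvent lam D z Rz.
  move=> zr; have [[x x0 Sx]|//] := dichotomy z; case: x0.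
  by apply: (no_eigenvalue dat pb rho0 _ tau0 hT _ Sx); rewrite zr.
have [Rz hRz] : exists Rz : R[i] -> {linear H -> H}, forall z, cabs (z - c) = r ->
    is_Sresolvent lam D z (Rz z).
  have /choice[Rz h] : forall z, exists T' : {linear H -> H}, cabs (z - c) = r -> is_Sresolvent lam D z T'.
    move=> z; have [/onc[T' h]|h] := pselect (cabs (z - c) = r); first by exists T'.
    (* A default value off the circle, where nothing is required. *)
    by exists E.
  by exists Rz.
exists [:: (c, r)], (fun z => conjugate (Rz z)); split.
- by rewrite /= r0.
- by [].
- rewrite WE spectrumE; apply/seteqP; split=> z /=; first by rewrite orbF.
  by move=> [? ?]; rewrite orbF.
- move=> z /=; rewrite orbF => /eqP zr; exact: is_resolvent_conjugate (hRz z zr).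
move=> x y hx hy; rewrite big_seq1 /=.
pose phi (a : H) := csum (fun i => U a i * (cfb y i)^*).
have ysum (a : H) : csummable (fun i => a i * (cfb y i)^*).
  under eq_fun do rewrite mulrC.
  by apply: csummable_CS; apply: is_ell2J; exact: coefP.
have phi_lin z (a a' : H) : phi (z *: a + a') = z * phi a + phi a'.
  rewrite /phi -csumZ // -csumD //; last exact: csummableZ.
  by congr csum; apply/funext => i; rewrite linearP !lcoefE mulrDl mulrA.
have phi0 : phi 0 = 0.
  by have := phi_lin 1 0 0; rewrite scale1r addr0 mul1r => /eqP; rewrite -subr_eq subrr => /eqP.
have phi_bd a : cabs (phi a) <= nrm (cfb y) * 2 * nrm a.
  rewrite -mulrA; apply: le_trans (_ : nrm (cfb y) * nrm (U a) <= _); last first.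
    by rewrite ler_wpM2l ?nrm_ge0.
  rewrite /phi; under eq_fun do rewrite mulrC.
  by apply: csum_CS; [exact: nrm_ge0|move=> n; under eq_bigr do rewrite cabsJ; exact: psum_nrm].
have ipc (T' : H -> H) : ip (conjugate T' x) y = phi (T' (V (cfb x))).
  have hT' : L2 (conjugate T' x) by exact: L2_conjugate.
  by rewrite (ip_cf onb hT' hy) cf_conjugate.
rewrite ipc; set a := V (cfb x).
have [C1 C10 hC1] := pb; set B := nrm (cfb y) * 2.
have B0 : 0 <= B by rewrite mulr_ge0 // nrm_ge0.
have iterT s v : nrm (iter s T v) <= tau ^+ s * nrm v.
  elim: s => [|s IH]; first by rewrite expr0 mul1r.
  by rewrite iterS exprS -mulrA; apply: le_trans (hT _) _; rewrite ler_wpM2l.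
pose A := B * C1 * nrm a + B * tau * nrm a.
have t1 : 0 <= B * C1 * nrm a by rewrite !mulr_ge0 ?nrm_ge0.
have t2 : 0 <= B * tau * nrm a by rewrite !mulr_ge0 ?nrm_ge0.
symmetry; rewrite (@circle_mean_series _ c r A rho tau (fun s => phi (iter s N0 (E a)))
   (fun s => phi (iter s.+1 T a))) //=.
- exact: addr_ge0.
- by rewrite rho0.
- move=> s; apply: le_trans (phi_bd _) _.
  apply: (@le_trans _ _ (B * C1 * nrm a * rho ^+ s)).
    have -> : B * C1 * nrm a * rho ^+ s = B * (C1 * rho ^+ s * nrm a) by ring.
    by rewrite ler_wpM2l.
  by rewrite ler_wpM2r ?exprn_ge0 // /A lerDl.
- move=> s; apply: le_trans (phi_bd _) _.
  apply: (@le_trans _ _ (B * tau * nrm a * tau ^+ s)).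
    have -> : B * tau * nrm a * tau ^+ s = B * (tau ^+ s.+1 * nrm a) by rewrite exprS; ring.
    by rewrite ler_wpM2l //; exact: (iterT s.+1).
  by rewrite ler_wpM2r ?exprn_ge0 // /A lerDr.
move=> z zr; have zc : z != c by rewrite -subr_eq0 -cabs_gt0 zr.
rewrite ipc -/a; have [[C2 hC2] _] := hRz z zr.
pose w n := (z - c) ^- n *: iter n N0 (E a) + (z - c) ^+ n *: iter n T (a - E a).
have E1 n : \sum_(s < n) ((z - c) ^- s.+1 * phi (iter s N0 (E a)) - (z - c) ^+ s * phi (iter s.+1 T a))
    - phi (Rz z a) = - phi (Rz z (w n)).
  rewrite [in X in _ - X](laurent dat (hRz z zr) zc n a) -/(w n).
  have phiD (v v' : H) : phi (v + v') = phi v + phi v' by have := phi_lin 1 v v'; rewrite scale1r mul1r.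
  have phiZ s (v : H) : phi (s *: v) = s * phi v by have := phi_lin s v 0; rewrite phi0 !addr0.
  have phiS : phi (\sum_(s < n) ((z - c) ^- s.+1 *: iter s N0 (E a) - (z - c) ^+ s *: iter s.+1 T a)) =
     \sum_(s < n) ((z - c) ^- s.+1 * phi (iter s N0 (E a)) - (z - c) ^+ s * phi (iter s.+1 T a)).
    elim: (n) => [|m IH]; first by rewrite !big_ord0 phi0.
    by rewrite !big_ord_recr /= phiD IH -scaleNr phiD !phiZ mulNr.
  by rewrite phiD phiS opprD addrA subrr add0r.
rewrite /ctends; under eq_fun do rewrite E1 cabsN.
pose g n := B * `|C2| * (C1 * nrm a * (rho / r) ^+ n + nrm (a - E a) * (tau * r) ^+ n).
have gb n : cabs (phi (Rz z (w n))) <= g n.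
  apply: le_trans (phi_bd _) _; rewrite /g -!mulrA ler_wpM2l ?nrm_ge0 // ler_wpM2l //.
  apply: le_trans (hC2 _) _; apply: (@le_trans _ _ (`|C2| * nrm (w n))).
    by rewrite ler_wpM2r ?nrm_ge0 // ler_norm.
  rewrite ler_wpM2l // /w; apply: le_trans (nrmD _ _) _; rewrite !nrmZ cabsV cabsX zr.
  apply: lerD.
    rewrite expr_div_n; apply: (@le_trans _ _ (r ^- n * (C1 * rho ^+ n * nrm a))).
      by rewrite ler_wpM2l // invr_ge0 exprn_ge0 // ltW.
    by rewrite le_eqVlt; apply/orP; left; apply/eqP; ring.
  rewrite exprMn; apply: (@le_trans _ _ (r ^+ n * (tau ^+ n * nrm (a - E a)))).
    by rewrite ler_wpM2l // exprn_ge0 // ltW.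
  by rewrite le_eqVlt; apply/orP; left; apply/eqP; ring.
have g0 : g n @[n --> \oo] --> (0 : R).
  rewrite -(mulr0 (B * `|C2|)); apply: cvgM; first exact: cvg_cst.
  rewrite -(addr0 0); apply: cvgD; apply: geometric_cvg0.
  - by rewrite divr_ge0 // ltW.
  - by rewrite ltr_pdivrMr // mul1r.
  - by rewrite mulr_ge0 // ltW.
  - by [].
apply: (squeeze_cvgr _ (cvg_cst 0) g0).
by near=> n; rewrite cabs_ge0 gb.
Unshelve. all: by end_near.
Qed.

End Transfer.

(** * The Hilbert-Schmidt norm of a difference of projections *)

Section HilbertSchmidt.
Context {R : realType} (omega : R) {omega_pos : positive_length omega}.
Variables (b : nat -> R -> R[i]).
Notation L2 := (@L2 R omega).
Notation L2norm := (@L2norm R omega).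
Notation ip := (@ip R omega).
Notation H := (ell2 R).
Hypothesis onb : orthonormal_basis omega b.
Notation cfb := (cf omega b).
Variables (U V P : {linear H -> H}) (Km : nat -> nat -> R[i]) (W : pred nat) (B : R).
Hypothesis UV : forall x, U (V x) = x.
Hypothesis V_nrm : forall x, nrm (V x) <= 2 * nrm x.
Hypothesis Km_sum : forall (x : H) i, csummable (fun j => Km i j * x j).
Hypothesis UE : forall x i, U x i = x i + csum (fun j => Km i j * x j).
Hypothesis PE : forall x i, P x i = (W i)%:R * x i.

(** The entries of K P - P K; they vanish unless exactly one of the two indices is in W. *)
Let Z i j := Km i j * ((W j)%:R - (W i)%:R).
Hypothesis Z_bound : forall n p, \sum_(i < n) \sum_(j < p) cabs (Z i j) ^+ 2 <= B.

Let Zsum i : is_ell2 (Z i).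
Proof.
exists B => n; apply: le_trans (Z_bound i.+1 n); rewrite big_ord_recr /= lerDr.
by apply: sumr_ge0 => j _; apply: sumr_ge0 => l _; exact: sqr_ge0.
Qed.

Let Zrow i n : \sum_(j < n) cabs (Z i j) ^+ 2 <= rsum (fun j => cabs (Z i j) ^+ 2).
Proof.
have [M hM] := Zsum i.
by apply: (@psum_le_rsum _ _ M) => // j; exact: sqr_ge0.
Qed.

Let rsum_ge0 i : 0 <= rsum (fun j => cabs (Z i j) ^+ 2).
Proof. by have := Zrow i 0; rewrite big_ord0. Qed.

Let commutator (a : H) i : U (P (V a)) i - P a i = csum (fun j => Z i j * V a j).
Proof.
rewrite -[in P a](UV a) UE !PE UE.
have h := Km_sum (V a) i; have hP := Km_sum (P (V a)) i.
rewrite mulrDr opprD addrACA subrr add0r -csumZ // -csumB //; last exact: csummableZ.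
congr csum; apply/funext => j; rewrite PE /Z; ring.
Qed.

(* Bessel's inequality for the functional [a |-> csum (fun j => Z i j * V a j)]. *)
Let row_bessel (c : nat -> R -> R[i]) i n : orthonormal_basis omega c ->
  \sum_(l < n) cabs (csum (fun j => Z i j * V (cfb (c l)) j)) ^+ 2
    <= 4 * rsum (fun j => cabs (Z i j) ^+ 2).
Proof.
move=> onc; pose f (a : H) := csum (fun j => Z i j * V a j).
have L2c l : L2 (c l) by case: onc.
have Zs (a : H) : csummable (fun j => Z i j * a j) by exact: csummable_CS.
have f_lin z (a a' : H) : f (z *: a + a') = z * f a + f a'.
  rewrite /f -csumZ // -csumD //; last exact: csummableZ.
  by congr csum; apply/funext => j; rewrite linearP !lcoefE; ring.
have f0 : f 0 = 0.
  by rewrite /f (_ : (fun _ => _) = fun=> 0) ?csum0 //; apply/funext => j; rewrite linear0 lcoefE mulr0.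
pose r := rsum (fun j => cabs (Z i j) ^+ 2).
have f_bd (a : H) : cabs (f a) <= Num.sqrt r * (2 * nrm a).
  apply: le_trans (_ : Num.sqrt r * nrm (V a) <= _); last by rewrite ler_wpM2l ?sqrtr_ge0.
  by apply: (@csum_CS _ (Z i)); [exact: sqrtr_ge0|move=> p; rewrite sqr_sqrtr ?rsum_ge0 //; exact: Zrow].
(* The functional takes the value s at this vector, whose norm is sqrt s. *)
pose v := partial_sum c (fun l => (f (cfb (c l)))^*) n.
have L2v : L2 v by exact: L2_partial_sum.
set s := \sum_(l < n) _; have s0 : 0 <= s by apply: sumr_ge0 => l _; exact: sqr_ge0.
have nv : nrm (cfb v) = Num.sqrt s.
  rewrite (nrm_cf onb L2v) -[LHS]ger0_norm ?L2norm_ge0 // -sqrtr_sqr.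
  rewrite /v (L2norm_partial_sum onc); congr Num.sqrt; apply: eq_bigr => l _.
  by rewrite cabsJ.
have fv : f (cfb v) = s%:C.
  have E p : f (cfb (partial_sum c (fun l => (f (cfb (c l)))^*) p)) = (\sum_(l < p) cabs (f (cfb (c l))) ^+ 2)%:C.
    elim: p => [|p IH].
      have -> : partial_sum c (fun l => (f (cfb (c l)))^*) 0 = fun=> 0.
        by apply/funext => t; rewrite /partial_sum big_ord0.
      by rewrite big_ord0 (cf0 onb) f0.
    have -> : partial_sum c (fun l => (f (cfb (c l)))^*) p.+1 =
        fun t => partial_sum c (fun l => (f (cfb (c l)))^*) p t + (f (cfb (c p)))^* * c p t.
      by apply/funext => t; rewrite /partial_sum big_ord_recr.
    pose proof (L2_partial_sum onc (fun l => (f (cfb (c l)))^*) p) as hp.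
    rewrite (cfD onb hp (L2Z _ (L2c p))) (cfZ onb _ (L2c p)) addrC f_lin IH big_ord_recr /= rmorphD /=.
    by rewrite addrC; congr (_ + _); rewrite mulrC mulcJ.
  exact: E.
have := f_bd (cfb v); rewrite fv cabsR ger0_norm // nv => h.
have [->|sn0] := eqVneq s 0; first by rewrite mulr_ge0.
have sp : 0 < Num.sqrt s by rewrite sqrtr_gt0 lt_neqAle eq_sym sn0.
have h2 : Num.sqrt s <= 2 * Num.sqrt r.
  rewrite -(ler_pM2r sp) -expr2 sqr_sqrtr //; apply: le_trans h _.
  by rewrite le_eqVlt; apply/orP; left; apply/eqP; ring.
rewrite -/r -[s]sqr_sqrtr // -[r]sqr_sqrtr ?rsum_ge0 //.
have -> : 4 * Num.sqrt r ^+ 2 = (2 * Num.sqrt r) ^+ 2 :> R by ring.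
by rewrite lerXn2r ?nnegrE ?mulr_ge0 ?sqrtr_ge0.
Qed.

(** For any orthonormal basis the sum of squares is exchanged with the sum over rows, and
    [row_bessel] bounds each row; the factor 4 is the square of the norm bound of V. *)
Lemma HSnorm_conjugate_sub :
  (HSnorm omega (fun x t => (conjugate onb U V P x t - lift onb P x t)%R)
    <= (Num.sqrt (4 * B))%:E)%E.
Proof.
have B0 : 0 <= B by have := Z_bound 0 0; rewrite big_ord0.
apply: ub_ereal_sup => _ [c onc <-].
have L2c l : L2 (c l) by case: onc.
pose F : nat -> R -> R[i] := fun l t =>
  @conjugate _ _ omega_pos _ onb U V P (c l) t - @lift _ _ omega_pos _ onb P (c l) t.
have hF l : L2norm (F l) ^+ 2 = rsum (fun i => cabs (csum (fun j => Z i j * V (cfb (c l)) j)) ^+ 2).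
  have h1 : L2 (conjugate onb U V P (c l)) by exact: L2_conjugate.
  have h2 : L2 (lift onb P (c l)) by exact: L2_syn.
  rewrite -(nrm_cf onb (L2B h1 h2)) nrm_sqr; congr rsum; apply/funext => i.
  by rewrite (cfB onb h1 h2) cf_conjugate cf_lift lcoefB commutator.
have hS n : \sum_(l < n) L2norm (F l) ^+ 2 <= 4 * B.
  under eq_bigr do rewrite hF.
  apply: (@rsum2_bound _ (fun l i => cabs (csum (fun j => Z i j * V (cfb (c l)) j)) ^+ 2)).
    by move=> *; exact: sqr_ge0.
  move=> p p'; rewrite exchange_big /=.
  apply: (@le_trans _ _ (\sum_(i < p') 4 * rsum (fun j => cabs (Z i j) ^+ 2))).
    by apply: ler_sum => i _; exact: row_bessel.
  rewrite -mulr_sumr ler_wpM2l //.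
  apply: (@rsum2_bound _ (fun i j => cabs (Z i j) ^+ 2)) => //.
  by move=> *; exact: sqr_ge0.
have F0 n : (0 <= (L2norm (F n) ^+ 2)%:E)%E by rewrite lee_fin sqr_ge0.
have hlim : (\sum_(0 <= n <oo) (L2norm (F n) ^+ 2)%:E <= (4 * B)%:E)%E.
  apply: lime_le; first by apply: is_cvg_nneseries => n _ _; exact: F0.
  by apply: nearW => n; rewrite sumEFin lee_fin big_mkord.
rewrite -powR12_sqrt ?mulr_ge0 // -poweR_EFin.
apply: gt0_ler_poweR; rewrite ?in_itv /= ?leey ?andbT //.
- by apply: nneseries_ge0 => n _ _; exact: F0.
- by rewrite lee_fin mulr_ge0.
Qed.

End HilbertSchmidt.

(** * Tails of inverse powers *)

Section TailSums.
Context {R : realType}.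

(** Telescoping with 1/(x + 1)^2 <= 1/x - 1/(x + 1); the first term, at most 1/s, accounts for the
    factor 2. *)
Lemma sum_inv_sq_tail s n : (0 < s)%N -> \sum_(i < n) (if (s <= i)%N then i%:R ^- 2 else 0) <= 2 / s%:R :> R.
Proof.
move=> s0; have sR : 0 < s%:R :> R by rewrite ltr0n.
have [ns|sn] := leqP n s.
  rewrite big1 ?divr_ge0 // => i _; rewrite leqNgt (leq_trans (ltn_ord i) ns) //.
suff h p : \sum_(i < s + p.+1) (if (s <= i)%N then i%:R ^- 2 else 0) <= 2 / s%:R - (s + p)%:R^-1 :> R.
  have := h (n - s.+1)%N; have -> : (s + (n - s.+1).+1)%N = n by lia.
  by move=> h'; apply: le_trans h' _; rewrite gerBl invr_ge0.
elim: p => [|p IH].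
  rewrite addn1 big_ord_recr /= leqnn big1 ?add0r; last by move=> i _; rewrite leqNgt ltn_ord.
  rewrite addn0 -exprVn; set v := s%:R^-1; have : v <= 1 by rewrite invf_le1 // ler1n.
  have : 0 <= v by rewrite invr_ge0.
  nra.
rewrite addnS big_ord_recr /= leq_addr; apply: le_trans (lerD IH (lexx _)) _.
have a0 : 0 < (s + p)%:R :> R by rewrite ltr0n addn_gt0 s0.
rewrite -!addrA lerD2l addnS -natr1; move: (s + p)%:R a0 => a a0.
have a1 : 0 < a + 1 by lra.
rewrite -subr_ge0; have -> : - (a + 1)^-1 - (- a^-1 + (a + 1) ^- 2) = (a * (a + 1) ^+ 2)^-1.
  have a0' : a != 0 by rewrite gt_eqF.
  have a1' : a + 1 != 0 by rewrite gt_eqF.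
  field.
  by rewrite a0' a1'.
by rewrite invr_ge0 mulr_ge0 ?exprn_ge0 ?ltW.
Qed.

Lemma sum_inv_pow_tail e s n : (0 < s)%N -> (0 < e)%N ->
  \sum_(i < n) (if (s <= i)%N then i%:R ^- (2 * e) else 0) <= 2 / s%:R ^+ (2 * e).-1 :> R.
Proof.
move=> s0 e0; have sR : 0 < s%:R :> R by rewrite ltr0n.
apply: (@le_trans _ _ (\sum_(i < n) s%:R ^- (2 * e - 2) * (if (s <= i)%N then i%:R ^- 2 else 0))).
  apply: ler_sum => i _; case: ifP => [si|_]; last by rewrite mulr0.
  have iR : 0 < i%:R :> R by rewrite ltr0n (leq_trans s0).
  have -> : (2 * e)%N = ((2 * e - 2) + 2)%N by lia.
  rewrite exprD invfM addnK ler_wpM2r ?invr_ge0 ?exprn_ge0 //.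
  by rewrite lef_pV2 ?posrE ?exprn_gt0 // lerXn2r ?nnegrE // ler_nat.
rewrite -mulr_sumr; apply: le_trans (ler_wpM2l _ (sum_inv_sq_tail n s0)) _.
  by rewrite invr_ge0 exprn_ge0.
have -> : (2 * e).-1 = (2 * e - 2).+1 by lia.
by rewrite exprSr invfM mulrCA.
Qed.

End TailSums.

(** * The spectral splitting *)

Section Splitting.
Context {R : realType} (omega : R) {omega_pos : positive_length omega}.
Variables (bc : bcond) (k : nat) (q : R -> R[i]).
Hypothesis k_gt1 : (1 < k)%N.
Hypothesis L2q : @L2 R omega q.
Notation L2 := (@L2 R omega).
Notation L2norm := (@L2norm R omega).
Notation ip := (@ip R omega).
Notation aeeq := (@aeeq R omega).
Notation H := (ell2 R).
Notation b := (bas omega bc).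
Notation cfb := (cf omega b).
Notation onb := (@bas_onb R omega omega_pos bc).

Notation lam := (lamb omega bc k).
Notation blk := (blkb bc).
Notation M := (Mq omega q).
Notation c := (c0 omega k).
Variable m : nat.
Hypothesis m_gt0 : (0 < m)%N.
Hypothesis m_large : 32 * M <= c * m%:R ^+ 2.
Notation sim := (simb blk m).
Notation del := (del M m).
Variables (Km Dm : nat -> nat -> R[i]) (U V D : {linear H -> H}).
Hypothesis UV : forall x, U (V x) = x.
Hypothesis VU : forall x, V (U x) = x.
Hypothesis U_nrm : forall x, nrm (U x) <= 2 * nrm x.
Hypothesis V_nrm : forall x, nrm (V x) <= 2 * nrm x.
Hypothesis L_sim : forall x y, Lgraph lam (Qb omega bc q) (U x) (U y) <->
  exists2 w, scaled_by lam x w & y = w - D x.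
Hypothesis DE : forall (x : H) i, D x i = csum (fun j => Dm i j * x j).
Hypothesis Dm_off : forall i j, ~~ sim i j -> Dm i j = 0.
Hypothesis Dm_near : forall n i j, sim i j -> (0 < n)%N -> (n <= j)%N ->
  cabs (Dm i j - Qb omega bc q i j) <= 8 * M ^+ 2 / (c * n%:R ^+ 2).
Hypothesis D_nrm : forall x, nrm (D x) <= del * nrm x.

Let M_gt0 : 0 < M. Proof. exact: Mq_gt0. Qed.
Let c_gt0 : 0 < c. Proof. exact: c0_gt0. Qed.
Let del0 : 0 < del. Proof. exact: (del_gt0 m M_gt0). Qed.

Lemma gap_sim i j : ~~ sim i j -> 4 * del <= `|lam i - lam j|.
Proof.
apply: (gap_del M_gt0 c_gt0 m_gt0 m_large _ (blkb_le bc)) => i' j'.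
exact: lamb_gap.
Qed.

Lemma cut_ge n : (n <= head_bound bc n)%N.
Proof. by rewrite /head_bound; case: bc; lia. Qed.

Lemma simE i j : (m < blk i)%N -> sim i j = (blk j == blk i).
Proof. by rewrite /simb; lia. Qed.

(** The cutoff is the last index of the blocks up to some n >= m, so it respects the blocks;
    [head_bound] counts indices, hence its predecessor. *)
Lemma cutoff_lamb (B : R) : exists2 N, forall i, (N <= i)%N -> B <= lam i &
  forall i j, sim i j -> (i <= N)%N = (j <= N)%N.
Proof.
have [n0 hn0] : exists n : nat, `|B| / c <= n%:R.
  by exists (Num.bound (`|B| / c)); apply: ltW; apply: archi_boundP; rewrite divr_ge0 // ltW.
pose n := (maxn m n0.+2).
have nn : (m <= n /\ n0.+2 <= n)%N by rewrite /n; lia.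
have cn := cut_ge n.
exists (head_bound bc n).-1 => [i Ni|i j].
  apply: le_trans (lamb_low bc k_gt1 i).
  have i1 : (n0 < i)%N by lia.
  apply: (le_trans (ler_norm B)); rewrite mulrC -ler_pdivrMr //; apply: le_trans hn0 _.
  by rewrite -natrX ler_nat; nia.
have e l : (l <= (head_bound bc n).-1)%N = (blk l <= n)%N.
  by rewrite blkb_cut; lia.
by rewrite !e /simb; lia.
Qed.

Lemma L_S y f : L2 y -> L2 f ->
  Lbc omega k q bc y f <-> Sgraph lam D (V (cfb y)) (V (cfb f)).
Proof. move=> hy hf; apply: iff_trans (Lbc_coord bc k_gt1 L2q hy hf) _.
by have := L_sim (V (cfb y)) (V (cfb f)); rewrite !UV. Qed.

Lemma dichotomy z : eigenvalue_S lam D z \/ exists Rz, is_Sresolvent lam D z Rz.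
Proof. exact: (Sresolvent_or_eigenvalue DE Dm_off D_nrm del0 cutoff_lamb). Qed.

Lemma spectrum_eig : spectrum omega k q bc = [set z | eigenvalue_S lam D z].
Proof. exact: (spectrumE onb UV VU U_nrm V_nrm L_S dichotomy). Qed.

Lemma saturated_blk (W : pred nat) : (forall n, W n -> (m < n)%N) ->
  saturated sim (fun i => W (blk i)).
Proof.
move=> Wm i j; rewrite /simb => /eqP ij.
have [mi|im] := ltnP m (blk i); first by congr W; lia.
by apply/idP/idP => /Wm; lia.
Qed.

Lemma saturated_head : saturated sim (fun i => (blk i <= m)%N).
Proof. by move=> i j; rewrite /simb; lia. Qed.

Lemma eig_on_ext (W W' : pred nat) z : W =1 W' -> eig_on lam D W z -> eig_on lam D W' z.
Proof. by move=> WW [x [x0 xW Sx]]; exists x; split=> // i; rewrite -WW; exact: xW. Qed.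

(** A common eigenvalue is within [del] of some lam i and of some lam j, whereas unrelated indices
    have values at least [4 * del] apart. *)
Lemma eig_on_meet (W W' : pred nat) z : eig_on lam D W z -> eig_on lam D W' z ->
  exists i j, [/\ W i, W' j & sim i j].
Proof.
move=> /(eig_on_near D_nrm del0)[i Wi hi] /(eig_on_near D_nrm del0)[j Wj hj].
exists i, j; split=> //; apply: contraT => /gap_sim.
have -> : `|lam i - lam j| = cabs ((lam i)%:C - (lam j)%:C) by rewrite -rmorphB cabsR.
have := cabs_distD z (lam i)%:C (lam j)%:C; rewrite (cabs_distC _ z).
by move: hi hj del0; set dl := del; move=> h1 h2 h3 h4 h5; exfalso; lra.
Qed.

Lemma eig_sim z : eigenvalue_S lam D z -> exists i, eig_on lam D (sim i) z.
Proof.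
exact: (eigenvalue_eig_on (simb_refl _ _) (simb_sym _ _) (@simb_trans _ _) DE Dm_off).
Qed.

Definition sigma_head : set R[i] := [set z | eig_on lam D (fun i => blk i <= m)%N z].
Definition sigma_block n : set R[i] := [set z | eig_on lam D (fun i => blk i == n) z].

Lemma spectrum_split : spectrum omega k q bc =
  sigma_head `|` \bigcup_(n in [set n | (m < n)%N]) sigma_block n.
Proof.
rewrite spectrum_eig; apply/seteqP; split=> z /=.
  move=> /eig_sim; case=> i.
  have [mi|im] := ltnP m (blk i).
    by move=> h; right; exists (blk i) => //; apply: eig_on_ext h => j; rewrite simE.
  by move=> h; left; apply: eig_on_ext h => j; rewrite /simb; lia.
by case=> [|[n _]]; exact: eig_on_eigenvalue.
Qed.

Lemma sigma_block_disjoint n n' z : (m < n)%N -> sigma_block n z -> sigma_block n' z -> n = n'.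
Proof.
move=> mn /eig_on_meet h /h[i [j [/= /eqP ni /eqP nj]]].
by rewrite /simb ni nj; lia.
Qed.

Lemma sigma_head_disjoint n z : (m < n)%N -> sigma_head z -> sigma_block n z -> False.
Proof.
move=> mn /eig_on_meet h /h[i [j [/= ni /eqP nj]]].
by rewrite /simb nj; lia.
Qed.

(** The head is a matrix of size [head_bound bc m], and its eigenvalues are among the roots of the
    characteristic polynomial. *)
Lemma card_sigma_head : (sigma_head #<= `I_(head_bound bc m))%card.
Proof.
have cm := cut_ge m; have e : head_bound bc m = (head_bound bc m).-1.+1 by lia.
have el l : (l <= (head_bound bc m).-1)%N = (blk l <= m)%N by rewrite blkb_cut; lia.
have [|r [sr hr]] := head_eigenvalues lam DE Dm_off (N := (head_bound bc m).-1).
  by move=> i j; rewrite !el; exact: saturated_head.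
apply: (@card_le_trans _ _ _ [set z | z \in r]).
  apply: subset_card_le => z h; apply: hr; apply: eig_on_ext h => i /=; exact: esym (el i).
apply: (@card_le_trans _ _ _ (nth 0 r @` `I_(head_bound bc m))).
  apply: subset_card_le => z /= zr; exists (index z r); last exact: nth_index.
  by rewrite /= e -sr index_mem.
exact: card_image_le.
Qed.

Lemma eigval_block n i : blk i == n -> lam i = eigval0 omega k bc n.
Proof. by move=> /eqP <-; rewrite lambE. Qed.

Lemma block_ex n : (0 < n)%N -> exists i, blk i == n.
Proof.
move=> n0; exists (match bc with Per => n.*2 | Ap => n.*2 | Dir => n.-1 end).
by rewrite /blkb; case: bc; rewrite ?uphalf_double ?doubleK // prednK.
Qed.

Lemma riesz_block n (P : {linear H -> H}) : (m < n)%N ->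
  (forall x i, P x i = (blk i == n)%:R * x i) -> (forall x, nrm (P x) <= nrm x) ->
  riesz_projection omega k q bc (sigma_block n) (conjugate onb U V P).
Proof.
move=> mn PE Pn.
have [i0 bi0] := @block_ex n ltac:(lia).
have sat : saturated sim (fun i => blk i == n).
  by apply: (@saturated_blk (fun l => l == n)) => l /eqP ->.
have far i : blk i != n -> 4 * del <= `|lam i - eigval0 omega k bc n|.
  move=> bi; rewrite -(eigval_block bi0); apply: gap_sim.
  by move/eqP: bi0 => bi0; rewrite simb_sym simE bi0 // eq_sym.
have [T [N0 [dat pb hT]]] := block_data DE Dm_off D_nrm del0 sat PE Pn (@eigval_block n) far.
(* The radius lies between [del], the growth of [N0] on the block, and [3 * del], the inverse of the
   bound on T. *)
apply: (riesz_projection_conjugate onb UV VU U_nrm V_nrm L_S dichotomy (r := 2 * del) (C := 1)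
  dat _ pb _ _ hT).
- by move=> v; rewrite mul1r.
- by apply/andP; split; [exact: ltW|rewrite ltr_pMl // ltr1n].
- by rewrite invr_ge0 mulr_ge0 // ltW.
- have -> : (3 * del)^-1 * (2 * del) = 2 / 3 by field; rewrite gt_eqF.
  lra.
apply/seteqP; split=> z /=.
  move=> h; split; first exact: eig_on_eigenvalue h.
  have [i bi hi] := eig_on_near D_nrm del0 h.
  by rewrite -(eigval_block bi); apply: le_lt_trans hi _; rewrite ltr_pMl ?ltr1n.
move=> [/eig_sim[i h] zn].
have [j ij hj] := eig_on_near D_nrm del0 h.
have bj : blk j == n.
  apply: contraT => /far.
  have -> : `|lam j - eigval0 omega k bc n| = cabs ((lam j)%:C - (eigval0 omega k bc n)%:C).
    by rewrite -rmorphB cabsR.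
  have := cabs_distD z (lam j)%:C (eigval0 omega k bc n)%:C; rewrite (cabs_distC _ z).
  by move: hj zn del0; set dl := del; move=> h1 h2 h3 h4 h5; exfalso; lra.
apply: eig_on_ext h => l; move: ij bj; rewrite /simb; lia.
Qed.

Lemma cf_sum n (F : nat -> R -> R[i]) : (forall i, (i < n)%N -> L2 (F i)) ->
  cfb (fun t => \sum_(i < n) F i t) = \sum_(i < n) cfb (F i).
Proof.
elim: n => [|n IH] h.
  rewrite big_ord0 -(cf0 onb); congr cf; apply/funext => t; exact: big_ord0.
have hn : L2 (fun t => \sum_(i < n) F i t) by apply: L2_sum => i ni; apply: h; lia.
rewrite big_ord_recr /= -IH; last by move=> i ni; apply: h; lia.
rewrite -(cfD onb hn (h n (ltnSn n))); congr cf; apply/funext => t; exact: big_ord_recr.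
Qed.

(** The range of E consists of vectors supported in the coordinates up to N, so the conjugate of E
    has range in the span of the images under U of finitely many coordinate vectors. *)
Lemma discrete_L : discrete_spectrum omega k q bc.
Proof.
move=> z0; rewrite spectrum_eig => /= ez0.
have [E [T [N0 [N [dat [CE CE0 hE] [CT CT0 hT] pb [hN _]]]]]] :=
  data_exists DE Dm_off D_nrm del0 cutoff_lamb z0.
have hT' v : nrm (T v) <= (CT + 1) * nrm v.
  by apply: le_trans (hT v) _; rewrite ler_wpM2r ?nrm_ge0 // lerDl.
(* Half of the radius within which the bound on T excludes eigenvalues other than z0; the summand 1
   avoids a division by 0. *)
pose r := (2 * (CT + 1))^-1.
have r0 : 0 < r by rewrite invr_gt0 mulr_gt0 //; lra.
have rT : (CT + 1) * r = 2^-1 by rewrite /r; field; lra.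
exists (conjugate onb U V E).
  have r2 : 0 < r / 2 by rewrite divr_gt0.
  apply: (riesz_projection_conjugate onb UV VU U_nrm V_nrm L_S dichotomy (r := r) (C := CE)
    dat hE (pb _ r2) _ _ hT').
  - by apply/andP; split; lra.
  - lra.
  - by rewrite rT; lra.
  apply/seteqP; split=> z /= => [->|[ez zr]]; first by rewrite subrr cabs0.
  apply: contrapT => zz; have zz0 : 0 < cabs (z - z0) by rewrite cabs_gt0 subr_eq0; apply/eqP.
  have [x x0 Sx] := ez; apply: x0.
  (* As [N0] is nilpotent, [rho] may be any positive number, in particular half the distance from z
     to z0. *)
  have h2 : 0 < cabs (z - z0) / 2 by rewrite divr_gt0.
  apply: (no_eigenvalue dat (pb _ h2) _ _ _ hT' _ Sx); [lra|lra|lra|].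
  apply: le_lt_trans (_ : (CT + 1) * r < _); last by rewrite rT; lra.
  by rewrite ler_wpM2l ?(ltW zr) //; lra.
have L2b i : L2 (b i) by exact: L2_bas.
pose u i : R -> R[i] := @syn _ _ omega_pos _ onb (U (cfb (b i))).
have L2u i : L2 (u i) by exact: L2_syn.
have cfu i : cfb (u i) = U (cfb (b i)) by exact: cf_syn.
have eb i j : cfb (b i) j = (i == j)%:R by rewrite (cfE onb j (L2b i)) ip_bas.
exists (mkseq u N.+1) => [[i iN]|x hx].
  by rewrite nth_mkseq //; move: iN; rewrite size_mkseq.
exists (fun i => E (V (cfb x)) i).
have hL : L2 (conjugate onb U V E x) by exact: L2_conjugate.
have -> : (fun t => \sum_(i < size (mkseq u N.+1)) E (V (cfb x)) i * (mkseq u N.+1)`_i t) =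
   (fun t => \sum_(i < N.+1) E (V (cfb x)) i * u i t).
  apply/funext => t; rewrite size_mkseq; apply: eq_bigr => i _.
  by rewrite nth_mkseq.
have hz i : L2 (fun t => E (V (cfb x)) i * u i t) by exact: (L2Z _ (L2u i)).
apply: (cf_inj onb hL); first by apply: (@L2_sum _ _ _ N.+1 (fun i t => E (V (cfb x)) i * u i t)).
rewrite cf_conjugate (@cf_sum N.+1 (fun i t => E (V (cfb x)) i * u i t)) //.
under eq_bigr => i _ do rewrite (cfZ onb _ (L2u i)) cfu -linearZ.
rewrite -linear_sum; congr (U _); apply: ell2_ext => j.
rewrite lcoef_sum; under eq_bigr => i _ do rewrite lcoefZ eb.
have [jN|Nj] := ltnP j N.+1.
  rewrite (bigD1 (Ordinal jN)) //= eqxx mulr1 big1 ?addr0 // => i /negP ij.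
  by rewrite (_ : (i == j :> nat) = false) ?mulr0 //; apply/negP => /eqP e; apply: ij; apply/eqP/val_inj.
rewrite hN // big1 // => i _.
by rewrite (_ : (i == j :> nat) = false) ?mulr0 //; apply: ltn_eqF; apply: leq_trans Nj.
Qed.

Definition fst_index n :=
  match bc with Per => n.*2.-1 | Ap => n.*2 | Dir => n.-1 end.

Lemma blk_pair n i : bc <> Dir -> (0 < n)%N ->
  (blk i == n) = (i == fst_index n) || (i == (fst_index n).+1).
Proof.
move=> bcD n0; have := odd_double_half i; rewrite /blkb /fst_index ?uphalf_half.
by case: bc bcD => // _; case: (odd i) => /=; lia.
Qed.

Lemma blk_single n i : bc = Dir -> (0 < n)%N -> (blk i == n) = (i == fst_index n).
Proof. by rewrite /blkb /fst_index => -> n0; lia. Qed.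

Lemma blk_fst n i : (0 < n)%N -> blk i == n -> (i == fst_index n) || (i == (fst_index n).+1).
Proof.
move=> n0; have [bD|bD] := pselect (bc = Dir); first by rewrite blk_single // => ->.
by rewrite blk_pair.
Qed.

(** On a late block D is within e/4 of Q by [Dm_near], and Q within e/4 of the mean times the
    identity by [Qb_block]; [eig_on_close] doubles the sum. *)
Lemma sigma_block_close (e : R) : 0 < e -> exists N, forall n z, (N <= n)%N -> (m < n)%N ->
  sigma_block n z -> cabs (z - ((eigval0 omega k bc n)%:C - mean omega q)) <= e.
Proof.
move=> e0; have e4 : 0 < e / 4 by rewrite divr_gt0.
pose proof (Qb_block bc k_gt1 L2q e4) as [N1 hN1].
have [n2 n20 hn2] : exists2 n2, (0 < n2)%N & 8 * M ^+ 2 / (c * n2%:R ^+ 2) <= e / 4.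
  pose X := 8 * M ^+ 2 / c / (e / 4); exists (Num.bound X).+1 => //.
  have X0 : 0 <= X.
    by rewrite /X divr_ge0 ?(ltW e4) // divr_ge0 ?(ltW c_gt0) // mulr_ge0 ?sqr_ge0.
  have Xn : X <= (Num.bound X).+1%:R.
    by apply: le_trans (ltW (archi_boundP X0)) _; rewrite ler_nat.
  rewrite invfM mulrA ler_pdivrMr ?exprn_gt0 // -ler_pdivrMl // mulrC; apply: le_trans Xn _.
  by rewrite -natrX ler_nat leq_pmulr.
(* The margin allows for an index being one less than the number of its block. *)
exists (maxn N1 n2).+2 => n z Nn mn hz.
have -> : e = 2 * (e / 2) by field.
have n0 : (0 < n)%N by exact: leq_trans mn.
apply: (eig_on_close DE (fun i => @blk_fst n i n0) (@eigval_block n) _ _ hz).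
  by rewrite divr_ge0 // ltW.
move=> i l /eqP bi /eqP bl.
have il : sim i l by rewrite simE bi ?bl.
have hi := blkb_le bc i; have hl := blkb_le bc l.
apply: le_trans (cabs_distD (Qb omega bc q i l) _ _) _.
have -> : e / 2 = e / 4 + e / 4 by field.
have [Ni nl] : (N1 <= i)%N /\ (n2 <= l)%N.
  by move: Nn hi hl; rewrite bi bl; clear; lia.
apply: lerD; first by apply: le_trans hn2; exact: Dm_near.
by apply: hN1; rewrite ?bi ?bl.
Qed.

Lemma eigval_asymp_of mu : (forall n, (m < n)%N -> sigma_block n (mu n)) ->
  eigval_asymp omega k q bc mu.
Proof.
move=> hmu; apply/cvgrPdist_le => e e0; have [N hN] := sigma_block_close e0.
exists (maxn N m.+1) => // n /= Nn.
rewrite sub0r normrN ger0_norm ?cabs_ge0 //.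
by apply: hN; [lia|lia|apply: hmu; lia].
Qed.

(** The two roots of the quadratic equation of [eig_pair], by a complex square root of the
    discriminant; they may coincide. *)
Lemma sigma_block_pair n : bc <> Dir -> (m < n)%N -> exists z : R[i] * R[i], sigma_block n = [set z.1; z.2].
Proof.
move=> bD mn; have n0 : (0 < n)%N by lia.
have sat : saturated sim (fun i => blk i == n).
  by apply: (@saturated_blk (fun l => l == n)) => l /eqP ->.
set j := fst_index n; pose c0 := (eigval0 omega k bc n)%:C.
have lj : lam j = eigval0 omega k bc n by apply: eigval_block; rewrite blk_pair // eqxx.
have lj1 : lam j.+1 = eigval0 omega k bc n by apply: eigval_block; rewrite blk_pair // eqxx orbT.
pose p := Dm j j; pose s := Dm j.+1 j.+1; pose t := Dm j j.+1 * Dm j.+1 j.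
pose d := sqrtC ((p - s) ^+ 2 + 4 * t).
have dd : d ^+ 2 = (p - s) ^+ 2 + 4 * t by exact: sqrtCK.
exists (c0 + (- (p + s) + d) / 2, c0 + (- (p + s) - d) / 2).
have F z : (z - c0 + p) * (z - c0 + s) - t =
    (z - (c0 + (- (p + s) + d) / 2)) * (z - (c0 + (- (p + s) - d) / 2)).
  have -> : (z - (c0 + (- (p + s) + d) / 2)) * (z - (c0 + (- (p + s) - d) / 2)) =
     (z - c0 + (p + s) / 2) ^+ 2 - d ^+ 2 / 4 by field.
  by rewrite dd; field.
have E z : sigma_block n z <-> (z - c0 + p) * (z - c0 + s) = t.
  by apply: (eig_pair DE Dm_off z _ sat lj lj1) => i; exact: blk_pair.
apply/seteqP; split=> z /=.
  move=> /E e; have := F z; rewrite e subrr => /esym/eqP.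
  by rewrite mulf_eq0 !subr_eq0 => /orP[/eqP ->|/eqP ->]; [left|right].
move=> h; apply/E/eqP; rewrite -subr_eq0 F mulf_eq0 !subr_eq0.
by case: h => ->; rewrite eqxx ?orbT.
Qed.

Lemma sigma_block_single n : bc = Dir -> (m < n)%N -> exists z : R[i], sigma_block n = [set z].
Proof.
move=> bD mn; have n0 : (0 < n)%N by lia.
have sat : saturated sim (fun i => blk i == n).
  by apply: (@saturated_blk (fun l => l == n)) => l /eqP ->.
exists ((lam (fst_index n))%:C - Dm (fst_index n) (fst_index n)).
have E z : sigma_block n z <-> z = (lam (fst_index n))%:C - Dm (fst_index n) (fst_index n).
  by apply: (eig_single lam DE Dm_off z _ sat) => i; exact: blk_single.
by apply/seteqP; split=> z /= /E.
Qed.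

Lemma splitting : spectral_splitting omega k q bc m sigma_head sigma_block.
Proof.
split; [exact: discrete_L|exact: spectrum_split| |exact: card_sigma_head|].
  split=> [i j /= mi mj [z [hi hj]]|n mn]; first exact: sigma_block_disjoint mi hi hj.
  by apply/seteqP; split=> z //= [h1 h2]; exact: sigma_head_disjoint mn h1 h2.
have pair : bc <> Dir -> exists mu_m mu_p : nat -> R[i],
   [/\ forall n, (m < n)%N -> sigma_block n = [set mu_m n; mu_p n],
       eigval_asymp omega k q bc mu_m & eigval_asymp omega k q bc mu_p].
  move=> bD; have /choice[mu hmu] : forall n, exists z : R[i] * R[i],
      (m < n)%N -> sigma_block n = [set z.1; z.2].
    move=> n; have [mn|nm] := ltnP m n; last by exists (0, 0).
    by have [z hz] := sigma_block_pair bD mn; exists z.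
  exists (fun n => (mu n).1), (fun n => (mu n).2); split=> [n mn||]; first exact: hmu.
    by apply: eigval_asymp_of => n mn; rewrite (hmu n mn); left.
  by apply: eigval_asymp_of => n mn; rewrite (hmu n mn); right.
have single : bc = Dir -> exists mu : nat -> R[i],
   (forall n, (m < n)%N -> sigma_block n = [set mu n]) /\ eigval_asymp omega k q bc mu.
  move=> bD; have /choice[mu hmu] : forall n, exists z : R[i],
      (m < n)%N -> sigma_block n = [set z].
    move=> n; have [mn|nm] := ltnP m n; last by exists 0.
    by have [z hz] := sigma_block_single bD mn; exists z.
  exists mu; split=> [n mn|]; first exact: hmu.
  by apply: eigval_asymp_of => n mn; rewrite (hmu n mn).
move: pair single; clear; case: bc => pair single; [exact: pair|exact: pair|exact: single].
Qed.

(** N depends on v only and serves for all y dominated by v, as strong convergence of the sums of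
    projections requires. *)
Lemma tail_small (v : H) (e : R) : 0 < e -> exists N, forall y : H,
  (forall i, (i < N)%N -> y i = 0) -> (forall i, cabs (y i) <= cabs (v i)) -> nrm y <= e.
Proof.
move=> e0; have e2 : 0 < e ^+ 2 by rewrite exprn_gt0.
have /cvgrPdist_le/(_ _ e2)[N _ hN] := @cvg_nrm _ v; exists N => y y0 yv.
apply: nrm_le; first exact: ltW.
move=> n; have h := hN N (leqnn N); have p := psum_nrm v (N + n).
apply: le_trans (_ : \sum_(i < N + n) cabs (y i) ^+ 2 <= _).
  by apply: (@psum_le _ (fun i => cabs (y i) ^+ 2)); [move=> i; exact: sqr_ge0|exact: leq_addl].
move: p; rewrite !big_split_ord /= [X in X + _ <= e ^+ 2]big1 ?add0r => [p|i _]; last first.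
  by rewrite y0 // cabs0 expr0n.
have h1 : \sum_(i < n) cabs (y (N + i)%N) ^+ 2 <= \sum_(i < n) cabs (v (N + i)%N) ^+ 2.
  by apply: ler_sum => i _; rewrite lerXn2r ?nnegrE ?cabs_ge0.
have := le_trans (ler_norm _) h; lra.
Qed.

(** A and B are U and V for the perturbed projections and the identity for the unperturbed ones.
    Partial sums are coordinate projections between A and B; the error vanishes on the first
    coordinates and is dominated by the coordinates of B x. *)
Lemma op_sum_lift (A B P : {linear H -> H}) (Om : set nat)
    (Pn : nat -> (R -> R[i]) -> R -> R[i]) :
  (forall x, nrm (A x) <= 2 * nrm x) -> (forall x, nrm (B x) <= 2 * nrm x) ->
  (forall x i, P x i = `[< Om (blk i) >]%:R * x i) -> (forall x, nrm (P x) <= nrm x) ->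
  (forall n x, Om n -> L2 x -> L2 (Pn n x) /\ exists2 y : H, cfb (Pn n x) = A y &
     forall i, y i = (blk i == n)%:R * B (cfb x) i) ->
  op_sum omega Om Pn (lift onb (fun a => A (P (B a)))).
Proof.
move=> hA hB PE hP hPn; split.
  apply: (@bounded_lift _ _ _ _ onb _ 4) => [z a a'|a]; first by rewrite !linearP.
  have := hA (P (B a)); have := hP (B a); have := hB a; lra.
move=> x hx; pose F N t := \sum_(0 <= n < N | n \in Om) Pn n x t.
have hF N : L2 (F N) /\ exists2 y : H, cfb (F N) = A y &
    forall i, y i = (`[< Om (blk i) >] && (blk i < N)%N)%:R * B (cfb x) i.
  elim: N => [|N [h [y yF yE]]].
    have -> : F 0%N = fun=> 0 by apply/funext => t; rewrite /F big_geq.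
    split; first exact: L2_cst.
    by exists 0; [rewrite (cf0 onb) linear0|move=> i; rewrite andbF mul0r].
  have FS : F N.+1 = fun t => F N t + (if N \in Om then Pn N x t else 0).
    by apply/funext => t; rewrite /F big_mkcond big_nat_recr //= -big_mkcond.
  have [NO|NO] := boolP (N \in Om); last first.
    have -> : F N.+1 = F N by rewrite FS (negbTE NO); apply/funext => t; rewrite addr0.
    split=> //; exists y => // i; rewrite yE; congr (_%:R * _).
    have [Oi|//] := asboolP (Om (blk i)); rewrite /= ltnS [in RHS]leq_eqVlt.
    by case: eqP => // e; exfalso; move/negP: NO; apply; rewrite -e in_setE.
  have [hn [w wn wE]] := hPn N x (set_mem NO) hx.
  have -> : F N.+1 = fun t => F N t + Pn N x t by rewrite FS NO.
  split; first exact: L2D.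
  exists (y + w); first by rewrite (cfD onb h hn) yF wn linearD.
  move=> i; rewrite lcoefD yE wE -mulrDl -natrD; congr (_%:R * _).
  rewrite ltnS [in RHS]leq_eqVlt; case: eqP => [->|_] /=; last by rewrite addn0.
  have -> : `[< Om N >] by apply/asboolP; exact: set_mem.
  by rewrite ltnn.
apply/cvgrPdist_le => e e0; have e2 : 0 < e / 2 by rewrite divr_gt0.
have [N hN] := tail_small (B (cfb x)) e2.
exists N.+1 => // n /= Nn; rewrite sub0r normrN ger0_norm ?L2norm_ge0 //.
have hT : L2 (lift onb (fun a => A (P (B a))) x) by exact: L2_syn.
have [hn [y yF yE]] := hF n.
rewrite -[X in L2norm X]/(fun t => F n t - lift onb (fun a => A (P (B a))) x t).
rewrite -(nrm_cf onb (L2B hn hT)) (cfB onb hn hT) yF cf_lift -linearB.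
apply: le_trans (hA _) _; rewrite -ler_pdivlMl // mulrC; apply: hN => i.
  move=> iN; rewrite lcoefB yE PE -mulrBl.
  have -> : (blk i < n)%N by have := blkb_le bc i; move: iN Nn; clear; lia.
  by rewrite andbT subrr mul0r.
rewrite lcoefB yE PE -mulrBl cabsM ler_piMl ?cabs_ge0 //.
have bool_diff (u v : bool) : cabs ((u && v)%:R - u%:R : R[i]) <= 1.
  case: u; last by rewrite subrr cabs0.
  by case: v; rewrite ?andbT ?andbF ?subrr ?sub0r ?cabsN ?cabs1 ?cabs0.
exact: bool_diff.
Qed.

Lemma bas_fst n : bc <> Dir -> (0 < n)%N ->
  b (fst_index n) = efun omega bc (- n%:Z - (theta bc)%:Z) /\
  b (fst_index n).+1 = efun omega bc n%:Z.
Proof.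
case: n => // n; rewrite /bas /fst_index; case: bc => // _ _.
  by rewrite doubleS /bidx /= odd_double /= ?uphalf_double ?doubleK subr0.
by rewrite /bidx doubleS /= odd_double /= ?doubleK ?uphalf_double.
Qed.

Lemma cf_proj1 j x : L2 x -> L2 (proj1 omega (b j) x) /\
  forall i, cfb (proj1 omega (b j) x) i = (i == j)%:R * cfb x i.
Proof.
move=> hx; have hb : L2 (b j) by exact: L2_bas.
have hz : L2 (proj1 omega (b j) x) by exact: (L2Z _ hb).
split=> // i; rewrite (cfZ onb (ip x (b j)) hb) lcoefZ (cfE onb i hb) ip_bas -(cfE onb j hx).
by rewrite eq_sym; case: eqP => [->|_]; rewrite ?mulr1 ?mul1r ?mulr0 ?mul0r.
Qed.

Lemma cf_proj0 n x : (0 < n)%N -> L2 x -> L2 (proj0 omega bc n x) /\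
  forall i, cfb (proj0 omega bc n x) i = (blk i == n)%:R * cfb x i.
Proof.
move=> n0 hx; have [bD|bD] := pselect (bc = Dir).
  have -> : proj0 omega bc n x = proj1 omega (b (fst_index n)) x.
    by rewrite /fst_index /bas; case: bc bD => // _; rewrite /= prednK.
  have [h1 h2] := cf_proj1 (fst_index n) hx; split=> // i.
  by rewrite h2 blk_single.
have [e1 e2] := bas_fst bD n0.
have -> : proj0 omega bc n x =
    fun t => proj1 omega (b (fst_index n)) x t + proj1 omega (b (fst_index n).+1) x t.
  by rewrite e1 e2 /proj0; case: bc bD => // _; rewrite gtn_eqF.
have [h1 c1] := cf_proj1 (fst_index n) hx; have [h2 c2] := cf_proj1 (fst_index n).+1 hx.
split=> [|i]; first exact: L2D.
have -> : cfb (fun t => proj1 omega (b (fst_index n)) x t + proj1 omega (b (fst_index n).+1) x t) i =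
   (i == fst_index n)%:R * cfb x i + (i == (fst_index n).+1)%:R * cfb x i.
  move: (proj1 omega (b (fst_index n)) x) (proj1 omega (b (fst_index n).+1) x) h1 h2 c1 c2 => u v h1 h2 c1 c2.
  by rewrite (cfD onb h1 h2) lcoefD c1 c2.
rewrite (blk_pair i bD n0); move: (cfb x i) => v.
rewrite -mulrDl -natrD; congr (_%:R * _).
by case: eqP => [->|_]; rewrite ?add0n // ltn_eqF.
Qed.

Hypothesis Km_sum : forall (x : H) i, csummable (fun j => Km i j * x j).
Hypothesis UE : forall x i, U x i = x i + csum (fun j => Km i j * x j).
Hypothesis Km_le : forall i j, cabs (Km i j) <= 2 * M * `|kap lam blk m i j|.

(** An entry is nonzero only if i or j is in W and hence at least s. Row i of [kap] contributes at
    most 4 / (c i^(2k - 1))^2, and summing over i >= s lowers the exponent 4k - 2 by one; the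
    columns follow by symmetry. *)
Lemma commutator_bound (W : pred nat) s n p : (0 < s)%N -> (forall i, W i -> (s <= i)%N) ->
  \sum_(i < n) \sum_(j < p) cabs (Km i j * ((W j)%:R - (W i)%:R)) ^+ 2 <=
  64 * M ^+ 2 / c ^+ 2 / s%:R ^+ (4 * k - 3).
Proof.
move=> s0 Ws; pose kp := kap lam blk m.
pose ind i : R := (s <= i)%N%:R.
have ent i j : cabs (Km i j * ((W j)%:R - (W i)%:R)) ^+ 2 <=
    4 * M ^+ 2 * (ind i * kp i j ^+ 2 + ind j * kp j i ^+ 2).
  rewrite /kp [kap _ _ _ j i ^+ 2]kap_sq_sym -mulrDl.
  have w : cabs ((W j)%:R - (W i)%:R) ^+ 2 <= ind i + ind j.
    rewrite /ind; have := Ws i; have := Ws j.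
    case: (W i); case: (W j) => h1 h2; rewrite ?subrr ?subr0 ?sub0r ?cabsN ?cabs0 ?cabs1 ?expr0n ?expr1n.
    - by rewrite addr_ge0.
    - by rewrite h2 // lerDl.
    - by rewrite h1 // lerDr.
    - by rewrite addr_ge0.
  rewrite cabsM exprMn -[X in _ <= _ * (_ * X)]real_normK ?num_real //.
  have -> : 4 * M ^+ 2 * ((ind i + ind j) * `|kap lam blk m i j| ^+ 2) =
     (2 * M * `|kap lam blk m i j|) ^+ 2 * (ind i + ind j) by ring.
  apply: ler_pM; rewrite ?sqr_ge0 //.
  by rewrite lerXn2r ?nnegrE ?cabs_ge0 ?mulr_ge0 ?(ltW M_gt0).
have gap i' j' : blk i' != blk j' ->
    c * `|i'%:R - j'%:R| * (maxn i' j')%:R ^+ (2 * k - 4).+3 <= `|lam i' - lam j'|.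
  exact: lamb_gap.
have rows n' p' : \sum_(i < n') ind i * \sum_(j < p') kp i j ^+ 2 <= 8 / c ^+ 2 / s%:R ^+ (4 * k - 3).
  apply: (@le_trans _ _ (\sum_(i < n') 4 / c ^+ 2 *
      (if (s <= i)%N then i%:R ^- (2 * (2 * k - 1)) else 0))).
    apply: ler_sum => i _; rewrite /ind; case: ifP => [si|_]; last by rewrite mul0r mulr0.
    rewrite mul1r; have i0 : (0 < i)%N by exact: leq_trans si.
    apply: le_trans (kap_sq_row M_gt0 c_gt0 m_gt0 m_large gap (blkb_le bc) p' i0 (leqnn i)) _.
    have -> : (2 * k - 4).+3 = (2 * k - 1)%N by move: k_gt1; clear; lia.
    by rewrite exprMn invfM mulrA -exprM mulnC.
  rewrite -mulr_sumr.
  have k0 : (0 < 2 * k - 1)%N by move: k_gt1; clear; lia.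
  have cc : 0 <= 4 / c ^+ 2 by rewrite divr_ge0 ?sqr_ge0.
  apply: le_trans (ler_wpM2l cc (sum_inv_pow_tail n' s0 k0)) _.
  have -> : (2 * (2 * k - 1)).-1 = (4 * k - 3)%N by move: k_gt1; clear; lia.
  rewrite le_eqVlt; apply/orP; left; apply/eqP; rewrite mulrA; congr (_ / _).
  by rewrite mulrAC; congr (_ / _); ring.
apply: (@le_trans _ _ (4 * M ^+ 2 * (\sum_(i < n) ind i * \sum_(j < p) kp i j ^+ 2 +
     \sum_(j < p) ind j * \sum_(i < n) kp j i ^+ 2))).
  under [X in _ + X]eq_bigr do rewrite mulr_sumr.
  rewrite [X in _ + X]exchange_big -big_split mulr_sumr /=.
  apply: ler_sum => i _; rewrite mulr_sumr -big_split mulr_sumr /=.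
  by apply: ler_sum => j _; exact: ent.
have M4 : 0 <= 4 * M ^+ 2 by rewrite mulr_ge0 // sqr_ge0.
apply: le_trans (ler_wpM2l M4 (lerD (rows n p) (rows p n))) _.
rewrite le_eqVlt; apply/orP; left; apply/eqP; rewrite -mulrDl !mulrA; congr (_ / _).
by rewrite -mulrDl mulrA; congr (_ / _); ring.
Qed.

(** Its square is 4 * 64 * M^2 / c^2 times 2^(4k), the power of 2 being the price of d <= 2 (d -
    1). *)
Definition splitting_const : R := 16 * M / c * 2 ^+ (2 * k).

Lemma HSnorm_splitting (Om : set nat) (P : {linear H -> H}) d : Om d ->
  (forall n, Om n -> (m < n)%N) -> (forall n, Om n -> (d <= n)%N) ->
  (forall x i, P x i = `[< Om (blk i) >]%:R * x i) ->
  (HSnorm omega (fun x t => (conjugate onb U V P x t - lift onb P x t)%R)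
    <= (splitting_const / d%:R `^ (2 * k%:R - 3 / 2))%:E)%E.
Proof.
move=> Od Om_m Om_d PE; have md := Om_m _ Od.
(* An index may be one less than its block number, hence d - 1. As d > m >= 1, d is at most 2 s, and
   s can be replaced by d at the cost of a factor 2^(4k - 3). *)
pose s := d.-1; have s0 : (0 < s)%N by rewrite /s; move: md m_gt0; clear; lia.
have ds : (d <= 2 * s)%N by rewrite /s; move: md m_gt0; clear; lia.
have Ws i : `[< Om (blk i) >] -> (s <= i)%N.
  by move=> /asboolP/Om_d; have := blkb_le bc i; rewrite /s; clear; lia.
apply: le_trans (HSnorm_conjugate_sub onb UV V_nrm Km_sum UE PE
  (fun n p => commutator_bound n p s0 Ws)) _.
rewrite lee_fin.
have d0 : 0 < d%:R :> R by rewrite ltr0n; move: md; clear; lia.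
have sR : 0 < s%:R :> R by rewrite ltr0n.
set C := splitting_const; set y := d%:R `^ _.
have C0 : 0 < C by rewrite /C /splitting_const mulr_gt0 ?exprn_gt0 // divr_gt0 // mulr_gt0.
have y0 : 0 < y by exact: powR_gt0.
have yy : y ^+ 2 = d%:R ^+ (4 * k - 3).
  rewrite -powR_mulrn ?(ltW y0) // /y -powRrM -[RHS]powR_mulrn ?(ltW d0) //; congr (_ `^ _).
  have -> : (4 * k - 3)%:R = 4 * k%:R - 3 :> R.
    by rewrite natrB ?natrM //; move: k_gt1; clear; lia.
  by field.
rewrite -[leRHS]ger0_norm; last by rewrite divr_ge0 // ltW.
rewrite -sqrtr_sqr; apply: ler_wsqrtr; rewrite [leRHS]expr_div_n yy.
have ->: C ^+ 2 = 256 * M ^+ 2 / c ^+ 2 * 2 ^+ (4 * k).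
  have sq (v w : R) : (16 * v / w * 2 ^+ (2 * k)) ^+ 2 = 256 * v ^+ 2 / w ^+ 2 * 2 ^+ (4 * k).
    have -> : (4 * k)%N = (2 * k * 2)%N by rewrite mulnAC.
    by rewrite !exprMn exprVn [in RHS](exprM _ (2 * k) 2); ring.
  exact: sq.
have -> : 4 * (64 * M ^+ 2 / c ^+ 2 / s%:R ^+ (4 * k - 3)) =
   256 * M ^+ 2 / c ^+ 2 * (s%:R ^+ (4 * k - 3))^-1 by ring.
have X0 : 0 <= 256 * M ^+ 2 / c ^+ 2 by rewrite divr_ge0 ?sqr_ge0 // mulr_ge0 ?sqr_ge0.
move: (256 * M ^+ 2 / c ^+ 2) X0 => X X0; rewrite -[X * _ / _]mulrA; apply: ler_wpM2l => //.
rewrite ler_pdivlMr ?exprn_gt0 // ler_pdivrMl ?exprn_gt0 //.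
apply: (@le_trans _ _ ((2 * s)%:R ^+ (4 * k - 3))).
  by rewrite lerXn2r ?nnegrE // ler_nat.
rewrite natrM exprMn mulrC ler_wpM2l ?exprn_ge0 // ler_weXn2l ?ler1n //.
exact: leq_subr.
Qed.

End Splitting.

Theorem theorem6 (R : realType) (k : nat) (omega : R) (q : R -> R[i])
    (bc : bcond) :
  (1 < k)%N -> 0 < omega -> L2 omega q ->
  exists (m : nat) (sigma0 : set R[i]) (sigma : nat -> set R[i])
         (Pt : nat -> (R -> R[i]) -> (R -> R[i])),
    [/\ bc = Dir -> (0 < m)%N,
        spectral_splitting omega k q bc m sigma0 sigma,
        forall n, (m < n)%N -> riesz_projection omega k q bc (sigma n) (Pt n) &
        exists2 C : R, 0 < C &
          forall (Omega : set nat) (d : nat),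
            Omega `<=` [set n | (m < n)%N] ->
            Omega d -> (forall n, Omega n -> (d <= n)%N) ->
            exists T T0 : (R -> R[i]) -> (R -> R[i]),
              [/\ op_sum omega Omega Pt T,
                  op_sum omega Omega (proj0 omega bc) T0 &
                  (HSnorm omega (fun x t => (T x t - T0 x t)%R)
                     <= (C / d%:R `^ (2 * k%:R - 3 / 2))%:E)%E]].
Proof.
move=> k_gt1 omega_gt0 L2q; have omega_pos : positive_length omega := omega_gt0.
pose M := Mq omega q; pose c := c0 omega k.
have M_gt0 : 0 < M by exact: Mq_gt0.
have c_gt0 : 0 < c by exact: c0_gt0.
have [m m_gt0 m_large] : exists2 m, (0 < m)%N & 32 * M <= c * m%:R ^+ 2.
  exists (Num.bound (32 * M / c)).+1 => //.
  have X0 : 0 <= 32 * M / c by rewrite divr_ge0 ?(ltW c_gt0) // mulr_ge0 // ltW.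
  rewrite -ler_pdivrMl // mulrC; apply: le_trans (ltW (archi_boundP X0)) _.
  by rewrite -natrX ler_nat; apply: leq_trans (leqnSn _) _; rewrite leq_pmulr.
pose proof (similarity M_gt0 c_gt0 m_gt0 m_large (Qb_col bc L2q) (fun i j => @lamb_gap _ _ _ bc k k_gt1 i j)
  (blkb_le bc) (@blkb_eq bc) (blkb_cut bc) (head_bound_le bc) (lamb_low bc k_gt1))
  as [Km [Dm [U [V [D [[UV VU Un Vn] L_sim [Ks UE Kn] [Ds DE Do Dn Db]]]]]]].
have /choice[Pb hPb] n := prj_op (R := R) (fun i => blkb bc i == n).
exists m, (sigma_head omega bc k m D), (sigma_block omega bc k D),
  (fun n => conjugate (bas_onb bc) U V (Pb n)); split=> //.
- exact: (splitting k_gt1 L2q m_gt0 m_large UV VU Un Vn L_sim DE Do Dn Db).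
- move=> n mn; have [PE Pn] := hPb n.
  exact: (riesz_block k_gt1 L2q m_gt0 m_large UV VU Un Vn L_sim DE Do Db mn PE Pn).
exists (splitting_const omega k q).
  by rewrite /splitting_const mulr_gt0 ?exprn_gt0 // divr_gt0 // mulr_gt0.
move=> Om d Om_m Od Om_d.
have [P [PE Pn]] := prj_op (R := R) (fun i => `[< Om (blkb bc i) >]).
exists (conjugate (bas_onb bc) U V P), (lift (bas_onb bc) P); split.
- apply: (op_sum_lift Un Vn PE Pn) => n x On hx; split; first exact: L2_conjugate.
  by exists (Pb n (V (cf omega (bas omega bc) x))); [exact: cf_conjugate|exact: (hPb n).1].
- have [I IE] : exists I : {linear ell2 R -> ell2 R}, forall x, I x = x by exact: lin_ex.
  have I2 x : nrm (I x) <= 2 * nrm x by rewrite IE; have := nrm_ge0 x; lra.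
  have -> : lift (bas_onb bc) P = lift (bas_onb bc) (fun a => I (P (I a))).
    by congr lift; apply/funext => a; rewrite !IE.
  apply: (op_sum_lift I2 I2 PE Pn) => n x On hx.
  have n0 : (0 < n)%N by exact: leq_trans (Om_m _ On).
  have [h hE] := cf_proj0 bc k_gt1 m_gt0 m_large n0 hx; split=> //.
  exists (cf omega (bas omega bc) (proj0 omega bc n x)); first by rewrite IE.
  by move=> i; rewrite IE.
exact: (HSnorm_splitting k_gt1 m_gt0 m_large UV Vn Ks UE Kn Od Om_m Om_d PE).
Qed.
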